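(* Let $Y$ be a smooth semiprojective variety, let $\mathcal{S}$ be a divisorial fan on $Y$ (with polyhedral coefficients living in $N_{\mathbb{Q}}$), and let $X=X(\mathcal{S})$ be the associated prevariety. (i) $X$ is separated if and only if $\mathcal{S}$ is separated. (ii) $X$ is complete if and only if $\mathcal{S}$ is complete.
   Context: Basic notions. $\mathbb{K}$ is an algebraically closed field; varieties are over $\mathbb{K}$. $N$ is a lattice (finitely generated free abelian group), $M=\mathrm{Hom}(N,\mathbb{Z})$, $N_{\mathbb{Q}}=\mathbb{Q}\otimes N$, $M_{\mathbb{Q}}=\mathbb{Q}\otimes M$, $T=\mathrm{Spec}\,\mathbb{K}[M]$. A variety is semiprojective if it is projective over some affine variety. For a pointed convex polyhedral cone $\sigma\subseteq N_{\mathbb{Q}}$, a $\sigma$-polyhedron is a convex polyhedron in $N_{\mathbb{Q}}$ with tail (recession) cone $\sigma$; these form a semigroup $\mathrm{Pol}^+_\sigma(N)$ under Minkowski addition (neutral element $\sigma$), with Grothendieck group $\mathrm{Pol}_\sigma(N)$. A polyhedral divisor on a normal variety $Y$ with tail cone $\sigma$ is an element of $\mathrm{Pol}_\sigma(N)\otimes_{\mathbb{Z}}\mathrm{WDiv}(Y)$. For $\mathcal{D}=\sum\Delta_D\otimes D$ with $D$ prime and $\Delta_D\in\mathrm{Pol}^+_\sigma(N)$ (all but finitely many $\Delta_D$ equal to $\sigma$), and $u\in\sigma^\vee\subseteq M_{\mathbb{Q}}$, set $\mathcal{D}(u)=\sum\min_{v\in\Delta_D}\langle u,v\rangle\,D\in\mathrm{WDiv}_{\mathbb{Q}}(Y)$.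 A pp-divisor is a polyhedral divisor $\mathcal{D}$ such that (1) $\mathcal{D}=\sum\Delta_D\otimes D$ for some effective divisors $D\in\mathrm{WDiv}_{\mathbb{Q}}(Y)$ and $\Delta_D\in\mathrm{Pol}_\sigma^+(N)$; (2) each $\mathcal{D}(u)$, $u\in\sigma^\vee$, is a semiample $\mathbb{Q}$-Cartier divisor (has a base point free multiple); (3) for $u$ in the relative interior of $\sigma^\vee$, some multiple of $\mathcal{D}(u)$ is big, i.e. admits a section with affine complement. $\mathrm{PPDiv}_{\mathbb{Q}}(Y,\sigma)$ is the set of pp-divisors with tail cone $\sigma$. Empty coefficients. $\emptyset$ is also allowed as a coefficient, with $\emptyset+\Delta:=\emptyset$, $0\cdot\emptyset:=\sigma$. In that case one requires that $\bigcup_{\Delta_D=\emptyset}\mathrm{supp}\,D$ is the support of an effective semiample divisor, and $\mathcal{D}\in\mathrm{PPDiv}_{\mathbb{Q}}(Y,\sigma)$ means that the restriction of $\mathcal{D}$ to $\mathrm{Loc}(\mathcal{D}):=Y\setminus\bigcup_{\Delta_D=\emptyset}\mathrm{supp}\,D$ is a pp-divisor on $\mathrm{Loc}(\mathcal{D})$; evaluations $\mathcal{D}(u)$ and linear systems are taken on $\mathrm{Loc}(\mathcal{D})$. Associated variety. $X(\mathcal{D}):=\mathrm{Spec}\,A$ with $A:=\bigoplus_{u\in M\cap\sigma^\vee}\Gamma(\mathrm{Loc}(\mathcal{D}),\mathcal{O}(\mathcal{D}(u)))$; it is a normal affine variety on which $T$ acts effectively via the grading. If $\mathcal{D}',\mathcal{D}$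 are pp-divisors on $Y$ with $\Delta'_D\subseteq\Delta_D$ for all prime $D$, then $\mathcal{D}(u)\le\mathcal{D}'(u)$ on $\mathrm{Loc}(\mathcal{D}')\subseteq\mathrm{Loc}(\mathcal{D})$ for $u\in\sigma^\vee\subseteq(\sigma')^\vee$, which yields a graded inclusion of algebras and the canonical $T$-equivariant morphism $X(\mathcal{D}')\to X(\mathcal{D})$. Faces. For a closed point $y\in Y$ the fiber polyhedron is $\Delta_y:=\sum_{D\ni y}\Delta_D$ (Minkowski sum over prime divisors; $\sigma$ if the sum is empty). For a polyhedron $\Delta$ and $w\in\sigma^\vee$, $\mathrm{face}(\Delta,w):=\{v\in\Delta;\ \langle w,v\rangle\le\langle w,v'\rangle\ \forall v'\in\Delta\}$. For pp-divisors $\mathcal{D}'\in\mathrm{PPDiv}_{\mathbb{Q}}(Y,\sigma')$ and $\mathcal{D}\in\mathrm{PPDiv}_{\mathbb{Q}}(Y,\sigma)$ on $Y$, $\mathcal{D}'$ is a face of $\mathcal{D}$ if $\Delta'_D\subseteq\Delta_D$ for all $D$ and for any closed point $y\in\mathrm{Loc}(\mathcal{D}')$ there are $w_y\in\sigma^\vee\cap M$ and $D_y\in|\mathcal{D}(w_y)|$ (effective divisors $\mathrm{div}(f)+\mathcal{D}(w_y)$, $f$ a nonzero rational function) with (i) $y\notin\mathrm{supp}(D_y)$; (ii) $\Delta'_y=\mathrm{face}(\Delta_y,w_y)$; (iii) $\mathrm{face}(\Delta'_v,w_y)=\mathrm{face}(\Delta_v,w_y)$ for every $v\in Y\setminus\mathrm{supp}(D_y)$.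 In this case the canonical morphism $X(\mathcal{D}')\to X(\mathcal{D})$ is an open embedding. Divisorial fan. $\mathcal{D}'\cap\mathcal{D}:=\sum(\Delta'_D\cap\Delta_D)\otimes D$. A divisorial fan on $(Y,N)$ is a set $\mathcal{S}$ of pp-divisors $\mathcal{D}\in\mathrm{PPDiv}_{\mathbb{Q}}(Y,\sigma_{\mathcal{D}})$ with tail cones $\sigma_{\mathcal{D}}\subseteq N_{\mathbb{Q}}$ such that for any two $\mathcal{D}',\mathcal{D}\in\mathcal{S}$ the intersection $\mathcal{D}'\cap\mathcal{D}$ is a face of both and belongs to $\mathcal{S}$. For $\mathcal{S}=\{\mathcal{D}^i\}$, the prevariety $X(\mathcal{S})$ with $T$-action is obtained by gluing the affine $T$-varieties $X(\mathcal{D}^i)$ along the canonical open embeddings $X(\mathcal{D}^i)\leftarrow X(\mathcal{D}^i\cap\mathcal{D}^j)\to X(\mathcal{D}^j)$. Valuations. A valuation of $\mathbb{K}(Y)/\mathbb{K}$ is a valuation $\mu\colon\mathbb{K}(Y)^*\to\mathbb{Q}$ with $\mu=0$ along $\mathbb{K}$. A (not necessarily closed) point $y\in Y$ is its (unique) center if the valuation ring $(\mathcal{O}_\mu,\mathfrak{m}_\mu)$ dominates $(\mathcal{O}_y,\mathfrak{m}_y)$, i.e. $\mathcal{O}_y\subseteq\mathcal{O}_\mu$ and $\mathfrak{m}_y=\mathfrak{m}_\mu\cap\mathcal{O}_y$. For smooth $Y$ and $\mu$ with center $y\in Y$ one gets a weight function on prime divisors: $\mu(D):=\mu(f)$ where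 $D=\mathrm{div}(f)$ near $y$ with $f\in\mathbb{K}(Y)$. For a pp-divisor $\mathcal{D}=\sum\Delta_D\otimes D$ set $\mu(\mathcal{D}):=\sum\mu(D)\cdot\Delta_D$ (Minkowski sum, with $0\cdot\Delta=\sigma_{\mathcal{D}}$ also for $\Delta=\emptyset$, and $\emptyset+\Delta=\emptyset$). The slice is $\mu(\mathcal{S}):=\{\mu(\mathcal{D});\ \mathcal{D}\in\mathcal{S}\}$. Definitions. $\mathcal{S}$ is separated if for any two $\mathcal{D}^i,\mathcal{D}^j\in\mathcal{S}$ and any valuation $\mu$ on $Y$ (a valuation of $\mathbb{K}(Y)/\mathbb{K}$ with center in $Y$) one has $\mu(\mathcal{D}^i\cap\mathcal{D}^j)=\mu(\mathcal{D}^i)\cap\mu(\mathcal{D}^j)$. $\mathcal{S}$ is complete if $Y$ is complete, $\mathcal{S}$ is separated, and for every valuation $\mu$ the slice $\mu(\mathcal{S})$ covers $N_{\mathbb{Q}}$.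
   Formalization: Part (ii) is proved for nonempty S with X(S) quasi-compact (automatic for finite nonempty S); for infinite S it can fail, e.g. Y a point and an infinite fan covering Q^2 with cones accumulating at an irrational ray, and it fails for empty S. *)

(* Defs.v *)
From HB Require Import structures.
From Stdlib Require Import Relation_Operators.
From mathcomp Require Import all_boot all_order all_algebra.
From mathcomp Require Import boolp classical_sets functions cardinality fsbigop.
From mathcomp Require Import mpoly.

Set Implicit Arguments.
Unset Strict Implicit.
Unset Printing Implicit Defensive.

Import Order.TTheory GRing.Theory Num.Theory.
Local Open Scope classical_set_scope.
Local Open Scope ring_scope.

(* Varieties are treated in the language of models of a function field
   (Chevalley, Zariski): an integral separated scheme of finite type over K with
   function field F is identified with the set of its local rings
   O_y inside F, so that a point of the variety is a subring of F.  Prevarieties,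
   which need not be separated, are spaces of closed points equipped with
   K-valued regular functions. *)

(* -------------------------------------------------------------------------- *)
(** * Subrings of a field, local rings and models *)

Section Subrings.
Variable F : fieldType.
Implicit Types (A O p : set F) (Y : set (set F)).

Record subring_set A : Prop := SubringSet {
  subring_one : A 1;
  subring_sub : forall x y, A x -> A y -> A (x - y);
  subring_mul : forall x y, A x -> A y -> A (x * y) }.

Record prime_ideal A p : Prop := PrimeIdeal {
  prime_sub : p `<=` A;
  prime_zero : p 0;
  prime_add : forall x y, p x -> p y -> p (x + y);
  prime_mul : forall a x, A a -> p x -> p (a * x);
  prime_proper : ~ p 1;
  prime_prime : forall a b, A a -> A b -> p (a * b) -> p a \/ p b }.

Definition localization A p : set F :=
  [set x | exists a b, [/\ A a, A b, ~ p b & x = a / b]].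

(** The affine scheme Spec A, as its set of local rings. *)
Definition spec A : set (set F) :=
  [set O | exists2 p, prime_ideal A p & O = localization A p].

(** The non-units of [O]; the maximal ideal when [O] is local. *)
Definition maxid O : set F := [set x | O x /\ ~ (x != 0 /\ O x^-1)].

Definition dominates O' O : Prop :=
  O `<=` O' /\ maxid O = maxid O' `&` O.

Definition fraction_field A : Prop :=
  forall x : F, exists a b, [/\ A a, A b, b != 0 & x = a / b].

Definition prime_chain A (d : nat) : Prop :=
  exists p : nat -> set F,
    (forall i, (i <= d)%N -> prime_ideal A (p i)) /\
    (forall i, (i < d)%N -> p i `<` p i.+1).

Definition krull_dim A (d : nat) : Prop :=
  prime_chain A d /\ ~ prime_chain A d.+1.

Definition regular_local O : Prop :=
  exists2 d, krull_dim O d &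
  exists t : 'I_d -> F, (forall i, maxid O (t i)) /\
    forall x, maxid O x ->
      exists a : 'I_d -> F, (forall i, O (a i)) /\ x = \sum_i a i * t i.

(** [y' `<=` y] says that [y] is a specialization of [y'], i.e. lies in the
    closure of [y']. *)
Definition closed_point Y y : Prop :=
  Y y /\ forall y', Y y' -> y' `<=` y -> y' = y.

Definition valuation_subring O : Prop :=
  subring_set O /\ forall x : F, x != 0 -> O x \/ O x^-1.

End Subrings.

(* -------------------------------------------------------------------------- *)
(** * Varieties over [K] *)

Section Varieties.
Variables (K F : fieldType) (iota : K -> F).
Implicit Types (Y : set (set F)).

(** The [K]-subalgebra of [F] generated by a finite sequence. *)
Definition alg_gen (s : seq F) : set F :=
  [set x | forall A, subring_set A -> (forall c, A (iota c)) ->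
     (forall z, z \in s -> A z) -> A x].

Definition affine Y : Prop := exists s, Y = spec (alg_gen s).

(** The second condition (no valuation ring dominates two distinct points) is
    the separatedness of the gluing of the affine charts. *)
Definition variety Y : Prop :=
  (exists ss : seq (seq F),
     [/\ ss != [::],
         forall s, s \in ss -> fraction_field (alg_gen s)
       & Y = [set y | exists2 s, s \in ss & spec (alg_gen s) y]]) /\
  (forall R y y', valuation_subring R -> Y y -> Y y' ->
     dominates R y -> dominates R y' -> y = y').

Definition smooth Y : Prop := forall y, Y y -> regular_local y.

(** [Y] is a closed subvariety of a product of P^k with an affine variety: here
    [b] generates the image in [F] of the coordinate ring of the affine variety
    and [x] is the tuple of the homogeneous coordinates that do not vanish
    identically on [Y] (up to a common factor); the standard charts of [Y] are
    the spectra of [K[b, x_0 / x_i, .., x_k / x_i]]. *)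
Definition semiprojective Y : Prop :=
  exists (b : seq F) (k : nat) (x : 'I_k.+1 -> F),
    (forall i, x i != 0) /\
    Y = [set y | exists i,
           spec (alg_gen (b ++ [seq x j / x i | j <- enum 'I_k.+1])) y].

(** The value in [K] at a closed point [y] of [f] in the local ring at [y]. *)
Definition value_at (y : set F) (f : F) : K :=
  xget 0 [set c | maxid y (f - iota c)].

End Varieties.

(* -------------------------------------------------------------------------- *)
(** * Spaces with functions *)

(** [regular U h]: the restriction of [h] to the open set [U] is regular (the
    values of [h] outside of [U] are irrelevant). *)
Record space_fun (K : Type) := SpaceFun {
  pt :> Type;
  is_open : set (set pt);
  regular : set pt -> set (pt -> K) }.

Section ModelSpace.
Variables (K F : fieldType) (iota : K -> F) (Y : set (set F)).

Definition model_pt := {y : set F | closed_point Y y}.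

(** The Zariski topology of a model has the sets of all points at which finitely
    many given elements of [F] are regular as a basis. *)
Definition model_open (U : set model_pt) : Prop :=
  forall y, U y -> exists s : seq F,
    (forall f, f \in s -> sval y f) /\
    (forall z : model_pt, (forall f, f \in s -> sval z f) -> U z).

Definition model_regular (U : set model_pt) (h : model_pt -> K) : Prop :=
  forall y, U y -> exists f : F, exists W : set model_pt,
    [/\ model_open W, W y &
        forall z, W z -> U z -> sval z f /\ h z = value_at iota (sval z) f].

Definition model_space : space_fun K := SpaceFun model_open model_regular.

End ModelSpace.

Section Glue.
Variables (K I : Type) (X : I -> space_fun K).
Variable R : {i & pt (X i)} -> {i & pt (X i)} -> Prop.

Definition glue_class (p : {i & pt (X i)}) : set {i & pt (X i)} :=
  [set q | clos_refl_sym_trans _ R p q].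

Definition glue_pt := {C : set {i & pt (X i)} | exists p, C = glue_class p}.

Definition glue_in i (x : X i) : glue_pt :=
  exist _ (glue_class (existT _ i x)) (ex_intro _ (existT _ i x) erefl).

(** The quotient of the disjoint union of the [X i] by the equivalence relation
    generated by [R]. *)
Definition glue : space_fun K :=
  @SpaceFun K glue_pt
    (fun U => forall i, is_open (@glue_in i @^-1` U))
    (fun U h => forall i, regular (@glue_in i @^-1` U) (h \o @glue_in i)).

End Glue.

Section SpaceProperties.
Variable K : fieldType.
Implicit Types X Z : space_fun K.

(** The Zariski topology of the product: the loci where some
    [sum_i f_i(x) g_i(z)], with [f_i] regular on [U] and [g_i] regular on [V],
    does not vanish form a basis. *)
Definition prod_open X Z (W : set (X * Z)) : Prop :=
  forall p, W p -> exists (U : set X) (V : set Z),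
    [/\ is_open U, is_open V, U p.1, V p.2 &
      exists (r : nat) (f : 'I_r -> X -> K) (g : 'I_r -> Z -> K),
        [/\ forall i, regular U (f i),
            forall i, regular V (g i),
            \sum_i f i p.1 * g i p.2 != 0 &
            forall q : X * Z, U q.1 -> V q.2 ->
              \sum_i f i q.1 * g i q.2 != 0 -> W q]].

Definition separated X : Prop :=
  @prod_open X X (~` [set p : X * X | p.1 = p.2]).

Definition complete X : Prop :=
  separated X /\
  forall (E : fieldType) (j : {rmorphism K -> E}) (Z : set (set E)),
    variety j Z ->
    forall C : set (X * model_space j Z),
      prod_open (~` C) -> @is_open K (model_space j Z) (~` (snd @` C)).

Definition quasi_compact X : Prop :=
  forall C : set (set X),
    (forall U, C U -> is_open U) -> (forall x, exists2 U, C U & U x) ->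
    exists C0 : set (set X),
      [/\ C0 `<=` C, finite_set C0 & forall x, exists2 U, C0 U & U x].

End SpaceProperties.

(* -------------------------------------------------------------------------- *)
(** * Divisors on a smooth variety *)

Section Divisors.
Variables (K F : fieldType) (iota : K -> F).
(* [W] is a smooth variety with function field [F] or an open subset of one. *)
Implicit Types (W : set (set F)) (H : set F -> rat).

(** A prime divisor is represented by its generic point; the divisor [E]
    contains the point [y] iff [y `<=` E]. *)
Definition prime_divisor W : set (set F) := [set E | W E /\ krull_dim E 1].

Definition ord_spec (E : set F) (f : F) (k : int) : Prop :=
  exists t u, [/\ maxid E t, forall x, maxid E x -> E (x / t),
                  E u, E u^-1 & [/\ t != 0, u != 0 & f = u * t ^ k]].

Definition ord (E : set F) (f : F) : int := xget 0 [set k | ord_spec E f k].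

(* A Q-divisor on [W] is a function [H], of which only the values at the prime
   divisors of [W] are used. *)

(** [f] is nonzero and [div f + H] is effective on [W]. *)
Definition effective_section W H (f : F) : Prop :=
  f != 0 /\ forall E, prime_divisor W E -> 0 <= (ord E f)%:~R + H E.

(** The elements of Gamma(W, O(H)). *)
Definition global_section W H (f : F) : Prop :=
  f = 0 \/ effective_section W H f.

(** The support of [div f + H]. *)
Definition supp W H (f : F) : set (set F) :=
  [set y | W y /\ exists E,
     [/\ prime_divisor W E, y `<=` E & (ord E f)%:~R + H E != 0]].

Definition multiple (m : nat) H : set F -> rat := fun E => m%:R * H E.

Definition q_cartier W H : Prop :=
  exists2 m, (0 < m)%N & forall y, W y ->
    exists2 f : F, f != 0 & forall E, prime_divisor W E -> y `<=` E ->
      (ord E f)%:~R = multiple m H E.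

Definition base_point_free W H : Prop :=
  forall y, W y -> exists2 f, effective_section W H f & ~ supp W H f y.

Definition semiample W H : Prop :=
  exists2 m, (0 < m)%N & base_point_free W (multiple m H).

Definition has_big_multiple W H : Prop :=
  exists2 m, (0 < m)%N & exists2 f, effective_section W (multiple m H) f &
    affine iota (W `\` supp W (multiple m H) f).

End Divisors.

(* -------------------------------------------------------------------------- *)
(** * Polyhedra *)

(* N = M = Z^n, with the standard pairing. *)
Section Polyhedra.
Variable n : nat.
Notation V := 'rV[rat]_n.
Implicit Types (sigma Delta : set V) (u v w : V).

Definition pairing u v : rat := \sum_j u 0 j * v 0 j.

Definition lattice_vect (u : 'rV[int]_n) : V := map_mx intr u.

Definition polyhedral_cone sigma : Prop :=
  exists s : seq V, sigma = [set v | forall u, u \in s -> 0 <= pairing u v].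

Definition pointed sigma : Prop := forall v, sigma v -> sigma (- v) -> v = 0.

Definition dual_cone sigma : set V :=
  [set u | forall v, sigma v -> 0 <= pairing u v].

(** The interior of the cone [C] relative to its linear span [C - C]. *)
Definition relint (C : set V) : set V :=
  [set u | C u /\ exists2 e : rat, 0 < e & forall a b, C a -> C b ->
     (forall j, `|(a - b) 0 j| < e) -> C (u + (a - b))].

Definition polyhedron Delta : Prop :=
  exists s : seq (V * rat),
    Delta = [set v | forall c, c \in s -> c.2 <= pairing c.1 v].

Definition tail_cone Delta : set V :=
  [set v | forall x t, Delta x -> 0 <= t -> Delta (x + t *: v)].

Definition sigma_polyhedron sigma Delta : Prop :=
  [/\ polyhedron Delta, Delta !=set0 & tail_cone Delta = sigma].

Definition face Delta w : set V :=
  [set v | Delta v /\ forall v', Delta v' -> pairing w v <= pairing w v'].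

(** [c * Delta], with [0 * Delta = sigma] even when [Delta] is empty. *)
Definition poly_scale sigma (c : rat) Delta : set V :=
  if c == 0 then sigma else [set c *: v | v in Delta].

(** The Minkowski sum of the [Delta i] for [i] in [P], all but finitely many of
    which are equal to the neutral element [sigma]. *)
Definition minkowski_sum (I : choiceType) sigma (P : set I)
    (Delta : I -> set V) : set V :=
  [set v | exists (w : V) (x : I -> V),
     [/\ sigma w,
         forall i, P i -> Delta i <> sigma -> Delta i (x i) &
         v = w + \sum_(i \in [set i | P i /\ Delta i <> sigma]) x i]].

End Polyhedra.

(* -------------------------------------------------------------------------- *)
(** * pp-divisors and divisorial fans *)

(** [coef E] is the coefficient of the prime divisor [E], possibly empty; it is
    required to equal [tail] at sets [E] that are not prime divisors. *)
Record polydiv (F : fieldType) (n : nat) := PolyDiv {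
  tail : set 'rV[rat]_n;
  coef : set F -> set 'rV[rat]_n }.

Section PolyhedralDivisors.
Variables (F : fieldType) (n : nat).
Variable Y : set (set F).
Implicit Types (D : polydiv F n) (u v w : 'rV[rat]_n).

Definition loc D : set (set F) :=
  [set y | Y y /\ forall E, prime_divisor Y E -> y `<=` E -> coef D E !=set0].

(** The evaluation D(u), on [loc D]. *)
Definition eval D u : set F -> rat := fun E =>
  xget 0 [set m | exists2 v, face (coef D E) u v & m = pairing u v].

Definition inter D' D : polydiv F n :=
  PolyDiv (tail D' `&` tail D) (fun E => coef D' E `&` coef D E).

(** The fiber polyhedron at [y]. *)
Definition fiber D (y : set F) : set 'rV[rat]_n :=
  minkowski_sum (tail D) [set E | prime_divisor Y E /\ y `<=` E] (coef D).

Definition face_of D' D : Prop :=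
  (forall E, prime_divisor Y E -> coef D' E `<=` coef D E) /\
  forall y, closed_point Y y -> loc D' y ->
    exists (u : 'rV[int]_n) (f : F), let w := lattice_vect u in
      [/\ dual_cone (tail D) w,
          effective_section (loc D) (eval D w) f,
          ~ supp (loc D) (eval D w) f y,
          fiber D' y = face (fiber D y) w &
          forall z, closed_point Y z -> ~ supp (loc D) (eval D w) f z ->
            face (fiber D' z) w = face (fiber D z) w].

(** Valuations are only considered on nonzero elements of [F]. *)
Definition valuation_over (K : fieldType) (iota : K -> F) (mu : F -> rat) :=
  [/\ forall x y, x != 0 -> y != 0 -> mu (x * y) = mu x + mu y,
      forall x y, x != 0 -> y != 0 -> x + y != 0 ->
        Num.min (mu x) (mu y) <= mu (x + y) &
      forall c, c != 0 -> mu (iota c) = 0].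

Definition valuation_ring (mu : F -> rat) : set F :=
  [set x | x = 0 \/ 0 <= mu x].

Definition center (mu : F -> rat) (y : set F) : Prop :=
  Y y /\ dominates (valuation_ring mu) y.

(** [E] is the divisor of [f] near [y]. *)
Definition local_equation (y E : set F) (f : F) : Prop :=
  f != 0 /\ forall E', prime_divisor Y E' -> y `<=` E' ->
    ord E' f = (`[< E' = E >] : nat)%:Z.

Definition weight (mu : F -> rat) (y E : set F) : rat :=
  xget 0 [set c | exists2 f, local_equation y E f & c = mu f].

(** mu(D), where [y] is the center of [mu]. *)
Definition slice (mu : F -> rat) (y : set F) D : set 'rV[rat]_n :=
  minkowski_sum (tail D) (prime_divisor Y)
    (fun E => poly_scale (tail D) (weight mu y E) (coef D E)).

End PolyhedralDivisors.

Section Fans.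
Variables (K F : fieldType) (iota : {rmorphism K -> F}) (n : nat).
Variable Y : set (set F).
Implicit Types (D : polydiv F n) (S : set (polydiv F n)).

Record pp_divisor D : Prop := PPDivisor {
  pp_tail : polyhedral_cone (tail D) /\ pointed (tail D);
  pp_support : finite_set [set E | coef D E <> tail D] /\
    [set E | coef D E <> tail D] `<=` prime_divisor Y;
  pp_coef : forall E, prime_divisor Y E ->
    coef D E = set0 \/ sigma_polyhedron (tail D) (coef D E);
  pp_loc : exists H : set F -> rat,
    [/\ forall E, prime_divisor Y E -> 0 <= H E,
        forall E, prime_divisor Y E -> (H E != 0 <-> coef D E = set0) &
        semiample Y H];
  pp_semiample : forall u, dual_cone (tail D) u ->
    q_cartier (loc Y D) (eval D u) /\ semiample (loc Y D) (eval D u);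
  pp_big : forall u, relint (dual_cone (tail D)) u ->
    has_big_multiple iota (loc Y D) (eval D u) }.

Definition divisorial_fan S : Prop :=
  (forall D, S D -> pp_divisor D) /\
  forall D' D, S D' -> S D ->
    [/\ face_of Y (inter D' D) D', face_of Y (inter D' D) D & S (inter D' D)].

Definition fan_separated S : Prop :=
  forall D' D mu y, S D' -> S D -> valuation_over iota mu -> center Y mu y ->
    slice Y mu y (inter D' D) = slice Y mu y D' `&` slice Y mu y D.

Definition fan_complete S : Prop :=
  [/\ complete (model_space iota Y), fan_separated S &
      forall mu y, valuation_over iota mu -> center Y mu y ->
        forall v, exists2 D, S D & slice Y mu y D v].

(** The field F(M), the fraction field of the Laurent polynomial ring F[M]. *)
Definition laurent_field : fieldType := {fraction {mpoly F[n]}}.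

Definition laurent_const (f : F) : laurent_field := tofrac (mpolyC n f).

Definition character (u : 'rV[int]_n) : laurent_field :=
  \prod_(j < n) tofrac ('X_j : {mpoly F[n]}) ^ (u 0 j).

(** The algebra A of [D], inside F[M]. *)
Definition pp_algebra D : set laurent_field :=
  [set a | exists (s : seq 'rV[int]_n) (c : 'rV[int]_n -> F),
     (forall u, u \in s -> dual_cone (tail D) (lattice_vect u) /\
        global_section (loc Y D) (eval D (lattice_vect u)) (c u)) /\
     a = \sum_(u <- s) laurent_const (c u) * character u].

Definition X_pp D : space_fun K :=
  model_space (laurent_const \o iota) (spec (pp_algebra D)).

(** The chart points [p] and [q] are the images of a point of X(D' cap D) under
    the canonical morphisms; the morphism of spectra induced by an inclusion of
    algebras sends a point to the one whose local ring it dominates. *)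
Definition gluing_rel S (p q : {D : {D | S D} & pt (X_pp (sval D))}) : Prop :=
  exists x : X_pp (inter (sval (projT1 p)) (sval (projT1 q))),
    dominates (sval x) (sval (projT2 p)) /\
    dominates (sval x) (sval (projT2 q)).

Definition X_fan S : space_fun K := glue (@gluing_rel S).

End Fans.

(* Main.v *)
Require Import Defs.
From HB Require Import structures.
From mathcomp Require Import all_boot all_order all_algebra mpoly.
From mathcomp Require Import boolp classical_sets functions cardinality fsbigop filter.
From mathcomp Require Import ring lra zify.

Set Implicit Arguments.
Unset Strict Implicit.
Unset Printing Implicit Defensive.

Import Order.TTheory GRing.Theory Num.Theory.
Local Open Scope classical_set_scope.
Local Open Scope ring_scope.

(** Separatedness and completeness of X(S) are tested on K-rational places R of the fraction field L
of K(Y)[M]. Approximating R by rational-valued valuations nu of L, with restriction mu to K(Y) and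
vector v of values of the characters, one finds that nu is nonnegative on A_D iff mu has a centre
and v lies in mu(D): finitely many sections of D detect this. So the slice condition says that
A_D, A_D' <= R imply A_(D cap D') <= R, which is the valuative criterion of separatedness, and the
covering condition says that every R contains some A_D, which is the one of completeness. *)

(** Places are K-rational because the spaces consist of closed points with K-valued functions.
    Slices only see valuations with values in Q, while a place may have a value group of any rank;
    approximation keeps the signs of finitely many elements only. This is why everything is reduced
    to finite lists of sections, and why quasi-compactness enters: it leaves finitely many charts.
    Two geometric facts link sections to slices. Local rings of smooth points are factorial, so that
    mu f is the sum of the orders of f weighted by mu, and functions without poles are regular. And
    the face conditions, imposed fibrewise at closed points, amount to a localization: A_(D') lies
    in A_D[1/g] for a homogeneous g invertible on the given place. This identifies local rings
    across charts and makes the gluing relation transitive. Integrality and algebraicity are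
    expressed by valuation rings throughout. Completeness quantifies over varieties whose function
    field E is unrelated to that of X; limits along an ultrafilter are therefore taken with values
    in an ultrapower of K, and a place of the ultrapower brings the values back to K. *)

Notation "s `in` A" := (forall x, x \in s -> A x) (at level 70).

Lemma in_consP (I : eqType) (x y : I) s : reflect (x = y \/ x \in s) (x \in y :: s).
Proof. by exact: predU1P. Qed.

Lemma mem_tail (I : eqType) (x y : I) s : x \in s -> x \in y :: s.
Proof. by move=> xs; rewrite inE xs orbT. Qed.

Lemma in_catP (I : eqType) (x : I) s t : reflect (x \in s \/ x \in t) (x \in s ++ t).
Proof. by rewrite mem_cat; exact: orP. Qed.

Lemma choice_in (I : eqType) T (x0 : T) (s : seq I) (P : I -> T -> Prop) :
 (forall i, i \in s -> exists x, P i x) -> exists f, forall i, i \in s -> P i (f i).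
Proof.
move=> h; have /choice[f] : forall i, exists x, i \in s -> P i x; last by exists f.
by move=> i; have [/h[x]|] := boolP (i \in s); [exists x|exists x0].
Qed.

(** * Subrings and ideals *)

Section Subring.
Variable F : fieldType.
Implicit Types (A B C R J : set F) (p q : {poly F}).

Lemma subring0 A : subring_set A -> A 0.
Proof. by case=> h1 hB _; have := hB _ _ h1 h1; rewrite subrr. Qed.

Lemma subringN A x : subring_set A -> A x -> A (- x).
Proof. by move=> hA Ax; rewrite -sub0r; apply: (subring_sub hA) => //; apply: subring0. Qed.

Lemma subringD A x y : subring_set A -> A x -> A y -> A (x + y).
Proof. by move=> hA Ax Ay; rewrite -[y]opprK; apply: (subring_sub hA) => //; apply: subringN. Qed.

Lemma subringX A x n : subring_set A -> A x -> A (x ^+ n).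
Proof.
by move=> hA Ax; elim: n => [|n IH]; [exact: subring_one | rewrite exprS; apply: subring_mul].
Qed.

Lemma subring_sum A (I : eqType) (r : seq I) (P : pred I) (f : I -> F) :
 subring_set A -> (forall i, i \in r -> P i -> A (f i)) -> A (\sum_(i <- r | P i) f i).
Proof.
move=> hA hf; rewrite big_seq_cond; apply: big_ind => [|x y|i /andP[]]; last exact: hf.
- exact: subring0.
- exact: subringD.
Qed.

Lemma subring_prod A (I : eqType) (r : seq I) (P : pred I) (f : I -> F) :
 subring_set A -> (forall i, i \in r -> P i -> A (f i)) -> A (\prod_(i <- r | P i) f i).
Proof.
move=> hA hf; rewrite big_seq_cond; apply: big_ind => [|x y|i /andP[]]; last exact: hf.
- exact: subring_one.
- exact: subring_mul.
Qed.

Record ideal A J : Prop := Ideal {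
 ideal_sub : J `<=` A;
 ideal0 : J 0;
 idealD : forall x y, J x -> J y -> J (x + y);
 idealM : forall a x, A a -> J x -> J (a * x) }.

Lemma principal_is_ideal A b : subring_set A -> A b -> ideal A [set x | exists2 c, A c & x = b * c].
Proof.
move=> hA Ab; split.
- by move=> _ [c Ac ->]; exact: subring_mul.
- by exists 0; [exact: subring0|rewrite mulr0].
- by move=> _ _ [c Ac ->] [d Ad ->]; exists (c + d); [exact: subringD|rewrite mulrDr].
- by move=> a _ Aa [c Ac ->]; exists (a * c); [exact: subring_mul|rewrite mulrCA].
Qed.

Lemma prime_ideal_ideal A J : prime_ideal A J -> ideal A J.
Proof. by case. Qed.

Lemma idealN A J x : subring_set A -> ideal A J -> J x -> J (- x).
Proof.
move=> hA hJ Jx; rewrite -mulN1r; apply: (idealM hJ) => //.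
by apply: subringN => //; apply: subring_one.
Qed.

Lemma idealB A J x y : subring_set A -> ideal A J -> J x -> J y -> J (x - y).
Proof. by move=> hA hJ Jx Jy; apply: (idealD hJ) => //; apply: (idealN hA hJ). Qed.

Lemma ideal_sum A J (I : eqType) (r : seq I) (P : pred I) (f : I -> F) :
 ideal A J -> (forall i, i \in r -> P i -> J (f i)) -> J (\sum_(i <- r | P i) f i).
Proof.
move=> hJ hf; rewrite big_seq_cond; apply: big_ind => [|x y|i /andP[]]; last exact: hf.
- exact: ideal0 hJ.
- exact: idealD hJ _ _.
Qed.

Lemma prime_ideal_exp A J x n : subring_set A -> prime_ideal A J -> A x -> J (x ^+ n) -> J x.
Proof.
move=> hA hJ Ax; elim: n => [/(prime_proper hJ)//|n IH]; rewrite exprS => h.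
by case: (prime_prime hJ Ax (subringX n hA Ax) h).
Qed.

Definition polyin A p := forall i, A p`_i.

Lemma polyinC A c : subring_set A -> A c -> polyin A c%:P.
Proof. by move=> hA Ac i; rewrite coefC; case: ifP => // _; apply: subring0. Qed.

Lemma polyin0 A : subring_set A -> polyin A 0.
Proof. by move=> hA i; rewrite coef0; apply: subring0. Qed.

Lemma polyinX A : subring_set A -> polyin A 'X.
Proof.
by move=> hA i; rewrite coefX; case: eqP => _; [exact: subring_one | exact: subring0].
Qed.

Lemma polyinN A p : subring_set A -> polyin A p -> polyin A (- p).
Proof. by move=> hA hp i; rewrite coefN; apply: subringN. Qed.

Lemma polyinD A p q : subring_set A -> polyin A p -> polyin A q -> polyin A (p + q).
Proof. by move=> hA hp hq i; rewrite coefD; apply: subringD. Qed.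

Lemma polyinB A p q : subring_set A -> polyin A p -> polyin A q -> polyin A (p - q).
Proof. by move=> hA hp hq; apply: polyinD => //; apply: polyinN. Qed.

Lemma polyinM A p q : subring_set A -> polyin A p -> polyin A q -> polyin A (p * q).
Proof.
by move=> hA hp hq i; rewrite coefM; apply: subring_sum => // j _ _; apply: (subring_mul hA).
Qed.

Lemma polyinMl A J p q : ideal A J -> polyin A p -> polyin J q -> polyin J (p * q).
Proof. by move=> hJ hp hq i; rewrite coefM; apply: (ideal_sum hJ) => j _ _; apply: (idealM hJ). Qed.

Lemma polyinZ A c p : subring_set A -> A c -> polyin A p -> polyin A (c *: p).
Proof. by move=> hA hc hp i; rewrite coefZ; apply: (subring_mul hA). Qed.

Lemma polyinXn A n : subring_set A -> polyin A 'X^n.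
Proof. by move=> hA i; rewrite coefXn; case: eqP => _; [apply: subring_one | apply: subring0]. Qed.

Lemma polyinZX A c n : subring_set A -> A c -> polyin A (c *: 'X^n).
Proof. by move=> hA hc; apply: polyinZ => //; apply: polyinXn. Qed.

Lemma polyin_sum A (I : eqType) (r : seq I) (P : pred I) (f : I -> {poly F}) :
 subring_set A -> (forall i, i \in r -> P i -> polyin A (f i)) ->
 polyin A (\sum_(i <- r | P i) f i).
Proof. by move=> hA hf j; rewrite coef_sum; apply: subring_sum => // i hi Pi; apply: hf. Qed.

Lemma sub_polyin A B p : A `<=` B -> polyin A p -> polyin B p.
Proof. by move=> h hp i; apply: h. Qed.

Lemma horner_in A p x : subring_set A -> polyin A p -> A x -> A p.[x].
Proof.
move=> hA hp Ax; rewrite horner_coef; apply: subring_sum => // i _ _.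
by apply: (subring_mul hA) => //; apply: subringX.
Qed.

Lemma polyin_factor A p c : subring_set A -> A c -> polyin A p ->
 exists2 q, polyin A q & p = q * ('X - c%:P) + p.[c]%:P.
Proof.
move=> hA Ac; elim/poly_ind: p => [|p a IH] hp.
 by exists 0; [| rewrite mul0r horner0 addr0].
have hp' : polyin A p.
 by move=> i; have := hp i.+1; rewrite coefD coefMX coefC addr0.
have [q hq E] := IH hp'.
exists (q * 'X + p.[c]%:P).
 apply: polyinD => //; first by apply: polyinM => //; apply: polyinX.
 by apply: polyinC => //; apply: horner_in.
rewrite {1}E hornerMXaddC; ring.
Qed.

Definition adj A x : set F := [set y | exists2 p, polyin A p & y = p.[x]].

Lemma adj_subring A x : subring_set A -> subring_set (adj A x).
Proof.
move=> hA; split.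
- by exists 1; [apply: polyinC => //; apply: subring_one | rewrite hornerE].
- move=> _ _ [p hp ->] [q hq ->]; exists (p - q); last by rewrite !hornerE.
 exact: polyinB.
- move=> _ _ [p hp ->] [q hq ->]; exists (p * q); last by rewrite hornerM.
 exact: polyinM.
Qed.

Lemma sub_adj A x : subring_set A -> A `<=` adj A x.
Proof. by move=> hA a Aa; exists a%:P; [apply: polyinC | rewrite hornerC]. Qed.

Lemma adj_gen A x : subring_set A -> adj A x x.
Proof. by move=> hA; exists 'X; [apply: polyinX | rewrite hornerX]. Qed.

Lemma adj_min A x C : subring_set C -> A `<=` C -> C x -> adj A x `<=` C.
Proof. by move=> hC hAC Cx _ [p hp ->]; apply: horner_in => //; apply: sub_polyin hp. Qed.

Definition gen A (s : seq F) : set F :=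
 [set x | forall C, subring_set C -> A `<=` C -> s `in` C -> C x].

Lemma gen_subring A s : subring_set (gen A s).
Proof.
split=> [C hC _ _|x y hx hy C hC hA hs|x y hx hy C hC hA hs]; first exact: subring_one.
- by apply: (subring_sub hC); [apply: hx | apply: hy].
- by apply: (subring_mul hC); [apply: hx | apply: hy].
Qed.

Lemma gen_base A s : A `<=` gen A s.
Proof. by move=> a Aa C _ + _; apply. Qed.

Lemma gen_mem A s z : z \in s -> gen A s z.
Proof. by move=> hz C _ _; apply. Qed.

Lemma gen_min A s C : subring_set C -> A `<=` C -> s `in` C -> gen A s `<=` C.
Proof. by move=> hC hA hs x; apply. Qed.

Lemma gen_sub A s B t : A `<=` gen B t -> s `in` gen B t ->
 gen A s `<=` gen B t.
Proof. by move=> h1 h2; apply: gen_min => //; apply: gen_subring. Qed.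

Lemma gen_cons A x s : gen A (x :: s) = adj (gen A s) x.
Proof.
apply/seteqP; split.
 apply: gen_min => [|a Aa|z].
 - exact/adj_subring/gen_subring.
 - by apply: sub_adj; [exact: gen_subring | exact: gen_base].
 - case/in_consP=> [->|hz]; first exact/adj_gen/gen_subring.
  by apply: sub_adj; [exact: gen_subring | exact: gen_mem].
apply: adj_min; first exact: gen_subring.
 by apply: gen_sub => [|z hz]; [exact: gen_base | apply: gen_mem; exact: mem_tail].
by apply: gen_mem; rewrite mem_head.
Qed.

Lemma gen_nil A : subring_set A -> gen A [::] = A.
Proof.
by move=> hA; apply/seteqP; split; [apply: gen_min | exact: gen_base].
Qed.

End Subring.

(** * Valuation rings *)

Section ValuationRings.
Variable F : fieldType.
Implicit Types (A B C R J k : set F) (p q : {poly F}).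
Local Notation vr := (@valuation_subring F).

Lemma vr_sub R : vr R -> subring_set R. Proof. by case. Qed.

Lemma maxid0 R : subring_set R -> maxid R 0.
Proof. by move=> hR; split; [exact: subring0 | case; rewrite eqxx]. Qed.

Lemma maxid_proper R : subring_set R -> ~ maxid R 1.
Proof.
move=> hR [h []]; split; first exact: oner_neq0.
by rewrite invr1.
Qed.

Lemma maxid_sub R : maxid R `<=` R. Proof. by move=> x []. Qed.

Lemma vr_unit R x : R x -> ~ maxid R x -> x != 0 /\ R x^-1.
Proof. by move=> Rx h; apply: contrapT => h2; apply: h. Qed.

Lemma unit_notmax R x : x != 0 -> R x^-1 -> ~ maxid R x.
Proof. by move=> x0 hx [_ []]. Qed.

Lemma vr_out R x : vr R -> ~ R x -> x != 0 /\ maxid R x^-1.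
Proof.
move=> [hR hv] nR; have x0 : x != 0.
 by apply/eqP => E; apply: nR; rewrite E; apply: subring0.
split=> //; split; first by case: (hv x x0).
by rewrite invrK => -[].
Qed.

Lemma vr_max_out R x : x != 0 -> maxid R x^-1 -> ~ R x.
Proof. by move=> x0 [_ h] Rx; apply: h; rewrite invrK invr_eq0. Qed.

Lemma maxidM R a x : subring_set R -> R a -> maxid R x -> maxid R (a * x).
Proof.
move=> hR Ra [Rx nx]; split; first exact: (subring_mul hR).
move=> [ax0 h]; apply: nx; have [a0 x0] : a != 0 /\ x != 0.
 by move: ax0; rewrite mulf_eq0 negb_or => /andP.
by split=> //; have := subring_mul hR Ra h; rewrite invfM mulrA divff // mul1r.
Qed.

Lemma maxid_ideal R : vr R -> ideal R (maxid R).
Proof.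
move=> hv; have hR := vr_sub hv; split.
- exact: maxid_sub.
- exact: maxid0.
- have aux : forall x y, maxid R x -> maxid R y -> y != 0 -> R (x / y) -> maxid R (x + y).
  move=> x y mx my y0 hxy.
  rewrite -[x + y](mulfVK y0) mulrDl divff //; apply: maxidM => //.
  by apply: subringD => //; apply: subring_one.
 move=> x y mx my; have [->|x0] := eqVneq x 0; first by rewrite add0r.
 have [->|y0] := eqVneq y 0; first by rewrite addr0.
 have xy0 : x / y != 0 by rewrite mulf_neq0 ?invr_eq0.
 have [h|h] := proj2 hv _ xy0; first exact: aux.
 by rewrite addrC; apply: aux; move: h; rewrite invf_div.
- by move=> a x; apply: maxidM.
Qed.

Definition local (O : set F) := subring_set O /\ forall x y, maxid O x -> maxid O y -> maxid O (x + y).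

Lemma vr_local R : vr R -> local R.
Proof. by move=> hv; split; [exact: vr_sub | exact: idealD (maxid_ideal hv)]. Qed.

Lemma local_ideal O : local O -> ideal O (maxid O).
Proof.
by move=> [hO hD]; split=> //; [exact: maxid_sub|exact: maxid0|move=> a x; exact: maxidM].
Qed.

Lemma local_prime O : local O -> prime_ideal O (maxid O).
Proof.
move=> hO; have hi := local_ideal hO; have hs := proj1 hO; split; try by case: hi.
 exact: maxid_proper.
move=> a b Oa Ob hab; apply: contrapT => /not_orP[na nb].
have [a0 ia] := vr_unit Oa na; have [b0 ib] := vr_unit Ob nb.
apply: (unit_notmax _ _ hab); first by rewrite mulf_neq0.
by rewrite invfM; apply: (subring_mul hs).
Qed.

Lemma vr_prime R a b : vr R -> R a -> R b -> maxid R (a * b) -> maxid R a \/ maxid R b.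
Proof. by move=> /vr_local/local_prime hp; exact: (prime_prime hp). Qed.

Lemma maxid_prime R A : vr R -> subring_set A -> A `<=` R -> prime_ideal A (maxid R `&` A).
Proof.
move=> hv hA AR; have hR := vr_sub hv; have hm := maxid_ideal hv; split.
- by [].
- by split; [exact: maxid0 | exact: subring0].
- by move=> x y [? ?] [? ?]; split; [exact: (idealD hm) | exact: subringD].
- by move=> a x ? [? ?]; split; [apply: (idealM hm) => //; apply: AR | exact: (subring_mul hA)].
- by move=> [/(maxid_proper hR)].
- by move=> a b Aa Ab [h _]; have [?|?] := vr_prime hv (AR _ Aa) (AR _ Ab) h; [left|right].
Qed.

Lemma vr_unit_add R u m : vr R -> R u -> ~ maxid R u -> maxid R m -> ~ maxid R (u + m).
Proof.
move=> hv Ru nu hm h; apply: nu; have := idealB (vr_sub hv) (maxid_ideal hv) h hm.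
by rewrite addrK.
Qed.

Lemma maxidX R x n : vr R -> maxid R x -> (0 < n)%N -> maxid R (x ^+ n).
Proof.
move=> hv hx; case: n => // n _; rewrite exprSr; apply: maxidM => //; first exact: vr_sub.
by apply: subringX; [exact: vr_sub | exact: maxid_sub].
Qed.

Lemma maxid_exp R x n : vr R -> R x -> maxid R (x ^+ n) -> maxid R x.
Proof.
move=> hv Rx; elim: n => [/(maxid_proper (vr_sub hv))//|n IH]; rewrite exprS => h.
by case: (vr_prime hv Rx (subringX n (vr_sub hv) Rx) h).
Qed.

Record acsub k : Prop := AcSub {
 ac_sub : subring_set k;
 ac_inv : forall x, k x -> k x^-1;
 ac_root : forall p, polyin k p -> p \is monic -> (1 < size p)%N -> exists2 c, k c & root p c }.

Definition rational k A J := forall a, A a -> exists2 c, k c & J (a - c).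

(** The residue field of such a ring is k itself, so that every element has a value in k or a pole;
    its centre on a model is a closed point. *)
Record kvr k R : Prop := Kvr {
 kvr_vr : vr R;
 kvr_k : k `<=` R;
 kvr_rat : rational k R (maxid R) }.

End ValuationRings.

Ltac ideal_of J := match goal with
 | h : ideal _ J |- _ => constr:(h)
 | h : prime_ideal _ J |- _ => constr:(prime_ideal_ideal h)
 | h : local ?R |- _ => lazymatch J with maxid R => constr:(local_ideal h) end
 | h : valuation_subring ?R |- _ => lazymatch J with maxid R => constr:(maxid_ideal h) end
 | h : kvr _ ?R |- _ => lazymatch J with maxid R => constr:(maxid_ideal (kvr_vr h)) end
 end.
Ltac member_hook := fail.

(* Closes goals A x, where A is a subring or an ideal, by decomposing x. *)
Ltac member_in n := first [ assumption | lazymatch n with S ?m => lazymatch goal with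
 | |- subring_set ?A => match goal with
   | |- subring_set (gen _ _) => exact: gen_subring
   | |- subring_set (adj _ _) => refine (adj_subring _ _); member_in m
   | h : local A |- _ => exact (proj1 h)
   | h : valuation_subring A |- _ => exact (vr_sub h)
   | h : kvr _ A |- _ => exact (vr_sub (kvr_vr h))
   | h : acsub A |- _ => exact (ac_sub h)
   | |- _ => member_hook
   end
 | |- valuation_subring _ => eapply kvr_vr; eassumption
 | |- ideal _ ?J => first [let h := ideal_of J in exact h | member_hook]
 | |- polyin ?A ?x => first [
   lazymatch x with
   | GRing.one _ => refine (polyinC _ _)
   | @Algebra.zero _ => refine (polyin0 _)
   | polyC _ => refine (polyinC _ _)
   | polyX _ => refine (polyinX _)
   | ?a - ?b => refine (polyinB _ _ _)
   | ?a + ?b => refine (polyinD _ _ _)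
   | - ?a => refine (polyinN _ _)
   | ?a * ?b => refine (polyinM _ _ _)
   | ?a *: ?b => refine (polyinZ _ _ _)
   | 'X^_ => refine (polyinXn _ _)
   end; member_in m
  | match goal with h : polyin ?B x |- _ => refine (sub_polyin _ h); member_in m end ]
 | |- subset ?B ?A => first [ let x := fresh in let h := fresh in move=> x h; member_in m ]
 | |- ?A ?x => first [
   lazymatch x with
   | GRing.one _ => refine (subring_one (A := A) _)
   | @Algebra.zero _ => refine (subring0 (A := A) _)
   | ?a - ?b => refine (subring_sub (A := A) _ _ _)
   | ?a + ?b => refine (subringD (A := A) _ _ _)
   | - ?a => refine (subringN (A := A) _ _)
   | ?a * ?b => refine (subring_mul (A := A) _ _ _)
   | ?a ^+ ?i => refine (subringX (A := A) i _ _)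
   | ?a^-1 => refine (ac_inv (k := A) _ _)
   | ?p.[?a] => refine (horner_in (A := A) _ _ _)
   end; member_in m
  | let h := ideal_of A in lazymatch x with
   | @Algebra.zero _ => exact (ideal0 h)
   | ?a - ?b => refine (idealB _ h _ _); member_in m
   | ?a + ?b => refine (idealD h _ _); member_in m
   | - ?a => refine (idealN _ h _); member_in m
   | ?a * ?b => first [refine (idealM h _ _); member_in m | rewrite (mulrC a b); refine (idealM h _ _); member_in m]
   end
  | lazymatch A with
   | gen _ _ => first [refine (gen_base _); member_in m | refine (gen_mem _ _); solve [assumption | exact: mem_head]]
   | maxid _ => lazymatch x with @Algebra.zero _ => refine (maxid0 _); member_in m end
   end
  | match goal with
   | h : maxid A x |- _ => exact (maxid_sub h)
   | h : prime_ideal A ?J, h' : ?J x |- _ => exact (prime_sub h h')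
   | h : ideal A ?J, h' : ?J x |- _ => exact (ideal_sub h h')
   | h : polyin A ?p |- _ => lazymatch x with p`_?i => exact (h i) end
   | h : subset ?B A |- _ => refine (h x _); member_in m
   | h : kvr ?k A |- _ => refine (kvr_k h _); member_in m
   end
  | member_hook
  | match goal with h : forall y, _ -> A _ |- _ => simple apply h; member_in m end ]
 end end ].
Ltac member := member_in 6%N.

(** * Chevalley's extension theorem, for valuation rings and for rational places *)

Section Places.
Variable F : fieldType.
Implicit Types (A B C R J k : set F) (p q : {poly F}).
Local Notation vr := (@valuation_subring F).

(** The elements congruent to a constant modulo J form a subring, which contains k and s. *)
Lemma gen_rational k s J : subring_set k -> ideal (gen k s) J -> s `in` J ->
 rational k (gen k s) J.
Proof.
move=> ks hJ sJ; have hA := gen_subring k s; have kA := @gen_base _ k s.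
suff : gen k s `<=` [set x | gen k s x /\ exists2 c, k c & J (x - c)] by move=> h x /h[].
apply: gen_min => [|c kc|x xs]; last 2 first.
- by split; [member|exists c; rewrite ?subrr; member].
- by split; [exact: gen_mem|exists 0; member].
split.
- by split; [member|exists 1; [member|rewrite subrr; member]].
- move=> x y [Ax [c kc hc]] [Ay [d kd hd]]; split; first member.
 by exists (c - d); [|have -> : x - y - (c - d) = (x - c) - (y - d) by ring]; member.
- move=> x y [Ax [c kc hc]] [Ay [d kd hd]]; split; first member.
 exists (c * d); first member.
 have -> : x * y - c * d = x * (y - d) + d * (x - c) by ring.
 member.
Qed.

Section Zorn.
Variables (k A0 J0 : set F) (b : bool).
Hypothesis hk : b -> acsub k.

(** Pairs of a ring and a proper ideal extending (A0, J0), to be maximized by Zorn's lemma. With the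
    flag [b] set, the ring must moreover be k plus the ideal; one argument thus yields valuation
    rings ([b = false]) and rational places ([b = true]). *)
Record good (BJ : set F * set F) : Prop := Good {
 good_sub : subring_set BJ.1;
 good_ideal : ideal BJ.1 BJ.2;
 good_proper : ~ BJ.2 1;
 good_A : A0 `<=` BJ.1;
 good_J : J0 `<=` BJ.2;
 good_rat : b -> k `<=` BJ.1 /\ rational k BJ.1 BJ.2 }.

Let T := {BJ | good BJ}.
Let le (x y : T) : bool := `[< (sval x).1 `<=` (sval y).1 /\ (sval x).2 `<=` (sval y).2 >].

Lemma good_premaximal : good (A0, J0) -> exists t : T, forall s : T, le t s -> le s t.
Proof.
move=> h0; pose t0 : T := exist _ _ h0.
have := @ZL_preorder T t0 le; apply.
- by move=> t; apply/asboolP; split.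
- by move=> r s t /asboolP[a1 a2] /asboolP[b1 b2]; apply/asboolP; split=> x hx; member.
move=> C Ctot; have [hne|hem] := pselect (exists t, C t); last first.
 by exists t0 => s hs; exfalso; apply: hem; exists s.
have [t1 Ct1] := hne.
pose B := [set x | exists2 t, C t & (sval t).1 x]; pose J := [set x | exists2 t, C t & (sval t).2 x].
have tot2 : forall s t, C s -> C t -> exists2 r, C r & le s r /\ le t r.
 move=> s t Cs Ct; case: (Ctot _ _ Cs Ct) => h.
  by exists t => //; split=> //; apply/asboolP; split.
 by exists s => //; split=> //; apply/asboolP; split.
have hg : good (B, J).
 split=> /=.
 - split.
  + by exists t1 => //; exact: (subring_one (good_sub (svalP t1))).
  + move=> x y [s Cs hx] [t Ct hy]; have [r Cr [/asboolP[l1 _] /asboolP[l2 _]]] := tot2 _ _ Cs Ct.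
   by exists r => //; apply: (subring_sub (good_sub (svalP r))); member.
  + move=> x y [s Cs hx] [t Ct hy]; have [r Cr [/asboolP[l1 _] /asboolP[l2 _]]] := tot2 _ _ Cs Ct.
   by exists r => //; apply: (subring_mul (good_sub (svalP r))); member.
 - split.
  + by move=> x [s Cs hx]; exists s => //; apply: (ideal_sub (good_ideal (svalP s))).
  + by exists t1 => //; exact: (ideal0 (good_ideal (svalP t1))).
  + move=> x y [s Cs hx] [t Ct hy]; have [r Cr [/asboolP[_ l1] /asboolP[_ l2]]] := tot2 _ _ Cs Ct.
   by exists r => //; apply: (idealD (good_ideal (svalP r))); member.
  + move=> x y [s Cs hx] [t Ct hy]; have [r Cr [/asboolP[l1 _] /asboolP[_ l2]]] := tot2 _ _ Cs Ct.
   by exists r => //; apply: (idealM (good_ideal (svalP r))); member.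
 - by move=> [s Cs]; apply: (good_proper (svalP s)).
 - by move=> x hx; exists t1 => //; apply: (good_A (svalP t1)).
 - by move=> x hx; exists t1 => //; apply: (good_J (svalP t1)).
 - move=> hb; split=> [c kc|a [s Cs hs]].
   by exists t1 => //; apply: (proj1 (good_rat (svalP t1) hb)).
  have [c kc hc] := proj2 (good_rat (svalP s) hb) _ hs.
  by exists c => //; exists s.
by exists (exist _ _ hg) => s Cs; apply/asboolP; split=> x hx; exists s.
Qed.

Variable t : T.
Hypothesis tmax : forall s : T, le t s -> le s t.
Let B := (sval t).1.
Let J := (sval t).2.
Let hB : subring_set B := good_sub (svalP t).
Let hJ : ideal B J := good_ideal (svalP t).
Let J1 : ~ J 1 := good_proper (svalP t).

Lemma good_max B' J' : good (B', J') -> B `<=` B' -> J `<=` J' -> B' `<=` B.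
Proof.
move=> hg h1 h2; have /asboolP[]// : le (exist _ _ hg) t.
by apply: tmax; apply/asboolP.
Qed.

(** If J generated a proper ideal J' of B[x], the pair could be enlarged. With the flag set, x must
    also be sent to a constant, so some J' + (x - c) has to be proper. Otherwise every x - c is
    invertible modulo J'; since polynomials over k split, x satisfies no relation over k modulo J',
    whereas the inverse of x is a polynomial in x modulo J'. *)
Lemma good_out x : ~ B x -> exists2 p, polyin J p & p.[x] = 1.
Proof.
move=> nBx; apply: contrapT => nJ.
pose B' := adj B x; pose J' := [set y | exists2 p, polyin J p & y = p.[x]].
have hB' : subring_set B' := adj_subring x hB.
have sBB' : B `<=` B' by apply: sub_adj.
have Bx : B' x by apply: adj_gen.
have JJ' : J `<=` J'.
 move=> a Ja; exists a%:P; last by rewrite hornerC.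
 by move=> i; rewrite coefC; case: ifP => // _; member.
have hJ' : ideal B' J'.
 split.
 - by move=> _ [p hp ->]; exists p => //; member.
 - member.
 - move=> _ _ [p hp ->] [q hq ->]; exists (p + q); last by rewrite hornerD.
  by move=> i; rewrite coefD; apply: (idealD hJ).
 - move=> _ _ [p hp ->] [q hq ->]; exists (p * q); last by rewrite hornerM.
  exact: polyinMl hJ hp hq.
have J'1 : ~ J' 1 by move=> [p hp E]; apply: nJ; exists p.
have [hb|hb] := boolP b; last first.
 apply: nBx; apply: (@good_max B' J') => //; split=> //=.
 - by move=> y /(good_A (svalP t)) /sBB'.
 - by move=> y /(good_J (svalP t)) /JJ'.
 - by rewrite (negbTE hb).
have [kB ratB] := good_rat (svalP t) hb; have hk' := hk hb; have ks := ac_sub hk'.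
pose Jc c := [set y | exists y1 y2, [/\ J' y1, B' y2 & y = y1 + (x - c) * y2]].
have hJc c : k c -> ideal B' (Jc c).
 move=> kc; split.
 - move=> _ [y1 [y2 [h1 h2 ->]]]; apply: subringD => //; first member.
  apply: (subring_mul hB') => //; apply: (subring_sub hB') => //.
  by apply: sBB'; apply: kB.
 - by exists 0, 0; rewrite mulr0 addr0; split=> //; member.
 - move=> _ _ [y1 [y2 [h1 h2 ->]]] [z1 [z2 [g1 g2 ->]]]; exists (y1 + z1), (y2 + z2); split; last by ring.
   member.
  member.
 - move=> a _ Ba [y1 [y2 [h1 h2 ->]]]; exists (a * y1), (a * y2); split; last by ring.
   member.
  member.
have key : exists2 c, k c & ~ Jc c 1.
 apply: contrapT => nkey.
 have allc c : k c -> Jc c 1 by move=> kc; apply: contrapT => h; apply: nkey; exists c.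
 have redk : forall y, B' y -> exists2 q, polyin k q & J' (y - q.[x]).
  move=> _ [p hp ->]; elim/poly_ind: p hp => [|p a IH] hp.
   exists 0; first member.
   by rewrite subrr; member.
  have hp' : polyin B p by move=> i; have := hp i.+1; rewrite coefD coefMX coefC addr0.
  have Ba : B a by have := hp 0%N; rewrite coefD coefMX coefC add0r.
  have [q hq hq2] := IH hp'; have [c kc hc] := ratB a Ba.
  exists (q * 'X + c%:P).
   member.
  rewrite !hornerMXaddC.
  have -> : p.[x] * x + a - (q.[x] * x + c) = x * (p.[x] - q.[x]) + (a - c) by ring.
  member.
 (* A relation q(x) in J' is shortened by splitting off a root c of q: x - c is a unit modulo J',
    since 1 lies in [Jc c]. *)
 have norel : forall n q, (size q <= n.+1)%N -> polyin k q -> q \is monic -> ~ J' q.[x].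
  elim=> [|n IH] q sq hq mq hJq.
   have E := size1_polyC sq.
   move: mq hJq; rewrite E monicE lead_coefC => /eqP ->; rewrite hornerC; member.
  have [s1|s1] := leqP (size q) 1; first exact: (IH q (leq_trans s1 _) hq mq hJq).
  have [c kc rc] := ac_root hk' hq mq s1.
  have [r hr E] := polyin_factor ks kc hq.
  move: E; rewrite (rootP rc) addr0 => E.
  have mr : r \is monic by move: mq; rewrite E monicMr // monicXsubC.
  have sr : (size r <= n.+1)%N.
   by move: sq; rewrite E size_Mmonic ?monicXsubC ?monic_neq0 // size_XsubC addn2.
  apply: (IH r sr hr mr).
  have [y1 [y2 [h1 h2 E1]]] := allc c kc.
  have Br : B' r.[x].
   by apply: horner_in => //; apply: sub_polyin hr => z kz; apply: sBB'; apply: kB.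
  have -> : r.[x] = r.[x] * y1 + y2 * q.[x].
   rewrite E hornerM hornerXsubC -{1}[r.[x]]mulr1 {1}E1; ring.
  member.
 have [y1 [y2 [h1 h2 E1]]] := allc 0 (subring0 ks).
 have [q hq hq2] := redk _ h2.
 pose r := q * 'X - 1.
 have hr : polyin k r.
  by apply: polyinB; member.
 have r0 : r != 0.
  apply/eqP => /(congr1 (fun p : {poly F} => p.[0])); rewrite hornerD hornerM hornerX mulr0 hornerN hornerC add0r horner0 => /eqP.
  by rewrite oppr_eq0 oner_eq0.
 have Jr : J' r.[x].
  rewrite hornerD hornerM hornerX hornerN hornerC {1}E1 subr0.
  have -> : q.[x] * x - (y1 + x * y2) = (- x) * (y2 - q.[x]) + (-1) * y1 by ring.
  apply: (idealD hJ'); apply: (idealM hJ') => //; apply: subringN => //.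
  member.
 have l0 : lead_coef r != 0 by rewrite lead_coef_eq0.
 have kl : k (lead_coef r)^-1 by apply: (ac_inv hk'); apply: hr.
 apply: (norel (size r) ((lead_coef r)^-1 *: r)).
 - by rewrite (leq_trans (size_scale_leq _ _)).
 - member.
 - by rewrite monicE lead_coefZ mulVf.
 - by rewrite hornerZ; apply: (idealM hJ') => //; apply: sBB'; apply: kB.
have [c kc nc] := key.
apply: nBx; apply: (@good_max B' (Jc c)) => //.
- split=> //=.
 + exact: hJc.
 + by move=> y /(good_A (svalP t)) /sBB'.
 + move=> y /(good_J (svalP t)) /JJ' hy; exists y, 0; split=> //; first member.
  by rewrite mulr0 addr0.
 + move=> _; split=> [y ky|_ [p hp ->]]; first by apply: sBB'; apply: kB.
  have := polyin_factor hB (kB _ kc) hp => -[q hq E].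
  have [d kd hd] := ratB p.[c] (horner_in hB hp (kB _ kc)).
  exists d => //; exists (p.[c] - d), q.[x]; split.
  * member.
  * member.
  * by rewrite {1}E !hornerE; ring.
- move=> y /JJ' hy; exists y, 0; split=> //; first member.
 by rewrite mulr0 addr0.
Qed.

(** A relation p(1/(1 - a)) = 1 with coefficients in J, cleared of denominators, puts a power of 1 -
    a into J; but such powers are congruent to 1. *)
Lemma good_unit a : J a -> B (1 - a)^-1.
Proof.
move=> Ja; apply: contrapT => /good_out [p hp E].
have a1 : 1 - a != 0.
 apply/eqP => h; apply: J1; have -> : 1 = a by apply/eqP; rewrite -subr_eq0 h.
 by [].
have Ba : B (1 - a) by member.
have h1 : J ((1 - a) ^+ size p).
 rewrite -[_ ^+ _]mulr1 -[X in _ * X]E horner_coef mulr_sumr; apply: (ideal_sum hJ) => i _ _.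
 rewrite exprVn mulrCA -expfB //.
 by rewrite mulrC; apply: (idealM hJ) => //; member.
have h2 : forall n, J (1 - (1 - a) ^+ n).
 elim=> [|n IH]; first by rewrite subrr; member.
 have -> : 1 - (1 - a) ^+ n.+1 = (1 - a) * (1 - (1 - a) ^+ n) + a by rewrite exprS; ring.
 member.
by apply: J1; have := idealD hJ (h2 (size p)) h1; rewrite subrK.
Qed.

(** Chevalley's argument: if neither x nor its inverse lies in B, there are relations p(x) = 1 and
    q(1/x) = 1 over J. The one of larger degree is shortened by means of the other, whose
    coefficient 1 - q_0 is a unit by [good_unit]. *)
Lemma good_vr x : x != 0 -> B x \/ B x^-1.
Proof.
move=> x0; apply: contrapT => /not_orP[n1 n2].
have [p0 hp0 E0] := good_out n1; have [q0 hq0 F0] := good_out n2.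
have key : forall N n m (x y : F) p q, x * y = 1 -> (n + m <= N)%N ->
  polyin J p -> polyin J q -> (size p <= n.+1)%N -> (size q <= m.+1)%N ->
  p.[x] = 1 -> q.[y] = 1 -> False.
 elim=> [|N IH] n m {x0 n1 n2 E0 F0}x y p q xy hN hp hq sp sq Ep Eq.
  have n0 : n = 0%N by move: hN; rewrite leqn0 addn_eq0 => /andP[/eqP].
  move: sp; rewrite n0 => /size1_polyC E; apply: J1.
  by rewrite -Ep E hornerC.
 wlog mn : n m x y p q xy hN hp hq sp sq Ep Eq / (m <= n)%N.
  move=> W; case/orP: (leq_total m n) => h; first exact: (W n m x y p q).
  by apply: (W m n y x q p) => //; [rewrite mulrC | rewrite addnC].
 have [n0|n0] := posnP n.
  move: sp; rewrite n0 => /size1_polyC E; apply: J1.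
  by rewrite -Ep E hornerC.
 pose u := (1 - q`_0)^-1; have Bu : B u by apply: good_unit.
 have u0 : 1 - q`_0 != 0.
  apply/eqP => h; apply: J1; have -> : 1 = q`_0 by apply/eqP; rewrite -subr_eq0 h.
  by [].
 (* The relation q(y) = 1 makes 1 - q_0 the sum of the q_(j+1) y^(j+1). Hence r(x) = p_n x^n, and p'
    + r is a relation of smaller degree. *)
 pose r := \sum_(j < m) (p`_n * u * q`_j.+1) *: 'X^(n - j.+1).
 pose p' := \poly_(i < n) p`_i.
 have Jr : polyin J (p' + r).
  move=> i; rewrite coefD; apply: (idealD hJ).
   by rewrite coef_poly; case: ifP => // _; member.
  rewrite coef_sum; apply: (ideal_sum hJ) => j _ _; rewrite coefZ coefXn mulrC.
  apply: (idealM hJ); first by case: eqP => _; [exact: subring_one | exact: subring0].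
  by apply: (idealM hJ) => //; apply: (subring_mul hB) => //; apply: (ideal_sub hJ).
 apply: (IH n.-1 m x y (p' + r) q) => //.
 - by rewrite -ltnS -addSn prednK.
 - rewrite prednK //; apply: leq_trans (size_polyD _ _) _; rewrite geq_max size_poly /=.
  apply: leq_trans (size_sum _ _ _) _; apply/bigmax_leqP => j _.
  apply: leq_trans (size_scale_leq _ _) _; rewrite size_polyXn.
  by rewrite subnS prednK ?subn_gt0 ?leq_subr // (leq_trans _ mn).
 - have x0 : x != 0 by apply/eqP => h; move: xy; rewrite h mul0r => /esym/eqP; rewrite oner_eq0.
  have yx : y = x^-1 by rewrite -[y]mul1r -(mulVf x0) -mulrA xy mulr1.
  have E1 : p = p' + p`_n *: 'X^n.
   apply/polyP => i; rewrite coefD coef_poly coefZ coefXn.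
   case: ltngtP => h; rewrite ?mulr0 ?addr0 ?mulr1 ?add0r ?h //.
   by rewrite nth_default // (leq_trans sp).
  have E2 : 1 - q`_0 = \sum_(j < m) q`_j.+1 * y ^+ j.+1.
   have := Eq; rewrite (horner_coef_wide _ sq) big_ord_recl /= mulr1 => <-.
   by rewrite addrC addKr.
  have E3 : r.[x] = p`_n * x ^+ n.
   rewrite horner_sum (eq_bigr (fun j : 'I_m => p`_n * u * x ^+ n * (q`_j.+1 * y ^+ j.+1))).
    rewrite -mulr_sumr -E2 /u; field; member.
   move=> j _; rewrite hornerZ hornerXn yx exprVn expfB_cond ?(negbTE x0) ?add0n; first by ring.
   exact: leq_trans (ltn_ord j) mn.
  by rewrite hornerD E3 -Ep {2}E1 hornerD hornerZ hornerXn.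
exact: (key (size p0 + size q0)%N (size p0) (size q0) x x^-1 p0 q0 (divff x0)).
Qed.

Lemma good_maxid : J `<=` maxid B.
Proof.
move=> a Ja; split; first member.
by move=> [a0 h]; apply: J1; rewrite -(mulVf a0); member.
Qed.

End Zorn.

Lemma exists_vr A J : subring_set A -> ideal A J -> ~ J 1 ->
 exists R, [/\ vr R, A `<=` R & J `<=` maxid R].
Proof.
move=> hA hJ J1; have hk : false -> acsub A by [].
have hg : good A A J false (A, J) by split.
have [t tmax] := good_premaximal hg.
exists (sval t).1; split.
- by split; [exact: good_sub (svalP t) | exact: (good_vr hk tmax)].
- exact: good_A (svalP t).
- by move=> x /(good_J (svalP t)); apply: good_maxid.
Qed.

Lemma exists_kvr k A J : acsub k -> k `<=` A -> subring_set A -> ideal A J -> ~ J 1 ->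
 rational k A J -> exists R, [/\ kvr k R, A `<=` R & J `<=` maxid R].
Proof.
move=> hk kA hA hJ J1 hrat; have hk' : true -> acsub k by [].
have hg : good k A J true (A, J) by split.
have [t tmax] := good_premaximal hg.
have [h1 h2] := good_rat (svalP t) isT.
exists (sval t).1; split.
- split=> //; first by split; [exact: good_sub (svalP t) | exact: (good_vr hk' tmax)].
 by move=> a /h2[c kc hc]; exists c => //; apply: good_maxid.
- exact: good_A (svalP t).
- by move=> x /(good_J (svalP t)); apply: good_maxid.
Qed.

Lemma vr_integral R A x p : vr R -> A `<=` R -> polyin A p -> p \is monic -> root p x -> R x.
Proof.
move=> hv AR hp mp rx; apply: contrapT => /(vr_out hv)[x0 mx]; have hR := vr_sub hv.
have hm := maxid_ideal hv.
have s0 : (0 < size p)%N by rewrite size_poly_gt0 monic_neq0.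
have E : x ^+ (size p).-1 = - \sum_(i < (size p).-1) p`_i * x ^+ i.
 apply/eqP; rewrite -addr_eq0 addrC; apply/eqP; have /rootP := rx.
 by rewrite horner_coef -(prednK s0) big_ord_recr -lead_coefE (monicP mp) mul1r.
apply: (maxid_proper hR); rewrite -(divff (expf_neq0 (size p).-1 x0)) {1}E mulNr mulr_suml.
apply: (idealN hR hm); apply: (ideal_sum hm) => i _ _.
rewrite -mulrA; apply: (idealM hm); first exact: AR.
have hi := ltn_ord i; rewrite -[X in _ / x ^+ X](subnK (ltnW hi)) exprD invfM mulrCA divff ?expf_neq0 //.
by rewrite mulr1 -exprVn; apply: maxidX => //; rewrite subn_gt0.
Qed.

(** If x lies in A[1/x], clearing denominators gives a monic equation. If not, 1/x generates a
    proper ideal of A[1/x], and a valuation ring in which 1/x is not a unit omits x. *)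
Lemma integral_of_vr A x : subring_set A -> (forall R, vr R -> A `<=` R -> R x) ->
 exists p, [/\ polyin A p, p \is monic & root p x].
Proof.
move=> hA h; have [->|x0] := eqVneq x 0.
 by exists 'X; rewrite monicX /root hornerX; split=> //; member.
pose B := adj A x^-1; have hB : subring_set B by apply: adj_subring.
have Bx : B x^-1 by apply: adj_gen.
have [[q hq E]|nB] := pselect (B x); last first.
 have [|[b Bb E]|R [hv BR mR]] := @exists_vr B [set y | exists2 b, B b & y = x^-1 * b] hB.
 - split.
  + by move=> _ [b Bb ->]; member.
  + by exists 0; [member| rewrite mulr0].
  + by move=> _ _ [b Bb ->] [c Bc ->]; exists (b + c); [member| rewrite mulrDr].
  + by move=> a _ Ba [b Bb ->]; exists (a * b); [member| rewrite mulrCA].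
 - by apply: nB; rewrite -[x]mulr1 E mulVKf.
 exfalso; apply: (@vr_max_out _ R x x0).
  by apply: mR; exists 1; [member| rewrite mulr1].
 by apply: h => // a Aa; apply: BR; apply: sub_adj.
pose n := size q; pose r := \sum_(i < n) q`_i *: 'X^(n - i) : {poly F}.
have sr : (size r < size ('X^(n.+1) : {poly F}))%N.
 rewrite size_polyXn; apply: leq_trans (size_sum _ _ _) _; apply/bigmax_leqP => j _.
 by apply: leq_trans (size_scale_leq _ _) _; rewrite size_polyXn ltnS leq_subr.
exists ('X^(n.+1) - r); split.
- apply: polyinB => //; first member.
 by apply: polyin_sum => // i _ _; apply: polyinZX.
- by rewrite monicE lead_coefDl ?size_polyN // lead_coefXn.
apply/rootP; rewrite hornerD hornerN hornerXn exprSr {2}E horner_coef mulr_sumr horner_sum -sumrB big1 // => i _.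
rewrite hornerZ hornerXn exprVn mulrCA -expfB ?subrr //.
Qed.

End Places.

(** * Residue fields *)

(* [res_sub] is a subring of [R] and [res_max] an ideal of it with quotient a field. *)
Record resdata (R : comPzRingType) := ResData {
 res_sub : set R;
 res_max : set R;
 res_one : res_sub 1;
 res_subB : forall x y, res_sub x -> res_sub y -> res_sub (x - y);
 res_subM : forall x y, res_sub x -> res_sub y -> res_sub (x * y);
 res_max_sub : res_max `<=` res_sub;
 res_max0 : res_max 0;
 res_maxB : forall x y, res_max x -> res_max y -> res_max (x - y);
 res_maxM : forall a x, res_sub a -> res_max x -> res_max (a * x);
 res_max1 : ~ res_max 1;
 res_inv : forall x, res_sub x -> ~ res_max x ->
  exists2 y, res_sub y & res_max (x * y - 1) }.

Section ResidueField.
Variables (R : comPzRingType) (D : resdata R).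
Local Notation A := (res_sub D).
Local Notation m := (res_max D).

Let rep (x : R) : R := xget 0 [set y | A y /\ m (x - y)].

(** The quotient is realized as the set of the representatives chosen by [rep], so that it inherits
    equality and choice from R. *)
Definition kap : Type := {x : R | `[< A x /\ rep x = x >]}.
HB.instance Definition _ := [Choice of kap by <:].

Let A0 : A 0. Proof. by have := res_subB (res_one D) (res_one D); rewrite subrr. Qed.
Let AN x : A x -> A (- x).
Proof. by move=> h; rewrite -sub0r; apply: res_subB. Qed.
Let AD x y : A x -> A y -> A (x + y).
Proof. by move=> hx hy; rewrite -[y]opprK; apply: res_subB => //; apply: AN. Qed.
Let mN x : m x -> m (- x).
Proof. by move=> h; rewrite -sub0r; apply: res_maxB => //; exact: res_max0. Qed.
Let mD x y : m x -> m y -> m (x + y).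
Proof. by move=> hx hy; rewrite -[y]opprK; apply: res_maxB => //; apply: mN. Qed.

Let repP x : A x -> A (rep x) /\ m (x - rep x).
Proof.
by move=> Ax; apply: (@xgetPex _ 0 [set y | A y /\ m (x - y)]); exists x;
  rewrite /= subrr; split=> //; exact: res_max0.
Qed.

Let rep_eq x y : m (x - y) -> rep x = rep y.
Proof.
move=> h; congr (xget _ _); apply/funext => z; apply/propext; split=> -[Az hz]; split=> //.
- by have := res_maxB hz h; rewrite opprB addrC addrA subrK.
- by have := mD h hz; rewrite addrA subrK.
Qed.

Let rep_fix x : A x -> `[< A (rep x) /\ rep (rep x) = rep x >].
Proof. by move=> /repP [h1 h2]; apply/asboolP; split=> //; apply/esym/rep_eq. Qed.

Definition pi (x : R) : kap :=
 match pselect (A x) with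
 | left h => exist _ (rep x) (rep_fix h)
 | right _ => exist _ (rep 0) (rep_fix A0)
 end.

Let val_pi x : A x -> sval (pi x) = rep x.
Proof. by rewrite /pi; case: pselect. Qed.

Let kapP (u : kap) : A (sval u) /\ pi (sval u) = u.
Proof.
case: u => x hx /=; have /asboolP[Ax Ex] := hx; split=> //.
by apply/val_inj; rewrite [LHS]val_pi.
Qed.

Lemma piP (u : kap) : exists2 x, A x & u = pi x.
Proof. by have [h1 h2] := kapP u; exists (sval u). Qed.

Lemma pi_eqP x y : A x -> A y -> pi x = pi y <-> m (x - y).
Proof.
move=> Ax Ay; split=> [/(congr1 sval)|h].
 rewrite !val_pi // => E; have [_ h1] := repP Ax; have [_ h2] := repP Ay.
 by have := res_maxB h1 h2; rewrite E opprB addrA subrK.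
by apply/val_inj; rewrite [LHS]val_pi // [RHS]val_pi //; apply: rep_eq.
Qed.

Let add (u v : kap) := pi (sval u + sval v).
Let opp (u : kap) := pi (- sval u).
Let mul (u v : kap) := pi (sval u * sval v).
Let inv (u : kap) :=
 if u == pi 0 then pi 0 else pi (xget 0 [set y | A y /\ m (sval u * y - 1)]).

Let vpi x : A x -> m (sval (pi x) - x).
Proof. by move=> Ax; rewrite val_pi // -opprB; apply: mN; case: (repP Ax). Qed.

Let addE x y : A x -> A y -> add (pi x) (pi y) = pi (x + y).
Proof.
move=> Ax Ay; apply/pi_eqP; [by apply: AD; apply: (proj1 (kapP _)) | exact: AD |].
by have := mD (vpi Ax) (vpi Ay); rewrite opprD addrACA.
Qed.
Let oppE x : A x -> opp (pi x) = pi (- x).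
Proof.
move=> Ax; apply/pi_eqP; [by apply: AN; apply: (proj1 (kapP _)) | exact: AN |].
by rewrite -opprD; apply: mN; exact: vpi.
Qed.
Let mulE x y : A x -> A y -> mul (pi x) (pi y) = pi (x * y).
Proof.
move=> Ax Ay; apply/pi_eqP; [by apply: res_subM; apply: (proj1 (kapP _)) | exact: res_subM |].
have -> : sval (pi x) * sval (pi y) - x * y
 = sval (pi x) * (sval (pi y) - y) + y * (sval (pi x) - x) by ring.
by apply: mD; apply: res_maxM => //; [apply: (proj1 (kapP _)) | exact: vpi | exact: vpi].
Qed.

Let addA : associative add.
Proof.
move=> u v w; have [x Ax ->] := piP u; have [y Ay ->] := piP v; have [z Az ->] := piP w.
by rewrite !addE ?addrA //; apply: AD.
Qed.
Let addC : commutative add.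
Proof. by move=> u v; rewrite /add addrC. Qed.
Let add0 : left_id (pi 0) add.
Proof. by move=> u; have [x Ax ->] := piP u; rewrite addE // add0r. Qed.
Let addN : left_inverse (pi 0) opp add.
Proof. by move=> u; have [x Ax ->] := piP u; rewrite oppE // addE ?addNr //; apply: AN. Qed.
HB.instance Definition _ := GRing.isZmodule.Build kap addA addC add0 addN.

Let mulA : associative mul.
Proof.
move=> u v w; have [x Ax ->] := piP u; have [y Ay ->] := piP v; have [z Az ->] := piP w.
by rewrite !mulE ?mulrA //; apply: res_subM.
Qed.
Let mulC : commutative mul.
Proof. by move=> u v; rewrite /mul mulrC. Qed.
Let mul1 : left_id (pi 1) mul.
Proof. by move=> u; have [x Ax ->] := piP u; rewrite mulE ?mul1r //; exact: res_one. Qed.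
Let mulD : left_distributive mul add.
Proof.
move=> u v w; have [x Ax ->] := piP u; have [y Ay ->] := piP v; have [z Az ->] := piP w.
by rewrite (addE Ax Ay) !mulE ?addE ?mulrDl //; [apply: res_subM | apply: res_subM | apply: AD].
Qed.
Let one_neq0 : pi 1 != pi 0 :> kap.
Proof.
apply/eqP => /pi_eqP; rewrite subr0 => h; apply: (@res_max1 _ D); apply: h => //.
exact: res_one.
Qed.
HB.instance Definition _ := GRing.Zmodule_isComNzRing.Build kap mulA mulC mul1 mulD one_neq0.

Let mulV : forall u : kap, u != 0 -> inv u * u = 1.
Proof.
move=> u u0; rewrite /inv (negbTE u0); have [Au Eu] := kapP u.
have hm : ~ m (sval u).
 by move=> h; move/eqP: u0; apply; rewrite -Eu; apply/pi_eqP => //; rewrite subr0.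
have [y Ay hy] := res_inv Au hm.
rewrite -[X in _ * X]Eu.
have := @xgetPex _ 0 [set y | A y /\ m (sval u * y - 1)] (ex_intro _ y (conj Ay hy)).
move: (xget _ _) => z [Az hz]; rewrite [LHS]mulE //.
by apply/pi_eqP; [exact: res_subM | exact: res_one | rewrite mulrC].
Qed.
Let inv0 : inv 0 = 0.
Proof. by rewrite /inv eqxx. Qed.
HB.instance Definition _ := GRing.ComNzRing_isField.Build kap mulV inv0.

Lemma piD x y : A x -> A y -> pi (x + y) = pi x + pi y.
Proof. by move=> Ax Ay; rewrite -addE. Qed.
Lemma piN x : A x -> pi (- x) = - pi x.
Proof. by move=> Ax; rewrite -oppE. Qed.
Lemma piB x y : A x -> A y -> pi (x - y) = pi x - pi y.
Proof. by move=> Ax Ay; rewrite piD ?piN //; apply: AN. Qed.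
Lemma piM x y : A x -> A y -> pi (x * y) = pi x * pi y.
Proof. by move=> Ax Ay; rewrite -mulE. Qed.
Lemma pi0 : pi 0 = 0. Proof. by []. Qed.
Lemma pi1 : pi 1 = 1. Proof. by []. Qed.
Lemma pi_eq0 x : A x -> pi x = 0 <-> m x.
Proof. by move=> Ax; rewrite pi_eqP // subr0. Qed.
Lemma piX x n : A x -> pi (x ^+ n) = pi x ^+ n.
Proof.
move=> Ax; suff [] : A (x ^+ n) /\ pi (x ^+ n) = pi x ^+ n by [].
elim: n => [|n [h1 h2]]; first by split=> //; exact: res_one.
by rewrite !exprS; split; [exact: res_subM | rewrite piM // h2].
Qed.
Lemma pi_sum (I : eqType) (r : seq I) (f : I -> R) : (forall i, i \in r -> A (f i)) ->
 A (\sum_(i <- r) f i) /\ pi (\sum_(i <- r) f i) = \sum_(i <- r) pi (f i).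
Proof.
elim: r => [|i r IH] h; first by rewrite !big_nil.
have [h1 h2] := IH (fun j hj => h j (@mem_behead _ (i :: r) j hj)).
have hi : A (f i) by apply: h; rewrite mem_head.
by rewrite !big_cons; split; [exact: AD | rewrite piD // h2].
Qed.

End ResidueField.

(** * Noetherian rings *)

Section Noether.
Variable R : comNzRingType.
Implicit Types (A J : set R) (s t : seq R).

(** Subrings and ideals once more, now inside any commutative ring: Hilbert's theorem is about
    polynomial rings, and the Rees algebra below lives in one. *)
Record rsub A : Prop := RSub {
 rsub1 : A 1;
 rsubB : forall x y, A x -> A y -> A (x - y);
 rsubM : forall x y, A x -> A y -> A (x * y) }.

Record rideal A J : Prop := RIdeal {
 rideal_sub : J `<=` A;
 rideal0 : J 0;
 ridealD : forall x y, J x -> J y -> J (x + y);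
 ridealM : forall a x, A a -> J x -> J (a * x) }.

Lemma rsub0 A : rsub A -> A 0.
Proof. by case=> h1 hB _; have := hB _ _ h1 h1; rewrite subrr. Qed.

Lemma rsubD A x y : rsub A -> A x -> A y -> A (x + y).
Proof.
move=> hA Ax Ay; rewrite -[y]opprK; apply: (rsubB hA) => //.
by rewrite -sub0r; apply: (rsubB hA) => //; apply: rsub0.
Qed.

Lemma rsub_sum A (I : eqType) (r : seq I) (f : I -> R) :
 rsub A -> (forall i, i \in r -> A (f i)) -> A (\sum_(i <- r) f i).
Proof.
move=> hA hf; rewrite big_seq; apply: big_ind => [|x y|i]; last exact: hf.
- exact: rsub0.
- exact: rsubD.
Qed.

Lemma rideal_sum A J (I : eqType) (r : seq I) (f : I -> R) :
 rideal A J -> (forall i, i \in r -> J (f i)) -> J (\sum_(i <- r) f i).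
Proof.
move=> hA hf; rewrite big_seq; apply: big_ind => [|x y|i]; last exact: hf.
- exact: rideal0 hA.
- exact: ridealD hA _ _.
Qed.

Definition lin A s : set R :=
 [set x | exists2 c : nat -> R, (forall i, A (c i)) & x = \sum_(i < size s) c i * s`_i].

Lemma lin0 A s : rsub A -> lin A s 0.
Proof. by move=> hA; exists (fun=> 0) => [i|]; [exact: rsub0 | rewrite big1 // => i _; rewrite mul0r]. Qed.

Lemma linD A s x y : rsub A -> lin A s x -> lin A s y -> lin A s (x + y).
Proof.
move=> hA [c hc ->] [d hd ->]; exists (fun i => c i + d i) => [i|]; first exact: rsubD.
by rewrite -big_split; apply: eq_bigr => i _; rewrite mulrDl.
Qed.

Lemma linM A s a x : rsub A -> A a -> lin A s x -> lin A s (a * x).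
Proof.
move=> hA ha [c hc ->]; exists (fun i => a * c i) => [i|]; first exact: rsubM.
by rewrite mulr_sumr; apply: eq_bigr => i _; rewrite mulrA.
Qed.

Lemma lin_mem A s x : rsub A -> x \in s -> lin A s x.
Proof.
move=> hA hx; have hi : (index x s < size s)%N by rewrite index_mem.
exists (fun i => (i == index x s)%:R) => [i|].
 by case: eqP => _; [exact: rsub1 | exact: rsub0].
rewrite (bigD1 (Ordinal hi)) //= eqxx mul1r nth_index // big1 ?addr0 // => i ni.
suff -> : (i == index x s :> nat) = false by rewrite mul0r.
by apply: contraNF ni => /eqP E; apply/eqP/val_inj.
Qed.

Lemma lin_ideal A s : rsub A -> s `in` A -> rideal A (lin A s).
Proof.
move=> hA hs; split; [|exact: lin0|by move=> *; apply: linD|by move=> *; apply: linM].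
move=> _ [c hc ->]; apply: rsub_sum => // i _; apply: (rsubM hA) => //.
by apply: hs; rewrite mem_nth.
Qed.

Lemma lin_min A J s : rideal A J -> s `in` J -> lin A s `<=` J.
Proof.
move=> hJ hs _ [c hc ->]; apply: (rideal_sum hJ) => i _; apply: (ridealM hJ) => //.
by apply: hs; rewrite mem_nth.
Qed.

Lemma lin_sub A s t : rsub A -> s `in` lin A t -> lin A s `<=` lin A t.
Proof.
move=> hA hs _ [c hc ->]; apply: big_ind => [|x y|i _]; [exact: lin0|exact: linD|].
by apply: linM => //; apply: hs; rewrite mem_nth.
Qed.

Lemma lin_catl A s t : rsub A -> lin A s `<=` lin A (s ++ t).
Proof. by move=> hA; apply: lin_sub => // x hx; apply: lin_mem => //; rewrite mem_cat hx. Qed.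

Lemma lin_catr A s t : rsub A -> lin A t `<=` lin A (s ++ t).
Proof. by move=> hA; apply: lin_sub => // x hx; apply: lin_mem => //; rewrite mem_cat hx orbT. Qed.

Definition noeth A := forall J, rideal A J ->
 exists2 s, (s `in` J) & J `<=` lin A s.

(** Zorn's lemma applies because the union of a chain is finitely generated, hence contained in one
    member of the chain. *)
Lemma noeth_max A (C : set (set R)) : noeth A -> (forall J, C J -> rideal A J) ->
 (exists J, C J) -> exists2 J, C J & forall J', C J' -> J `<=` J' -> J' `<=` J.
Proof.
move=> hn hC [J0 CJ0]; pose T := {J | C J}; pose t0 : T := exist _ _ CJ0.
pose le (x y : T) : bool := `[< sval x `<=` sval y >].
have [|||t tmax] := @ZL_preorder T t0 le.
- by move=> t; apply/asboolP.
- by move=> r s t /asboolP h1 /asboolP h2; apply/asboolP => x /h1/h2.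
- move=> D Dtot; have [hne|hem] := pselect (exists t : T, D t); last first.
  by exists t0 => s hs; exfalso; apply: hem; exists s.
 have [t1 Dt1] := hne.
 have tot2 : forall s t : T, D s -> D t -> exists2 r : T, D r & sval s `<=` sval r /\ sval t `<=` sval r.
  move=> s t Ds Dt; case: (Dtot _ _ Ds Dt) => /asboolP h.
   by exists t => //; split=> // x.
  by exists s => //; split=> // x.
 pose U := [set x | exists2 t : T, D t & sval t x].
 have hU : rideal A U.
  split.
  + by move=> x [s Ds hx]; apply: (rideal_sub (hC _ (svalP s))).
  + by exists t1 => //; exact: (rideal0 (hC _ (svalP t1))).
  + move=> x y [s Cs hx] [t Ct hy]; have [r Cr [l1 l2]] := tot2 _ _ Cs Ct.
   by exists r => //; apply: (ridealD (hC _ (svalP r))); member.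
  + by move=> a x Aa [s Ds hx]; exists s => //; apply: (ridealM (hC _ (svalP s))).
 have [s hs Us] := hn U hU.
 have [t Dt ht] : exists2 t : T, D t & s `in` sval t.
  elim: s {Us} hs => [|x s IH] hs; first by exists t1.
  have [t Dt ht] := IH (fun y hy => hs y (@mem_behead _ (x :: s) y hy)).
  have [t' Dt' hx] := hs x (mem_head _ _).
  have [r Dr [l1 l2]] := tot2 _ _ Dt Dt'.
  exists r => // y /in_consP[->|hy]; [member|apply: l1; exact: ht].
 exists t => r Dr; apply/asboolP => x hx; apply: (lin_min (hC _ (svalP t)) ht).
 by apply: Us; exists r.
- exists (sval t); first exact: (svalP t).
 move=> J' CJ' h; have /asboolP // : le (exist _ _ CJ') t.
 by apply: tmax; apply/asboolP.
Qed.

Lemma noeth_field A : rsub A -> (forall x, A x -> x <> 0 -> exists2 y, A y & y * x = 1) -> noeth A.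
Proof.
move=> hA hf J hJ; have [[x Jx x0]|h] := pselect (exists2 x, J x & x <> 0).
 have [y Ay E] := hf x (rideal_sub hJ Jx) x0.
 exists [:: x] => [z|z Jz]; first by rewrite inE => /eqP ->.
 rewrite -[z]mulr1 -E mulrA; apply: linM => //; first by apply: (rsubM hA) => //; apply: (rideal_sub hJ).
 by apply: lin_mem => //; rewrite mem_head.
exists [::] => // x Jx; have -> : x = 0 by apply: contrapT => x0; apply: h; exists x.
exact: lin0.
Qed.

Definition radj A x : set R := [set y | exists2 p : {poly R}, (forall i, A p`_i) & y = p.[x]].

End Noether.

Definition pin (R : comNzRingType) (A : set R) : set {poly R} := [set p | forall i, A p`_i].

Section Hilbert.
Variables (R : comNzRingType) (A : set R).
Hypotheses (hA : rsub A) (nA : noeth A).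

Lemma pin_rsub : rsub (pin A).
Proof.
split.
- by move=> i; rewrite coefC; case: ifP => _; [exact: rsub1 | exact: rsub0].
- by move=> p q hp hq i; rewrite coefB; apply: (rsubB hA).
- by move=> p q hp hq i; rewrite coefM; apply: rsub_sum => // j _; apply: (rsubM hA).
Qed.

Lemma pin_ZX c n : A c -> pin A (c *: 'X^n).
Proof.
move=> Ac i; rewrite coefZ coefXn; apply: (rsubM hA) => //.
by case: eqP => _; [exact: rsub1 | exact: rsub0].
Qed.

(** [L d] collects the coefficients of degree d of the elements of J of degree at most d. These
    ideals increase, and their union is generated by elements of a single [L N]. In degrees at least
    N the leading term is removed by multiples of lifts of these generators; the degrees below N are
    treated one by one. *)
Theorem hilbert_basis : noeth (pin A).
Proof.
move=> J hJ.
pose L d := [set a | exists p, [/\ J p, (size p <= d.+1)%N & p`_d = a]].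
have hL d : rideal A (L d).
 split.
 - by move=> _ [p [Jp _ <-]]; apply: (rideal_sub hJ).
 - by exists 0; rewrite size_poly0 coef0; split=> //; exact: (rideal0 hJ).
 - move=> _ _ [p [Jp sp <-]] [q [Jq sq <-]]; exists (p + q); rewrite coefD; split=> //.
   exact: (ridealD hJ).
  by rewrite (leq_trans (size_polyD _ _)) // geq_max sp.
 - move=> a _ Aa [p [Jp sp <-]]; exists (a *: p); rewrite coefZ; split=> //.
   rewrite -mul_polyC; apply: (ridealM hJ) => // i; rewrite coefC; case: ifP => // _.
   exact: rsub0.
  exact: leq_trans (size_scale_leq _ _) sp.
have LS d : L d `<=` L d.+1.
 move=> _ [p [Jp sp <-]]; exists (p * 'X); split.
 - rewrite mulrC; apply: (ridealM hJ) => // i; rewrite coefX.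
  by case: eqP => _; [exact: rsub1 | exact: rsub0].
 - have [->|p0] := eqVneq p 0; first by rewrite mul0r size_poly0.
  by rewrite size_mulX.
 - by rewrite coefMX.
have Lle d e : (d <= e)%N -> L d `<=` L e.
 by move=> /subnK <-; elim: (e - d)%N => // n IH; apply: subset_trans IH _.
have lift d (s : seq R) : s `in` L d -> exists P : seq {poly R},
  [/\ P `in` J, forall p, p \in P -> (size p <= d.+1)%N & [seq (p : {poly R})`_d | p <- P] = s].
 elim: s => [|x s IH] hs; first by exists [::].
 have [P [h1 h2 <-]] := IH (fun y hy => hs y (@mem_behead _ (x :: s) y hy)).
 have [p [Jp sp <-]] := hs x (mem_head _ _).
 exists (p :: P); split=> // q /in_consP[->//|]; [exact: h1|exact: h2].
have red d (P : seq {poly R}) (p : {poly R}) : P `in` J -> (forall q, q \in P -> (size q <= d.+1)%N) ->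
  forall e, (d <= e)%N -> J p -> (size p <= e.+1)%N -> lin A [seq (q : {poly R})`_d | q <- P] (p`_e) ->
  exists r, [/\ lin (pin A) P r, J (p - r) & (size (p - r)%R <= e)%N].
 move=> JP sP e de Jp sp [c hc E]; pose r := \sum_(i < size P) (c i *: 'X^(e - d)) * P`_i.
 have hr : lin (pin A) P r by exists (fun i => c i *: 'X^(e - d)) => // i; apply: pin_ZX.
 exists r; split=> //.
  have -> : p - r = p + (-1) * r by rewrite mulN1r.
  apply: (ridealD hJ) => //; apply: (ridealM hJ).
   by rewrite -sub0r; apply: (rsubB pin_rsub); [exact: rsub0 pin_rsub|exact: rsub1 pin_rsub].
  exact: (lin_min hJ JP).
 apply/leq_sizeP => j; rewrite leq_eqVlt => /orP[/eqP <-|ej].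
  rewrite coefB E size_map coef_sum; apply/eqP; rewrite subr_eq0; apply/eqP.
  apply: eq_bigr => i _; rewrite (nth_map 0) // -scalerAl coefZ coefXnM.
  by rewrite ltnNge leq_subr subKn.
 rewrite coefB (nth_default _ (leq_trans sp ej)) sub0r coef_sum big1 ?oppr0 // => i _.
 rewrite -scalerAl coefZ coefXnM; case: ifP => _; rewrite ?mulr0 // nth_default ?mulr0 //.
 apply: leq_trans (sP _ (mem_nth _ (ltn_ord i))) _.
 by move: de ej; lia.
have low d : exists2 P, (P `in` J) & forall p, J p -> (size p <= d)%N -> lin (pin A) P p.
 elim: d => [|d [P JP hP]].
  by exists [::] => // p _; rewrite leqn0 size_poly_eq0 => /eqP ->; exact: lin0 pin_rsub.
 have [s hs Ls] := nA (hL d); have [Q [JQ sQ EQ]] := lift d s hs.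
 exists (P ++ Q) => [p|p Jp sp]; first by case/in_catP=> [/JP|/JQ].
 have hd : lin A [seq (q : {poly R})`_d | q <- Q] (p`_d) by rewrite EQ; apply: Ls; exists p.
 have [r [h1 h2 h3]] := red d Q p JQ sQ d (leqnn d) Jp sp hd.
 rewrite -[p](subrK r); apply: linD; first exact: pin_rsub.
  by apply: lin_catl; [exact: pin_rsub | exact: hP].
 by apply: lin_catr; first exact: pin_rsub.
pose LL := [set a | exists d, L d a].
have hLL : rideal A LL.
 split.
 - by move=> x [d hd]; apply: (rideal_sub (hL d)).
 - by exists 0%N; exact: (rideal0 (hL 0%N)).
 - move=> x y [d hd] [e he]; exists (maxn d e); apply: (ridealD (hL _)).
   exact: Lle (leq_maxl _ _) _ hd.
  exact: Lle (leq_maxr _ _) _ he.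
 - by move=> a x Aa [d hd]; exists d; apply: (ridealM (hL d)).
have [s hs Ls] := nA hLL.
have [N hN] : exists N, s `in` L N.
 elim: s {Ls} hs => [|x s IH] hs; first by exists 0%N.
 have [N hN] := IH (fun y hy => hs y (@mem_behead _ (x :: s) y hy)).
 have [d hd] := hs x (mem_head _ _); exists (maxn N d) => y /in_consP[->|hy].
  exact: Lle (leq_maxr _ _) _ hd.
 exact: Lle (leq_maxl _ _) _ (hN _ hy).
have [Q [JQ sQ EQ]] := lift N s hN; have [P JP hP] := low N.
exists (P ++ Q) => [p|p]; first by case/in_catP=> [/JP|/JQ].
have [n] := ubnP (size p); elim: n p => // n IH p sp Jp.
have [sN|Ns] := leqP (size p) N; first by apply: lin_catl; [exact: pin_rsub | exact: hP].
have s0 : (0 < size p)%N by exact: leq_ltn_trans Ns.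
have hl : lin A [seq (q : {poly R})`_N | q <- Q] (p`_(size p).-1).
 by rewrite EQ; apply: Ls; exists (size p).-1, p; rewrite prednK.
have [||r [h1 h2 h3]] := red N Q p JQ sQ (size p).-1 _ Jp _ hl; rewrite ?prednK //.
 by rewrite -ltnS prednK.
rewrite -[p](subrK r); apply: linD; first exact: pin_rsub.
 by apply: IH => //; apply: leq_ltn_trans h3 _; rewrite prednK.
by apply: lin_catr; first exact: pin_rsub.
Qed.

End Hilbert.

Section Adjoin.
Variable R : comNzRingType.
Implicit Types A : set R.

Lemma radj_rsub A x : rsub A -> rsub (radj A x).
Proof.
move=> hA; have hP := pin_rsub hA; split.
- by exists 1; [exact: (rsub1 hP) | rewrite hornerC].
- by move=> _ _ [p hp ->] [q hq ->]; exists (p - q); [exact: (rsubB hP) | rewrite hornerD hornerN].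
- by move=> _ _ [p hp ->] [q hq ->]; exists (p * q); [exact: (rsubM hP) | rewrite hornerM].
Qed.

Lemma noeth_adj A x : rsub A -> noeth A -> noeth (radj A x).
Proof.
move=> hA nA J hJ; have hP := pin_rsub hA.
pose I := [set p : {poly R} | pin A p /\ J p.[x]].
have hI : rideal (pin A) I.
 split.
 - by move=> p [].
 - by split; [exact: (rsub0 hP) | rewrite horner0; exact: (rideal0 hJ)].
 - by move=> p q [? ?] [? ?]; split; [exact: (rsubD hP) | rewrite hornerD; exact: (ridealD hJ)].
 - move=> a p ha [? ?]; split; first exact: (rsubM hP).
  by rewrite hornerM; apply: (ridealM hJ) => //; exists a.
have [P hIP h] := hilbert_basis hA nA hI.
exists [seq p.[x] | p <- P] => [_ /mapP[p /hIP[_ hp] ->]//|y Jy].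
have [p hp E] := rideal_sub hJ Jy.
have [c hc Ec] : lin (pin A) P p by apply: h; split=> //; rewrite -E.
exists (fun i => (c i).[x]) => [i|]; first by exists (c i) => //; exact: hc.
rewrite E Ec horner_sum size_map; apply: eq_bigr => i _.
by rewrite hornerM (nth_map 0).
Qed.

Fixpoint radjs A s := if s is x :: s' then radj (radjs A s') x else A.

Lemma radjs_rsub A s : rsub A -> rsub (radjs A s).
Proof. by move=> hA; elim: s => //= x s; apply: radj_rsub. Qed.

Lemma noeth_radjs A s : rsub A -> noeth A -> noeth (radjs A s).
Proof. by move=> hA nA; elim: s => //= x s; apply: noeth_adj; apply: radjs_rsub. Qed.

Lemma sub_radj A x : rsub A -> A `<=` radj A x.
Proof.
move=> hA a Aa; exists a%:P; last by rewrite hornerC.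
by move=> i; rewrite coefC; case: ifP => // _; exact: rsub0.
Qed.

Lemma sub_radjs A s : rsub A -> A `<=` radjs A s.
Proof.
by move=> hA; elim: s => //= x s IH; apply: subset_trans IH _; apply: sub_radj; apply: radjs_rsub.
Qed.

Lemma radjs_mem A s x : rsub A -> x \in s -> radjs A s x.
Proof.
move=> hA; elim: s => //= y s IH /in_consP[->|hx].
 exists 'X; last by rewrite hornerX.
 move=> i; rewrite coefX; case: eqP => _; [exact: (rsub1 (radjs_rsub s hA)) |].
 exact: (rsub0 (radjs_rsub s hA)).
by apply: sub_radj; [exact: radjs_rsub | exact: IH].
Qed.

Lemma radjs_min A s C : rsub C -> A `<=` C -> s `in` C -> radjs A s `<=` C.
Proof.
move=> hC AC; elim: s => //= x s IH hs _ [p hp ->].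
have sC : radjs A s `<=` C by apply: IH => y hy; apply: hs; rewrite inE hy orbT.
rewrite horner_coef; apply: rsub_sum => // i _; apply: (rsubM hC); first by apply: sC.
elim: (nat_of_ord i) => [|n IHn]; first exact: (rsub1 hC).
by rewrite exprS; apply: (rsubM hC) => //; apply: hs; rewrite mem_head.
Qed.

End Adjoin.

Section FieldNoether.
Variable F : fieldType.
Implicit Types (A B m k : set F).

Lemma subring_rsub A : subring_set A -> rsub A. Proof. by case. Qed.
Lemma ideal_rideal A m : ideal A m -> rideal A m. Proof. by case. Qed.
Lemma rideal_ideal A m : rideal A m -> ideal A m. Proof. by case. Qed.

Lemma radjs_gen A s : subring_set A -> radjs A s = gen A s.
Proof.
move=> hA; elim: s => [|x s IH]; first by rewrite gen_nil.
by rewrite gen_cons /= IH.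
Qed.

Lemma noeth_gen k s : acsub k -> noeth (gen k s).
Proof.
move=> hk; have hk' := ac_sub hk; rewrite -radjs_gen //; apply: noeth_radjs.
 exact: subring_rsub.
apply: noeth_field; first exact: subring_rsub.
by move=> x kx /eqP x0; exists x^-1; [member| rewrite mulVf].
Qed.

Fixpoint ipow B m n : set F :=
 if n is n'.+1 then
  [set x | exists s : seq (F * F), (forall p, p \in s -> m p.1 /\ ipow B m n' p.2) /\
                   x = \sum_(p <- s) p.1 * p.2]
 else B.

Lemma ipow_ideal B m n : subring_set B -> ideal B m -> ideal B (ipow B m n).
Proof.
move=> hB hm; elim: n => [|n IH] /=.
 by split=> //; [member| move=> *; member| move=> *; member].
split.
- move=> _ [s [hs ->]]; apply: subring_sum => // p hp _; have [h1 h2] := hs p hp.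
 member.
- by exists [::]; rewrite big_nil.
- move=> _ _ [s [hs ->]] [t [ht ->]]; exists (s ++ t); rewrite big_cat; split=> // p.
 by case/in_catP=> [/hs|/ht].
- move=> a _ Ba [s [hs ->]]; exists [seq (a * p.1, p.2) | p <- s]; split.
  by move=> _ /mapP[p /hs[h1 h2] ->]; split=> //; apply: (idealM hm).
 by rewrite big_map mulr_sumr; apply: eq_bigr => p _; rewrite mulrA.
Qed.

Lemma ipowM B m n a b : subring_set B -> ideal B m -> m a -> ipow B m n b -> ipow B m n.+1 (a * b).
Proof.
move=> hB hm ha hb; exists [:: (a, b)]; rewrite big_seq1; split=> // p.
by rewrite inE => /eqP ->.
Qed.

(* Krull's intersection theorem in B / gB, by way of the Rees algebra of m (Perdry's argument). *)
Theorem krull_intersection B m g b : subring_set B -> noeth B -> ideal B m -> B g ->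
 (forall n, exists r c, [/\ ipow B m n r, B c & b = r + g * c]) ->
 exists e c, [/\ m e, B c & (1 - e) * b = g * c].
Proof.
move=> hB nB hm Bg hb; have [t ht mt] := nB m (ideal_rideal hm).
pose B0 : set {poly F} := [set p | exists2 c, B c & p = c%:P].
have hB0 : rsub B0.
 split.
 - by exists 1 => //; member.
 - by move=> _ _ [c Bc ->] [d Bd ->]; exists (c - d); [member|rewrite polyCB].
 - by move=> _ _ [c Bc ->] [d Bd ->]; exists (c * d); [member|rewrite polyCM].
have nB0 : noeth B0.
 move=> J hJ; pose I := [set c | J c%:P].
 have hI : rideal B I.
  split.
  - move=> c /(rideal_sub hJ)[d Bd /polyC_inj ->//].
  - exact: (rideal0 hJ).
  - by move=> x y hx hy; rewrite /I /= polyCD; apply: (ridealD hJ).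
  - by move=> a x Ba hx; rewrite /I /= polyCM; apply: (ridealM hJ) => //; exists a.
 have [s hs Is] := nB I hI; exists [seq c%:P | c <- s] => [_ /mapP[c /hs hc ->]//|p Jp].
 have [c Bc E] := rideal_sub hJ Jp; have [d hd Ed] : lin B s c by apply: Is; rewrite /I /= -E.
 exists (fun i => (d i)%:P) => [i|]; first by exists (d i).
 rewrite E Ed rmorph_sum size_map; apply: eq_bigr => i _; rewrite (nth_map 0) //.
 exact: polyCM.
pose ts := [seq a *: 'X | a <- t].
pose Re := radjs B0 ts.
have hRe : rsub Re by apply: radjs_rsub.
have nRe : noeth Re by apply: noeth_radjs.
have mX a : m a -> Re (a *: 'X).
 move=> /mt[c hc ->]; rewrite scaler_suml; apply: rsub_sum => // i _.
 rewrite -scalerA -mul_polyC; apply: (rsubM hRe).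
  by apply: sub_radjs => //; exists (c i).
 by apply: radjs_mem => //; apply: map_f; rewrite mem_nth.
have powX n r : ipow B m n r -> Re (r *: 'X^n).
 elim: n r => [|n IH] r /= hr.
  by rewrite alg_polyC; apply: sub_radjs => //; exists r.
 case: hr => s [hs ->]; rewrite scaler_suml; apply: rsub_sum => // p /hs[h1 h2].
 have -> : (p.1 * p.2) *: 'X^(n.+1) = (p.1 *: 'X) * (p.2 *: 'X^n) :> {poly F}.
  by rewrite -scalerAl -scalerAr scalerA exprS.
 by apply: (rsubM hRe); [exact: mX | exact: IH].
have coefRe p : Re p -> B p`_0 /\ forall i, m p`_i.+1.
 pose C : set {poly F} := [set p | B p`_0 /\ forall i, m p`_i.+1].
 suff : Re `<=` C by apply.
 have hBm i (q : {poly F}) : C q -> B q`_i.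
  by case: i => [[]//|i [_ h]]; apply: (ideal_sub hm).
 have hC : rsub C.
  split.
  - split=> [|i]; rewrite coef1; [exact: subring_one | exact: (ideal0 hm)].
  - move=> p1 p2 [a1 a2] [b1 b2]; split=> [|i]; rewrite coefB; first member.
   exact: (idealB hB hm).
  - move=> p1 p2 h1 h2; split=> [|i]; rewrite coefM.
    by rewrite big_ord1; apply: (subring_mul hB); exact: hBm.
   apply: (ideal_sum hm) => j _ _; case: (nat_of_ord j) => [|j'].
    by rewrite subn0; apply: (idealM hm); [exact: hBm | case: h2].
   by rewrite mulrC; apply: (idealM hm); [exact: hBm | case: h1].
 apply: radjs_min => // [_ [c Bc ->]|_ /mapP[a ha ->]].
  by split=> [|i]; rewrite coefC //=; member.
 split=> [|i]; rewrite coefZ coefX ?mulr0; first member.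
 by rewrite mulrC; apply: (idealM hm); [case: eqP => _; [exact: subring_one|exact: subring0] | exact: ht].
have [r hr] : exists r : nat -> F, forall n, exists2 c, ipow B m n (r n) /\ B c & b = r n + g * c.
 have /choice[r hr] : forall n, exists r, exists2 c, ipow B m n r /\ B c & b = r + g * c.
  by move=> n; have [r [c [? ? ?]]] := hb n; exists r, c.
 by exists r.
(* The ideal generated by all r_n X^n, where b = r_n + g c_n with r_n in m^n. The Rees algebra being
   noetherian, some r_N X^N is a combination of the earlier ones. *)
pose J : set {poly F} := [set p | exists N, lin Re [seq r i *: 'X^i | i <- iota 0 N] p].
have Jr n : Re (r n *: 'X^n) by have [c [h _] _] := hr n; apply: powX.
have linle N M : (N <= M)%N -> lin Re [seq r i *: 'X^i | i <- iota 0 N] `<=` lin Re [seq r i *: 'X^i | i <- iota 0 M].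
 by move=> /subnKC <-; rewrite iotaD map_cat; apply: lin_catl.
have hJ : rideal Re J.
 have hl N : rideal Re (lin Re [seq r i *: 'X^i | i <- iota 0 N]).
  by apply: lin_ideal => // _ /mapP[i _ ->].
 split.
 - by move=> p [N]; apply: (rideal_sub (hl N)).
 - by exists 0%N; exact: (rideal0 (hl 0%N)).
 - move=> x y [N hN] [M hM]; exists (maxn N M); apply: (ridealD (hl _)).
   exact: linle (leq_maxl _ _) _ hN.
  exact: linle (leq_maxr _ _) _ hM.
 - by move=> a x Ra [N hN]; exists N; apply: (ridealM (hl N)).
have [s hs Js] := nRe J hJ.
have [N hN] : exists N, forall p, p \in s -> lin Re [seq r i *: 'X^i | i <- iota 0 N] p.
 elim: s {Js} hs => [|x s IH] hs; first by exists 0%N.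
 have [N hN] := IH (fun y hy => hs y (@mem_behead _ (x :: s) y hy)).
 have [d hd] := hs x (mem_head _ _); exists (maxn N d) => y /in_consP[->|hy].
  exact: linle (leq_maxr _ _) _ hd.
 exact: linle (leq_maxl _ _) _ (hN _ hy).
have [q hq E] : lin Re [seq r i *: 'X^i | i <- iota 0 N] (r N *: 'X^N).
 apply: (lin_sub hRe hN); apply: Js; exists N.+1; apply: lin_mem => //.
 by apply/mapP; exists N; rewrite ?mem_iota ?ltnSn.
(* For i < N the coefficient of degree N - i of an element of the Rees algebra lies in m, hence so
   does e. Substituting r_i = b - g c_i in the relation for r_N gives (1 - e) b in gB. *)
pose e := \sum_(i < N) (q i)`_(N - i).
have {}E : r N = \sum_(i < N) (q i)`_(N - i) * r i.
 move: E => /(congr1 (fun p : {poly F} => p`_N)); rewrite coefZ coefXn eqxx mulr1 => ->.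
 rewrite coef_sum size_map size_iota; apply: eq_bigr => i _.
 rewrite (nth_map 0%N) ?size_iota // nth_iota // add0n -scalerAr coefZ coefMXn.
 by rewrite ltnNge (ltnW (ltn_ord i)) mulrC.
have [c hc] : exists c : nat -> F, forall n, B (c n) /\ b = r n + g * c n.
 have /choice[c hc] : forall n, exists c, B c /\ b = r n + g * c.
  by move=> n; have [c [_ ?] ?] := hr n; exists c.
 by exists c.
have me i : (i < N)%N -> m (q i)`_(N - i).
 by move=> iN; have [_] := coefRe _ (hq i); rewrite -subnSK.
exists e, (c N - \sum_(i < N) (q i)`_(N - i) * c i); split.
- by apply: (ideal_sum hm) => i _ _; apply: me.
- apply: (subring_sub hB); first by case: (hc N).
 apply: subring_sum => // i _ _; apply: (subring_mul hB); last by case: (hc i).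
 by apply: (ideal_sub hm); apply: me.
- rewrite mulrBl mul1r {1}(proj2 (hc N)) E.
 have -> : e * b = \sum_(i < N) (q i)`_(N - i) * r i + g * \sum_(i < N) (q i)`_(N - i) * c i.
  rewrite mulr_suml mulr_sumr -big_split; apply: eq_bigr => i _ /=.
  by rewrite {1}(proj2 (hc i)); ring.
 by ring.
Qed.

End FieldNoether.

(** * Algebraic independence *)

Section Transcendence.
Variable F : fieldType.
Implicit Types (A B C R : set F) (s : seq F) (p : {poly F}).
Local Notation vr := (@valuation_subring F).

Definition transc A x := forall p, polyin A p -> p.[x] = 0 -> p = 0.

(* R contains the field of fractions of A. *)
Definition fr R A := A `<=` R /\ forall a, A a -> a != 0 -> R a^-1.

(** Algebraicity over A, stated by valuation rings ([algbP]); in this form transitivity and closure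
    under the ring operations are immediate. *)
Definition algb A x := forall R, vr R -> fr R A -> R x.

Fixpoint indep A s := if s is x :: s' then transc A x /\ indep (adj A x) s' else True.

Lemma nontranscP A x : ~ transc A x <-> exists p, [/\ polyin A p, p != 0 & root p x].
Proof.
split=> [h|[p [hp p0 /rootP rp]] h]; last by move/eqP: p0; apply; apply: h.
apply: contrapT => h2; apply: h => p hp rp; apply: contrapT => /eqP p0.
by apply: h2; exists p; split=> //; apply/rootP.
Qed.

(** The valuation rings containing the fraction field L of A test integrality over L, which is
    algebraicity; the denominators of the monic equation are then cleared. *)
Lemma algbP A x : subring_set A -> algb A x <-> ~ transc A x.
Proof.
move=> hA; split; last first.
 move=> /nontranscP[p [hp p0 rp]] R hv [AR iR].
 have l0 : lead_coef p != 0 by rewrite lead_coef_eq0.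
 apply: (@vr_integral F R R x ((lead_coef p)^-1 *: p) hv).
 - by [].
 - apply: polyinZ; [member| by apply: iR => //; apply: hp | member].
 - by rewrite monicE lead_coefZ mulVf.
 - by rewrite rootZ ?invr_eq0.
move=> h; pose L := [set y | exists a b, [/\ A a, A b, b != 0 & y = a / b]].
have hL : subring_set L.
 split.
 - by exists 1, 1; rewrite oner_neq0 divr1; split=> //; member.
 - move=> _ _ [a [b [Aa Ab b0 ->]]] [c [d [Ac Ad d0 ->]]]; exists (a * d - c * b), (b * d).
  split; [|member|exact: mulf_neq0|by field; rewrite d0].
  member.
 - move=> _ _ [a [b [Aa Ab b0 ->]]] [c [d [Ac Ad d0 ->]]]; exists (a * c), (b * d).
  split; [member|member|exact: mulf_neq0|by field; rewrite d0].
have [p [hp mp rp]] : exists p, [/\ polyin L p, p \is monic & root p x].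
 apply: integral_of_vr => // R hv LR; apply: h => //; split=> [a Aa|a Aa a0].
  by apply: LR; exists a, 1; rewrite oner_neq0 divr1; split=> //; member.
 by apply: LR; exists 1, a; rewrite div1r; split=> //; member.
have [d [Ad d0 hd]] : exists d, [/\ A d, d != 0 & polyin A (d *: p)].
 suff : forall n, exists d, [/\ A d, d != 0 & forall i, (i < n)%N -> A (d * p`_i)].
  move=> /(_ (size p))[d [Ad d0 hd]]; exists d; split=> // i; rewrite coefZ.
  case: (ltnP i (size p)) => hi; first member.
  by rewrite nth_default; member.
 elim=> [|n [d [Ad d0 hd]]]; first by exists 1; rewrite oner_neq0; split=> //; member.
 have [a [b [Aa Ab b0 E]]] := hp n; exists (d * b); rewrite mulf_neq0 //; split=> //.
  member.
 move=> i; rewrite ltnS leq_eqVlt => /orP[/eqP ->|hi].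
  by rewrite E -mulrA [b * _]mulrC mulfVK; member.
 by rewrite mulrAC; member.
apply/nontranscP; exists (d *: p); split=> //; last by rewrite rootZ.
by rewrite scaler_eq0 negb_or d0 monic_neq0.
Qed.

Lemma algb_mono A B x : A `<=` B -> algb A x -> algb B x.
Proof. by move=> AB h R hv [BR iR]; apply: h => //; split=> a /AB; [exact: BR|exact: iR]. Qed.

Lemma transc_mono A B x : A `<=` B -> transc B x -> transc A x.
Proof. by move=> AB h p hp; apply: h; member. Qed.

Lemma algb_base A x : A x -> algb A x. Proof. by move=> Ax R hv [AR _]; member. Qed.

Lemma algb_subring A : subring_set (algb A).
Proof.
split=> [R hv _|x y hx hy R hv hR|x y hx hy R hv hR].
- member.
- by apply: (subring_sub (vr_sub hv)); [apply: hx | apply: hy].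
- by apply: (subring_mul (vr_sub hv)); [apply: hx | apply: hy].
Qed.

Lemma algbV A x : subring_set A -> algb A x -> algb A x^-1.
Proof.
move=> hA; have [->|x0] := eqVneq x 0; first by rewrite invr0.
move=> /(algbP _ hA)/nontranscP[p [hp p0 /rootP rp]]; apply/algbP => //; apply/nontranscP.
pose n := size p; pose q := \poly_(i < n) p`_(n.-1 - i).
have n0 : (0 < n)%N by rewrite size_poly_gt0.
exists q; split.
- by move=> i; rewrite coef_poly; case: ifP => _ //; member.
- apply/eqP => /(congr1 (fun q : {poly F} => q`_0)); rewrite coef_poly n0 subn0 coef0 => /eqP.
 by rewrite lead_coef_eq0 (negbTE p0).
- apply/rootP; rewrite horner_poly.
 apply: (mulfI (expf_neq0 n.-1 x0)); rewrite mulr0 -[RHS]rp mulr_sumr horner_coef.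
 rewrite (reindex_inj rev_ord_inj) /=; apply: eq_bigr => i _.
 have hi : (i <= n.-1)%N by rewrite -ltnS prednK.
 have -> : (n - i.+1 = n.-1 - i)%N by rewrite -subn1 -subnDA.
 rewrite mulrCA exprVn -expfB_cond ?(negbTE x0) ?leq_subr // subKn //.
Qed.

Lemma algb_trans A B s y : subring_set B -> A `<=` B -> s `in` algb B ->
 algb (gen A s) y -> algb B y.
Proof.
move=> hB AB hs h R hv hR.
have sub : gen A s `<=` algb B.
 by apply: gen_min => [|a Aa|//]; [exact: algb_subring | apply: algb_base; member].
apply: h => //; split=> [a /sub|a /sub ha a0]; first exact.
exact: (algbV hB ha hv hR).
Qed.

(** A polynomial in y with coefficients in A[x] is rearranged by powers of x. It does not become
    zero, because y is transcendental over A. *)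
Lemma exchange A x y : subring_set A -> algb (adj A x) y -> transc A y -> algb (adj A y) x.
Proof.
move=> hA /(algbP _ (adj_subring x hA))/nontranscP[p [hp p0 /rootP rp]] ty.
apply/algbP; first member.
have /choice[P hP] : forall j, exists q, polyin A q /\ p`_j = q.[x].
 by move=> j; have [q hq E] := hp j; exists q.
have [j hj] : exists j, p`_j != 0.
 by exists (size p).-1; rewrite lead_coef_eq0.
have Pj : P j != 0 by apply/eqP => E; move: hj; rewrite (proj2 (hP j)) E horner0 eqxx.
pose N := \max_(j < size p) size (P j).
pose q i := \poly_(j < size p) (P j)`_i.
have hq i : polyin A (q i).
 by move=> k; rewrite coef_poly; case: ifP => _; [exact: (proj1 (hP k)) | member].
apply/nontranscP; exists (\poly_(i < N) (q i).[y]); split.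
- move=> i; rewrite coef_poly; case: ifP => _; first by exists (q i).
 member.
- have sj : (j < size p)%N.
  by rewrite ltnNge; apply: contra hj => h; rewrite nth_default.
 pose i := (size (P j)).-1.
 have iN : (i < N)%N.
  apply: leq_trans (leq_bigmax (Ordinal sj)); rewrite prednK // size_poly_gt0 //.
 apply/eqP => /(congr1 (fun q : {poly F} => q`_i)); rewrite coef_poly iN coef0 => /ty.
 move=> /(_ (hq i)) /(congr1 (fun q : {poly F} => q`_j)); rewrite coef_poly sj coef0 => /eqP.
 by rewrite lead_coef_eq0 (negbTE Pj).
- apply/rootP; rewrite horner_poly; rewrite (eq_bigr (fun i : 'I_N =>
  \sum_(j < size p) (P j)`_i * y ^+ j * x ^+ i)); last first.
  by move=> i _; rewrite horner_poly mulr_suml.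
 rewrite exchange_big /= -[RHS]rp horner_coef; apply: eq_bigr => l _.
 rewrite (proj2 (hP l)) (@horner_coef_wide _ N) ?mulr_suml; last first.
  exact: (leq_bigmax l).
 by apply: eq_bigr => i _; rewrite mulrAC.
Qed.

Lemma gen_adj A x s : subring_set A -> gen A (x :: s) = gen (adj A x) s.
Proof.
move=> hA; apply/seteqP; split.
 apply: gen_sub => [a Aa|z]; first by apply: gen_base; apply: sub_adj.
 by case/in_consP=> [->|hz]; [apply: gen_base; apply: adj_gen | apply: gen_mem].
apply: gen_sub => [|z hz]; last by apply: gen_mem; exact: mem_tail.
apply: adj_min; [member| member| by apply: gen_mem; rewrite mem_head].
Qed.

Lemma gen_perm A s s' : s =i s' -> gen A s = gen A s'.
Proof.
move=> E; apply/seteqP; split; apply: gen_sub => [|z hz]; try member.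
 by apply: gen_mem; rewrite -E.
by apply: gen_mem; rewrite E.
Qed.

Lemma gen_rcons A s x : subring_set A -> gen A (rcons s x) = adj (gen A s) x.
Proof. by move=> hA; rewrite -gen_cons; apply: gen_perm => y; rewrite mem_rcons. Qed.

Lemma indep_rcons A s x : subring_set A ->
 indep A (rcons s x) <-> indep A s /\ transc (gen A s) x.
Proof.
elim: s A => [|y s IH] A hA /=; first by rewrite gen_nil //; split=> -[].
rewrite IH; last member.
by rewrite gen_adj //; split=> [[h1 [h2 h3]]|[[h1 h2] h3]].
Qed.

(* Steinitz' exchange lemma. *)
Theorem indep_size A s (z : seq F) : subring_set A -> indep A s -> s `in` algb (gen A z) ->
 (size s <= size z)%N.
Proof.
have [d] := ubnP (size z); elim: d A s z => // d IH A s z sz hA.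
case: s => [//|x s] [tx hs] h.
(* Since x is transcendental over A but algebraic over A[z], there is a first w in z whose
   adjunction makes x algebraic. *)
have [z1 [w [z2 [Ez hw1 hw2]]]] : exists (z1 : seq F) w z2, [/\ z = z1 ++ w :: z2,
  algb (adj (gen A z1) w) x & ~ algb (gen A z1) x].
 have gsplit : forall z0 z1 : seq F, ~ algb (gen A z1) x -> algb (gen A (z1 ++ z0)) x ->
   exists (z2 : seq F) w z3, [/\ z1 ++ z0 = z2 ++ w :: z3,
    algb (adj (gen A z2) w) x & ~ algb (gen A z2) x].
  elim=> [|w z0 IHz] z1 h1 h2; first by rewrite cats0 in h2.
  have [h3|h3] := pselect (algb (adj (gen A z1) w) x); first by exists z1, w, z0.
  by rewrite -cat_rcons in h2 *; apply: IHz => //; rewrite gen_rcons.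
 apply: (gsplit z [::]); last by apply: h; rewrite mem_head.
 by rewrite gen_nil // => /algbP; apply.
(* After the exchange, x takes over the role of w: over A[x] the list z without w still makes
   everything algebraic. *)
have hw : algb (adj (gen A z1) x) w.
 apply: exchange => //; first member.
 by apply: contrapT => h'; apply: hw2; apply/algbP; member.
suff : (size s <= size (z1 ++ z2))%N by rewrite Ez !size_cat addnS.
have hAx := adj_subring x hA.
 apply: (IH (adj A x)) => //.
  by move: sz; rewrite Ez !size_cat addnS.
 move=> y hy; have hB := gen_subring (adj A x) (z1 ++ z2).
 apply: (@algb_trans A _ z) => //.
 - by move=> a Aa; apply: gen_base; apply: sub_adj.
 - move=> v; rewrite Ez mem_cat orbCA => /orP[/eqP ->|hv].
   apply: algb_mono hw; apply: adj_min => //.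
    apply: gen_sub => [a Aa|v' hv']; first by apply: gen_base; apply: sub_adj.
    by apply: gen_mem; rewrite mem_cat hv'.
   by apply: gen_base; apply: adj_gen.
  by apply: algb_base; apply: gen_mem; rewrite mem_cat.
 - by apply: h; rewrite inE hy orbT.
Qed.

(** [indep] adjoins the elements one after the other; the exchange property makes their order
    immaterial. *)
Lemma indep_swap A x y s : subring_set A -> indep A (x :: y :: s) -> indep A (y :: x :: s).
Proof.
move=> hA /= [tx [ty hs]]; have ty' : transc A y by apply: transc_mono ty; apply: sub_adj.
split=> //; split.
 move=> p hp rp; apply: contrapT => p0.
 have : algb (adj A y) x.
  apply/algbP; first member.
  by apply/nontranscP; exists p; split=> //; apply/eqP .
 by move=> /(exchange hA) /(_ tx) /algbP; apply=> //; member.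
suff <- : adj (adj A x) y = adj (adj A y) x by [].
have E u v : adj (adj A u) v = gen A [:: u; v].
 by rewrite !gen_adj ?gen_nil; do ?member.
by rewrite !E; apply: gen_perm => z; rewrite !inE orbC.
Qed.

Lemma indep_front A s1 x s2 : subring_set A -> indep A (s1 ++ x :: s2) -> indep A (x :: s1 ++ s2).
Proof.
elim: s1 A => [//|y s1 IH] A hA /= [ty /IH h]; apply: indep_swap => //.
by split=> //; apply: h; member.
Qed.

Lemma indep_back A x t : subring_set A -> indep A (x :: t) -> indep A t /\ transc (gen A t) x.
Proof.
elim: t A => [|y t IH] A hA h; first by rewrite gen_nil; case: h.
have [ty /IH] := indep_swap hA h; move=> /(_ (adj_subring y hA)) [h1 h2].
by split=> //; rewrite gen_adj.
Qed.

Lemma acsub_algb k x : acsub k -> algb k x -> k x.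
Proof.
move=> hk; have hk' := ac_sub hk; move=> /(algbP _ hk')/nontranscP[p [hp p0 rp]].
have [n] := ubnP (size p); elim: n p hp p0 rp => // n IH p hp p0 rp sn.
have kl : k (lead_coef p)^-1 by apply: (ac_inv hk); apply: hp.
have l0 : lead_coef p != 0 by rewrite lead_coef_eq0.
have [||c kc rc] := ac_root hk (polyinZ hk' kl hp).
- by rewrite monicE lead_coefZ mulVf.
- rewrite size_scale ?invr_eq0 //; rewrite ltnNge; apply/negP => s1.
 move: rp p0; rewrite (size1_polyC s1) /root hornerC => /eqP ->.
 by rewrite eqxx.
rewrite rootZ ?invr_eq0 // in rc.
have [q hq E] := polyin_factor hk' kc hp; rewrite (rootP rc) addr0 in E.
move: rp; rewrite E rootM root_XsubC => /orP[rq|/eqP ->//].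
have q0 : q != 0 by apply: contraNneq p0 => q0; rewrite E q0 mul0r.
by apply: (IH q); move: sn; rewrite E size_Mmonic ?monicXsubC // size_XsubC addn2.
Qed.

End Transcendence.

(** * Noether normalization and the Nullstellensatz *)

Section Normalization.
Variables (F : fieldType) (k : set F).
Hypothesis hk : acsub k.
Implicit Types (A B C R : set F) (s : seq F).
Local Notation vr := (@valuation_subring F).
Let ks := ac_sub hk.

(* g is equivalent to c u^e for every valuation with a pole at u. *)
Definition lead R u (c : F) (e : nat) g := maxid R (g / u ^+ e - c).

Lemma kunit R c : vr R -> k `<=` R -> k c -> c != 0 -> ~ maxid R c.
Proof. by move=> hv kR kc c0; apply: unit_notmax; member. Qed.

Lemma lead_small R u c e g E : vr R -> k `<=` R -> u != 0 -> maxid R u^-1 -> k c ->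
 lead R u c e g -> (e < E)%N -> maxid R (g / u ^+ E).
Proof.
move=> hv kR u0 mu kc hl eE; have hR := vr_sub hv.
have -> : g / u ^+ E = ((g / u ^+ e - c) + c) * u^-1 ^+ (E - e).
 rewrite subrK exprVn -mulrA -invfM -exprD subnKC ?(ltnW eE) //.
apply: maxidM => //; first by apply: subringD => //; [exact: maxid_sub | member].
by apply: maxidX => //; rewrite subn_gt0.
Qed.

(** The exponents are chosen for a finite family gs at once: whenever u has a pole and each x of s
    differs from its power u^e by a finite element, every g has a leading term that does not depend
    on R; N bounds the degrees of these terms. Exponents exceed 1 so that subtracting u^e from x
    changes nothing modulo the square of a maximal ideal containing u, which [drop_step]
    exploits. *)
Definition Wprop A (s : seq F) (u : F) := forall gs : seq F,
 (forall g, g \in gs -> A g /\ g != 0) ->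
 exists (t : seq (F * nat)) (N : nat), [/\ map fst t = s, forall p, p \in t -> (1 < p.2)%N &
  forall g, g \in gs -> exists c e, [/\ k c, c != 0, (e <= N)%N &
   forall R, vr R -> k `<=` R -> ~ R u -> (forall p, p \in t -> R (p.1 - u ^+ p.2)) ->
    lead R u c e g]].

(* The leading behaviour of a polynomial in x, when x is equivalent to u^E with E large. *)
Lemma lead_poly A s u x (ps : seq {poly F}) : Wprop A s u -> subring_set A ->
 (forall p, p \in ps -> polyin A p /\ p != 0) ->
 exists (t : seq (F * nat)) (N : nat), [/\ map fst t = rcons s x, forall p, p \in t -> (1 < p.2)%N &
  forall p, p \in ps -> exists c e, [/\ k c, c != 0, (e <= N)%N &
   forall R, vr R -> k `<=` R -> ~ R u -> (forall q, q \in t -> R (q.1 - u ^+ q.2)) ->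
    lead R u c e p.[x]]].
Proof.
move=> hW hA hps; pose gs := [seq g <- flatten [seq polyseq p | p <- ps] | g != 0].
have [g|t [N [Et t2 ht]]] := hW gs.
 rewrite mem_filter => /andP[g0 /flattenP[l /mapP[p hp ->]] /(nthP 0)[i _ E]].
 by split=> //; have [hA' _] := hps p hp; rewrite -E.
(* As E exceeds all leading exponents of the coefficients, the term of p of top degree in x
   dominates the others. It is also at least 2, as [Wprop] demands. *)
pose E := N.+2.
exists (rcons t (x, E)), (N + E * \max_(p <- ps) size p)%N; split.
- by rewrite map_rcons Et.
- by move=> p; rewrite mem_rcons => /orP[/eqP -> //|]; exact: t2.
move=> p hp; have [pA p0] := hps p hp.
have coef j : p`_j != 0 -> p`_j \in gs.
 move=> pj; rewrite mem_filter pj; apply/flattenP; exists (polyseq p); first exact: map_f.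
 by apply: mem_nth; rewrite ltnNge; apply: contra pj => h; rewrite nth_default.
pose n := (size p).-1; have sp : size p = n.+1 by rewrite prednK // size_poly_gt0.
have pn : p`_n != 0 by rewrite lead_coef_eq0.
have [c [e [kc c0 eN hl]]] := ht _ (coef n pn).
exists c, (e + E * n)%N; split=> //.
 rewrite leq_add // leq_mul2l; apply: leq_trans (leq_pred _) _.
 exact: (@leq_bigmax_seq _ _ _ (fun p : {poly F} => size p) p hp isT).
move=> R hv kR nu hR; have [u0 mu] := vr_out hv nu; have hm := maxid_ideal hv.
have hR' := vr_sub hv; have kR1 : forall q, q \in t -> R (q.1 - u ^+ q.2).
 by move=> q hq; apply: hR; rewrite mem_rcons inE hq orbT.
pose y := x / u ^+ E.
have my : maxid R (y - 1).
 have -> : y - 1 = (x - u ^+ E) * u^-1 ^+ E.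
  by rewrite mulrBl exprVn divff // expf_neq0.
 apply: maxidM => //; last by apply: maxidX.
 by apply: (hR (x, E)); rewrite mem_rcons mem_head.
have Ry : R y by rewrite -[y](subrK 1); apply: subringD => //; [exact: maxid_sub | member].
have mz a b : R a -> maxid R (a - b) -> forall i, maxid R (a * y ^+ i - b).
 move=> Ra mab; elim=> [|i IH]; first by rewrite mulr1.
 have -> : a * y ^+ i.+1 - b = (a * y ^+ i) * (y - 1) + (a * y ^+ i - b) by rewrite exprS; ring.
 apply: (idealD hm) => //; apply: maxidM => //; apply: (subring_mul hR') => //.
 member.
rewrite /lead horner_coef sp big_ord_recr /= mulrDl -addrA; apply: (idealD hm); last first.
 have -> : p`_n * x ^+ n / u ^+ (e + E * n) = (p`_n / u ^+ e) * y ^+ n.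
  rewrite expr_div_n -exprM exprD; field; by rewrite !expf_neq0.
 apply: mz; last exact: hl.
 rewrite -[_ / _](subrK c); apply: subringD => //; [exact: maxid_sub (hl _ hv kR nu kR1) | member].
rewrite mulr_suml; apply: (ideal_sum hm) => i _ _.
have [->|pi0] := eqVneq p`_i 0; first by rewrite !mul0r; member.
have [c' [e' [kc' c'0 eN' hl']]] := ht _ (coef i pi0).
have -> : p`_i * x ^+ i / u ^+ (e + E * n) = y ^+ i * (p`_i / u ^+ (e + E * (n - i))).
 rewrite -{1}[in X in (E * X)%N](subnKC (ltnW (ltn_ord i))) mulnDr expr_div_n -exprM.
 by rewrite !exprD; field; rewrite !expf_neq0.
apply: maxidM => //; first member.
apply: (lead_small hv kR u0 mu kc' (hl' _ hv kR nu kR1)).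
have : (0 < n - i)%N by rewrite subn_gt0.
by case: (n - i)%N => // d _; lia.
Qed.

Lemma Wprop_gen u s : transc k u -> indep (adj k u) s -> Wprop (gen (adj k u) s) s u.
Proof.
move=> tu; have hku := adj_subring u ks; elim/last_ind: s => [_|s x IH].
 rewrite gen_nil // => gs hgs.
 have /(choice_in 0)[P hP] g : g \in gs -> exists p, [/\ polyin k p, p != 0 & g = p.[u]].
  move=> hg; have [[p hp E] g0] := hgs g hg; exists p; split=> //.
  by apply: contraNneq g0 => p0; rewrite E p0 horner0.
 exists [::], (\max_(g <- gs) (size (P g)))%N; split=> // g hg.
 have [pk p0 E] := hP g hg; exists (lead_coef (P g)), (size (P g)).-1; split.
 - exact: pk.
 - by rewrite lead_coef_eq0.
 - apply: leq_trans (leq_pred _) _.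
  exact: (@leq_bigmax_seq _ _ _ (fun g => size (P g)) g hg isT).
 move=> R hv kR nu _; have [u0 mu] := vr_out hv nu; have hm := maxid_ideal hv.
 have sP : (size (P g) <= (size (P g)).-1.+1)%N by apply: leqSpred.
 rewrite /lead {1}E (horner_coef_wide _ sP) big_ord_recr /=.
 rewrite mulrDl mulfK ?expf_neq0 // addrK mulr_suml; apply: (ideal_sum hm) => i _ _.
 rewrite -mulrA; apply: (maxidM (vr_sub hv)); first by apply: kR.
 rewrite -[X in _ / u ^+ X](subnK (ltnW (ltn_ord i))) exprD invfM mulrCA divff ?expf_neq0 //.
 by rewrite mulr1 -exprVn; apply: maxidX => //; rewrite subn_gt0.
move=> /indep_rcons[//|hs tx] gs; rewrite gen_rcons // => hgs.
have /(choice_in 0)[P hP] g : g \in gs -> exists p, [/\ polyin (gen (adj k u) s) p, p != 0 & g = p.[x]].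
 move=> hg; have [[p hp E] g0] := hgs g hg; exists p; split=> //.
 by apply: contraNneq g0 => p0; rewrite E p0 horner0.
have [|p /mapP[g hg ->]|t [N [Et t2 ht]]] := @lead_poly (gen (adj k u) s) s u x [seq P g | g <- gs] (IH hs).
- member.
- by have [? ? _] := hP g hg.
exists t, N; split=> // g hg; have [c [e [kc c0 eN h]]] := ht (P g) (map_f _ hg).
by exists c, e; split=> // R hv kR nu hR; have [_ _ ->] := hP g hg; apply: h.
Qed.

(** Nagata's substitution. Let x be the first element of s that depends on its predecessors and u.
    If u had a pole at R, the relation of x would have a nonzero leading term, although its value is
    0. Hence u is integral over k and the differences x - u^e. *)
Lemma nagata u s : transc k u -> ~ indep (adj k u) s ->
 exists t : seq (F * nat), [/\ map fst t = s, forall p, p \in t -> (1 < p.2)%N &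
  forall R, vr R -> k `<=` R -> (forall p, p \in t -> R (p.1 - u ^+ p.2)) -> R u].
Proof.
move=> tu; have hku := adj_subring u ks.
elim/last_ind: s => [[]//|s x IH] ns.
have [hs|/IH[t [Et t2 ht]]] := pselect (indep (adj k u) s); last first.
 (* Elements after the first dependent one may take any exponent above 1. *)
 exists (rcons t (x, 2)); rewrite map_rcons Et; split=> // [p|R hv kR h].
  by rewrite mem_rcons => /orP[/eqP ->|/t2].
 by apply: ht => // p hp; apply: h; rewrite mem_rcons inE hp orbT.
have : ~ transc (gen (adj k u) s) x by move=> tx; apply: ns; apply/indep_rcons.
move=> /nontranscP[p [hp p0 /rootP rp]].
have [|q|t [N [Et t2 ht]]] := @lead_poly _ s u x [:: p] (Wprop_gen tu hs).
- member.
- by rewrite inE => /eqP ->.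
exists t; split=> // R hv kR h; apply: contrapT => nu.
have [c [e [kc c0 _ hl]]] := ht p (mem_head _ _).
have := hl R hv kR nu h; rewrite /lead rp mul0r sub0r => h2.
apply: (kunit hv kR kc c0); rewrite -[c]opprK.
member.
Qed.

(** Integrality of l over k[z] is stated by valuation rings. A dependent list is replaced by the
    differences x - u^e of [nagata], which are fewer by one. *)
Theorem noether_normalization l : exists z : seq F,
 [/\ indep k z, z `in` gen k l &
   forall R, vr R -> k `<=` R -> z `in` R -> l `in` R].
Proof.
have [n] := ubnP (size l); elim: n l => // n IH [|u s] sl; first by exists [::].
have sub s' : s' `in` gen k (u :: s) -> gen k s' `<=` gen k (u :: s).
 by move=> h; apply: gen_sub; member.
have [tu|ntu] := pselect (transc k u); last first.
 have ku : k u by apply: acsub_algb => //; apply/algbP.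
 have [z [h1 h2 h3]] := IH s sl; exists z; split=> // [x /h2|R hv kR hz x].
  by apply: sub => y hy; apply: gen_mem; exact: mem_tail.
 by case/in_consP=> [->|]; [member| exact: h3].
have [hi|ni] := pselect (indep (adj k u) s).
 by exists (u :: s); split=> // x hx; exact: gen_mem.
have [t [Et t2 ht]] := nagata tu ni; pose s' := [seq p.1 - u ^+ p.2 | p <- t].
have [|z [h1 h2 h3]] := IH s'; first by rewrite size_map -(size_map fst) Et.
have gu : gen k (u :: s) u by apply: gen_mem; rewrite mem_head.
exists z; split=> // [x /h2|R hv kR hz].
 apply: sub => _ /mapP[p hp ->]; apply: (subring_sub (gen_subring _ _)).
  by apply: gen_mem; rewrite inE -Et map_f ?orbT.
 member.
have hs' : forall p, p \in t -> R (p.1 - u ^+ p.2) by move=> p hp; apply: (h3 R) => //; apply: map_f.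
have Ru : R u by apply: ht.
move=> x; rewrite -Et => /orP[/eqP ->//|/mapP[p hp ->]].
rewrite -[p.1](subrK (u ^+ p.2)); apply: subringD; [member|exact: hs'|].
member.
Qed.

(** The ideal of the point 0, built one variable at a time: a polynomial in the last variable
    belongs to it when its constant coefficient belongs to the previous ideal. *)
Lemma origin z : indep k z -> exists J, [/\ ideal (gen k z) J, ~ J 1, rational k (gen k z) J &
 z `in` J].
Proof.
elim/last_ind: z => [_|z x IH /indep_rcons[//|/IH[J [hJ J1 rJ zJ]] tx]].
 rewrite gen_nil //; exists [set 0]; split=> //.
 - split=> //=; [by move=> _ -> ; member| by move=> x y -> ->; rewrite addr0 | by move=> a x _ ->; rewrite mulr0].
 - by move=> /eqP; rewrite oner_eq0.
 - by move=> a ka; exists a => //=; rewrite subrr.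
have hA := gen_subring k z; have hAx := adj_subring x hA; rewrite gen_rcons //.
exists [set y | exists2 p, polyin (gen k z) p /\ J p`_0 & y = p.[x]]; split.
- split.
 + by move=> _ [p [hp _] ->]; exists p.
 + exists 0; last by rewrite horner0.
  by split; [member| rewrite coef0; member].
 + move=> _ _ [p [hp p0] ->] [q [hq q0] ->]; exists (p + q); last by rewrite hornerD.
  by split; [member| rewrite coefD; member].
 + move=> _ _ [p hp ->] [q [hq q0] ->]; exists (p * q); last by rewrite hornerM.
  split; first member.
  by rewrite coefM big_ord1; apply: (idealM hJ).
- move=> [p [hp p0] E]; apply: J1; suff -> : 1 = p`_0 by [].
 suff -> : p = 1 by rewrite coef1.
 apply/eqP; rewrite -subr_eq0; apply/eqP/tx; last by rewrite hornerD hornerN hornerC -E subrr.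
 member.
- move=> _ [p hp ->]; have [c kc hc] := rJ _ (hp 0%N); exists c => //.
 exists (p - c%:P); last by rewrite hornerD hornerN hornerC.
 split; last by rewrite coefB coefC.
 member.
- move=> y; rewrite mem_rcons => /orP[/eqP ->|hy].
  exists 'X; last by rewrite hornerX.
  by split; [member| rewrite coefX; exact: (ideal0 hJ)].
 exists y%:P; last by rewrite hornerC.
 split; last by rewrite coefC; exact: zJ.
 by apply: polyinC => //; exact: gen_mem.
Qed.

(** A place above the origin of the affine space with coordinate ring k[z]; since l is integral over
    k[z], it is finite on l. *)
Theorem nullstellensatz (l : seq F) : exists2 R, kvr k R & l `in` R.
Proof.
have [z [h1 _ h3]] := noether_normalization l.
have [J [hJ J1 rJ zJ]] := origin h1.
have [R [hR AR JR]] := exists_kvr hk (@gen_base _ k z) (gen_subring k z) hJ J1 rJ.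
exists R => //; apply: h3; [member| member| move=> x /zJ/JR; exact: maxid_sub].
Qed.

End Normalization.

(** * Completely integrally closed rings and minimal polynomials *)

Section Closed.
Variable F : fieldType.
Implicit Types (A B R k : set F) (p q : {poly F}).
Local Notation vr := (@valuation_subring F).

Lemma size_sub_lead p q : p != 0 -> size q = size p -> lead_coef q = lead_coef p ->
 (size (p - q)%R < size p)%N.
Proof.
move=> p0 sq lq; have s0 : (0 < size p)%N by rewrite size_poly_gt0.
rewrite -[X in (_ < X)%N](prednK s0); apply/leq_sizeP => j; rewrite leq_eqVlt => /orP[/eqP <-|].
 by move: lq; rewrite !lead_coefE sq coefB => ->; rewrite subrr.
by rewrite prednK // => hj; rewrite coefB !nth_default ?subrr // sq.
Qed.

(** Complete integral closedness: if all powers of f have a common denominator h, then f lies in A.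
    This form passes to polynomial rings by comparing leading coefficients, and it yields integral
    closedness ([cic_integral]). *)
Definition cic A := forall f h, A h -> h != 0 -> (forall j, A (h * f ^+ j)) -> A f.

Lemma cic_field k : acsub k -> cic k.
Proof.
move=> hk f h kh h0 /(_ 1%N); rewrite expr1 => hf.
by rewrite -[f](mulKf h0); member.
Qed.

Lemma almost_shift A h f g i j : subring_set A -> A g -> (forall j, A (h * f ^+ j)) ->
 A (h * f ^+ i * (f - g) ^+ j).
Proof.
move=> hA Ag hf; elim: j i => [|j IH] i; first by rewrite mulr1.
have -> : h * f ^+ i * (f - g) ^+ j.+1 = h * f ^+ i.+1 * (f - g) ^+ j - g * (h * f ^+ i * (f - g) ^+ j).
 by rewrite !exprS; ring.
by apply: (subring_sub hA) => //; apply: (subring_mul hA).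
Qed.

(* The leading coefficient of an almost integral fraction of polynomials is almost integral over A. *)
Lemma cic_adj A x : subring_set A -> cic A -> transc A x -> cic (adj A x).
Proof.
move=> hA cA tx; have hB := adj_subring x hA.
have inj p q : polyin A p -> polyin A q -> p.[x] = q.[x] -> p = q.
 move=> hp hq E; apply/eqP; rewrite -subr_eq0; apply/eqP/tx; first member.
 by rewrite hornerD hornerN E subrr.
have nz p : p != 0 -> polyin A p -> p.[x] != 0.
 by move=> p0 hp; apply: contraNneq p0 => E; apply/eqP/tx.
have key : forall n a c f h, polyin A a -> polyin A c -> c != 0 -> adj A x h -> h != 0 ->
  (size a <= n)%N -> f = a.[x] / c.[x] -> (forall j, adj A x (h * f ^+ j)) -> adj A x f.
 elim=> [|n IH] a c f h ha hc c0 hh h0 sa Ef hf.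
  move: sa; rewrite leqn0 size_poly_eq0 => /eqP a0.
  by rewrite Ef a0 horner0 mul0r; member.
 have [a0|a0] := eqVneq a 0; first by rewrite Ef a0 horner0 mul0r; member.
 have [H hH EH] := hh; have H0 : H != 0 by apply: contraNneq h0 => E; rewrite EH E horner0.
 have /choice[E hE] : forall j, exists E, polyin A E /\ H * a ^+ j = E * c ^+ j.
  move=> j; have [E hE EE] := hf j; exists E; split=> //; apply: inj.
  - by apply: polyinM => //; elim: j {EE} => [|j IHj]; rewrite ?exprS;
    [apply: polyinC; member| member].
  - by apply: polyinM => //; elim: j {EE} => [|j IHj]; rewrite ?exprS;
    [apply: polyinC; member| member].
  - rewrite !hornerM !horner_exp -EE Ef EH expr_div_n -!mulrA mulVf ?mulr1 //.
   by rewrite expf_neq0 // nz.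
 have E0 j : E j != 0.
  apply: contraNneq (mulf_neq0 H0 (expf_neq0 j a0)) => E0.
  by rewrite (proj2 (hE j)) E0 mul0r.
 have sz p j : p != 0 -> size (p ^+ j) = ((size p).-1 * j).+1%N.
  move=> p0; rewrite -[LHS]prednK ?size_poly_gt0 ?expf_neq0 //.
  by rewrite size_exp.
 (* Degrees in H a^j = E_j c^j give deg H + j (deg a - deg c) >= 0; taking j larger than deg H
    forces deg c <= deg a. *)
 have ca : (size c <= size a)%N.
  have := congr1 (fun p : {poly F} => size p) (proj2 (hE (size H))).
  have eE : (0 < size (E (size H)))%N by rewrite size_poly_gt0.
  have hs : (0 < size H)%N by rewrite size_poly_gt0.
  have as0 : (0 < size a)%N by rewrite size_poly_gt0.
  rewrite !size_mul ?expf_neq0 // !sz //; move: (size (E _)) eE => e.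
  move: (size H) (size a) (size c) hs as0 => u v w; nia.
 pose la := lead_coef a / lead_coef c.
 have lc0 : lead_coef c != 0 by rewrite lead_coef_eq0.
 (* The quotient of the leading coefficients has the leading coefficient of H as a common
    denominator of its powers. Subtracting the corresponding monomial from f then lowers the degree
    of the numerator. *)
 have Ala : A la.
  apply: (cA la (lead_coef H)); [exact: hH | by rewrite lead_coef_eq0 |] => j.
  have := congr1 lead_coef (proj2 (hE j)); rewrite !lead_coefM !lead_coef_exp => E1.
  rewrite expr_div_n mulrA E1 mulfK ?expf_neq0 //; exact: (proj1 (hE j)).
 pose g := la *: 'X^(size a - size c); have hg : polyin A g by apply: polyinZX.
 have Bg : adj A x g.[x] by exists g.
 have sg : size (g * c) = size a.
  rewrite -scalerAl size_scale ?mulf_neq0 ?invr_eq0 ?lead_coef_eq0 //.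
  rewrite mulrC size_mulXn // subnK //.
 have -> : f = (f - g.[x]) + g.[x] by rewrite subrK.
 apply: (subringD hB) => //; apply: (IH (a - g * c) c _ h) => //.
 - member.
 - rewrite -ltnS; apply: leq_trans _ sa.
  apply: size_sub_lead => //; by rewrite lead_coefM lead_coefZ lead_coefXn mulr1 divfK.
 - rewrite Ef hornerD hornerN hornerM mulrBl mulfK //; exact: nz.
 - by move=> j; have := almost_shift 0 j hB Bg hf; rewrite mulr1.
move=> f h hh h0 hf; have [H hH EH] := hh; have [a ha Ea] := hf 1%N.
apply: (key (size a) a H f h) => //.
 by apply: contraNneq h0 => E; rewrite EH E horner0.
by rewrite -Ea -EH mulrAC divff // mul1r.
Qed.

Lemma cic_gen k z : acsub k -> indep k z -> cic (gen k z).
Proof.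
move=> hk; have ks := ac_sub hk; elim/last_ind: z => [_|z x IH /(indep_rcons _ _ ks)[hz tx]].
 by rewrite gen_nil //; apply: cic_field.
by rewrite gen_rcons //; apply: cic_adj => //; [member| exact: IH].
Qed.

(** With n the degree of a monic equation, b^n clears the denominators of the powers of f = a / b up
    to n, and the equation expresses the higher powers by these. *)
Lemma cic_integral A a b : subring_set A -> cic A -> A a -> A b -> b != 0 ->
 (forall R, vr R -> A `<=` R -> R (a / b)) -> A (a / b).
Proof.
move=> hA cA Aa Ab b0 /(integral_of_vr hA)[p [hp mp /rootP rp]]; set f := a / b in rp *.
pose n := (size p).-1; have sp : size p = n.+1 by rewrite prednK // size_poly_gt0 monic_neq0.
have rec j : f ^+ (j + n) = - \sum_(i < n) p`_i * f ^+ (j + i).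
 have : f ^+ j * p.[f] = 0 by rewrite rp mulr0.
 rewrite horner_coef sp big_ord_recr /= -lead_coefE (monicP mp) mul1r mulrDr -exprD.
 move/eqP; rewrite addrC addr_eq0 mulr_sumr => /eqP ->; congr (- _); apply: eq_bigr => i _.
 by rewrite exprD mulrCA.
apply: (cA f (b ^+ n)); [member|exact: expf_neq0|].
move=> j; have [m] := ubnP j; elim: m j => // m IH j jm.
have [jn|nj] := leqP j n.
 have -> : b ^+ n * f ^+ j = b ^+ (n - j) * a ^+ j.
  by rewrite -{1}(subnK jn) exprD expr_div_n; field; rewrite expf_neq0.
 member.
rewrite -(subnK (ltnW nj)) rec mulrN mulr_sumr; apply: (subringN hA).
apply: subring_sum => // i _ _; rewrite mulrCA; apply: (subring_mul hA) => //.
by apply: IH; move: jm nj (ltn_ord i); lia.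
Qed.

Lemma exists_max R (s : seq F) x : vr R -> x \in s -> x != 0 ->
 exists c, [/\ c \in s, c != 0 & forall y, y \in s -> R (y / c)].
Proof.
move=> hv; have hR := vr_sub hv; elim: s x => // y s IH x hx x0.
have [hall|] := pselect (forall u, u \in s -> u = 0).
 have y0 : y != 0 by move: hx x0; case/in_consP=> [->//|/hall ->]; rewrite eqxx.
 exists y; rewrite mem_head; split=> // u /in_consP[->|/hall ->].
  by rewrite divff; member.
 by rewrite mul0r; member.
move=> /existsNP[u /not_implyP[us /eqP u0]]; have [c [cs c0 hc]] := IH u us u0.
have [y0|y0] := eqVneq y 0.
 exists c; rewrite inE cs orbT; split=> // v /in_consP[->|/hc//].
 by rewrite y0 mul0r; member.
have [h|h] := proj2 hv (y / c) (mulf_neq0 y0 (invr_neq0 c0)).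
 by exists c; rewrite inE cs orbT; split=> // v /in_consP[->|/hc].
exists y; rewrite mem_head; split=> // v /in_consP[->|/hc hv'].
 by rewrite divff; member.
have -> : v / y = (v / c) * (y / c)^-1 by field; rewrite c0.
member.
Qed.

Lemma content R p : vr R -> p != 0 -> exists c, [/\ c != 0, polyin R (c^-1 *: p) &
 exists i, ~ maxid R (c^-1 *: p)`_i].
Proof.
move=> hv p0; have hl : lead_coef p \in polyseq p.
 by rewrite mem_nth // prednK // size_poly_gt0.
have [|c [cs c0 hc]] := exists_max hv hl; first by rewrite lead_coef_eq0.
exists c; split=> //.
 move=> i; rewrite coefZ mulrC; have [hi|hi] := ltnP i (size p); first by apply: hc; apply: mem_nth.
 by rewrite nth_default // mul0r; member.
have /(nthP 0)[i _ E] := cs; exists i; rewrite coefZ E mulVf //.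
by apply: maxid_proper; member.
Qed.

Lemma primitiveM R p q : vr R -> polyin R p -> polyin R q -> (exists i, ~ maxid R p`_i) ->
 (exists i, ~ maxid R q`_i) -> exists i, ~ maxid R (p * q)`_i.
Proof.
move=> hv hp hq hi hj; have hm := maxid_ideal hv; have hR := vr_sub hv.
have [i ni ltin] : exists2 i, ~ maxid R p`_i & forall i', (i' < i)%N -> maxid R p`_i'.
 have hx : exists i, `[< ~ maxid R p`_i >] by have [i h] := hi; exists i; apply/asboolP.
 case: (ex_minnP hx) => i /asboolP ni mini; exists i => // i' h; apply: contrapT => h2.
 by have := mini i' (introT (asboolP _) h2); rewrite leqNgt h.
have [j nj ltjn] : exists2 i, ~ maxid R q`_i & forall i', (i' < i)%N -> maxid R q`_i'.
 have hx : exists i, `[< ~ maxid R q`_i >] by have [j h] := hj; exists j; apply/asboolP.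
 case: (ex_minnP hx) => j /asboolP nj minj; exists j => // i' h; apply: contrapT => h2.
 by have := minj i' (introT (asboolP _) h2); rewrite leqNgt h.
exists (i + j)%N; rewrite coefM.
have hi' : (i < (i + j).+1)%N by rewrite leq_addr.
rewrite (bigD1 (Ordinal hi')) //= addKn; apply: (vr_unit_add hv).
- exact: (subring_mul hR).
- by move=> /(vr_prime hv (hp i) (hq j))[].
apply: (ideal_sum hm) => l _ nl.
case: (ltngtP l i) => [lt|gt|E]; last by move: nl; rewrite -val_eqE /= E eqxx.
 by rewrite mulrC; apply: maxidM => //; apply: ltin.
apply: maxidM => //; apply: ltjn; have := ltn_ord l; lia.
Qed.

(** Contents c of p and d of q multiply ([primitiveM]), so c d lies in R together with p q. As q is
    monic, 1 / d lies in R, and hence so does c. *)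
Lemma gauss R p q : vr R -> p \is monic -> q \is monic -> polyin R (p * q) -> polyin R p.
Proof.
move=> hv mp mq hpq; have hR := vr_sub hv.
have [c [c0 h1 h2]] := content hv (monic_neq0 mp); have [d [d0 g1 g2]] := content hv (monic_neq0 mq).
have [i ni] := primitiveM hv h1 g1 h2 g2.
have Rd : R d^-1.
 have := g1 (size q).-1; rewrite coefZ -lead_coefE (monicP mq) mulr1 //.
have Rcd : R (c * d).
 move: ni; rewrite -scalerAl -scalerAr scalerA coefZ => ni.
 have Ru : R (c^-1 * d^-1 * (p * q)`_i).
  have := polyinM hR h1 g1 i; by rewrite -scalerAl -scalerAr scalerA coefZ.
 have [u0 Rv] := vr_unit Ru ni; have pq0 : (p * q)`_i != 0.
  by apply: contraNneq u0 => ->; rewrite mulr0.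
 have -> : c * d = (c^-1 * d^-1 * (p * q)`_i)^-1 * (p * q)`_i.
  by field; rewrite d0 c0.
 by apply: (subring_mul hR).
move=> j; have -> : p`_j = (c * d) * d^-1 * (c^-1 *: p)`_j.
 by rewrite coefZ; field; rewrite c0.
by apply: (subring_mul hR) => //; member.
Qed.

Lemma div_monic A m p : subring_set A -> m \is monic -> polyin A m -> polyin A p ->
 exists q r, [/\ polyin A q, polyin A r, (size r < size m)%N & p = m * q + r].
Proof.
move=> hA mm hm; have [n] := ubnP (size p); elim: n p => // n IH p sp hp.
have m0 : (0 < size m)%N by rewrite size_poly_gt0 monic_neq0.
have [h|h] := ltnP (size p) (size m).
 by exists 0, p; split=> //; [member| rewrite mulr0 add0r].
have p0 : p != 0 by rewrite -size_poly_gt0; apply: leq_trans h.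
pose g := lead_coef p *: 'X^(size p - size m).
have hg : polyin A g by apply: polyinZX => //; apply: hp.
have sg : size (g * m) = size p.
 by rewrite -scalerAl size_scale ?lead_coef_eq0 // mulrC size_mulXn ?monic_neq0 // subnK.
have [||q [r [h1 h2 h3 E]]] := IH (p - g * m).
- apply: leq_trans _ (_ : size p <= n)%N => //; apply: size_sub_lead => //.
 by rewrite lead_coefM lead_coefZ lead_coefXn mulr1 (monicP mm) mulr1.
- member.
exists (g + q), r; split=> //; first member.
by rewrite mulrDr -addrA -E; ring.
Qed.

(** The minimal polynomial over the fraction field divides a monic equation over A. By Gauss's lemma
    its coefficients lie in every valuation ring above A, and A is integrally closed; division by it
    then stays inside A. *)
Lemma min_poly A b : subring_set A -> cic A -> (forall R, vr R -> A `<=` R -> R b) ->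
 exists m, [/\ polyin A m, m \is monic, root m b &
  forall p, polyin A p -> root p b -> exists2 q, polyin A q & p = m * q].
Proof.
move=> hA cA hb; pose L := [set y | exists x d, [/\ A x, A d, d != 0 & y = x / d]].
have AL : A `<=` L.
 by move=> x Ax; exists x, 1; rewrite oner_neq0 divr1; split=> //; member.
have hL : subring_set L.
 split.
 - member.
 - move=> _ _ [x [y [Ax Ay y0 ->]]] [z [t [Az At t0 ->]]]; exists (x * t - z * y), (y * t).
  split; [|member|exact: mulf_neq0|by field; rewrite t0].
  member.
 - move=> _ _ [x [y [Ax Ay y0 ->]]] [z [t [Az At t0 ->]]]; exists (x * z), (y * t).
  split; [member|member|exact: mulf_neq0|by field; rewrite t0].
have iL x : L x -> L x^-1.
 move=> [y [t [Ay At t0 ->]]]; have [->|y0] := eqVneq y 0; first by rewrite mul0r invr0; member.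
 by exists t, y; rewrite invf_div.
have [p0 [hp0 mp0 rp0]] := integral_of_vr hA hb.
pose Q n := `[< exists m, [/\ polyin L m, m \is monic, root m b & size m = n] >].
have exQ : exists n, Q n.
 by exists (size p0); apply/asboolP; exists p0; split=> //; member.
case: (ex_minnP exQ) => n /asboolP[m [hm mm rm sm]] minm.
have mind p : polyin L p -> root p b -> (size p < size m)%N -> p = 0.
 move=> hp rp; apply: contraTeq => pn0; rewrite -leqNgt.
 have l0 : lead_coef p != 0 by rewrite lead_coef_eq0.
 rewrite -(size_scale p (invr_neq0 l0)) sm; apply: minm; apply/asboolP.
 exists ((lead_coef p)^-1 *: p); split=> //.
 - by apply: polyinZ => //; apply: iL; apply: hp.
 - by rewrite monicE lead_coefZ mulVf.
 - by rewrite rootZ ?invr_eq0.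
have divd A' p : subring_set A' -> A' `<=` L -> polyin A' m -> polyin A' p -> root p b ->
  exists2 q, polyin A' q & p = m * q.
 move=> hA' sA' hm' hp rp; have [q [r [h1 h2 h3 E]]] := div_monic hA' mm hm' hp.
 exists q => //; rewrite E (mind r) ?addr0 //; first member.
 by apply/rootP; move/rootP: rp; rewrite E hornerD hornerM (rootP rm) mul0r add0r.
have hmA : polyin A m.
 have [q hq E] := divd L p0 hL (fun x h => h) hm (sub_polyin AL hp0) rp0.
 have mq : q \is monic by move: mp0; rewrite E monicMl.
 move=> i; have [x [d [Ax Ad d0 Ei]]] := hm i; rewrite Ei; apply: cic_integral => // R hv AR.
 rewrite -Ei; apply: (gauss hv mm mq); rewrite -E; member.
by exists m; split=> // p hp rp; apply: divd.
Qed.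

(** Serves to find, for a nonconstant polynomial, a variable that occurs in it. *)
Lemma gen_inter A z a : subring_set A -> indep A z -> gen A z a ->
 (forall z1 x z2, z = z1 ++ x :: z2 -> gen A (z1 ++ z2) a) -> A a.
Proof.
elim: z A => [|x z IH] A hA hz; first by rewrite gen_nil.
move=> ha h; have [hz' tx] := indep_back hA hz; have hAx := adj_subring x hA.
have az : gen A z a := h [::] x z erefl.
have [p hp E] : adj A x a.
 apply: IH => //; first by case: hz.
  by rewrite -gen_adj.
 move=> z1 y z2 E; rewrite -gen_adj // -cat_cons; apply: h; by rewrite E.
have : p - a%:P = 0.
 have hg := gen_subring A z; apply: tx; last by rewrite hornerD hornerN hornerC E subrr.
 member.
by move/eqP; rewrite subr_eq0 => /eqP E2; have := hp 0%N; rewrite E2 coefC.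
Qed.

(* Krull's principal ideal theorem: with B integral over the polynomial ring k[z], the constant
  term of the minimal polynomial of b involves some variable x of z, and b stays a non-unit after
  inverting the nonzero polynomials in the other variables t. *)
Theorem principal_ideal k l z b : acsub k -> indep k z -> z `in` gen k l ->
 (forall R, vr R -> k `<=` R -> z `in` R -> forall x, x \in l -> R x) ->
 gen k l b -> b != 0 -> ~ gen k l b^-1 ->
 exists R t, [/\ vr R, gen k l `<=` R, maxid R b, (size t).+1 = size z &
  [/\ t `in` gen k l, indep k t & forall g, gen k t g -> g != 0 -> R g^-1]].
Proof.
move=> hk hz zB hint Bb b0 nB; have ks := ac_sub hk.
pose B := gen k l; pose P := gen k z; have hB : subring_set B := gen_subring k l.
have hP : subring_set P := gen_subring k z.
have PB : P `<=` B by apply: gen_sub; member.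
have int c : B c -> forall R, vr R -> P `<=` R -> R c.
 move=> Bc R hv PR; apply: Bc; first member.
  by move=> a ka; apply: PR; exact: gen_base.
 by apply: hint => //; [move=> a ka; apply: PR; exact: gen_base | move=> x hx; apply: PR; exact: gen_mem].
have [m [hm mm rm mind]] := min_poly hP (cic_gen hk hz) (int b Bb).
pose a := m`_0.
have fact : b * \sum_(i < (size m).-1) m`_i.+1 * b ^+ i = - a.
 apply/eqP; rewrite -addr_eq0; apply/eqP; move/rootP: rm; rewrite horner_coef.
 have sm : size m = (size m).-1.+1 by rewrite prednK // size_poly_gt0 monic_neq0.
 rewrite sm big_ord_recl /= mulr1 => E; rewrite -[RHS]E addrC mulr_sumr; congr (_ + _).
 by apply: eq_bigr => i _; rewrite exprS; ring.
have Bs : B (\sum_(i < (size m).-1) m`_i.+1 * b ^+ i).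
 by apply: subring_sum => // i _ _; apply: (subring_mul hB); [apply: PB; exact: hm | member].
have a0 : a != 0.
 apply/eqP => a0; have E : m = (\poly_(i < (size m).-1) m`_i.+1) * 'X.
  apply/polyP => -[|i]; rewrite coefMX //= coef_poly; case: ltnP => // h.
  by rewrite nth_default // -(prednK (_ : (0 < size m)%N)) ?size_poly_gt0 ?monic_neq0.
 set q := (\poly_(i < _) _) in E; have rq : root q b.
  by move: rm; rewrite E rootM rootX (negbTE b0) orbF.
 have hq : polyin P q by move=> i; rewrite coef_poly; case: ifP => _; [| member].
 have [r hr Er] := mind q hq rq; have q0 : q != 0.
  by apply: contraTneq mm => q0; rewrite E q0 mul0r monicE lead_coef0 eq_sym oner_neq0.
 have r0 : r != 0 by apply: contraNneq q0 => r0; rewrite Er r0 mulr0.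
 have := congr1 (fun p : {poly F} => size p) E; rewrite size_mulX // => Es.
 have := congr1 (fun p : {poly F} => size p) Er; rewrite size_mul ?(monic_neq0 mm) //.
 rewrite Es; have : (0 < size r)%N by rewrite size_poly_gt0.
 by move: (size q) (size r) => u v; lia.
(* By [fact], b divides a in B, so a nonzero constant a would make b a unit. *)
have nka : ~ k a.
 move=> ka; apply: nB; have -> : b^-1 = - a^-1 * \sum_(i < (size m).-1) m`_i.+1 * b ^+ i.
  apply: (mulfI b0); rewrite divff // mulrCA fact; by field.
 member.
have [z1 [x [z2 [Ez na]]]] : exists z1 x z2, z = z1 ++ x :: z2 /\ ~ gen k (z1 ++ z2) a.
 apply: contrapT => h; apply: nka; apply: (gen_inter ks hz); first exact: hm.
 move=> z1 x z2 E; apply: contrapT => h2; apply: h; by exists z1, x, z2.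
pose t := z1 ++ z2; pose P1 := gen k t.
have [ht tx] : indep k t /\ transc P1 x.
 by apply: indep_back => //; apply: indep_front; rewrite // -Ez.
have EP : P = adj P1 x.
 rewrite -gen_cons; apply: gen_perm => y.
 by rewrite Ez !mem_cat !inE mem_cat orbCA.
have hP1 : subring_set P1 := gen_subring k t.
have P1P : P1 `<=` P by rewrite EP; apply: sub_adj.
pose B1 := [set y | exists c g, [/\ B c, P1 g, g != 0 & y = c / g]].
have hB1 : subring_set B1.
 split.
 - by exists 1, 1; rewrite oner_neq0 divr1; split=> //; member.
 - move=> _ _ [c [g [Bc Pg g0 ->]]] [c' [g' [Bc' Pg' g'0 ->]]]; exists (c * g' - c' * g), (g * g').
  split; [|member|exact: mulf_neq0|by field; rewrite g'0].
  member.
 - move=> _ _ [c [g [Bc Pg g0 ->]]] [c' [g' [Bc' Pg' g'0 ->]]]; exists (c * c'), (g * g').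
  by split; [member|member|exact: mulf_neq0|field; rewrite g'0].
have BB1 : B `<=` B1.
 by move=> c Bc; exists c, 1; rewrite oner_neq0 divr1; split=> //; member.
(* Suppose 1/b = c/g, with a monic equation H of degree d for c. Then b is a root of the polynomial
   G obtained from H by substituting g/b for c and clearing denominators, so m divides G. Constant
   terms give g^d = a q_0 in P1[x]; as g lies in P1, degrees in x put a into P1, against the choice
   of x. *)
have nb : ~ B1 b^-1.
 move=> [c [g [Bc Pg g0 E]]]; have [H [hH mH /rootP rH]] := integral_of_vr hP (int c Bc).
 pose d := (size H).-1; have sH : size H = d.+1 by rewrite prednK // size_poly_gt0 monic_neq0.
 pose G := \poly_(i < d.+1) (H`_(d - i) * g ^+ (d - i)).
 have Ec : c = g / b by rewrite E mulrCA divff // mulr1.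
 have hG : polyin P G.
  move=> i; rewrite coef_poly; case: ifP => _; last member.
  by apply: (subring_mul hP); [| member].
 have rG : root G b.
  apply/rootP; rewrite horner_poly; move: rH; rewrite horner_coef sH.
  move=> /(congr1 (fun x => x * b ^+ d)); rewrite mul0r mulr_suml => EH; rewrite -[RHS]EH.
  rewrite (reindex_inj rev_ord_inj) /=; apply: eq_bigr => i _.
  have hi : (i <= d)%N by rewrite -ltnS.
  rewrite subSS subKn // Ec expr_div_n.
  have -> : b ^+ d = b ^+ (d - i) * b ^+ i by rewrite -exprD subnK.
  by field; rewrite expf_neq0.
 have [q hq Eq] := mind G hG rG.
 have E0 : g ^+ d = a * q`_0.
  have := congr1 (fun p : {poly F} => p`_0) Eq; rewrite coefM big_ord1 subnn coef_poly /= subn0.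
  by rewrite -lead_coefE (monicP mH) mul1r.
 have /[!EP] -[al hal Eal] : P a by exact: hm.
 have /[!EP] -[be hbe Ebe] : P q`_0 by [].
 have Pgd : P1 (g ^+ d) := subringX _ hP1 Pg.
 have E1 : al * be = (g ^+ d)%:P.
  apply/eqP; rewrite -subr_eq0; apply/eqP/tx; last by rewrite hornerD hornerM hornerN hornerC -Eal -Ebe E0 subrr.
  member.
 have s1 : size (al * be) == 1%N by rewrite E1 size_polyC expf_neq0.
 apply: na; rewrite Eal; move: s1; rewrite size_mul_eq1 => /andP[/eqP s1 _].
 by rewrite (size1_polyC (_ : (size al <= 1)%N)) ?s1 // hornerC; apply: hal.
have [||R [hv B1R mR]] := @exists_vr _ B1 [set y | exists2 c, B1 c & y = b * c] hB1.
- split.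
 + by move=> _ [c hc ->]; member.
 + by exists 0; [member| rewrite mulr0].
 + by move=> _ _ [c hc ->] [d hd ->]; exists (c + d); [member| rewrite mulrDr].
 + by move=> y _ hy [c hc ->]; exists (y * c); [member| rewrite mulrCA].
- by move=> [c hc E]; apply: nb; suff -> : b^-1 = c by []; apply: (mulfI b0); rewrite divff.
exists R, t; split=> //.
- member.
- by apply: mR; exists 1; [member| rewrite mulr1].
- by rewrite Ez !size_cat addnS.
split=> // [y hy|g Pg g0]; last first.
 by apply: B1R; exists 1, g; rewrite div1r; split=> //; member.
by apply: zB; move: hy; rewrite Ez !mem_cat inE => /orP[->//|->]; rewrite !orbT.
Qed.

End Closed.

(** * Approximation by rational-valued valuations *)

Section QValuation.
Variable F : fieldType.
Implicit Types (A B R k : set F) (x y : F).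
Local Notation vr := (@valuation_subring F).

Definition unitin R x := [/\ x != 0, R x & R x^-1].

Lemma unitinM R x y : vr R -> unitin R x -> unitin R y -> unitin R (x * y).
Proof.
move=> hv [x0 Rx ix] [y0 Ry iy]; split; first exact: mulf_neq0.
 member.
by rewrite invfM; member.
Qed.

Lemma unitinV R x : unitin R x -> unitin R x^-1.
Proof. by case=> x0 h1 h2; split; rewrite ?invrK // invr_eq0. Qed.

Lemma unitinX R x n : vr R -> unitin R x -> unitin R (x ^+ n).
Proof.
move=> hv hx; elim: n => [|n IH]; last by rewrite exprS; apply: unitinM.
by split; rewrite ?oner_neq0 ?invr1 //; exact: (subring_one (vr_sub hv)).
Qed.

Lemma vr_root R x n : vr R -> (0 < n)%N -> R (x ^+ n) -> R x.
Proof.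
move=> hv n0 h; apply: contrapT => /(vr_out hv)[x0 mx].
have := maxidX hv mx n0; rewrite exprVn => /(vr_max_out (expf_neq0 n x0)); exact.
Qed.

Lemma unitin_root R x n : vr R -> (0 < n)%N -> unitin R (x ^+ n) -> unitin R x.
Proof.
move=> hv n0 [h0 h1 h2]; split; first by move: h0; rewrite expf_eq0 n0.
 exact: vr_root h1.
by apply: (vr_root hv n0); rewrite exprVn.
Qed.

Lemma unitinP R x : R x -> ~ maxid R x -> unitin R x.
Proof. by move=> Rx /(vr_unit Rx)[]. Qed.

Lemma unitin_max R x : unitin R x -> ~ maxid R x.
Proof. by move=> [x0 _ h]; apply: unit_notmax. Qed.

Record qval k (nu : F -> rat) : Prop := Qval {
 qvalM : forall x y, x != 0 -> y != 0 -> nu (x * y) = nu x + nu y;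
 qvalD : forall x y, x != 0 -> y != 0 -> x + y != 0 -> Num.min (nu x) (nu y) <= nu (x + y);
 qvalk : forall c, k c -> c != 0 -> nu c = 0 }.

(** By hypothesis the value of t generates the value group up to torsion: if x^n and t^m differ by a
    unit, the value of x is m/n. *)
Lemma qval_of_vr k R t : acsub k -> vr R -> k `<=` R -> t != 0 -> maxid R t ->
 (forall x, x != 0 -> exists n m, (0 < n)%N /\ unitin R (x ^+ n / t ^ m)) ->
 exists nu, qval k nu /\ forall x, x != 0 -> (R x <-> 0 <= nu x) /\ (maxid R x <-> 0 < nu x).
Proof.
move=> hk hv kR t0 mt hcom; have hR := vr_sub hv.
have tz (m : int) : t ^ m != 0 by rewrite expfz_neq0.
have tpos (m : int) : 0 < m -> maxid R (t ^ m).
 by case: m => // m h; apply: maxidX.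
have tunit (m : int) : unitin R (t ^ m) -> m = 0.
 move=> hu; case: (ltgtP m 0) => // h; last by case: (unitin_max hu (tpos m h)).
 have := unitinV hu; rewrite invr_expz => /unitin_max; case.
 by apply: tpos; rewrite oppr_gt0.
pose val x q := exists n (m : int), [/\ (0 < n)%N, unitin R (x ^+ n / t ^ m) & q = m%:~R / n%:R :> rat].
have expn (x : F) (m : int) n : (x ^ m) ^+ n = x ^ (m * n%:Z) by rewrite -exprz_exp.
have val_uniq x q q' : x != 0 -> val x q -> val x q' -> q = q'.
 move=> x0 [n [m [n0 hu ->]]] [n' [m' [n0' hu' ->]]].
 have h1 := unitinX n' hv hu; have h2 := unitinX n hv hu'.
 have h3 := unitinM hv h1 (unitinV h2); rewrite !expr_div_n -!exprM [(n' * n)%N]mulnC !expn in h3.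
 have h4 : unitin R (t ^ (m' * n%:Z - m * n'%:Z)).
  rewrite expfzDr // -invr_expz; move: h3; congr unitin; field.
  by rewrite expf_neq0 // !tz.
 move: (tunit _ h4) => /eqP; rewrite subr_eq0 => /eqP E.
 have nq : n%:R != 0 :> rat by rewrite pnatr_eq0 -lt0n.
 have nq' : n'%:R != 0 :> rat by rewrite pnatr_eq0 -lt0n.
 have : (m' * n%:Z)%:~R = (m * n'%:Z)%:~R :> rat by rewrite E.
 rewrite !intrM => E2; apply: (mulIf nq); rewrite divfK //; apply: (mulIf nq').
 by rewrite mulrAC divfK.
have val_ex x : x != 0 -> exists q, val x q.
 by move=> /hcom[n [m [n0 hu]]]; exists (m%:~R / n%:R), n, m.
pose nu x : rat := xget 0 [set q | val x q].
have nuP x : x != 0 -> val x (nu x).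
 by move=> /val_ex[q hq]; apply: (@xgetPex _ 0 [set q | val x q]); exists q.
have nuE x q : x != 0 -> val x q -> nu x = q.
 by move=> x0 h; apply: (val_uniq x) => //; apply: nuP.
have nuM x y : x != 0 -> y != 0 -> nu (x * y) = nu x + nu y.
 move=> x0 y0; apply: nuE; first exact: mulf_neq0.
 have [n [m [n0 hu ->]]] := nuP x x0; have [n' [m' [n0' hu' ->]]] := nuP y y0.
 exists (n * n')%N, (m * n'%:Z + m' * n%:Z); split; first by rewrite muln_gt0 n0.
  have := unitinM hv (unitinX n' hv hu) (unitinX n hv hu').
  rewrite !expr_div_n -!exprM [(n' * n)%N]mulnC !expn expfzDr // exprMn.
  suff -> : forall a b c d : F, a / b * (c / d) = a * c / (b * d) by [].
  by move=> a b c d; rewrite invfM; ring.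
 field.
 by rewrite !pnatr_eq0 -!lt0n n0'.
have spec x : x != 0 -> (R x <-> 0 <= nu x) /\ (maxid R x <-> 0 < nu x).
 move=> x0; have [n [m [n0 hu ->]]] := nuP x x0.
 have nq : 0 < n%:R :> rat by rewrite ltr0n.
 have E : x ^+ n = (x ^+ n / t ^ m) * t ^ m by rewrite divfK.
 have -> : (0 <= m%:~R / n%:R :> rat) = (0 <= m) by rewrite pmulr_lge0 ?invr_gt0 // ler0z.
 have -> : (0 < m%:~R / n%:R :> rat) = (0 < m) by rewrite pmulr_lgt0 ?invr_gt0 // ltr0z.
 have [hu0 hu1 hu2] := hu.
 have pos : 0 < m -> maxid R x.
  move=> h; have mxn : maxid R (x ^+ n) by rewrite E; member.
  by apply: (maxid_exp hv _ mxn); apply: (vr_root hv n0); member.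
 have neg : m < 0 -> ~ R x.
  move=> h Rx; have : 0 < - m by rewrite oppr_gt0.
  move=> /tpos hm; apply: (unitin_max hu); rewrite invr_expz.
  member.
 have zer : m = 0 -> unitin R x.
  by move=> m0; apply: (unitin_root hv n0); move: hu; rewrite m0 divr1.
 case: (ltgtP m 0) => [h|h|h].
 - split; split=> //; first by move=> /(neg h).
  by move=> /(@maxid_sub _ R) /(neg h).
 - by split; split=> // _; [apply: maxid_sub; apply: pos | apply: pos].
 - have hx := zer h; split; split=> //; first by case: hx.
  by move=> /(unitin_max hx).
exists nu; split=> //; split=> //.
- have aux x y : x != 0 -> y != 0 -> x + y != 0 -> nu x <= nu y -> nu x <= nu (x + y).
  move=> x0 y0 xy0 le; have -> : x + y = x * (1 + y / x) by field.
  have h0 : 1 + y / x != 0.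
   have E : x + y = x * (1 + y / x) by field.
   by apply: contraNneq xy0 => E0; rewrite E E0 mulr0.
  rewrite nuM // ler_wpDr //; apply/(spec _ h0).1; apply: subringD => //; first member.
  have yx0 : y / x != 0 by rewrite mulf_neq0 ?invr_eq0.
  apply/(spec _ yx0).1; move: (nuM (y / x) x yx0 x0); rewrite divfK // => E.
  by move: le; rewrite E lerDr.
 move=> x y x0 y0 xy0; rewrite ge_min; have [h|h] := leP (nu x) (nu y).
  by rewrite aux.
 by rewrite addrC aux ?orbT 1?addrC // ltW.
- move=> c kc c0; apply: nuE => //; exists 1%N, 0; rewrite divr1 expr1; split=> //.
 by split=> //; member.
Qed.

End QValuation.

Section Approximation.
Variables (F : fieldType) (k : set F) (gs : seq F).
Implicit Types (R : set F).
Local Notation vr := (@valuation_subring F).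
Hypotheses (hk : acsub k) (hF : fraction_field (gen k gs)).
Let ks := ac_sub hk.

(** In a sum that vanishes, the least value is attained at least twice. *)
Lemma vr_two_terms R (s : seq F) : vr R -> \sum_(i < size s) s`_i = 0 -> (exists2 x, x \in s & x != 0) ->
 exists i j, [/\ (i < j < size s)%N, s`_i != 0, s`_j != 0 & unitin R (s`_j / s`_i)].
Proof.
move=> hv E [x xs x0]; have hR := vr_sub hv; have hm := maxid_ideal hv.
have [c [cs c0 hc]] := exists_max hv xs x0; have hi : (index c s < size s)%N by rewrite index_mem.
pose i := index c s; have Ei : s`_i = c by rewrite nth_index.
have [j [js ji hj]] : exists j, [/\ (j < size s)%N, j != i & ~ maxid R (s`_j / c)].
 apply: contrapT => h; apply: (@maxid_proper _ R hR); rewrite -[1]opprK.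
 apply: (idealN hR hm).
 have -> : - 1 = \sum_(j < size s | j != Ordinal hi) s`_j / c.
  apply/eqP; rewrite eq_sym -addr_eq0 addrC; apply/eqP; move: E; rewrite (bigD1 (Ordinal hi)) //= Ei => E.
  by rewrite -[1](divff c0) -mulr_suml -mulrDl E mul0r.
 apply: (ideal_sum hm) => j _ nj; apply: contrapT => h2; apply: h; exists j; split=> //.
have hu : unitin R (s`_j / c) by apply: unitinP => //; apply: hc; apply: mem_nth.
have sj0 : s`_j != 0 by case: hu; rewrite mulf_eq0 negb_or => /andP[].
case: (ltngtP i j) ji => // ij _.
- by exists i, j; rewrite ij Ei.
- exists j, i; rewrite ij Ei; split=> //.
 by have := unitinV hu; rewrite invf_div.
Qed.

(* In the blow-up chart of the elements x of l that are positive on R, all of them are divisible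
  by one of them, b; a prime of height one over b carries a discrete valuation up to torsion. *)
Theorem q_valuation R (l : seq F) : vr R -> k `<=` R -> exists2 nu, qval k nu &
 forall x, x \in l -> x != 0 -> (R x -> 0 <= nu x) /\ (maxid R x -> 0 < nu x).
Proof.
move=> hv kR; have hR := vr_sub hv; pose xs := [seq x <- l | `[< maxid R x /\ x != 0 >]].
have xsP x : x \in xs -> [/\ x \in l, maxid R x & x != 0].
 by rewrite mem_filter => /andP[/asboolP[? ?] ?].
have [[x hx]|nx] := pselect (exists x, x \in xs); last first.
 exists (fun=> 0) => //.
 move=> x xl x0; split=> // mx; exfalso; apply: nx; exists x.
 by rewrite mem_filter xl andbT; apply/asboolP.
have [_ _ x0] := xsP x hx; have [b [bs b0 hb]] := exists_max hv hx x0.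
have [bl mb _] := xsP b bs.
pose inR y := `[< R y >].
(* The chart contains the elements of l lying in R, the quotients by b of the positive ones, and
   each generator of F or its inverse, whichever lies in R; the last ones make F its fraction
   field. *)
pose L := [seq y <- l | inR y] ++ [seq y / b | y <- xs] ++
     [seq (if inR g then g else g^-1) | g <- gs].
have LR y : y \in L -> R y.
 rewrite !mem_cat => /orP[|/orP[/mapP[z hz ->]|/mapP[g hg ->]]]; last first.
 - rewrite /inR; case: asboolP => // h; by have [_ /maxid_sub] := vr_out hv h.
 - member.
 - by rewrite mem_filter => /andP[/asboolP].
pose C := gen k L; have hC : subring_set C := gen_subring k L.
have CR : C `<=` R by apply: gen_min.
have lC y : y \in l -> R y -> C y.
 by move=> hy Ry; apply: gen_mem; rewrite mem_cat mem_filter hy andbT; apply/orP; left; apply/asboolP.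
have [z [hz zC hint]] := noether_normalization hk L.
have nb : ~ C b^-1.
 by move=> /CR h; case: (unit_notmax b0 h).
have [R' [t [hv' CR' mb' st [tC ht tu]]]] := principal_ideal hk hz zC hint (lC b bl (maxid_sub mb)) b0 nb.
have hR' := vr_sub hv'; have hm' := maxid_ideal hv'.
have kR' : k `<=` R' by move=> c kc; member.
have hP := gen_subring k t.
have tR' : gen k t `<=` R' by apply: gen_min => // y /tC/CR'.
(* Nonzero elements of k[t] are units of R' and b is not, so p(b) has the value of b^e with e the
   order of p at 0. In particular t and b are independent, and counting makes every f algebraic over
   k[t, b]. *)
have low p : polyin (gen k t) p -> p != 0 -> exists e, unitin R' (p.[b] / b ^+ e).
 elim/poly_ind: p => [|p c IH] hp p0; first by rewrite eqxx in p0.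
 have hp' : polyin (gen k t) p.
  by move=> i; have := hp i.+1; rewrite coefD coefMX coefC addr0.
 have Pc : gen k t c by have := hp 0%N; rewrite coefD coefMX coefC add0r.
 have [c0|c0] := eqVneq c 0.
  have pn0 : p != 0 by apply: contraNneq p0 => ->; rewrite c0 mul0r addr0.
  have [e he] := IH hp' pn0; exists e.+1; rewrite hornerMXaddC c0 addr0 exprS invfM.
  by rewrite mulrA mulfK.
 exists 0%N; rewrite divr1 hornerMXaddC addrC; apply: unitinP.
  apply: subringD => //; first member.
  apply: (subring_mul hR'); last member.
  member.
 apply: (vr_unit_add hv'); first member.
  by apply: unit_notmax => //; apply: tu.
 member.
have tb : transc (gen k t) b.
 move=> p hp rp; apply: contrapT => /eqP p0; have [e [h _ _]] := low p hp p0.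
 by move: h; rewrite rp mul0r eqxx.
have htb : indep k (rcons t b) by apply/indep_rcons.
have algz y : algb (gen k z) y.
 have hz' := gen_subring k z.
 have aL y' : y' \in L -> algb (gen k z) y'.
  move=> hy' R2 hv2 [hA _]; apply: (hint R2) => //.
   member.
  by move=> w hw; apply: hA; exact: gen_mem.
 have ags g : g \in gs -> algb (gen k z) g.
  move=> hg; have := aL (if inR g then g else g^-1); rewrite !mem_cat map_f ?orbT // => /(_ isT).
  by case: ifP => // _ /(algbV hz'); rewrite invrK.
 have agen : gen k gs `<=` algb (gen k z).
  by apply: gen_min => //; [exact: algb_subring | move=> c kc; apply: algb_base; member].
 have [c [d [hc hd d0 ->]]] := hF y; apply: (subring_mul (algb_subring _)); first member.
 by apply: algbV; member.
have algtb f : algb (adj (gen k t) b) f.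
 apply/algbP; first member.
 move=> tf; have hi : indep k (rcons (rcons t b) f).
  by apply/indep_rcons => //; split=> //; rewrite gen_rcons.
 have := indep_size ks hi (fun y _ => algz y); rewrite !size_rcons -st ltnn //.
(* An algebraic equation of f over k[t, b] has two terms of equal value; their quotient compares a
   power of f with a power of b. *)
have com f : f != 0 -> exists n m, (0 < n)%N /\ unitin R' (f ^+ n / b ^ m).
 move=> f0; have /algbP := algtb f; move=> /(_ (adj_subring b hP))/nontranscP[p [hp p0 /rootP rp]].
 pose s := [seq p`_i * f ^+ i | i <- iota 0 (size p)].
 have ss : size s = size p by rewrite size_map size_iota.
 have sE i : (i < size p)%N -> s`_i = p`_i * f ^+ i.
  by move=> hi; rewrite (nth_map 0%N) ?size_iota // nth_iota.
 have [||i [j [/andP[ij js] si sj hu]]] := @vr_two_terms R' s hv'.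
 - rewrite ss -[RHS]rp horner_coef; apply: eq_bigr => i _; exact: sE.
 - have sp : (0 < size p)%N by rewrite size_poly_gt0.
  exists s`_(size p).-1; first by rewrite mem_nth // ss prednK.
  by rewrite sE ?prednK // mulf_neq0 ?expf_neq0 // lead_coef_eq0.
 rewrite ss in js; have is' := ltn_trans ij js; rewrite !sE // in si sj hu.
 have pi0 : p`_i != 0 by move: si; rewrite mulf_eq0 negb_or => /andP[].
 have pj0 : p`_j != 0 by move: sj; rewrite mulf_eq0 negb_or => /andP[].
 have fac l' : p`_l' != 0 -> exists e, unitin R' (p`_l' / b ^+ e).
  move=> pl; have [q hq E] := hp l'; rewrite E; apply: low => //.
  by apply: contraNneq pl => q0; rewrite E q0 horner0.
 have [ei hei] := fac i pi0; have [ej hej] := fac j pj0.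
 exists (j - i)%N, (ei%:Z - ej%:Z); split; first by rewrite subn_gt0.
 have := unitinM hv' hu (unitinM hv' hei (unitinV hej)).
 congr unitin; rewrite expfzDr // -invr_expz -!exprnP.
 have -> : f ^+ (j - i) = f ^+ j / f ^+ i by rewrite expfB.
 by field; rewrite pj0 !expf_neq0.
have [nu [hnu hs]] := qval_of_vr hk hv' kR' b0 mb' com.
exists nu => // y yl y0; split=> [Ry|my]; first by apply/(hs y y0).1; apply: CR'; exact: lC.
apply/(hs y y0).2; have -> : y = (y / b) * b by rewrite divfK.
apply: maxidM => //; apply: CR'; apply: gen_mem; rewrite !mem_cat.
apply/orP; right; apply/orP; left; apply: map_f; rewrite mem_filter yl andbT; exact/asboolP.
Qed.

End Approximation.

(** * Local rings and K-rational places *)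

Section Local.
Variable F : fieldType.
Implicit Types (A B C O R k p q : set F).
Local Notation vr := (@valuation_subring F).

Definition resL O (h : local O) : resdata F.
Proof.
apply: (@ResData F O (maxid O)); have hs := proj1 h; have hi := local_ideal h.
- exact: subring_one.
- exact: subring_sub.
- exact: subring_mul.
- exact: maxid_sub.
- exact: ideal0 hi.
- by move=> x y; apply: idealB hs hi.
- exact: idealM hi.
- exact: maxid_proper.
- move=> x Ox nx; have [x0 ix] := vr_unit Ox nx; exists x^-1 => //.
 by rewrite divff // subrr; exact: ideal0 hi.
Defined.

Section Localization.
Variables (B p : set F).
Hypotheses (hB : subring_set B) (hp : prime_ideal B p).

Lemma notp_neq0 b : ~ p b -> b != 0.
Proof. by move=> nb; apply/eqP => b0; apply: nb; rewrite b0; member. Qed.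

Lemma notpM a b : B a -> B b -> ~ p a -> ~ p b -> ~ p (a * b).
Proof. by move=> Ba Bb na nb /(prime_prime hp Ba Bb)[]. Qed.

Lemma loc_base : B `<=` localization B p.
Proof.
by move=> a Ba; exists a, 1; split; [|member|exact: prime_proper hp|rewrite divr1].
Qed.

Lemma loc_sub : subring_set (localization B p).
Proof.
split; first by apply: loc_base; member.
- move=> _ _ [a [b [Ba Bb nb ->]]] [c [d [Bc Bd nd ->]]]; exists (a * d - c * b), (b * d).
 split; [|member|exact: notpM|by field; rewrite !notp_neq0].
 member.
- move=> _ _ [a [b [Ba Bb nb ->]]] [c [d [Bc Bd nd ->]]]; exists (a * c), (b * d).
 by split; [member|member|exact: notpM|field; rewrite !notp_neq0].
Qed.

Lemma loc_inv b : B b -> ~ p b -> localization B p b^-1.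
Proof. by move=> Bb nb; exists 1, b; rewrite div1r; split=> //; member. Qed.

Lemma loc_max x : maxid (localization B p) x <-> exists a b, [/\ p a, B b, ~ p b & x = a / b].
Proof.
split=> [[[a [b [Ba Bb nb ->]]] h]|[a [b [pa Bb nb ->]]]].
 exists a, b; split=> //; apply: contrapT => na; apply: h.
 by rewrite mulf_neq0 ?invr_eq0 ?notp_neq0 // invf_div; split=> //; exists b, a.
split; first by exists a, b; split=> //; member.
move=> [ab0 [c [d [Bc Bd nd E]]]]; move: (ab0); rewrite mulf_eq0 negb_or => /andP[a0 _].
have E2 : b * d = c * a by move: E; rewrite invf_div => E; rewrite -[b](divfK a0) E; field; rewrite notp_neq0.
by apply: (notpM Bb Bd nb nd); rewrite E2; member.
Qed.

Lemma loc_max_trace b : B b -> maxid (localization B p) b <-> p b.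
Proof.
move=> Bb; rewrite loc_max; split=> [[a [s [pa Bs ns E]]]|pb]; last first.
 by exists b, 1; rewrite divr1; split=> //; [member|exact: prime_proper hp].
have E2 : s * b = a by rewrite E mulrC divfK // notp_neq0.
by case: (prime_prime hp Bs Bb) => //; rewrite E2.
Qed.

Lemma loc_local : local (localization B p).
Proof.
split; first exact: loc_sub.
move=> x y /loc_max[a [b [pa Bb nb ->]]] /loc_max[c [d [pc Bd nd ->]]]; apply/loc_max.
exists (d * a + b * c), (b * d); split; [|member|exact: notpM|by field; rewrite !notp_neq0].
member.
Qed.

Lemma loc_min C : subring_set C -> B `<=` C -> (forall b, B b -> ~ p b -> C b^-1) ->
 localization B p `<=` C.
Proof.
by move=> hC BC hi _ [a [b [Ba Bb nb ->]]]; apply: (subring_mul hC); [member|apply: hi].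
Qed.

Lemma prime_loc q : prime_ideal B q -> q `<=` p ->
 prime_ideal (localization B p) [set x | exists a b, [/\ q a, B b, ~ p b & x = a / b]].
Proof.
move=> hq qp; split.
- by move=> _ [a [b [qa Bb nb ->]]]; exists a, b; split=> //; member.
- exists 0, 1; rewrite mul0r; split=> //; [member|member|exact: prime_proper hp].
- move=> _ _ [a [b [pa Bb nb ->]]] [c [d [pc Bd nd ->]]].
 exists (d * a + b * c), (b * d); split; [|member|exact: notpM|by field; rewrite !notp_neq0].
 member.
- move=> _ _ [a [b [Ba Bb nb ->]]] [c [d [qc Bd nd ->]]]; exists (a * c), (b * d).
 by split; [member|member|exact: notpM|field; rewrite !notp_neq0].
- move=> [a [b [qa Bb nb E]]]; have b1 := notp_neq0 nb; apply: nb; apply: qp.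
 suff -> : b = a by [].
 by rewrite -[a](divfK b1) -E mul1r.
- move=> _ _ [a [b [Ba Bb nb ->]]] [c [d [Bc Bd nd ->]]] [e [f [qe Bf nf E]]].
 have b0 := notp_neq0 nb; have d0 := notp_neq0 nd; have f0 := notp_neq0 nf.
 have E2 : f * (a * c) = (b * d) * e.
  have -> : a * c = (a / b) * (c / d) * (b * d) by field; rewrite d0.
  by rewrite E; field.
 have : q (f * (a * c)) by rewrite E2; member.
 move=> /(prime_prime hq Bf (subring_mul hB Ba Bc))[/qp//|/(prime_prime hq Ba Bc)[qa|qc]].
  by left; exists a, b.
 by right; exists c, d.
Qed.

Lemma loc_rational k : acsub k -> k `<=` B -> rational k B p ->
 rational k (localization B p) (maxid (localization B p)).
Proof.
move=> hk kB rp _ [a [b [Ba Bb nb ->]]]; have [c kc hc] := rp a Ba; have [d kd hd] := rp b Bb.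
have b0 := notp_neq0 nb; have d0 : d != 0 by apply: contra_notN nb => /eqP d0; move: hd; rewrite d0 subr0.
exists (c / d); first member.
have Bd : B d^-1 by member.
by apply/loc_max; exists (d^-1 * (d * (a - c) - c * (b - d))), b; split=> //; [member|field; rewrite b0].
Qed.

End Localization.

Lemma center_dom R B : vr R -> subring_set B -> B `<=` R ->
 dominates R (localization B (maxid R `&` B)).
Proof.
move=> hv hB BR; have hp := maxid_prime hv hB BR; have hR := vr_sub hv.
have sub : localization B (maxid R `&` B) `<=` R.
 apply: loc_min => // b Bb nb; have [|//] := @vr_unit _ R b (BR _ Bb).
 by move=> mb; apply: nb.
split=> //; apply/seteqP; split=> x.
 move=> mx; split; last member.
 move/(loc_max hp): mx => [a [b [[ma Ba] Bb nb ->]]]; rewrite mulrC; apply: maxidM => //.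
 by apply: sub; apply: loc_inv.
move=> [mx Ox]; split=> // -[x0 /sub h]; exact: unit_notmax x0 h mx.
Qed.

(** A nonzero prime q strictly inside p would lead to the chain 0 < q < p, of length 2, in the
    localization. *)
Lemma ht1_of_krull B p : subring_set B -> prime_ideal B p -> krull_dim (localization B p) 1 ->
 (exists2 x, p x & x != 0) /\
 forall q, prime_ideal B q -> q `<=` p -> (exists2 x, q x & x != 0) -> p `<=` q.
Proof.
move=> hB hp [[c [hc lc]] nch]; have hO := loc_sub hB hp.
have nz : exists2 x, p x & x != 0.
 have [_ /existsNP[x /not_implyP[c1x nc0]]] := lc 0%N isT.
 have h1 := hc 1%N isT; have [a [b [Ba Bb nb E]]] := prime_sub h1 c1x.
 have x0 : x != 0 by apply/eqP => x0; apply: nc0; rewrite x0; exact: prime_zero (hc 0%N isT).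
 have a0 : a != 0 by apply: contraNneq x0 => a0; rewrite E a0 mul0r.
 exists a => //; apply: contrapT => na; apply: (prime_proper h1).
 have : c 1%N (b / a * x).
  by apply: (prime_mul h1) => //; exists b, a.
 by rewrite E; have -> : b / a * (a / b) = 1 by field; rewrite (notp_neq0 hp nb).
split=> // q hq qp [x qx x0] y py; apply: contrapT => nqy; apply: nch.
pose q' := [set x | exists a b, [/\ q a, B b, ~ p b & x = a / b]].
pose c' i := if i == 0%N then [set 0] else if i == 1%N then q' else maxid (localization B p).
have hz : prime_ideal (localization B p) [set 0].
 split=> /=; [by move=> _ ->; member|by []|by move=> ? ? -> ->; rewrite addr0|by move=> ? ? _ ->; rewrite mulr0| |].
  by apply/eqP; rewrite oner_eq0.
 by move=> a b _ _ /eqP; rewrite mulf_eq0 => /orP[/eqP|/eqP]; [left|right].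
exists c'; split=> [[|[|[|//]]] _|[|[|//]] _].
- by [].
- exact: prime_loc.
- by apply: local_prime; exact: loc_local.
- split=> [_ ->|h]; first exact: prime_zero (prime_loc hB hp hq qp).
 have : q' x by exists x, 1; rewrite divr1; split=> //; [member|exact: prime_proper hp].
 by move=> /h /eqP; rewrite (negbTE x0).
- split=> [_ [a [b [qa Bb nb ->]]]|h].
  by apply/loc_max => //; exists a, b; split=> //; member.
 have /h[a [b [qa Bb nb E]]] : maxid (localization B p) y.
  by apply/loc_max_trace; member.
 have E2 : b * y = a by rewrite E mulrC divfK // (notp_neq0 hp nb).
 case: (prime_prime hq Bb (prime_sub hp py)) => [|/qp//|//]; by rewrite E2.
Qed.

Lemma indep_step A p q B x : prime_ideal A p -> prime_ideal A q -> q `<=` p -> subring_set A ->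
 subring_set B -> B `<=` A -> (forall b, B b -> p b -> b = 0) -> p x -> ~ q x ->
 forall r, polyin B r -> q r.[x] -> r = 0.
Proof.
move=> hp hq qp hA hB BA hb px nqx; have Ax := prime_sub hp px.
elim/poly_ind=> [//|r c IH] hr; rewrite hornerMXaddC => h.
have hr' : polyin B r by move=> i; have := hr i.+1; rewrite coefD coefMX coefC addr0.
have Bc : B c by have := hr 0%N; rewrite coefD coefMX coefC add0r.
have Ar : A r.[x] by member.
have c0 : c = 0.
 apply: hb => //; have -> : c = (r.[x] * x + c) - r.[x] * x by ring.
 member.
rewrite c0 addr0 in h *; case: (prime_prime hq Ar Ax h) => // /(IH hr') ->.
by rewrite mul0r add0r.
Qed.

(** An element of the upper but not of the lower of two consecutive primes is transcendental over a
    ring that meets the upper prime in 0 ([indep_step]), and the enlarged ring meets the lower prime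
    in 0. Descending the chain from the top adds d elements to s. *)
Lemma chain_indep k A s c d : acsub k -> k `<=` A -> subring_set A ->
 (forall i, (i <= d)%N -> prime_ideal A (c i)) -> (forall i, (i < d)%N -> c i `<` c i.+1) ->
 indep k s -> s `in` A -> (forall g, gen k s g -> c d g -> g = 0) ->
 exists t, size t = (size s + d)%N /\ indep k t.
Proof.
move=> hk kA hA; have ks := ac_sub hk; elim: d s => [|d IH] s hc lc hs sA h0.
 by exists s; rewrite addn0.
have [sub /existsNP[x /not_implyP[cx ncx]]] := lc d (ltnSn d).
have hA' : gen k s `<=` A by apply: gen_min.
have st := indep_step (hc d.+1 (leqnn _)) (hc d (leqnSn _)) sub hA (gen_subring k s) hA' h0 cx ncx.
have tx : transc (gen k s) x.
 move=> r hr rx; apply: st => //; rewrite rx; exact: prime_zero (hc d (leqnSn _)).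
have [|||||t [st' ht]] := IH (rcons s x).
- by move=> i hi; apply: hc; exact: leqW.
- by move=> i hi; apply: lc; exact: leqW.
- by apply/indep_rcons.
- move=> y; rewrite mem_rcons => /orP[/eqP ->|/sA//]; exact: prime_sub (hc d.+1 (leqnn _)) _ cx.
- by rewrite gen_rcons // => _ [r hr ->] /(st r hr) ->; rewrite horner0.
- by exists t; rewrite st' size_rcons addnS.
Qed.

Definition kbar k O (h : local O) : set (kap (resL h)) := [set u | exists2 c, k c & u = pi (resL h) c].
Arguments kbar k [O] h _.

Lemma pi_max O (h : local O) x : O x -> pi (resL h) x = 0 <-> maxid O x.
Proof. by move=> Ox; exact: (pi_eq0 (D := resL h) Ox). Qed.

Lemma acsub_pi k O (h : local O) : acsub k -> k `<=` O -> acsub (kbar k h).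
Proof.
move=> hk kR; pose D := resL h; have hR := proj1 h; have ks := ac_sub hk.
split.
- split; first by exists 1; [member|].
 + move=> _ _ [c kc ->] [d kd ->]; exists (c - d); first member.
  by rewrite (piB (D := D)) //; exact: kR.
 + move=> _ _ [c kc ->] [d kd ->]; exists (c * d); first member.
  by rewrite (piM (D := D)) //; exact: kR.
- move=> _ [c kc ->]; exists c^-1; first member.
 have [->|c0] := eqVneq c 0; first by rewrite !invr0.
 have ic : O c^-1 by member.
 have pc0 : pi D c != 0 by apply/eqP => /(pi_max h (kR _ kc)) /(unit_notmax c0 ic).
 by apply: (mulfI pc0); rewrite -(piM (D := D)) ?divff //; exact: kR.
- move=> q hq mq sq; have /choice[f hf] : forall i, exists c, k c /\ q`_i = pi D c.
  by move=> i; have [c kc E] := hq i; exists c.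
 pose n := (size q).-1; have sqn : size q = n.+1 by rewrite prednK // ltnW.
 pose g := 'X^n + \poly_(i < n) f i.
 have sg : (size (\poly_(i < n) f i)%R < size ('X^n : {poly F}))%N by rewrite size_polyXn ltnS.
 have gg i : g`_i = if (i < n)%N then f i else (i == n)%:R.
  rewrite coefD coefXn coef_poly; case: ltngtP => hh; rewrite ?addr0 ?add0r //.
 have hg : polyin k g.
  move=> i; rewrite gg; case: ifP => _; first by case: (hf i).
  by case: eqP => _; [exact: subring_one|exact: subring0].
 have [||c kc rc] := ac_root hk hg; first by rewrite monicE lead_coefDl // lead_coefXn.
  by rewrite size_polyDl // size_polyXn -sqn.
 exists (pi D c); first by exists c.
 have sgn : size g = n.+1 by rewrite size_polyDl // size_polyXn.
 have [h1 h2] := @pi_sum _ D _ (index_enum 'I_n.+1) (fun i => g`_i * c ^+ i)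
   (fun i _ => subring_mul hR (kR _ (hg i)) (kR _ (subringX i ks kc))).
 apply/rootP; move/rootP: rc; rewrite horner_coef sgn => E; move: h2; rewrite E pi0 => ->.
 rewrite horner_coef sqn; apply: eq_bigr => i _.
 rewrite (piM (D := D)) ?(piX (D := D)); [|exact: kR|exact: kR|by apply: kR; member].
 rewrite gg; congr (_ * _); case: ltnP => hh; first by case: (hf i).
 have -> : (i : nat) = n by apply/eqP; rewrite eqn_leq -ltnS ltn_ord.
 by rewrite eqxx -lead_coefE (monicP mq).
Qed.

(* The composite of R with a place of its residue field. *)
Theorem kplace k R (l : seq F) : acsub k -> vr R -> k `<=` R -> l `in` R ->
 exists R', [/\ kvr k R', R' `<=` R, maxid R `<=` maxid R' & l `in` R'].
Proof.
move=> hk hv kR lR; pose h := vr_local hv; pose D := resL h; have hR := vr_sub hv.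
have ks := ac_sub hk.
have kbI x : R x -> pi D x = 0 -> maxid R x by move=> Rx /(pi_max h Rx).
have hkb : acsub (kbar k h) := acsub_pi h hk kR.
(* The place of the residue field is chosen finite on the residues of l, so that the composite
   remains finite on l. *)
have [Rb hRb lRb] := nullstellensatz hkb [seq pi D x | x <- l].
have hvb := kvr_vr hRb; have hsb := vr_sub hvb.
pose R' := [set x | R x /\ Rb (pi D x)].
have hs' : subring_set R'.
 split.
 - by split; [member|rewrite pi1; member].
 - by move=> x y [? ?] [? ?]; split; [member|rewrite (piB (D := D)); member].
 - by move=> x y [? ?] [? ?]; split; [member|rewrite (piM (D := D)); member].
have inv x : R x -> ~ maxid R x -> [/\ x != 0, R x^-1, pi D x != 0 & pi D x^-1 = (pi D x)^-1].
 move=> Rx nx; have [x0 ix] := vr_unit Rx nx.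
 have p0 : pi D x != 0 by apply/eqP => /(kbI _ Rx).
 by split=> //; apply: (mulfI p0); rewrite -(piM (D := D)) ?divff.
have maxR' x : maxid R x -> R' x.
 move=> mx; split; first member.
 by rewrite ((pi_max h (maxid_sub mx)).2 mx); member.
have hv' : vr R'.
 split=> // x x0; have key y : y != 0 -> R y -> R' y \/ R' y^-1.
  move=> y0 Ry; have [my|ny] := pselect (maxid R y); first by left; member.
  have [_ iy py E] := inv y Ry ny; case: (proj2 hvb _ py) => hb; [by left|right].
  by split; rewrite ?E.
 case: (proj2 hv x x0) => hb; first exact: key.
 have ix0 : x^-1 != 0 by rewrite invr_eq0.
 by have := key _ ix0 hb; rewrite invrK => -[]; [right|left].
have mm : maxid R `<=` maxid R'.
 by move=> x mx; split; [member|move=> [x0 [ix _]]; case: (unit_notmax x0 ix)].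
exists R'; split=> //.
- split=> //.
  by move=> c kc; split; [member|apply: (kvr_k hRb); exists c].
 move=> x [Rx Rbx]; have [_ [c kc ->] hc] := kvr_rat hRb Rbx; exists c => //.
 have Rxc : R (x - c) by member.
 have E : pi D (x - c) = pi D x - pi D c by rewrite (piB (D := D)) //; exact: kR.
 rewrite -E in hc; split; first by split=> //; member.
 move=> [xc0 [ix Rbi]]; have nx : ~ maxid R (x - c) by apply: unit_notmax.
 have [_ _ p0 E2] := inv _ Rxc nx; rewrite E2 in Rbi; exact: unit_notmax p0 Rbi hc.
- by move=> x [].
- by move=> x xl; split; [member|apply: lRb; exact: map_f].
Qed.

(** Noetherian induction: a maximal counterexample I is not prime, and for a b in I with a, b
    outside I every prime above I lies above I + (a) or I + (b). *)
Lemma minimal_primes B J : subring_set B -> noeth B -> ideal B J -> exists ps : seq (set F),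
 (forall p, p \in ps -> prime_ideal B p /\ J `<=` p) /\
 forall p, prime_ideal B p -> J `<=` p -> exists2 q, q \in ps & q `<=` p.
Proof.
move=> hB nB hJ; apply: contrapT => nJ.
pose C := [set I | ideal B I /\ ~ exists ps : seq (set F),
 (forall p, p \in ps -> prime_ideal B p /\ I `<=` p) /\
 forall p, prime_ideal B p -> I `<=` p -> exists2 q, q \in ps & q `<=` p].
have [||I [hI nI] maxI] := @noeth_max _ B C nB; first by move=> I [/ideal_rideal].
 by exists J.
have [I1|I1] := pselect (I 1).
 by apply: nI; exists [::]; split=> // p hp /(_ 1 I1)/(prime_proper hp).
have big a : B a -> ~ I a -> exists ps : seq (set F),
  (forall p, p \in ps -> prime_ideal B p /\ I `<=` p) /\
  forall p, prime_ideal B p -> I `<=` p -> p a -> exists2 q, q \in ps & q `<=` p.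
 move=> Ba na; pose Ia := [set x | exists y b, [/\ I y, B b & x = y + b * a]].
 have IIa : I `<=` Ia by move=> x Ix; exists x, 0; rewrite mul0r addr0; split=> //; member.
 have hIa : ideal B Ia.
  split.
  - move=> _ [y [b [Iy Bb ->]]]; apply: (subringD hB); first member.
   member.
  - member.
  - move=> _ _ [y [b [Iy Bb ->]]] [z [c [Iz Bc ->]]]; exists (y + z), (b + c).
   by split; [member|member|ring].
  - move=> e _ Be [y [b [Iy Bb ->]]]; exists (e * y), (e * b).
   by split; [member|member|ring].
 apply: contrapT => nps; apply: na; apply: (maxI Ia) => //; last first.
  by exists 0, 1; rewrite mul1r add0r; split=> //; member.
 split=> // -[ps [h1 h2]]; apply: nps; exists ps; split.
  by move=> p /h1[? h]; split=> // x /IIa/h.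
 move=> p hp Ip pa; apply: h2 => // _ [y [b [Iy Bb ->]]].
 member.
have [pI|npI] := pselect (prime_ideal B I).
 apply: nI; exists [:: I]; split=> [p|p hp Ip]; first by rewrite inE => /eqP ->; split.
 by exists I; rewrite ?mem_head.
have [a [b [Ba Bb Iab na nb]]] : exists a b, [/\ B a, B b, I (a * b), ~ I a & ~ I b].
 apply: contrapT => h; apply: npI; case: hI => *; split=> // a b Ba Bb hab.
 by apply: contrapT => /not_orP[? ?]; apply: h; exists a, b.
have [ps [h1 h2]] := big a Ba na; have [qs [g1 g2]] := big b Bb nb.
apply: nI; exists (ps ++ qs); split=> [p|p hp Ip]; first by case/in_catP=> [/h1|/g1].
have /Ip /(prime_prime hp Ba Bb)[pa|pb] := Iab.
 by have [q hq qp] := h2 p hp Ip pa; exists q; rewrite ?mem_cat ?hq.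
by have [q hq qp] := g2 p hp Ip pb; exists q; rewrite ?mem_cat ?hq ?orbT.
Qed.

(* Inverting an element h that lies in the minimal primes of b not contained in p
  makes the principal ideal theorem produce a prime below p. *)
Theorem height_one k l p b : acsub k -> fraction_field (gen k l) -> prime_ideal (gen k l) p ->
 p b -> b != 0 -> exists E t z, [/\ prime_ideal (gen k l) E, E `<=` p, E b &
  krull_dim (localization (gen k l) E) 1] /\
  [/\ indep k z /\ (forall y, algb (gen k z) y), (size t).+1 = size z, indep k t,
   t `in` localization (gen k l) E &
   forall g, gen k t g -> g != 0 -> ~ maxid (localization (gen k l) E) g].
Proof.
move=> hk hF hp pb b0; pose B := gen k l; have ks := ac_sub hk.
have hB : subring_set B := gen_subring k l; have Bb := prime_sub hp pb.
pose bB := [set x | exists2 c, B c & x = b * c].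
have hbB : ideal B bB := principal_is_ideal hB Bb.
have [ps [h1 h2]] := minimal_primes hB (noeth_gen (s := l) hk) hbB.
have [h [Bh nh hh]] : exists h, [/\ B h, ~ p h & forall q, q \in ps -> ~ q `<=` p -> q h].
 elim: ps {h2} h1 => [|q ps IH] h1; first by exists 1; split=> //; [member|exact: prime_proper hp].
 have [h [Bh nh hh]] := IH (fun r hr => h1 r (@mem_behead _ (q :: ps) r hr)).
 have [hq _] := h1 q (mem_head _ _).
 have [qp|/existsNP[g /not_implyP[qg ng]]] := pselect (q `<=` p).
  by exists h; split=> // r /in_consP[->//|]; exact: hh.
 have Bg := prime_sub hq qg; exists (g * h); split=> [||r].
 - member.
 - exact: notpM hp _ _ _ _ ng nh.
 - case/in_consP=> [-> _|hr nr]; first member.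
  have [hr' _] := h1 r (@mem_behead _ (q :: ps) r hr).
  by apply: (prime_mul hr') => //; exact: hh.
have h0 : h != 0 := notp_neq0 hp nh.
pose C := gen k (h^-1 :: l).
have CE : forall x, C x -> exists2 n, (exists2 c, B c & x = c / h ^+ n) & true.
 pose C' := [set x | exists n c, B c /\ x = c / h ^+ n].
 have hC' : subring_set C'.
  split; first by exists 0%N, 1; rewrite divr1; split=> //; member.
  - move=> _ _ [n [c [Bc ->]]] [m [d [Bd ->]]]; exists (n + m)%N, (c * h ^+ m - d * h ^+ n); split.
    member.
   by rewrite exprD; field; rewrite !expf_neq0.
  - move=> _ _ [n [c [Bc ->]]] [m [d [Bd ->]]]; exists (n + m)%N, (c * d); split.
    member.
   by rewrite exprD; field; rewrite !expf_neq0.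
 have BC' : B `<=` C' by move=> c Bc; exists 0%N, c; rewrite divr1.
 have : C `<=` C'.
  apply: gen_min => // [c kc|x]; first by apply: BC'; exact: gen_base.
  case/in_consP=> [->|hx]; last by apply: BC'; exact: gen_mem.
  by exists 1%N, 1; rewrite div1r; split=> //; member.
 by move=> CC' x /CC'[n [c [Bc E]]]; exists n => //; exists c.
have BC : B `<=` C by apply: gen_sub => [|z hz]; [member|apply: gen_mem; exact: mem_tail].
(* If b were a unit of B[1/h], a power of h would lie in bB and thus in p. *)
have nb : ~ C b^-1.
 move=> /CE[n [c Bc E] _]; apply: nh; apply: (prime_ideal_exp (n := n) hB hp Bh).
 suff -> : h ^+ n = c * b by member.
 by rewrite -[LHS]mulr1 -(mulVf b0) E; field; rewrite expf_neq0.
have [z [hz zC hint]] := noether_normalization hk (h^-1 :: l).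
have [R [t [hv CR mb st [tC ht tu]]]] := principal_ideal hk hz zC hint (BC b Bb) b0 nb.
have BR : B `<=` R by move=> x /BC/CR.
have kR : k `<=` R by move=> c kc; member.
pose E := maxid R `&` B; have hE : prime_ideal B E := maxid_prime hv hB BR.
have Eb : E b by [].
have nEh : ~ E h.
 move=> [mh _]; apply: (unit_notmax h0 _ mh); apply: CR; apply: gen_mem; exact: mem_head.
pose O := localization B E; have hO : local O := loc_local hB hE.
have [OR domE] := center_dom hv hB BR; rewrite -/O in OR domE.
have CO : C `<=` O.
 apply: gen_min => [|c kc|x]; first member.
  by apply: loc_base => //; exact: gen_base.
 case/in_consP=> [->|hx]; first exact: loc_inv.
 by apply: loc_base => //; exact: gen_mem.
have tmax g : gen k t g -> g != 0 -> ~ maxid O g.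
 by move=> hg g0; rewrite domE => -[]; move/(unit_notmax g0): (tu g hg g0).
have algz y : algb (gen k z) y.
 have hz' := gen_subring k z.
 have aC : B `<=` algb (gen k z).
  move=> x Bx R2 hv2 [hA _]; apply: (Bx R2); first member.
   member.
  move=> w hw; apply: (hint R2) => //; last by rewrite inE hw orbT.
   member.
  by move=> v hvz; apply: hA; exact: gen_mem.
 have [c [d [hc hd d0 ->]]] := hF y; apply: (subring_mul (algb_subring _)); first member.
 by apply: algbV; member.
(* The list t, one element short of a transcendence basis, meets the maximal ideal of O in 0; a
   chain of length two would add two more independent elements. *)
have krull : krull_dim O 1.
 split.
  exists (fun i => if i == 0%N then [set 0] else maxid O); split=> [[|[|//]] _ /=|[|//] _ /=].
  - split=> /=; [by move=> _ ->; member|by []|by move=> ? ? -> ->; rewrite addr0|by move=> ? ? _ ->; rewrite mulr0| |].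
    by apply/eqP; rewrite oner_eq0.
   by move=> u v _ _ /eqP; rewrite mulf_eq0 => /orP[/eqP|/eqP]; [left|right].
  - exact: local_prime.
  - split=> [_ ->|hm]; first member.
   have /hm/eqP : maxid O b by apply/loc_max_trace.
   by rewrite (negbTE b0).
 move=> [c [hc lc]]; have [|||w [sw hw]] := @chain_indep k O t c 2 hk _ (loc_sub hB hE) hc lc ht.
 - by move=> x kx; apply: loc_base => //; exact: gen_base.
 - by move=> x /tC/CO.
 - move=> g hg cg; apply: contrapT => /eqP g0; apply: (tmax g hg g0).
  have hc2 := hc 2 isT; split; first member.
  move=> [_ ig]; apply: (prime_proper hc2); rewrite -(mulVf g0); member.
 - by have := indep_size ks hw (fun y _ => algz y); rewrite sw -st addn2 ltnn.
(* E contains a minimal prime q of b. Were q not inside p, it would contain h, and so would E; and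
   E, being of height one, equals q. *)
have [q qps qE] : exists2 q, q \in ps & q `<=` E.
 by apply: h2 => // _ [c Bc ->]; member.
have [hq bq] := h1 q qps.
have qp : q `<=` p.
 apply: contrapT => nqp; apply: nEh; apply: qE; exact: hh.
have [_ min] := ht1_of_krull hB hE krull.
have Eq : E `<=` q.
 by apply: min => //; exists b => //; apply: bq; exists 1; [member|rewrite mulr1].
exists E, t, z; split; split=> //; first member.
by move=> x /tC/CO.
Qed.

End Local.
Arguments kbar [F] k [O] h _.

Ltac member_loc := lazymatch goal with
 | |- subring_set (localization _ _) => apply: loc_sub; member
 | |- local (localization _ _) => apply: loc_local; member
 | |- localization _ _ _^-1 => apply: loc_inv; member
 | |- localization _ _ _ => apply: loc_base; member
 | |- ideal _ (ipow _ _ _) => apply: ipow_ideal; member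
 | |- ipow ?B ?J ?n _ => lazymatch goal with
  | _ : ideal _ (ipow B J n) |- _ => fail
  | |- _ => have ? : ideal B (ipow B J n) by apply: ipow_ideal; member
  end; member
 end.
Ltac member_hook ::= member_loc.

(** * Factoriality at regular points *)

Section Nakayama.
Variable F : fieldType.
Implicit Types (A B I J m : set F) (s t : seq F).

Lemma linI_D B I s x y : ideal B I -> lin I s x -> lin I s y -> lin I s (x + y).
Proof.
move=> hI [c hc ->] [d hd ->]; exists (fun i => c i + d i) => [i|]; first exact: (idealD hI).
by rewrite -big_split; apply: eq_bigr => i _; rewrite mulrDl.
Qed.

Lemma linI_M B I s a x : ideal B I -> B a -> lin I s x -> lin I s (a * x).
Proof.
move=> hI ha [c hc ->]; exists (fun i => a * c i) => [i|]; first exact: (idealM hI).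
by rewrite mulr_sumr; apply: eq_bigr => i _; rewrite mulrA.
Qed.

Lemma linI_mem B I s c x : ideal B I -> I c -> x \in s -> lin I s (c * x).
Proof.
move=> hI hc hx; have hi : (index x s < size s)%N by rewrite index_mem.
exists (fun i => if i == index x s then c else 0) => [i|].
 by case: eqP => // _; member.
rewrite (bigD1 (Ordinal hi)) //= eqxx nth_index // big1 ?addr0 // => i ni.
suff -> : (i == index x s :> nat) = false by rewrite mul0r.
by apply: contraNF ni => /eqP E; apply/eqP/val_inj.
Qed.

Record submod B J : Prop := Submod {
 submod0 : J 0;
 submodD : forall x y, J x -> J y -> J (x + y);
 submodM : forall a x, B a -> J x -> J (a * x) }.

(** Generators are eliminated one at a time: the relation of n reads u n = y modulo J with u = 1 -
    c, and multiplying the other relations by u removes n from them. J is a submodule of F, which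
    allows for a subring in its place. *)
Lemma nakayama B I J s : subring_set B -> ideal B I -> submod B J ->
 (forall x, x \in s -> exists2 y, lin I s y & J (x - y)) ->
 exists2 e, I e & forall x, x \in s -> J ((1 - e) * x).
Proof.
move=> hB hI hJ; have B1 := subring_one hB; have IB := ideal_sub hI.
elim: s => [|n s IH] h; first by exists 0 => //; member.
have split_ y : lin I (n :: s) y -> exists c y', [/\ I c, lin I s y' & y = c * n + y'].
 move=> [c hc ->]; rewrite big_ord_recl /=; exists (c 0%N), (\sum_(i < size s) c i.+1 * s`_i).
 by split=> //; exists (fun i => c i.+1).
have [_ /split_[c [y [Ic hy ->]]] Jn] := h n (mem_head _ _).
pose u := 1 - c; have Bu : B u by apply: (subring_sub hB) => //; exact: IB.
have Jun : J (u * n - y) by move: Jn; congr J; rewrite /u; ring.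
have [x xs|e Ie he] := IH.
 have [_ /split_[d [z [Id hz ->]]] Jx] := h x (@mem_behead _ (n :: s) x xs).
 exists (c * x + (d * y + u * z)).
  apply: (linI_D hI); first exact: (linI_mem hI).
  by apply: (linI_D hI); apply: (linI_M hI); member.
 have -> : x - (c * x + (d * y + u * z)) = u * (x - (d * n + z)) + d * (u * n - y).
  by rewrite /u; ring.
 by apply: (submodD hJ); apply: (submodM hJ); member.
have Be : B (1 - e) by member.
exists (1 - (1 - e) * u) => [|x].
 have -> : 1 - (1 - e) * u = u * e + c by rewrite /u; ring.
 member.
rewrite subKr inE => /orP[/eqP ->|xs]; last first.
 by rewrite [_ * u]mulrC -mulrA; apply: (submodM hJ); member.
rewrite -mulrA -[u * n](subrK y) mulrDr; apply: (submodD hJ); first exact: (submodM hJ).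
case: hy => d hd ->; rewrite mulr_sumr; apply: big_ind => [|x' y'|i _].
- exact: submod0 hJ.
- exact: (submodD hJ).
- by rewrite mulrCA; apply: (submodM hJ); [exact: IB|apply: he; rewrite mem_nth].
Qed.

Lemma finite_module A s : subring_set A ->
 (forall x, x \in s -> exists p, [/\ polyin A p, p \is monic & root p x]) ->
 exists2 t, gen A s `<=` lin A t & t `in` gen A s.
Proof.
move=> hA; have hr := subring_rsub hA; elim: s => [|x s IH] hs.
 exists [:: 1] => [a|x]; last by rewrite inE => /eqP ->; member.
 by rewrite gen_nil // => Aa; rewrite -[a]mulr1; apply: linM => //; apply: lin_mem; rewrite ?mem_head.
have [t ht tA] := IH (fun y hy => hs y (@mem_behead _ (x :: s) y hy)).
have [p [hp mp rp]] := hs x (mem_head _ _); have hg := gen_subring A s.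
exists [seq y * x ^+ i | y <- t, i <- iota 0 (size p)] => [z|z /allpairsP[[y i] [/= hy _ ->]]]; last first.
 rewrite gen_cons; apply: (subring_mul (adj_subring x hg)).
  by apply: sub_adj; member.
 by apply: (subringX _ (adj_subring x hg)); exact: adj_gen.
rewrite gen_cons => -[q hq ->].
have [Q [r [h1 h2 h3 ->]]] := div_monic hg mp (sub_polyin (@gen_base _ A s) hp) hq.
rewrite hornerD hornerM (rootP rp) mul0r add0r horner_coef.
apply: big_ind => [|u v|i _]; [exact: lin0|exact: linD|].
have [c hc ->] := ht _ (h2 i); rewrite mulr_suml; apply: big_ind => [|u v|j _]; [exact: lin0|exact: linD|].
rewrite -mulrA; apply: linM => //; apply: lin_mem => //; apply: allpairs_f; first by rewrite mem_nth.
by rewrite mem_iota (ltn_trans (ltn_ord i)).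
Qed.

Lemma ipow_add B m i j a b : subring_set B -> ideal B m -> ipow B m i a -> ipow B m j b ->
 ipow B m (i + j) (a * b).
Proof.
move=> hB hm; elim: i a => [|i IH] a /=.
 by move=> Ba hb; member.
move=> [s [hs ->]] hb; rewrite mulr_suml; apply: (ideal_sum (ipow_ideal (i + j).+1 hB hm)) => p hp _.
have [h1 h2] := hs p hp; rewrite -mulrA; apply: ipowM => //; exact: IH.
Qed.

Lemma ipow_le B m i j : subring_set B -> ideal B m -> (i <= j)%N -> ipow B m j `<=` ipow B m i.
Proof.
move=> hB hm /subnK <-; elim: (j - i)%N => [//|d IH] x; rewrite addSn => -[s [hs ->]].
apply: (ideal_sum (ipow_ideal i hB hm)) => p /hs[h1 h2] _; apply: (idealM (ipow_ideal i hB hm)).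
 exact: (ideal_sub hm).
member.
Qed.

Lemma ipow_sub A B I m n : A `<=` B -> I `<=` m -> ipow A I n `<=` ipow B m n.
Proof.
move=> AB Im; elim: n => [//|n IH] x [s [hs ->]]; exists s; split=> // p /hs[h1 h2].
by split; member.
Qed.

Lemma ipow1 B m x : subring_set B -> ideal B m -> ipow B m 1 x <-> m x.
Proof.
move=> hB hm; split=> [[s [hs ->]]|mx].
 by apply: (ideal_sum hm) => p /hs[h1 h2] _; member.
by rewrite -[x]mulr1; apply: ipowM; member.
Qed.

Lemma noeth_loc B p : subring_set B -> prime_ideal B p -> noeth B -> noeth (localization B p).
Proof.
move=> hB hp nB J hJ; have hO := loc_sub hB hp; pose I := J `&` B.
have hI : rideal B I.
 split; [by move=> x []|by split; [exact: (rideal0 hJ)|member]| |].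
  by move=> x y [? ?] [? ?]; split; [exact: (ridealD hJ)|member].
 move=> a x Ba [? ?]; split; last member.
 by apply: (ridealM hJ); member.
have [s sI Is] := nB I hI; exists s => [x /sI[]//|x Jx].
have [a [b [Ba Bb nb E]]] := rideal_sub hJ Jx.
have b0 := notp_neq0 hp nb; have Ea : a = b * x by rewrite E; field.
have [c hc E2] : lin B s a.
 by apply: Is; split=> //; rewrite Ea; apply: (ridealM hJ); member.
exists (fun i => b^-1 * c i) => [i|].
 by apply: (subring_mul hO); [member|exact: loc_base].
have -> : x = b^-1 * a by rewrite Ea mulKf.
by rewrite E2 mulr_sumr; apply: eq_bigr => i _; rewrite mulrA.
Qed.

Lemma ipow_loc B p n x : subring_set B -> prime_ideal B p ->
 ipow (localization B p) (maxid (localization B p)) n x ->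
 exists s : F, [/\ B s, ~ p s & ipow B p n (s * x)].
Proof.
move=> hB hp; have hi := prime_ideal_ideal hp; elim: n x => [|n IH] x.
 move=> [a [b [Ba Bb nb E]]]; exists b; split=> //=.
 by rewrite E mulrC divfK // (notp_neq0 hp nb).
move=> [s [hs ->]]; elim: s hs => [|u s IHs] hs.
 exists 1; rewrite big_nil mulr0; split; [member|exact: prime_proper hp|].
 member.
have [|d [Bd nd hd]] := IHs; first by move=> v /mem_tail/hs.
have [h1 h2] := hs u (mem_head _ _); have [e [Be ne he]] := IH _ h2.
have [a [b [pa Bb nb E]]] := (loc_max hp _).1 h1; have b0 := notp_neq0 hp nb.
exists (d * (b * e)); split; [member| |].
 by apply: (notpM hp) => //; [member|apply: (notpM hp)].
rewrite big_cons mulrDr; apply: (idealD (ipow_ideal n.+1 hB hi)); last first.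
 rewrite mulrAC; member.
have -> : d * (b * e) * (u.1 * u.2) = d * (a * (e * u.2)) by rewrite E; field.
by apply: (idealM (ipow_ideal n.+1 hB hi)) => //; exact: ipowM.
Qed.

End Nakayama.

Section Residue.
Variables (F : fieldType) (k O : set F) (h : local O).
Hypotheses (hk : acsub k) (kO : k `<=` O).
Local Notation D := (resL h).
Local Notation kb := (kbar k h).
Local Notation p := (pi (resL h)).

Lemma gen_pi s : s `in` O ->
 gen kb (map p s) = [set u | exists2 a, gen k s a & u = p a].
Proof.
move=> sO; have hO := proj1 h; have gO : gen k s `<=` O by apply: gen_min.
apply/seteqP; split.
 apply: gen_min => [|_ [c kc ->]|_ /mapP[x xs ->]].
 - split; first by exists 1; [member|].
  + move=> _ _ [a ha ->] [b hb ->]; exists (a - b); first member.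
   by rewrite (piB (D := D)) //; exact: gO.
  + move=> _ _ [a ha ->] [b hb ->]; exists (a * b); first member.
   by rewrite (piM (D := D)) //; exact: gO.
 - by exists c => //; member.
 - by exists x => //; exact: gen_mem.
move=> _ [a ha ->]; pose C := [set a | O a /\ gen kb (map p s) (p a)].
suff : gen k s `<=` C by move=> /(_ a ha)[].
apply: gen_min => [|c kc|x xs].
- split; first by split; [member|rewrite pi1; member].
 + move=> x y [Ox ?] [Oy ?]; split; first member.
  by rewrite (piB (D := D)); member.
 + move=> x y [Ox ?] [Oy ?]; split; first member.
  by rewrite (piM (D := D)); member.
- by split; [member|apply: gen_base; exists c].
- by split; [member|apply: gen_mem; exact: map_f].
Qed.

Lemma pi_horner (q : {poly F}) x : polyin O q -> O x -> p q.[x] = (map_poly p q).[p x] /\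
 (forall i, (map_poly p q)`_i = p q`_i).
Proof.
move=> hq Ox; have hO := proj1 h.
have cE i : (map_poly p q)`_i = p q`_i by rewrite coef_map_id0.
split=> //; have sz : (size (map_poly p q) <= size q)%N.
 by apply/leq_sizeP => j hj; rewrite cE nth_default.
rewrite (horner_coef_wide _ sz) horner_coef.
have [_ ->] := @pi_sum _ D _ (index_enum 'I_(size q)) (fun i => q`_i * x ^+ i)
  (fun i _ => subring_mul hO (hq i) (subringX i hO Ox)).
apply: eq_bigr => i _; rewrite (piM (D := D)) ?(piX (D := D)) ?cE //; member.
Qed.

Lemma pi_lift (A : set F) (q : {poly kap D}) : A `<=` O -> subring_set A ->
 polyin [set u | exists2 a, A a & u = p a] q ->
 exists2 q', polyin A q' & map_poly p q' = q.
Proof.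
move=> AO hA hq; have /choice[f hf] : forall i, exists a, A a /\ q`_i = p a.
 by move=> i; have [a Aa E] := hq i; exists a.
pose q' := \poly_(i < size q) f i.
have hq' : polyin A q'.
 by move=> i; rewrite coef_poly; case: ifP => _; [case: (hf i)|member].
exists q' => //; apply/polyP => i; rewrite coef_map_id0 // coef_poly.
by case: ltnP => hi; [case: (hf i)|rewrite nth_default].
Qed.

(** Relations between residues lift to polynomials whose value lies in the maximal ideal; hence
    independence of the residues is independence of s together with injectivity of k[s] into the
    residue field. *)
Lemma indep_pi s : s `in` O ->
 (indep k s /\ forall g, gen k s g -> maxid O g -> g = 0) <-> indep kb (map p s).
Proof.
have hO := proj1 h; have ks := ac_sub hk; have hkb := acsub_pi h hk kO.
elim/last_ind: s => [|s x IH] sO.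
 split=> _; split=> // g; rewrite gen_nil // => kg mg; apply: contrapT => /eqP g0.
 by apply: (unit_notmax g0 _ mg); member.
have sO' y : y \in s -> O y by move=> hy; apply: sO; rewrite mem_rcons inE hy orbT.
have Ox : O x by apply: sO; rewrite mem_rcons mem_head.
have gO : gen k s `<=` O by apply: gen_min.
have hg := gen_subring k s; have hgb := gen_subring kb (map p s).
rewrite map_rcons; split.
 move=> [/(indep_rcons _ _ ks)[hs tx] h0]; rewrite gen_rcons // in h0.
 apply/(indep_rcons _ _ (ac_sub hkb)); split.
  by apply/IH => //; split=> // g gg; apply: h0; exact: sub_adj.
 move=> q; rewrite gen_pi // => hq rq; have [q' hq' E] := pi_lift gO hg hq.
 have [E1 E2] := pi_horner (sub_polyin gO hq') Ox.
 have q0 : q' = 0.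
  apply: tx => //; apply: h0; first by exists q'.
  by apply/pi_max; [member|rewrite E1 E].
 by rewrite -E q0 map_poly0.
move=> /(indep_rcons _ _ (ac_sub hkb))[/(IH sO')[hs h0] tx].
have key r : polyin (gen k s) r -> maxid O r.[x] -> r = 0.
 move=> hr mr; have [E1 E2] := pi_horner (sub_polyin gO hr) Ox.
 have r0 : map_poly p r = 0.
  apply: tx; first by rewrite gen_pi // => i; exists r`_i.
  by rewrite -E1; apply/pi_max; member.
 apply/polyP => i; rewrite coef0; apply: h0 => //; apply/(pi_max h); first exact: gO.
 by rewrite -E2 r0 coef0.
split; last by move=> g; rewrite gen_rcons // => -[r hr ->] /(key r hr) ->; rewrite horner0.
apply/indep_rcons => //; split=> // r hr rx; apply: key => //; rewrite rx; member.
Qed.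

End Residue.

Lemma acsub_range (K : closedFieldType) (F : fieldType) (iota : {rmorphism K -> F}) :
 acsub (range iota).
Proof.
split.
- split; first by exists 1; rewrite ?rmorph1.
 + by move=> _ _ [c _ <-] [d _ <-]; exists (c - d); rewrite ?rmorphB.
 + by move=> _ _ [c _ <-] [d _ <-]; exists (c * d); rewrite ?rmorphM.
- by move=> _ [c _ <-]; exists c^-1; rewrite ?fmorphV.
- move=> p hp mp sp; have /choice[f hf] : forall i, exists c, p`_i = iota c.
  by move=> i; have [c _ E] := hp i; exists c.
 pose q := \poly_(i < size p) f i; have E : map_poly iota q = p.
  apply/polyP => i; rewrite coef_map coef_poly; case: ltnP => h /=; first by rewrite hf.
  by rewrite rmorph0 nth_default.
 have : size q != 1%N by rewrite -(size_map_poly iota) E neq_ltn sp orbT.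
 by move=> /closed_rootP[x rx]; exists (iota x); [|rewrite -E fmorph_root].
Qed.

Section SteinitzDrop.
Variable F : fieldType.

Lemma indep_drop (A : set F) s : subring_set A -> ~ indep A s -> exists2 s' : seq F,
 (size s' < size s)%N & s `in` algb (gen A s').
Proof.
move=> hA; elim/last_ind: s => [[]//|s x IH] ns.
have [hs|/IH[s' ss hs']] := pselect (indep A s); last first.
 exists (rcons s' x) => [|y]; rewrite ?size_rcons //.
 rewrite mem_rcons => /orP[/eqP ->|/hs'].
  by apply: algb_base; apply: gen_mem; rewrite mem_rcons mem_head.
 apply: algb_mono; apply: gen_sub => [|z hz]; first member.
 by apply: gen_mem; rewrite mem_rcons inE hz orbT.
exists s => [|y]; rewrite ?size_rcons // mem_rcons => /orP[/eqP ->|hy].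
 by apply/algbP; [member|move=> tx; apply: ns; apply/indep_rcons].
by apply: algb_base; exact: gen_mem.
Qed.

Lemma indep_of_size (A : set F) s t : subring_set A -> indep A t ->
 t `in` algb (gen A s) -> (size s <= size t)%N -> indep A s.
Proof.
move=> hA ht h st; apply: contrapT => /(indep_drop hA)[s' ss hs'].
suff : (size t <= size s')%N by rewrite leqNgt (leq_trans ss).
apply: (indep_size hA ht) => x xt; apply: (@algb_trans _ A _ s) (h x xt) => //.
- member.
- member.
Qed.

Lemma polyX_factor (A : set F) (q : {poly F}) : subring_set A -> polyin A q -> q != 0 ->
 exists a q', [/\ polyin A q', q`_(a : nat) = q'`_0, q'`_0 != 0 & q = q' * 'X^a].
Proof.
move=> hA; elim/poly_ind: q => [|q c IH] hq q0; first by rewrite eqxx in q0.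
have hq' : polyin A q by move=> i; have := hq i.+1; rewrite coefD coefMX coefC addr0.
have [c0|c0] := eqVneq c 0.
 have pn0 : q != 0 by apply: contraNneq q0 => ->; rewrite c0 mul0r addr0.
 have [a [q' [h1 h2 h3 h4]]] := IH hq' pn0; exists a.+1, q'; split=> //.
  by rewrite c0 addr0 coefMX.
 by rewrite c0 addr0 {1}h4 exprSr mulrA.
by exists 0%N, (q * 'X + c%:P); rewrite mulr1 coefD coefMX coefC add0r.
Qed.

End SteinitzDrop.

(** * Height-one primes at a regular point are principal *)

Section Factorial.
Variables (K : closedFieldType) (F : fieldType) (iota : {rmorphism K -> F}).
Local Notation vr := (@valuation_subring _).
Local Notation k := (range iota).
Variables (l : seq F) (M E : set F).
Local Notation B := (gen k l).
Local Notation O := (localization B M).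
Local Notation OE := (localization B E).
Hypotheses (hF : fraction_field B) (hM : prime_ideal B M) (ratM : rational k B M)
 (hE : prime_ideal B E) (EM : E `<=` M) (krE : krull_dim OE 1).
Hypothesis lM : l `in` M.

Let hk : acsub k := acsub_range iota.
Let ks := ac_sub hk.
Let hB : subring_set B := gen_subring k l.
Let kB : k `<=` B. Proof. member. Qed.
Let hO : local O := loc_local hB hM.
Let hO' : subring_set O := loc_sub hB hM.
Let BO : B `<=` O. Proof. member. Qed.
Let kO : k `<=` O. Proof. member. Qed.
Let hOE : local OE := loc_local hB hE.
Let BOE : B `<=` OE. Proof. member. Qed.
Let kOE : k `<=` OE. Proof. member. Qed.
Let hm : ideal O (maxid O) := local_ideal hO.
Let m2 := ipow O (maxid O) 2.
Let hm2 : ideal O m2 := ipow_ideal 2 hO' hm.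
Let hMi : ideal B M := prime_ideal_ideal hM.
Local Notation D := (resL hOE).
Local Notation p := (pi (resL hOE)).
Local Notation kb := (kbar k hOE).
Let hkb : acsub kb := acsub_pi hOE hk kOE.

Let Mm x : M x -> maxid O x.
Proof. by move=> Mx; apply/(loc_max_trace hB hM); member. Qed.

Let m2m x : m2 x -> maxid O x.
Proof. by move=> /(ipow_le hO' hm (isT : (1 <= 2)%N))/(ipow1 _ hO' hm). Qed.

Let m2M a b : maxid O a -> maxid O b -> m2 (a * b).
Proof. by move=> ha hb; apply: (ipowM (n := 1)) => //; apply/(ipow1 _ hO' hm). Qed.

Let kM c : k c -> M c -> c = 0.
Proof.
move=> kc Mc; apply: contrapT => /eqP c0; apply: (prime_proper hM).
by rewrite -(mulVf c0); member.
Qed.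

Lemma rational_O x : O x -> exists2 c, k c & maxid O (x - c).
Proof. exact: (loc_rational hB hM hk kB ratM). Qed.

(** The preimage of the span of s in the cotangent space m/m^2. *)
Definition V s x := exists2 y, lin k s y & m2 (x - y).

Let rk : rsub k := subring_rsub ks.

Lemma V_D s x y : V s x -> V s y -> V s (x + y).
Proof.
move=> [u hu mu] [v hv mv]; exists (u + v); first exact: linD.
by rewrite opprD addrACA; member.
Qed.

Lemma V_M s c x : k c -> V s x -> V s (c * x).
Proof.
move=> kc [u hu mu]; exists (c * u); first exact: linM.
by rewrite -mulrBr; member.
Qed.

Lemma V_mem s x : x \in s -> V s x.
Proof. by move=> xs; exists x; [exact: lin_mem|rewrite subrr; member]. Qed.

Lemma V_m2 s x : m2 x -> V s x.
Proof. by move=> mx; exists 0; [exact: lin0|rewrite subr0]. Qed.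

Lemma V_sub s t : s `in` V t -> V s `<=` V t.
Proof.
move=> h x [y [c hc ->] my]; rewrite -[x](subrK (\sum_(i < size s) c i * s`_i)).
apply: V_D; first exact: V_m2.
apply: big_ind => [|u v|i _]; first exact: V_m2 (ideal0 hm2).
 exact: V_D.
by apply: V_M => //; apply: h; rewrite mem_nth.
Qed.

Lemma V_max s x : s `in` M -> V s x -> maxid O x.
Proof.
move=> sM [y [c hc ->] my]; rewrite -[x](subrK (\sum_(i < size s) c i * s`_i)).
apply: (idealD hm); first member.
apply: (ideal_sum hm) => i _ _; apply: (idealM hm); first exact: kO.
by apply: Mm; apply: sM; rewrite mem_nth.
Qed.

Definition spans s := maxid O `<=` V s.

(** Taylor expansion to first order at the origin: the elements that are a constant plus a linear
    form in l modulo m^2 form a subring. A denominator outside M acts on m/m^2 as its constant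
    term. *)
Lemma spans_gen : spans l.
Proof.
have key a : B a -> exists2 c, k c & V l (a - c).
 pose C := [set a | B a /\ exists2 c, k c & V l (a - c)].
 suff : B `<=` C by move=> h /h[].
 apply: gen_min => [|c kc|x xl].
 - split.
  + split; first member.
   by exists 1; [member|rewrite subrr; exact: V_m2 (ideal0 hm2)].
  + move=> x y [Bx [c kc hc]] [By [d kd hd]]; split; first member.
   exists (c - d); first member.
   have -> : x - y - (c - d) = (x - c) + (-1) * (y - d) by ring.
   by apply: V_D => //; apply: V_M; member.
  + move=> x y [Bx [c kc hc]] [By [d kd hd]]; split; first member.
   exists (c * d); first member.
   have -> : x * y - c * d = (x - c) * (y - d) + (c * (y - d) + d * (x - c)) by ring.
   apply: V_D; first by apply: V_m2; apply: m2M; exact: V_max lM _.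
   by apply: V_D; exact: V_M.
 - split; first member.
  by exists c => //; rewrite subrr; exact: V_m2 (ideal0 hm2).
 - split; first exact: gen_mem.
  by exists 0; [member|rewrite subr0; exact: V_mem].
move=> x /(loc_max hM)[a [b [Ma Bb nb ->]]].
have [c kc hc] := key a (prime_sub hM Ma); have b0 := notp_neq0 hM nb.
have c0 : c = 0.
 apply: kM => //; have := idealB hO' hm (Mm Ma) (V_max lM hc).
 by rewrite subKr => /(loc_max_trace hB hM (kB kc)).
rewrite c0 subr0 in hc; have [d kd hd] := ratM Bb.
have d0 : d != 0 by apply: contra_notN nb => /eqP E0; move: hd; rewrite E0 subr0.
have -> : a / b = d^-1 * a + (- (a * (b - d) * (b^-1 * d^-1))) by field; rewrite d0.
apply: V_D; first by apply: V_M; member.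
apply: V_m2; apply: (idealN hO' hm2); rewrite mulrC; apply: (idealM hm2).
 member.
by apply: m2M; member.
Qed.

(** Modulo m^2 the elements of s are combinations of the d generators t with coefficients in the
    residue field K. With more than d elements the coefficient matrix has a nonzero kernel vector,
    that is, a linear relation in m/m^2. *)
Lemma redundant d (t : 'I_d -> F) s : (forall i, maxid O (t i)) ->
 (forall x, maxid O x -> exists a : 'I_d -> F, (forall i, O (a i)) /\ x = \sum_i a i * t i) ->
 s `in` M -> (d < size s)%N ->
 exists s1 u s2, s = s1 ++ u :: s2 /\ V (s1 ++ s2) u.
Proof.
move=> mt ht sM ds; pose r := size s.
have /choice[c hc] : forall i : 'I_r, exists c : 'I_d -> K, m2 (s`_i - \sum_j iota (c j) * t j).
 move=> i; have [a [Oa ->]] := ht _ (Mm (sM _ (mem_nth 0 (ltn_ord i)))).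
 have /choice[c hc] : forall j, exists c : K, maxid O (a j - iota c).
  by move=> j; have [_ [c _ <-] h] := rational_O (Oa j); exists c.
 exists c; rewrite -sumrB; apply: (ideal_sum hm2) => j _ _; rewrite -mulrBl; exact: m2M.
pose C : 'M[K]_(r, d) := \matrix_(i, j) c i j.
have : kermx C != 0.
 rewrite kermx_eq0 -row_leq_rank -ltnNge; exact: leq_ltn_trans (rank_leq_col _) ds.
case/rowV0Pn => v /sub_kermxP vC v0.
have [i0 hi0] : exists i, v 0 i != 0.
 by apply/existsP; apply: contra_neqT v0 => /existsPn h; apply/rowP => i; rewrite mxE; apply/eqP/negbNE/h.
have hv : m2 (\sum_i iota (v 0 i) * s`_i).
 have -> : \sum_i iota (v 0 i) * s`_i = \sum_i iota (v 0 i) * (s`_i - \sum_j iota (c i j) * t j).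
  rewrite [RHS](eq_bigr (fun i => iota (v 0 i) * s`_i - \sum_j iota (v 0 i * c i j) * t j)); last first.
   by move=> i _; rewrite mulrBr mulr_sumr; congr (_ - _); apply: eq_bigr => j _; rewrite rmorphM mulrA.
  rewrite sumrB exchange_big /= [X in _ - X]big1 ?subr0 // => j _; rewrite -mulr_suml -rmorph_sum.
  have := congr1 (fun A : 'M_(1, d) => A 0 j) vC; rewrite mxE [X in _ = X]mxE => E0.
  rewrite (_ : \sum_i v 0 i * c i j = 0) ?rmorph0 ?mul0r // -[RHS]E0.
  by apply: eq_bigr => i _; rewrite mxE.
 by apply: (ideal_sum hm2) => i _ _; apply: (idealM hm2) => //; apply: kO.
exists (take i0 s), s`_i0, (drop i0.+1 s); split.
 by rewrite -drop_nth // cat_take_drop.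
have iv0 : iota (v 0 i0) != 0 by rewrite fmorph_eq0.
have kiv a : k (iota a / iota (v 0 i0)).
 by exists (a / v 0 i0) => //; rewrite fmorph_div.
have -> : s`_i0 = (iota (v 0 i0))^-1 * (\sum_i iota (v 0 i) * s`_i) +
  \sum_(i < r | i != i0) - (iota (v 0 i) / iota (v 0 i0)) * s`_i.
 rewrite (bigD1 i0) //= mulrDr mulKf // mulr_sumr -addrA -big_split /= big1 ?addr0 // => i _.
 by rewrite mulrA [_^-1 * _]mulrC mulNr subrr.
apply: V_D; first by apply: V_m2; apply: (idealM hm2) => //; apply: kO; exists (v 0 i0)^-1; rewrite ?fmorphV.
apply: big_ind => [|x y|i ni]; [exact: V_m2 (ideal0 hm2)|exact: V_D|].
apply: V_M; first by apply: (subringN ks).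
apply: V_mem; rewrite mem_cat; case: (ltngtP i i0) => [h|h|E0]; last by case/eqP: ni; apply: val_inj.
 by apply/orP; left; rewrite -(nth_take 0 h); apply: mem_nth; rewrite size_take_min leq_min h ltn_ord.
apply/orP; right; rewrite -(subnKC h) -nth_drop; apply: mem_nth.
by rewrite size_drop ltn_sub2r // (leq_ltn_trans h).
Qed.

Let pM x y : OE x -> OE y -> p (x * y) = p x * p y. Proof. exact: (piM (D := D)). Qed.
Let pB x y : OE x -> OE y -> p (x - y) = p x - p y. Proof. exact: (piB (D := D)). Qed.
Let pD x y : OE x -> OE y -> p (x + y) = p x + p y. Proof. exact: (piD (D := D)). Qed.
Let pX x n : OE x -> p (x ^+ n) = p x ^+ n. Proof. exact: (piX (D := D)). Qed.
Let pk c : k c -> kb (p c). Proof. by move=> kc; exists c. Qed.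

(** Integrality of B/E over the image of k[s], tested on the valuation rings of the residue field of
    E. *)
Definition intg (s : seq F) := forall R, vr R -> kb `<=` R -> (forall x, x \in s -> R (p x)) ->
 forall b, B b -> R (p b).

Lemma pgen (R : set (kap D)) s : subring_set R -> kb `<=` R -> s `in` OE ->
 (forall x, x \in s -> R (p x)) -> forall a, gen k s a -> R (p a).
Proof.
move=> hR kR sO sR a ha; have : gen kb (map p s) (p a) by rewrite (gen_pi hOE kOE sO); exists a.
by apply: gen_min => // _ /mapP[x xs ->]; member.
Qed.

Lemma intg_gen : intg l.
Proof.
move=> R hv kR lR b Bb; apply: (pgen (vr_sub hv) kR _ lR) => // x xl.
by apply: BOE; exact: gen_mem.
Qed.

(** Nagata's substitution in B/E replaces x by x - u^e and dispenses with u. As u lies in M and e is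
    at least 2, the classes in m/m^2 stay the same. If the residue of u is algebraic, it is a
    constant, and the constant is 0. *)
Lemma drop_step u s : M u -> s `in` M -> intg (u :: s) ->
 ~ indep kb (map p (u :: s)) -> exists s', [/\ size s' = size s, s' `in` M,
  forall x, x \in s -> exists2 x', x' \in s' & m2 (x - x') & intg s'].
Proof.
move=> Mu sM hi ni; have OEM x : M x -> OE x by move=> /(prime_sub hM)/BOE.
have m20 : m2 0 := ideal0 hm2.
have [tu|ntu] := pselect (transc kb (p u)); last first.
 exists s; split=> //; first by move=> x xs; exists x => //; rewrite subrr.
 have [c kc E0] : kb (p u) by apply: acsub_algb => //; apply/algbP; member.
 have Ec : E (u - c).
  apply/(loc_max_trace hB hE).
   member.
  apply/(pi_max hOE); first member.
  by rewrite pB ?E0 ?subrr; [|member|member].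
 have c0 : c = 0.
  by apply: kM; have := idealB hB hMi Mu (EM Ec); rewrite subKr.
 move=> R hv kR sR; apply: hi => // x /in_consP[->|]; last exact: sR.
 by apply: kR; exists c.
have [t [Et t2 ht]] := nagata hkb tu (fun h => ni (conj tu h)).
have sz : size t = size s by rewrite -(size_map fst) Et size_map.
pose s' := [seq q.1 - u ^+ q.2.2 | q <- zip s t].
have zsz : size (zip s t) = size s by rewrite size_zip sz minnn.
have mem_zip q : q \in zip s t -> q.1 \in s /\ q.2 \in t /\ q.2.1 = p q.1.
 move=> /(nthP (0, (0, 0%N)))[i]; rewrite zsz => hi' <-; rewrite nth_zip //=; split; first exact: mem_nth.
 split; first by apply: mem_nth; rewrite sz.
 have := congr1 (fun s0 => nth 0 s0 i) Et; rewrite (nth_map (0, 0%N)) ?sz // (nth_map 0) //.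
have u2 e : (1 < e)%N -> m2 (u ^+ e) /\ M (u ^+ e).
 case: e => [//|[//|e]] _; rewrite !exprS; split.
  rewrite mulrA mulrC; apply: (idealM hm2); last by apply: m2M; member.
  member.
 rewrite mulrC; apply: (prime_mul hM) => //; apply: (subring_mul hB); first member.
 member.
exists s'; split.
- by rewrite size_map.
- move=> _ /mapP[q /mem_zip[qs [qt _]] ->]; have [_ h] := u2 _ (t2 _ qt).
 member.
- move=> x /(nthP 0)[i hi' <-]; exists (s`_i - u ^+ (nth (0, 0%N) t i).2).
  apply/mapP; exists (nth (0, (0, 0%N)) (zip s t) i); first by apply: mem_nth; rewrite zsz.
  by rewrite nth_zip.
 by rewrite subKr; have [] := u2 _ (t2 _ (mem_nth (0, 0%N) (_ : (i < size t)%N))); rewrite ?sz.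
have hs' : forall q, q \in zip s t -> p (q.1 - u ^+ q.2.2) = q.2.1 - p u ^+ q.2.2.
 move=> q /mem_zip[qs [qt ->]]; rewrite pB ?pX //; [member|exact/OEM/sM|].
 member.
move=> R hv kR sR.
have hRt : forall q, q \in t -> R (q.1 - p u ^+ q.2).
 move=> q /(nthP (0, 0%N))[i hi' <-]; have hz : nth (0, (0, 0%N)) (zip s t) i \in zip s t.
  by apply: mem_nth; rewrite zsz -sz.
 by have := hs' _ hz; rewrite nth_zip //= => <-; apply: sR; apply/mapP; exists (nth (0, (0, 0%N)) (zip s t) i); rewrite // nth_zip.
have Ru : R (p u) by apply: ht.
apply: hi => // x /in_consP[->//|xs].
have : p x \in map fst t by rewrite Et map_f.
move=> /mapP[q qt ->]; rewrite -[q.1](subrK (p u ^+ q.2)); apply: (subringD (vr_sub hv)).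
 member.
member.
Qed.

(** The number n is the transcendence degree of the residue field of E, one less than that of F: the
    list t of [height_one] has n elements and stays independent modulo E. All bounds follow by
    counting independent elements. *)
Lemma dim_facts : exists n, [/\ forall d, prime_chain O d -> (d <= n.+1)%N,
 forall s, s `in` OE -> indep kb (map p s) -> (size s <= n)%N &
 forall s, s `in` OE -> intg s -> (size s <= n)%N -> indep kb (map p s) /\ size s = n].
Proof.
have [[b Eb b0] minE] := ht1_of_krull hB hE krE.
have [E' [t [z [[hE' E'E E'b _] [[hz algz] st ht tO tm]]]]] := height_one hk hF hE Eb b0.
have EE' : E' = E by apply/seteqP; split=> //; apply: minE => //; exists b.
rewrite {}EE' {E' hE' E'E E'b} in tO tm; exists (size t).
have z0 : prime_ideal OE [set 0].
 split=> /=; [by move=> _ ->; member|by []|by move=> ? ? -> ->; rewrite addr0|by move=> ? ? _ ->; rewrite mulr0| |].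
  by apply/eqP; rewrite oner_eq0.
 by move=> u v _ _ /eqP; rewrite mulf_eq0 => /orP[/eqP|/eqP]; [left|right].
have ti : indep kb (map p t).
 apply/(indep_pi hOE hk kOE) => //; split=> // g gg mg; apply: contrapT => /eqP g0; exact: tm gg g0 mg.
split.
- move=> d [c [hc lc]]; have [|||w [sw hw]] := @chain_indep _ k O [::] c d hk kO hO' hc lc.
 + by [].
 + by [].
 + move=> g; rewrite gen_nil // => kg cg; apply: contrapT => /eqP g0.
  apply: (prime_proper (hc d (leqnn d))); rewrite -(mulVf g0); apply: (prime_mul (hc d (leqnn d))) => //.
  member.
 + by have := indep_size ks hw (fun y _ => algz y); rewrite sw st.
- move=> s sO /(indep_pi hOE hk kOE sO)[hs h0].
 have [||w [sw hw]] := @chain_indep _ k OE s (fun i => if i == 0%N then [set 0] else maxid OE) 1 hk kOE (proj1 hOE) _ _ hs sO h0.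
 + by move=> [|[|//]] _; [|exact: local_prime].
 + move=> [|//] _ /=; split=> [_ ->|h]; first member.
  have /h/eqP : maxid OE b by apply/(loc_max_trace hB hE); member.
  by rewrite (negbTE b0).
 + by have := indep_size ks hw (fun y _ => algz y); rewrite sw -st addn1.
move=> s sO si sn.
have alg x : x \in map p t -> algb (gen kb (map p s)) x.
 move=> /mapP[y yt ->]; have [a [c [Ba Bc nc ->]]] := tO _ yt.
 have aB e : B e -> algb (gen kb (map p s)) (p e).
  move=> Be R hv [hR _]; apply: (si R hv) => //; first member.
  by move=> v vs; apply: hR; apply: gen_mem; exact: map_f.
 have c0 := notp_neq0 hE nc.
 have pc0 : p c != 0 by apply/eqP => /(pi_max hOE (BOE Bc))/(loc_max_trace hB hE Bc).
 have -> : p (a / c) = p a / p c.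
  apply: (mulIf pc0); rewrite -pM ?divfK //; [|member].
  member.
 apply: (subring_mul (algb_subring _)); first member.
 by apply: algbV; member.
have hi : indep kb (map p s).
 by apply: (indep_of_size (ac_sub hkb) ti alg); rewrite !size_map.
split=> //; apply/eqP; rewrite eqn_leq sn.
by have := indep_size (ac_sub hkb) ti alg; rewrite !size_map.
Qed.

(** The list s spans m/m^2 and B/E is integral over it; both are kept while s gets shorter. The
    dimension of m/m^2 is at most n + 1, so a longer list has a redundant element, which [drop_step]
    eliminates. At length n + 1 one more elimination sets u aside, and n elements over which B/E is
    integral are independent. *)
Lemma parameters : regular_local O -> exists zs u, [/\ zs `in` M, M u,
 spans (u :: zs), indep kb (map p zs) & intg zs].
Proof.
move=> [d [chd _] [t [mt ht]]]; have [n [dn up lo]] := dim_facts.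
have {}dn := dn d chd.
have OEM x : M x -> OE x by move=> /(prime_sub hM)/BOE.
have M0 : M 0 := prime_zero hM.
suff key : forall e s, size s = (e + n.+1)%N -> s `in` M -> spans s -> intg s ->
  exists zs u, [/\ zs `in` M, M u, spans (u :: zs), indep kb (map p zs) & intg zs].
 (* Padding with zeros guarantees the length of at least n + 1 from which the descent starts. *)
 apply: (key (size l) (l ++ nseq n.+1 0)).
 - by rewrite size_cat size_nseq.
 - by move=> x; rewrite mem_cat mem_nseq => /orP[/lM|/andP[_ /eqP ->]].
 - move=> x /spans_gen; apply: V_sub => y yl; apply: V_mem; by rewrite mem_cat yl.
 - by move=> R hv kR h; apply: (intg_gen hv kR) => x xl; apply: h; rewrite mem_cat xl.
have dep (s : seq F) : s `in` M -> (n < size s)%N -> ~ indep kb (map p s).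
 by move=> sM ns /up; move=> /(_ (fun x xs => OEM x (sM x xs))); rewrite leqNgt ns.
elim=> [|e IH] s ss sM sp si.
 case: s ss sM sp si => [//|u s] [ss] sM sp si.
 have Mu : M u by apply: sM; rewrite mem_head.
 have sM' x : x \in s -> M x by move=> /mem_tail/sM.
 have [|s' [ss' s'M hs' is']] := drop_step Mu sM' si; first by apply: dep => //=; rewrite ss.
 exists s', u; split=> //.
  move=> x /sp; apply: V_sub => y /in_consP[->|/hs'[y' ys' my]].
   by apply: V_mem; rewrite mem_head.
  by rewrite -[y](subrK y'); apply: V_D; [exact: V_m2|apply: V_mem; rewrite inE ys' orbT].
 have [] // := lo s' _ is'; last by rewrite ss' ss.
 by move=> x /s'M/OEM.
have [|s1 [u [s2 [Es Vu]]]] := redundant mt ht sM; first by lia.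
have Mu : M u by apply: sM; rewrite Es mem_cat mem_head orbT.
have sM' x : x \in s1 ++ s2 -> M x.
 by move=> xs; apply: sM; move: xs; rewrite Es !mem_cat inE => /orP[->//|->]; rewrite !orbT.
have mem x : (x \in s) = (x \in u :: s1 ++ s2) by rewrite Es !mem_cat !inE mem_cat orbCA.
have [||s' [ss' s'M hs' is']] := drop_step Mu sM'.
- by move=> R hv kR h; apply: si => // x; rewrite mem => /h.
- apply: (dep (u :: s1 ++ s2)) => [x|]; first by rewrite -mem => /sM.
 by move: ss; rewrite Es /= !size_cat /=; lia.
apply: (IH s') => //; first by move: ss; rewrite ss' Es !size_cat /=; lia.
have sub12 : V (s1 ++ s2) `<=` V s'.
 apply: V_sub => y /hs'[y' ys' my].
 by rewrite -[y](subrK y'); apply: V_D; [exact: V_m2|exact: V_mem].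
move=> x /sp; apply: V_sub => y; rewrite mem inE => /orP[/eqP ->|ys]; apply: sub12 => //.
exact: V_mem.
Qed.

(* The factor h vanishes at the other points of the fibre of zs through the point M. *)
Lemma separating zs : zs `in` M -> indep kb (map p zs) -> intg zs ->
 exists h, [/\ B h, M (1 - h) & forall R, vr R -> kb `<=` R -> (forall b, B b -> R (p b)) ->
  (forall x, x \in zs -> maxid R (p x)) -> ~ maxid R (p h) -> forall x, M x -> maxid R (p x)].
Proof.
move=> zM iz zi; have OEM x : M x -> OE x by move=> /(prime_sub hM)/BOE.
have hA := gen_subring kb (map p zs); have [J [hJ J1 rJ zJ]] := origin hkb iz.
have kkb := ac_sub hkb.
have kmax R c : vr R -> kb `<=` R -> kb c -> maxid R c -> c = 0.
 move=> hv kR kc mc; apply: contrapT => /eqP c0; exact: (kunit hkb hv kR kc c0).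
have JR R : vr R -> kb `<=` R -> (forall x, x \in zs -> maxid R (p x)) -> J `<=` maxid R.
 move=> hv kR zR j Jj; have hmR := maxid_ideal hv; have hRs := vr_sub hv.
 have AR : gen kb (map p zs) `<=` R by apply: gen_min => // _ /mapP[x /zR + ->]; exact: maxid_sub.
 have hJR : ideal (gen kb (map p zs)) (J `&` maxid R).
  split=> [x []||x y [? ?] [? ?]|a x Aa [? ?]]; first by move/(ideal_sub hJ).
  - by split; member.
  - by split; member.
  - by split; member.
 have [|c kc [c1 c2]] := gen_rational kkb hJR _ (ideal_sub hJ Jj).
  by move=> _ /mapP[x xz ->]; split; [apply: zJ; exact: map_f|member].
 suff c0 : c = 0 by rewrite c0 subr0 in c2.
 apply: contrapT => /eqP c0; apply: J1; rewrite -(mulVf c0); apply: (idealM hJ).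
  member.
 by have := idealB hA hJ Jj c1; rewrite subKr.
(* On the fibre over 0 the integral equation of x over k[zs] has constant coefficients. Written as
   x^a Q'(x) = 0 with Q'(0) = c nonzero, it shows that x vanishes wherever Q'(x) does not. The
   product of the Q'(x) / c over all x in l is the h sought. *)
have one x : x \in l -> exists a h c, [/\ B h, k c, c != 0, M (h - c) &
  forall R, vr R -> kb `<=` R -> (forall b, B b -> R (p b)) ->
  (forall x, x \in zs -> maxid R (p x)) -> maxid R (p (x ^+ a * h))].
 move=> xl; have Bx : B x by exact: gen_mem.
 have [P [hP mP /rootP rP]] : exists P, [/\ polyin (gen kb (map p zs)) P, P \is monic & root P (p x)].
  apply: integral_of_vr => // R hv hR; apply: (zi R) => //; first member.
  by move=> z zz; apply: hR; apply: gen_mem; exact: map_f.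
 have /choice[f hf] : forall j, exists c, k c /\ J (P`_j - p c).
  by move=> j; have [_ [c kc ->] hc] := rJ _ (hP j); exists c.
 pose n := (size P).-1; have sP : size P = n.+1 by rewrite prednK // size_poly_gt0 monic_neq0.
 pose Q := 'X^n + \poly_(j < n) f j.
 have sg : (size (\poly_(j < n) f j)%R < size ('X^n : {poly F}))%N by rewrite size_polyXn ltnS.
 have Q0 : Q != 0 by rewrite -size_poly_eq0 size_polyDl // size_polyXn.
 have hQ : polyin k Q.
  apply: polyinD => //; first member.
  by move=> j; rewrite coef_poly; case: ifP => _; [case: (hf j)|member].
 have [a [Q' [hQ' _ c0 EQ]]] := polyX_factor ks hQ Q0.
 have hQB := sub_polyin kB hQ'.
 exists a, Q'.[x], Q'`_0; split=> //; [member| |].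
  have -> : Q'.[x] - Q'`_0 = (\poly_(j < (size Q').-1) Q'`_j.+1).[x] * x.
   rewrite -{1}(_ : (\poly_(j < (size Q').-1) Q'`_j.+1) * 'X + (Q'`_0)%:P = Q').
    by rewrite hornerMXaddC addrK.
   apply/polyP => -[|j]; rewrite coefD coefMX coefC ?add0r //= addr0 coef_poly.
   by case: ltnP => // h; rewrite nth_default; move: h; case: (size Q').
  apply: (prime_mul hM); last member.
  by apply: (horner_in hB) => // j; rewrite coef_poly; case: ifP => _ //; member.
 move=> R hv kR BR zR; have hmR := maxid_ideal hv.
 have -> : x ^+ a * Q'.[x] = Q.[x] by rewrite EQ hornerM hornerXn mulrC.
 rewrite hornerD hornerXn horner_poly.
 have Ox : OE x := BOE Bx.
 have fO (j : 'I_n) : OE (f j * x ^+ j).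
  by apply: (subring_mul (proj1 hOE)); [apply: kOE; case: (hf j)|member].
 have [h1 h2] := @pi_sum _ D _ (index_enum 'I_n) (fun j => f j * x ^+ j) (fun j _ => fO j).
 rewrite pD ?pX //; last member.
 have E1 : p x ^+ n + \sum_(i < n) P`_i * p x ^+ i = 0.
  by move: rP; rewrite horner_coef sP big_ord_recr -lead_coefE (monicP mP) mul1r addrC.
 rewrite h2 (_ : p x ^+ n = - \sum_(i < n) P`_i * p x ^+ i); last first.
  by apply/eqP; rewrite -addr_eq0 E1.
 rewrite addrC -sumrB.
 apply: (ideal_sum hmR) => j _ _; have [kf Jf] := hf j.
 rewrite pM ?pX //; [|member|member].
 rewrite -mulrBl mulrC; apply: (idealM hmR); first member.
 by rewrite -opprB; apply: (idealN (vr_sub hv) hmR); apply: JR.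
have [h [Bh Mh hh]] : exists h, [/\ B h, M (1 - h) & forall R, vr R -> kb `<=` R ->
  (forall b, B b -> R (p b)) -> (forall x, x \in zs -> maxid R (p x)) -> ~ maxid R (p h) ->
  forall x, x \in l -> maxid R (p x)].
 suff aux : forall l' : seq F, (forall x, x \in l' -> x \in l) -> exists h, [/\ B h, M (1 - h) & forall R, vr R -> kb `<=` R ->
   (forall b, B b -> R (p b)) -> (forall x, x \in zs -> maxid R (p x)) -> ~ maxid R (p h) ->
   forall x, x \in l' -> maxid R (p x)] by exact: aux.
 elim=> [|x l' IH] sl.
  by exists 1; rewrite subrr; split=> //; member.
 have [h [Bh Mh hh]] := IH (fun y yl => sl y (@mem_behead _ (x :: l') y yl)).
 have [a [g [c [Bg kc c0 Mg hg]]]] := one x (sl x (mem_head _ _)).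
 have kc1 : k c^-1 by member.
 have Bcg : B (c^-1 * g) by member.
 exists (h * (c^-1 * g)); split; first member.
  have -> : 1 - h * (c^-1 * g) = (1 - h) - (h * c^-1) * (g - c) by field.
  member.
 move=> R hv kR BR zR nR; have hRs := vr_sub hv.
 have [nh ng] : ~ maxid R (p h) /\ ~ maxid R (p g).
  split=> hmm; apply: nR; rewrite pM; try exact: BOE.
   by rewrite mulrC; apply: maxidM; member.
  by rewrite [p (c^-1 * g)]pM; [|member|member]; rewrite mulrA; apply: maxidM; member.
 move=> y /in_consP[->|]; last exact: hh.
 have Bx : B x by apply: gen_mem; apply: sl; exact: mem_head.
 have := hg R hv kR BR zR; rewrite pM ?pX; [|member|member|member].
 have Rx := BR x Bx; move=> hxg; case: (vr_prime hv (subringX a hRs Rx) (BR g Bg) hxg); last by move/ng.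
 exact: maxid_exp.
exists h; split=> // R hv kR BR zR nR x Mx; have lR := hh R hv kR BR zR nR.
have hmR := maxid_ideal hv; have hRs := vr_sub hv.
have hJR : ideal B [set y | M y /\ maxid R (p y)].
 split=> [y []||y z [My my] [Mz mz]|b y Bb [My my]]; first by move/(prime_sub hM).
 - by split; [member|exact: maxid0].
 - by split; [member|rewrite pD; [exact: (idealD hmR)|member|member]].
 - split; first member.
  by rewrite pM; member.
have [|c kc [c1 c2]] := gen_rational ks hJR _ (prime_sub hM Mx); first by move=> y yl; split; member.
have c0 : c = 0 by apply: kM; have := idealB hB hMi Mx c1; rewrite subKr.
by rewrite c0 subr0 in c2.
Qed.

(* Over the polynomial ring k[zs, theta] the point M of the divisor E is isolated in its fibre and
  unramified, so by Nakayama's lemma the local ring of E at M is that of a hypersurface G = 0. *)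
Theorem principal_at_regular : regular_local O ->
 exists g, [/\ E g, g != 0 & forall x, E x -> exists2 c, O c & x = g * c].
Proof.
move=> hreg; have OEM x : M x -> OE x by move=> /(prime_sub hM)/BOE.
have [zs [u [zM Mu sp iz zi]]] := parameters hreg.
have [h [Bh Mh hh]] := separating zM iz zi.
have Bu := prime_sub hM Mu.
(* As h is congruent to 1 modulo M, th is congruent to u modulo m^2. Where h vanishes th equals 1,
   so the zeros of zs and th avoid the other points of the fibre. *)
pose th := u * h + (1 - h) ^+ 2.
have Mth : M th.
 apply: (prime_add hM); first member.
 by rewrite expr2; member.
have Bth := prime_sub hM Mth.
pose w := th :: zs.
have wM x : x \in w -> M x by case/in_consP=> [->|/zM].
have spw : spans w.
 move=> x /sp; apply: V_sub => y /in_consP[->|yz]; last first.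
  by apply: V_mem; rewrite inE yz orbT.
 have -> : u = th + (u * (1 - h) - (1 - h) * (1 - h)) by rewrite /th; ring.
 apply: V_D; first by apply: V_mem; rewrite mem_head.
 by apply: V_m2; apply: (idealB hO' hm2); apply: m2M; member.
have fibre R : vr R -> kb `<=` R -> (forall b, B b -> R (p b)) ->
  (forall x, x \in w -> maxid R (p x)) -> forall x, M x -> maxid R (p x).
 move=> hv kR BR wR; have hRs := vr_sub hv; have hmR := maxid_ideal hv.
 apply: (hh R) => // [x xz|mh]; first by apply: wR; rewrite inE xz orbT.
 apply: (maxid_proper hRs); have h1 : maxid R (p th) by apply: wR; rewrite mem_head.
 have Bh1 : B (1 - h) by member.
 have E1 : p th = p u * p h + (1 - p h) * (1 - p h).
  rewrite /th expr2 pD ?pM ?pB //; try exact: BOE; try exact: (BOE (subring_one hB)).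
  - member.
  - member.
 have -> : 1 = p th - (p u - (1 - p h) - 1) * p h by rewrite E1; ring.
 apply: (idealB hRs hmR) => //; apply: (idealM hmR) => //.
 apply: (subring_sub hRs); last member.
 apply: (subring_sub hRs); first member.
 member.
(* J = (w) + E is the maximal ideal M. *)
pose J := [set x | B x /\ exists2 y, lin B w y & E (x - y)].
have rB := subring_rsub hB; have hEi := prime_ideal_ideal hE.
have wB x : x \in w -> B x by move=> /wM/(prime_sub hM).
have linB y : lin B w y -> B y.
 move=> [c hc ->]; apply: subring_sum => // i _ _; apply: (subring_mul hB) => //.
 by apply: wB; rewrite mem_nth.
have hJ : ideal B J.
 split; [by move=> x []| | |].
 - by split; [member|exists 0; [exact: lin0|member]].
 - move=> x y [Bx [a ha ea]] [By [b hb eb]]; split; first member.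
  by exists (a + b); [exact: linD|rewrite opprD addrACA; member].
 - move=> c x Bc [Bx [a ha ea]]; split; first member.
  by exists (c * a); [exact: linM|rewrite -mulrBr; member].
have wJ x : x \in w -> J x.
 move=> xw; split; first member.
 by exists x; [exact: lin_mem|rewrite subrr; member].
have EJ : E `<=` J.
 by move=> x Ex; split; [member|exists 0; [exact: lin0|rewrite subr0]].
(* Otherwise some valuation ring of the residue field of E that contains B/E is positive on s and on
   J. By [fibre] it is positive on M, hence on the nonzero constant congruent to s. *)
have unitJ s : B s -> ~ M s -> exists2 b, B b & J (1 - b * s).
 move=> Bs ns; apply: contrapT => nb.
 pose Bb := [set v | exists2 b, B b & v = p b].
 have hBb : subring_set Bb.
  split; first by exists 1; [member|].
  + by move=> _ _ [a Ba ->] [b Bb' ->]; exists (a - b); [member|rewrite pB //; member].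
  + by move=> _ _ [a Ba ->] [b Bb' ->]; exists (a * b); [member|rewrite pM //; member].
 pose I := [set v | exists b j, [/\ B b, J j & v = p (b * s + j)]].
 have Bbj b j : B b -> J j -> B (b * s + j).
  by move=> Bb' Jj; member.
 have [||R [hv BR IR]] := @exists_vr _ Bb I hBb.
 - split.
  + by move=> _ [b [j [Bb' Jj ->]]]; exists (b * s + j) => //; member.
  + by exists 0, 0; rewrite mul0r addr0; split=> //; member.
  + move=> _ _ [b [j [Bb' Jj ->]]] [c [i [Bc Ji ->]]]; exists (b + c), (j + i).
   split; [member|member|].
   by rewrite -pD; [congr p; ring|member|member].
  + move=> _ _ [a Ba ->] [b [j [Bb' Jj ->]]]; exists (a * b), (a * j).
   split; [member|member|].
   by rewrite -pM; [congr p; ring|member|member].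
 - move=> [b [j [Bb' Jj E1]]]; apply: nb; exists b => //.
  have E2 : E (1 - (b * s + j)).
   apply/(loc_max_trace hB hE).
    member.
   apply/(pi_max hOE); first member.
   by rewrite pB ?pi1 ?E1 ?subrr //; member.
  have -> : 1 - b * s = (1 - (b * s + j)) + j by ring.
  member.
 have BR' b : B b -> R (p b) by move=> Bb'; apply: BR; exists b.
 have kR : kb `<=` R by move=> _ [c kc ->]; member.
 have JR j : J j -> maxid R (p j).
  move=> Jj; apply: IR; exists 0, j; rewrite mul0r add0r; split=> //; member.
 have MR := fibre R hv kR BR' (fun x xw => JR x (wJ x xw)).
 have [c kc hc] := ratM Bs.
 have c0 : c != 0 by apply: contra_notN ns => /eqP E0; move: hc; rewrite E0 subr0.
 have ms : maxid R (p s).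
  by apply: IR; exists 1, 0; rewrite mul1r addr0; split=> //; member.
 have mc : maxid R (p c).
  have -> : p c = p s - p (s - c) by rewrite pB; [ring|member|member].
  member.
 have ic : B c^-1 by member.
 apply: (maxid_proper (vr_sub hv)); rewrite -(pi1 D) -(mulVf c0) pM; [|member|member].
 by apply: maxidM; member.
(* The list w spans m/m^2; the denominator s introduced by the localization is inverted modulo J by
   [unitJ]. Nakayama's lemma then upgrades M = J + M^2 to M = J. *)
have MJ2 x : M x -> exists2 y, ipow B M 2 y & J (x - y).
 move=> Mx; have [y [c hc Ey] my] := spw _ (Mm Mx).
 have Jy : J y.
  rewrite Ey.
  apply: (ideal_sum hJ) => i _ _; apply: (idealM hJ); first exact: kB.
  by apply: wJ; rewrite mem_nth.
 have [s [Bs ns hs]] := ipow_loc hB hM my; have [b Bb Jb] := unitJ s Bs ns.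
 exists (b * (s * (x - y))); first member.
 have -> : x - b * (s * (x - y)) = (x - y) * (1 - b * s) + y by ring.
 apply: (idealD hJ) => //; apply: (idealM hJ) => //.
 member.
have MJ : M `<=` J.
 have [s sM Ms] := noeth_gen (s := l) hk (ideal_rideal hMi).
 have hJm : submod B J by split; [member|exact: idealD hJ|exact: idealM hJ].
 have [x xs|e Me he] := nakayama hB hMi hJm (s := s).
  have [y [t [ht ->]] Jy] := MJ2 x (sM x xs); exists (\sum_(q <- t) q.1 * q.2) => //.
  rewrite big_seq; apply: big_ind => [|v1 v2|q qt].
  - by exists (fun=> 0); [move=> i; exact: prime_zero hM|rewrite big1 // => i _; rewrite mul0r].
  - exact: (linI_D hMi).
  - have [h1 /(ipow1 _ hB hMi)/Ms[c hc ->]] := ht q qt.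
   exists (fun i => q.1 * c i) => [i|]; first by rewrite mulrC; exact: (prime_mul hM).
   by rewrite mulr_sumr; apply: eq_bigr => i _; rewrite mulrA.
 have nMe : ~ M (1 - e).
  move=> h1; apply: (prime_proper hM); rewrite -[1](subrK e); member.
 have Be : B (1 - e) by member.
 have [b Bb Jb] := unitJ _ Be nMe.
 have sJ x : x \in s -> J x.
  move=> xs; have -> : x = x * (1 - b * (1 - e)) + b * ((1 - e) * x) by ring.
  apply: (idealD hJ); apply: (idealM hJ) => //; [exact: prime_sub (sM x xs)|member].
 by move=> x /Ms; apply: lin_min => //; exact: ideal_rideal.
have pz : forall x, E x -> p x = 0.
 move=> x Ex; apply/(pi_max hOE); first member.
 by apply/(loc_max_trace hB hE); member.
have pE : forall x, B x -> p x = 0 -> E x.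
 by move=> x Bx /(pi_max hOE (BOE Bx))/(loc_max_trace hB hE Bx).
have wO x : x \in w -> OE x by move=> /wM/OEM.
have zO x : x \in zs -> OE x by move=> /zM/OEM.
pose Q := gen k w; pose P' := gen kb (map p w).
have hQ : subring_set Q := gen_subring k w; have hP' : subring_set P' := gen_subring kb (map p w).
have QB : Q `<=` B by apply: gen_min.
have PE : P' = [set v | exists2 a, Q a & v = p a] by exact: gen_pi.
have rP := subring_rsub hP'.
have kP : kb `<=` P' := @gen_base _ _ _.
have [t Bt tB] : exists2 t, (forall b, B b -> lin P' t (p b)) & forall v, v \in t -> exists2 b, B b & v = p b.
 have [x /mapP[y yl ->]|t ht tB] := @finite_module _ P' (map p l) hP'.
  apply: integral_of_vr => // R hv hR; apply: (zi R) => //; last exact: gen_mem.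
   member.
  by move=> z zz; apply: hR; apply: gen_mem; apply: map_f; rewrite inE zz orbT.
 exists t => [b Bb|v /tB].
  apply: ht; have : gen kb (map p l) (p b).
   by rewrite (gen_pi hOE kOE) => [|x xl]; [exists b|member].
  by apply: gen_min => [|c kc|x xl]; [member|member|exact: gen_mem].
 apply: (gen_min (C := [set v | exists2 b, B b & v = p b])).
 - split; first by exists 1; [member|].
  + by move=> _ _ [a Ba ->] [b Bb ->]; exists (a - b); [member|rewrite pB //; member].
  + by move=> _ _ [a Ba ->] [b Bb ->]; exists (a * b); [member|rewrite pM //; member].
 - by rewrite PE => _ [a Qa ->]; exists a => //; member.
 - by move=> _ /mapP[x xl ->]; exists x => //; exact: gen_mem.
pose I0 := lin P' (map p w).
have hI0 : ideal P' I0.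
 by apply: rideal_ideal; apply: lin_ideal => // x xw; exact: gen_mem.
have plin y : lin B w y -> exists2 c : nat -> F, (forall i, B (c i)) & p y = \sum_(i < size w) p (c i) * p w`_i.
 move=> [c hc ->]; exists c => //.
 have cO i : OE (c i * w`_i).
  apply: (subring_mul (proj1 hOE)); first exact: BOE.
  have [hi|hi] := ltnP i (size w); first by apply: wO; exact: mem_nth.
  by rewrite nth_default; member.
 have [_ ->] := @pi_sum _ D _ (index_enum 'I_(size w)) (fun i => c i * w`_i) (fun i _ => cO i).
 by apply: eq_bigr => i _; rewrite pM //; [exact: BOE|apply: wO; exact: mem_nth].
have Mlin x : M x -> exists2 c : nat -> F, (forall i, B (c i)) & p x = \sum_(i < size w) p (c i) * p w`_i.
 move=> Mx; have [Bx [y ly Exy]] := MJ _ Mx; have [c hc E1] := plin y ly; exists c => //.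
 by rewrite -[x](subrK y) pD ?(pz _ Exy) ?add0r; member.
(* B/E is a finite module over P', and B/E = P' + (w) B/E because constants and w account for k + M.
   By Nakayama's lemma 1 - e0 carries B/E into P': near the origin B/E and P' agree. *)
have [e0 I0e he0] : exists2 e0, I0 e0 & forall b, B b -> P' ((1 - e0) * p b).
 have hPm : submod P' P'.
  by split; [member|move=> x y hx hy; member|exact: (subring_mul hP')].
 have [v vt|e Ie he] := nakayama hP' hI0 hPm (s := t).
  have [b Bb ->] := tB v vt; have [c kc hc] := ratM Bb; have [d hd E1] := Mlin _ hc.
  exists (p (b - c)); last first.
   by rewrite pB; [rewrite subKr; member|member|member].
  rewrite E1; apply: big_ind => [|x y|i _].
  - by exists (fun=> 0); [move=> i; member|rewrite big1 // => i _; rewrite mul0r].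
  - exact: (linI_D hI0).
  - have [a ha ->] := Bt _ (hd i); exists (fun j => a j * p w`_i) => [j|].
    apply: (idealM hI0) => //; apply: lin_mem => //; apply: map_f; exact: mem_nth.
   by rewrite mulr_suml; apply: eq_bigr => j _; rewrite mulrAC.
 exists e => // b Bb; have [c hc ->] := Bt b Bb; rewrite mulr_sumr; apply: subring_sum => // i _ _.
 by rewrite mulrCA; apply: (subring_mul hP') => //; apply: he; exact: mem_nth.
pose A0 := gen kb (map p zs); have hA0 : subring_set A0 := gen_subring kb (map p zs).
(* The hypersurface: P' is the polynomial ring on zs with th adjoined, and G is the minimal
   polynomial of th. Its lift, evaluated at th, is the generator g. *)
have [G [hG mG rG minG]] : exists m, [/\ polyin A0 m, m \is monic, root m (p th) &
  forall q, polyin A0 q -> root q (p th) -> exists2 q', polyin A0 q' & q = m * q'].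
 apply: min_poly => //; first exact: cic_gen.
 move=> R hv hR; apply: (zi R) => //; first by move=> c kc; apply: hR; exact: gen_base.
 by move=> z zz; apply: hR; apply: gen_mem; exact: map_f.
have gz := gen_subring k zs; have gzO : gen k zs `<=` OE by apply: gen_min; member.
have A0E : A0 = [set v | exists2 a, gen k zs a & v = p a] by exact: gen_pi.
have [G' hG' EG] : exists2 q', polyin (gen k zs) q' & map_poly p q' = G.
 by apply: pi_lift => //; rewrite -A0E.
have [_ inj] := (indep_pi hOE hk kOE zO).2 iz.
pose g := G'.[th].
have thO : OE th by member.
have gB : gen k zs `<=` B by apply: gen_min => // x /zM/(prime_sub hM).
have Bg : B g by exact: (horner_in hB (sub_polyin gB hG') Bth).
have Eg : E g.
 apply: pE => //; have [-> _] := pi_horner hOE (sub_polyin gzO hG') thO.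
 by rewrite EG; apply/rootP.
(* An element of k[w] that vanishes modulo E is a polynomial in th whose residue is divisible by G;
   the quotient lifts, because k[zs] embeds into the residue field. *)
have keyQ q : Q q -> p q = 0 -> exists2 c, Q c & q = g * c.
 rewrite /Q gen_cons => -[r hr ->]; have [-> E2] := pi_horner hOE (sub_polyin gzO hr) thO => /rootP rr.
 have [|q1 hq1 E1] := minG (map_poly p r) _ rr.
  by move=> i; rewrite A0E; exists r`_i.
 have [|q' hq' Eq'] := pi_lift (h := hOE) (q := q1) gzO gz; first by rewrite -A0E.
 exists q'.[th]; first by exists q'.
 rewrite -hornerM; congr (_.[_]); apply/eqP; rewrite -subr_eq0; apply/eqP/polyP => i; rewrite coef0.
 have hGq : polyin (gen k zs) (G' * q') by member.
 apply: inj; first by rewrite coefB; apply: (subring_sub gz).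
 have c1 : OE r`_i by exact: gzO.
 have c2 : OE (G' * q')`_i by exact: gzO.
 rewrite coefB; apply/(pi_max hOE); first member.
 rewrite pB // -E2 E1 coefM coefM.
 have fO (j : 'I_i.+1) : OE (G'`_j * q'`_(i - j)) by apply: (subring_mul (proj1 hOE)); exact: gzO.
 have [_ ->] := @pi_sum _ D _ (index_enum 'I_i.+1) (fun j => G'`_j * q'`_(i - j)) (fun j _ => fO j).
 apply/eqP; rewrite subr_eq0; apply/eqP; apply: eq_bigr => j _.
 have [_ h1] := pi_horner hOE (sub_polyin gzO hG') thO; have [_ h2] := pi_horner hOE (sub_polyin gzO hq') thO.
 by rewrite pM; [rewrite -EG -Eq' h1 h2|exact: gzO|exact: gzO].
pose Iw := lin Q w; have rQ := subring_rsub hQ.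
have hIw : ideal Q Iw by apply: rideal_ideal; apply: lin_ideal => // x; exact: gen_mem.
have QO : Q `<=` O by move=> x /QB/BO.
have IwM : Iw `<=` M.
 move=> _ [c hc ->]; apply: (ideal_sum hMi) => i _ _; apply: (prime_mul hM); first exact: QB.
 by apply: wM; exact: mem_nth.
have Iwm : Iw `<=` maxid O by move=> x /IwM/Mm.
have kIw y : lin k w y -> Iw y by move=> [c hc ->]; exists c => // i; apply: gen_base.
(* Elements of O are approximated by elements of k[w] to any order, since constants and w generate O
   modulo m^2. *)
have ap1 n : forall x, ipow O (maxid O) n x ->
  exists2 q, ipow Q Iw n q & ipow O (maxid O) n.+1 (x - q).
 elim: n => [|n IH] x.
  move=> Ox; have [c kc hc] := rational_O Ox; exists c; first exact: gen_base.
  exact/(ipow1 _ hO' hm).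
 move=> [s [hs ->]]; elim: s hs => [|v s IHs] hs.
  by exists 0; rewrite ?big_nil; member.
 have [|q1 h1 h2] := IHs; first by move=> z /mem_tail/hs.
 have [mv bv] := hs v (mem_head _ _); have [y ky my] := spw _ mv; have [q hq hq2] := IH _ bv.
 exists (y * q + q1); first by apply: (idealD (ipow_ideal n.+1 hQ hIw)) => //; apply: ipowM; member.
 rewrite big_cons.
 have -> : v.1 * v.2 + \sum_(j <- s) j.1 * j.2 - (y * q + q1) =
  (v.1 - y) * v.2 + y * (v.2 - q) + (\sum_(j <- s) j.1 * j.2 - q1) by ring.
 apply: (idealD (ipow_ideal n.+2 hO' hm)) => //; apply: (idealD (ipow_ideal n.+2 hO' hm)).
  exact: (ipow_add (i := 2) (j := n)).
 by apply: (ipowM (n := n.+1)); member.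
have ap n x : O x -> exists2 q, Q q & ipow O (maxid O) n (x - q).
 move=> Ox; elim: n => [|n [q Qq hq]]; first by exists 0; member.
 have [q' hq' h1] := ap1 n _ hq; exists (q + q'); last by rewrite opprD addrA.
 by apply: (subringD hQ) => //; exact: (ideal_sub (ipow_ideal n hQ hIw)).
(* Modulo E the power M^n is generated by degree n products of w, because M = J does so for n =
   1. *)
have pw n : forall x, ipow B M n x -> exists ss : seq (F * F),
  (forall q, q \in ss -> ipow Q Iw n q.1 /\ B q.2) /\ p x = \sum_(q <- ss) p q.1 * p q.2.
 elim: n => [|n IH] x.
  move=> Bx; exists [:: (1, x)]; rewrite big_seq1 mul1r; split=> // q; rewrite inE => /eqP -> /=.
  by split=> //; member.
 move=> [s [hs ->]]; elim: s hs => [|v s IHs] hs; first by exists [::]; rewrite !big_nil.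
 have [|ss [h1 h2]] := IHs; first by move=> z /mem_tail/hs.
 have [Mv bv] := hs v (mem_head _ _); have [c hc Ec] := Mlin _ Mv; have [ss' [g1 g2]] := IH _ bv.
 have Bv2 : B v.2 := ideal_sub (ipow_ideal n hB hMi) bv.
 have Bs : B (\sum_(j <- s) j.1 * j.2).
  apply: subring_sum => // j js _; have [Mj bj] := hs j (@mem_behead _ (v :: s) j js).
  by apply: (subring_mul hB); [exact: prime_sub Mj|exact: (ideal_sub (ipow_ideal n hB hMi))].
 exists ([seq (w`_i * q.1, c i * q.2) | i <- seq.iota 0 (size w), q <- ss'] ++ ss); split.
  move=> q /in_catP[/allpairsP[[i q'] [hi hq' ->]]|/h1//].
  rewrite mem_iota add0n in hi.
  have [q1 q2] := g1 _ hq'; split; last exact: (subring_mul hB).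
  by apply: ipowM => //; apply: lin_mem => //; apply: mem_nth.
 rewrite big_cons big_cat big_allpairs_dep -h2 pD; [|member|member].
 congr (_ + _); rewrite pM; [|member|member].
 rewrite Ec g2 mulr_suml -(big_mkord xpredT (fun i => p (c i) * p w`_i * _)) /index_iota subn0 big_seq [RHS]big_seq.
 apply: eq_bigr => i; rewrite mem_iota add0n => /andP[_ hi]; rewrite mulr_sumr big_seq [RHS]big_seq.
 apply: eq_bigr => q qs; have [q1 q2] := g1 q qs.
 have Qw : Q q.1 := ideal_sub (ipow_ideal n hQ hIw) q1.
 have [o1 o2] := (BOE (hc i), wO _ (mem_nth 0 hi)); have [o3 o4] := (BOE (QB _ Qw), BOE q2).
 rewrite (pM o2 o3) (pM o1 o4).
 by set a := p (c i); set b := p q.1; set e := p q.2; set f := p w`_i; rewrite [a * f]mulrC mulrACA.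
have lift1 v : P' v -> exists2 a, Q a & v = p a by rewrite PE.
have [e' Ie' Ee'] : exists2 e', Iw e' & e0 = p e'.
 have [c hc E1] := I0e; have /choice[d hd] : forall i, exists a, Q a /\ c i = p a.
  by move=> i; have [a Qa E2] := lift1 _ (hc i); exists a.
 exists (\sum_(i < size w) d i * w`_i); first by exists d => // i; case: (hd i).
 have dO (i : 'I_(size w)) : OE (d i * w`_i).
  apply: (subring_mul (proj1 hOE)); last by apply: wO; exact: mem_nth.
  by apply: BOE; apply: QB; case: (hd i).
 have [_ ->] := @pi_sum _ D _ (index_enum 'I_(size w)) (fun i => d i * w`_i) (fun i _ => dO i).
 rewrite E1 size_map; apply: eq_bigr => i _; rewrite (nth_map 0) // pM ?(proj2 (hd i)) //.
  by apply: BOE; apply: QB; case: (hd i).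
 by apply: wO; exact: mem_nth.
have Me' : M e' by member.
have Be' : B (1 - e') by member.
have pe' : p (1 - e') = 1 - e0.
 by rewrite pB ?Ee' //; member.
(* Let f be congruent to q in k[w] modulo m^n. After multiplication by s and by 1 - e0 the error f -
   q is represented modulo E by tau in (w)^n. Then si q + tau is an element of k[w] vanishing modulo
   E, a multiple of g by [keyQ], and si is a unit of O. *)
have hf f n : E f -> exists r c, [/\ ipow O (maxid O) n r, O c & f = r + g * c].
 move=> Ef; have Bf := prime_sub hE Ef; have [q Qq hr] := ap n f (BO Bf).
 have Bq := QB _ Qq; have Bfq : B (f - q) by member.
 have [s [Bs ns hs]] := ipow_loc hB hM hr; have [ss [h1 h2]] := pw n _ hs.
 have /(choice_in 0)[d hd] (q0 : F * F) : q0 \in ss -> exists a, Q a /\ (1 - e0) * p q0.2 = p a.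
  by move=> q0s; have [_ B2] := h1 _ q0s; have [a Qa Ea] := lift1 _ (he0 _ B2); exists a.
 pose tau := \sum_(q0 <- ss) q0.1 * d q0.
 have htau : ipow Q Iw n tau.
  apply: (ideal_sum (ipow_ideal n hQ hIw)) => q0 q0s _; rewrite mulrC.
  by apply: (idealM (ipow_ideal n hQ hIw)); [case: (hd q0 q0s)|case: (h1 q0 q0s)].
 have Qtau : Q tau := ideal_sub (ipow_ideal n hQ hIw) htau.
 have Etau : p tau = (1 - e0) * p (s * (f - q)).
  have tO q0 : q0 \in ss -> OE (q0.1 * d q0).
   move=> q0s; apply: BOE; apply: (subring_mul hB); apply: QB; last by case: (hd q0 q0s).
   by apply: (ideal_sub (ipow_ideal n hQ hIw)); case: (h1 q0 q0s).
  have [_ ->] := @pi_sum _ D _ ss (fun q0 => q0.1 * d q0) tO.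
  rewrite h2 mulr_sumr big_seq [RHS]big_seq; apply: eq_bigr => q0 q0s.
  have [Qd Ed] := hd q0 q0s; have [i1 _] := h1 q0 q0s.
  rewrite pM; [rewrite -Ed; ring| |member].
  by apply: BOE; apply: QB; exact: (ideal_sub (ipow_ideal n hQ hIw)).
 have [si Qsi Esi] := lift1 _ (he0 _ Bs); have Bsi := QB _ Qsi.
 have [||c Qc Ec] := keyQ (si * q + tau).
 - member.
 - have Oq := BOE Bq; have Of := BOE Bf; have Os := BOE Bs; have Osi := BOE Bsi.
  rewrite pD; [|member|member].
  by rewrite Etau !pM -?Esi ?pB // ?(pz _ Ef); [ring|member].
 have nsi : ~ M si.
  move=> Msi; have : M ((1 - e') * s).
   have -> : (1 - e') * s = si - (si - (1 - e') * s) by ring.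
   apply: (idealB hB hMi) => //; apply: EM; apply: pE; first member.
   rewrite pB ?pM ?pe' ?Esi ?subrr //; try exact: BOE.
   member.
  move=> /(prime_prime hM Be' Bs)[|//] h3; apply: (prime_proper hM).
  by rewrite -[1](subrK e'); member.
 have isi := loc_inv hB Bsi nsi; have si0 := notp_neq0 hM nsi.
 exists (f - q - si^-1 * tau), (si^-1 * c); split.
 - apply: (idealB hO' (ipow_ideal n hO' hm)) => //; apply: (idealM (ipow_ideal n hO' hm)) => //.
  exact: (ipow_sub QO Iwm).
 - member.
 - have -> : g * (si^-1 * c) = si^-1 * (g * c) by ring.
  by rewrite -Ec; field.
have fin f : E f -> exists2 c, O c & f = g * c.
 move=> Ef; have nO := noeth_loc hB hM (noeth_gen (s := l) hk).
 have [e [c [me Oc Ec]]] := krull_intersection hO' nO hm (BO Bg) (fun n => hf f n Ef).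
 have Oe : O (1 - e) by member.
 have ne : ~ maxid O (1 - e).
  by move=> h1; apply: (maxid_proper hO'); rewrite -[1](subrK e); member.
 have [e1 ie] := vr_unit Oe ne; exists (c / (1 - e)); first member.
 by rewrite mulrA -Ec; field.
exists g; split=> //; apply/eqP => g0.
have [[b Eb b0] _] := ht1_of_krull hB hE krE; have [c _ E1] := fin b Eb.
by move: b0; rewrite E1 g0 mul0r eqxx.
Qed.

End Factorial.

(** * Smooth varieties *)

Section LocalFacts.
Variable F : fieldType.
Implicit Types (B O R y : set F).
Local Notation vr := (@valuation_subring F).

Lemma dominates_max R O x : dominates R O -> O x -> maxid R x <-> maxid O x.
Proof. by move=> [OR ->] Ox; split=> [|[]]. Qed.

Lemma dominates_inv R O x : dominates R O -> O x -> x != 0 -> R x^-1 -> O x^-1.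
Proof.
move=> dR Ox x0 ix; have nm : ~ maxid O x by move=> /(dominates_max dR Ox); exact: (unit_notmax x0 ix).
by case: (vr_unit Ox nm).
Qed.

Lemma dominatesI R O : O `<=` R -> maxid O `<=` maxid R -> dominates R O.
Proof.
move=> OR mR; split=> //; apply/seteqP; split=> [x mx|x [mx Ox]]; first by split; member.
apply: contrapT => nx; have [x0 ix] := vr_unit Ox nx.
by apply: (unit_notmax x0 (OR _ ix)).
Qed.

Lemma local_vr O : local O -> exists2 R, vr R & dominates R O.
Proof.
move=> h; have [|R [hR OR mR]] := exists_vr (proj1 h) (local_ideal h); first exact: maxid_proper (proj1 h).
by exists R => //; exact: dominatesI.
Qed.

Lemma loc_mono B p q : prime_ideal B p -> prime_ideal B q -> subring_set B ->
 (localization B p `<=` localization B q <-> q `<=` p).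
Proof.
move=> hp hq hB; split=> [h b qb|h].
 have Bb := prime_sub hq qb; apply: contrapT => npb.
 have ib := h _ (loc_inv hB Bb npb); have b0 := notp_neq0 hp npb.
 have mb : maxid (localization B q) b by apply/(loc_max_trace hB hq).
 exact: (unit_notmax b0 ib).
by move=> _ [a [b [Ba Bb nb ->]]]; exists a, b; split=> // /h.
Qed.

Lemma rational_max k B p q : acsub k -> k `<=` B -> prime_ideal B p -> rational k B p -> prime_ideal B q ->
 p `<=` q -> q `<=` p.
Proof.
move=> hk kB hp rp hq pq x qx; have Bx := prime_sub hq qx.
have [c kc pc] := rp _ Bx; have [c0|c0] := eqVneq c 0; first by rewrite c0 subr0 in pc.
have qc : q c.
 have -> : c = x + (-1) * (x - c) by ring.
 member.
by case: (prime_proper hq); rewrite -(mulVf c0); member.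
Qed.

Lemma rational_kvr k O : acsub k -> local O -> k `<=` O -> rational k O (maxid O) ->
 exists2 R, kvr k R & dominates R O.
Proof.
move=> hk hO kO hr; have [|R [hR OR mR]] := exists_kvr hk kO (proj1 hO) (local_ideal hO) _ hr.
 exact: maxid_proper (proj1 hO).
by exists R => //; exact: dominatesI.
Qed.

End LocalFacts.

Section Spec.
Variables (M : fieldType) (k : set M) (A : set M) (G : seq M).
Hypotheses (hk : acsub k) (kA : k `<=` A) (hA : subring_set A) (GA : forall a, a \in G -> A a)
 (hG : forall R, valuation_subring R -> k `<=` R -> G `in` R -> A `<=` R).

Definition ctr (R : set M) : set M := localization A (maxid R `&` A).

Lemma spec_ctr y R : spec A y -> dominates R y -> y = ctr R.
Proof.
move=> [p hp ->] d; congr localization; apply/seteqP; split=> [x px|x [mx Ax]].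
 have Ax := prime_sub hp px; split=> //; apply/(dominates_max d (loc_base hA hp Ax)); exact/(loc_max_trace hA hp).
by apply/(loc_max_trace hA hp Ax); apply/(dominates_max d); member.
Qed.

Lemma ctr_rational R : kvr k R -> A `<=` R -> rational k A (maxid R `&` A).
Proof.
move=> hR AR a Aa; have [c kc hc] := kvr_rat hR (AR a Aa); exists c => //; split=> //.
member.
Qed.

Lemma ctr_closed R : kvr k R -> A `<=` R -> closed_point (spec A) (ctr R).
Proof.
move=> hR AR; have hq := maxid_prime (kvr_vr hR) hA AR; split=> [|_ [p hp ->]]; first by exists (maxid R `&` A).
move=> /(loc_mono hp hq hA) qp; congr localization; apply/seteqP; split=> //.
exact: (rational_max hk kA hq (ctr_rational hR AR)).
Qed.

(** A rational place inside a valuation ring dominating y has as its centre a specialization of y,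
    which is y itself since y is closed. *)
Lemma closed_ctr y : closed_point (spec A) y -> exists R, [/\ kvr k R, A `<=` R & dominates R y].
Proof.
move=> [[p hp Ey] cy]; have yA : A `<=` y by rewrite Ey; member.
have [R0 h0 d0] : exists2 R, valuation_subring R & dominates R y by apply: local_vr; rewrite Ey; member.
have [R [hR RR mR lR]] := kplace hk h0 (fun c kc => proj1 d0 _ (yA _ (kA kc))) (fun a Ga => proj1 d0 _ (yA _ (GA Ga))).
have vR := kvr_vr hR; have AR := hG vR (kvr_k hR) lR; exists R; split=> //.
have -> : y = ctr R; last exact: center_dom.
apply/esym/cy; first by exists (maxid R `&` A) => //; exact: maxid_prime.
rewrite Ey; apply/(loc_mono (maxid_prime vR hA AR) hp hA) => x px; have Ax := prime_sub hp px; split=> //.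
by apply: mR; apply/(dominates_max d0 (yA _ Ax)); rewrite Ey; exact/(loc_max_trace hA hp Ax).
Qed.

End Spec.

Section Order.
Variables (F : fieldType) (E : set F).
Hypotheses (hE : local E) (nE : noeth E) (kE : krull_dim E 1) (rE : regular_local E)
 (fE : forall x : F, exists a b, [/\ E a, E b, b != 0 & x = a / b]).
Let hE' : subring_set E := proj1 hE.

Let chain_le d e : (d <= e)%N -> prime_chain E e -> prime_chain E d.
Proof.
move=> de [p [h1 h2]]; exists p; split=> i hi; [apply: h1|apply: h2]; lia.
Qed.

Lemma uniformizer : exists t, [/\ maxid E t, t != 0 & forall x, maxid E x -> E (x / t)].
Proof.
have [d hd [t [mt ht]]] := rE.
have d1 : d = 1%N.
 have [|h] := leqP d 1; last by case: (proj2 kE); apply: chain_le (proj1 hd).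
 case: d hd t mt ht => [|[|d]] // hd _ _ _ _; by case: (proj2 hd); exact: (proj1 kE).
subst d; exists (t ord0).
have mE x : maxid E x -> exists2 a, E a & x = a * t ord0.
 by move=> /ht[a [Ea ->]]; exists (a ord0); rewrite ?big_ord1.
have t0 : t ord0 != 0.
 apply/eqP => t0; have [p [h1 h2]] := proj1 kE; have [s01 ns] := h2 0%N isT; apply: ns => x px.
 have [hp0 hp1] := (h1 0%N isT, h1 1%N isT).
 have : maxid E x.
  apply: contrapT => nx; have Ex := prime_sub hp1 px; have [x0 ix] := vr_unit Ex nx.
  by apply: (prime_proper hp1); rewrite -(mulVf x0); member.
 by move=> /mE[a _ ->]; rewrite t0 mulr0; member.
by split=> // x /mE[a Ea ->]; rewrite mulfK.
Qed.

Lemma unitE u : E u -> ~ maxid E u -> u != 0 /\ E u^-1. Proof. exact: vr_unit. Qed.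

Lemma unit_expz u (i : int) : E u -> E u^-1 -> E (u ^ i).
Proof. by move=> Eu Ei; case: i => n; [exact: (subringX n hE' Eu)|rewrite NegzE -exprz_inv; exact: (subringX n.+1 hE' Ei)]. Qed.

(** The ideals generated by f / t^n increase with n; at a maximal one the quotient is a unit. *)
Lemma ord_spec_integral f : f != 0 -> E f -> exists k : nat, ord_spec E f k%:Z.
Proof.
move=> f0 Ef; have [t [mt t0 ht]] := uniformizer; have rE' := subring_rsub hE'.
pose J n := [set x | exists2 c, E c & x = (f / t ^+ n) * c].
have hJ n : E (f / t ^+ n) -> rideal E (J n) by move/(principal_is_ideal hE')/ideal_rideal.
have [||Jm [n Efn ->] hm] := noeth_max (C := [set I | exists2 n, E (f / t ^+ n) & I = J n]) nE.
- by move=> _ [n h ->]; exact: hJ.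
- by exists (J 0%N), 0%N => //; rewrite divr1.
exists n; have tn : t ^+ n != 0 by rewrite expf_neq0.
suff nm : ~ maxid E (f / t ^+ n).
 have [u0 iu] := unitE Efn nm; exists t, (f / t ^+ n); split=> //.
 by split=> //; rewrite mulfVK.
move=> m1; have := ht _ m1; rewrite -mulrA -invfM -exprSr => E1.
have [|||c Ec] := hm (J n.+1) _ _ (f / t ^+ n.+1).
- by exists n.+1.
- move=> _ [c Ec ->]; exists (t * c); first member.
 by rewrite exprS; field; rewrite tn.
- by exists 1; [member|rewrite mulr1].
move=> h; have : 1 = c * t.
 apply: (mulfI (_ : f / t ^+ n.+1 != 0)); first by rewrite mulf_neq0 ?invr_neq0 ?expf_neq0.
 by rewrite {1}h exprS; field; rewrite tn.
move=> h1; apply: (maxid_proper hE'); rewrite h1; member.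
Qed.

Lemma ord_specM f g (i j : int) : ord_spec E f i -> ord_spec E g j -> ord_spec E (f * g) (i + j).
Proof.
move=> [t [u [mt ht Eu iu [t0 u0 ->]]]] [s [v [ms hs Ev iv [s0 v0 ->]]]].
have Ew : E (s / t) by exact: ht. have iw : E (s / t)^-1 by rewrite invf_div; exact: hs.
have w0 : s / t != 0 by rewrite mulf_neq0 ?invr_neq0.
have -> : s ^ j = (s / t) ^ j * t ^ j by rewrite -expfzMl mulfVK.
move: (s / t) Ew iw w0 => w Ew iw w0; exists t, (u * v * w ^ j); split=> //.
- by apply: (subring_mul hE'); [member|exact: unit_expz].
- by rewrite !invfM invr_expz; apply: (subring_mul hE'); [member|exact: unit_expz].
by split=> //; [rewrite !mulf_neq0 ?expfz_neq0|rewrite expfzDr //; ring].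
Qed.

Lemma ord_specV f (i : int) : ord_spec E f i -> ord_spec E f^-1 (- i).
Proof.
move=> [t [u [mt ht Eu iu [t0 u0 ->]]]]; exists t, u^-1; rewrite invrK; split=> //.
by split; rewrite ?invr_neq0 // invfM invr_expz.
Qed.

Lemma ord_spec_unit0 (i : int) : ord_spec E 1 i -> i = 0.
Proof.
move=> [t [u [mt ht Eu iu [t0 u0 h]]]].
have key (n : nat) v : E v -> 1 = v * t ^+ n.+1 -> False.
 move=> Ev h1; apply: (maxid_proper hE'); rewrite h1 exprS mulrCA mulrC.
 member.
case: i h => [[|n]|n] // h; first by case: (key _ _ Eu h).
case: (key n _ iu); apply: (mulfI u0); rewrite mulr1 mulVKf //.
by move: h; rewrite NegzE => /(congr1 (fun x => x * t ^+ n.+1)); rewrite mul1r mulfVK // expf_neq0.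
Qed.

Lemma ord_ex f : f != 0 -> ord_spec E f (ord E f).
Proof.
move=> f0; apply: (@xgetPex _ 0 [set k | ord_spec E f k]).
have [a [b [Ea Eb b0 fab]]] := fE f.
have a0 : a != 0 by apply: contra_neq f0 => a0; rewrite fab a0 mul0r.
have [i hi] := ord_spec_integral a0 Ea; have [j hj] := ord_spec_integral b0 Eb.
by exists (i%:Z - j%:Z); rewrite fab; apply: ord_specM => //; exact: ord_specV.
Qed.

Lemma ord_uniq f (i : int) : ord_spec E f i -> ord E f = i.
Proof.
move=> hi; have f0 : f != 0 by case: hi => t [u [_ _ _ _ [t0 u0 ->]]]; rewrite mulf_neq0 ?expfz_neq0.
have := ord_specM (ord_ex f0) (ord_specV hi); rewrite divff // => /ord_spec_unit0 /eqP.
by rewrite subr_eq0 => /eqP.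
Qed.

Lemma ordM f g : f != 0 -> g != 0 -> ord E (f * g) = ord E f + ord E g.
Proof. by move=> f0 g0; apply: ord_uniq; apply: ord_specM; exact: ord_ex. Qed.

Lemma ordV f : f != 0 -> ord E f^-1 = - ord E f.
Proof. by move=> f0; apply: ord_uniq; apply: ord_specV; exact: ord_ex. Qed.

Lemma ord1 : ord E 1 = 0.
Proof. by apply: ord_spec_unit0; apply: ord_ex; exact: oner_neq0. Qed.

Lemma ordX f n : f != 0 -> ord E (f ^+ n) = ord E f *+ n.
Proof. by move=> f0; elim: n => [|n IH]; rewrite ?ord1 // exprS ordM ?expf_neq0 // IH mulrS. Qed.

Lemma ordXz f (i : int) : f != 0 -> ord E (f ^ i) = ord E f * i.
Proof.
move=> f0; case: i => n; first by rewrite ordX // -mulr_natr natz.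
by rewrite NegzE ordV ?expf_neq0 // ordX // mulrN -mulr_natr natz.
Qed.

Lemma ord_ge0 f : f != 0 -> (0 <= ord E f) <-> E f.
Proof.
move=> f0; split=> [h|/(ord_spec_integral f0)[n /ord_uniq -> //]].
have [t [u [mt ht Eu iu [t0 u0 ->]]]] := ord_ex f0; case: (ord E f) h => // n _.
by apply: (subring_mul hE') => //; apply: (subringX n hE'); member.
Qed.

Lemma ord_gt0 f : f != 0 -> (0 < ord E f) <-> maxid E f.
Proof.
move=> f0; split=> [h|[Ef h]].
 have Ef : E f by apply/ord_ge0 => //; exact: ltW.
 split=> // -[_ /ord_ge0]; rewrite invr_neq0 // ordV // => /(_ isT); lia.
rewrite lt_neqAle andbC (proj2 (ord_ge0 f0)) //=; apply/eqP => o0; apply: h; split=> //.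
by apply/ord_ge0; rewrite ?invr_neq0 // ordV // -o0.
Qed.

End Order.

Section Model.
Variables (K : closedFieldType) (F : fieldType) (iota : {rmorphism K -> F}) (Y : set (set F)) (ss : seq (seq F)).
Local Notation vr := (@valuation_subring F).
Local Notation k := (range iota).
Implicit Types (y z E : set F).
Let hk : acsub k := acsub_range iota.

Record model : Prop := Model {
 m_frac : forall s, s \in ss -> fraction_field (gen k s);
 m_cover : forall y, Y y <-> exists2 s, s \in ss & spec (gen k s) y;
 m_sep : forall R y y', vr R -> Y y -> Y y' -> dominates R y -> dominates R y' -> y = y' }.
Hypothesis hM : model.

Lemma chartP y : Y y -> exists s p, [/\ s \in ss, prime_ideal (gen k s) p & y = localization (gen k s) p].
Proof. by move=> /(m_cover hM)[s hs [p hp ->]]; exists s, p. Qed.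

Lemma Y_local y : Y y -> local y.
Proof. by move=> /chartP[s [p [_ hp ->]]]; member. Qed.

Lemma Y_base y : Y y -> k `<=` y.
Proof.
move=> /chartP[s [p [_ hp ->]]] c kc; member.
Qed.

Lemma Y_frac y : Y y -> forall x, exists a b, [/\ y a, y b, b != 0 & x = a / b].
Proof.
move=> /chartP[s [p [hs hp ->]]] x; have [a [b [Ba Bb b0 E]]] := m_frac hM hs x.
by exists a, b; split=> //; member.
Qed.

Lemma Y_noeth y : Y y -> noeth y.
Proof.
move=> /chartP[s [p [hs hp ->]]]; apply: noeth_loc => //; [member|exact: noeth_gen].
Qed.

Lemma center_Y R s : vr R -> s \in ss -> gen k s `<=` R ->
 Y (localization (gen k s) (maxid R `&` gen k s)) /\
 dominates R (localization (gen k s) (maxid R `&` gen k s)).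
Proof.
move=> hR hs BR; have hB := gen_subring k s; split; last exact: center_dom.
by apply/(m_cover hM); exists s => //; exists (maxid R `&` gen k s) => //; exact: maxid_prime.
Qed.

(** A valuation ring dominating y contains the chart ring and has a centre in that chart, which is y
    by separatedness. *)
Lemma chart_of s y : s \in ss -> Y y -> gen k s `<=` y ->
 exists2 p, prime_ideal (gen k s) p & y = localization (gen k s) p.
Proof.
move=> hs hy By; have [R hR dR] := local_vr (Y_local hy).
have BR : gen k s `<=` R by move=> x /By; case: dR => h _; exact: h.
have [h1 h2] := center_Y hR hs BR; exists (maxid R `&` gen k s); first by apply: maxid_prime; member.
exact: (m_sep hM hR).
Qed.

Lemma Y_chart y : Y y -> exists2 s, s \in ss & gen k s `<=` y.
Proof.
move=> /(chartP)[s [p [hs hp ->]]]; exists s; member.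
Qed.

Lemma rational_of_closed y : closed_point Y y -> rational k y (maxid y).
Proof.
move=> [hy cy]; have [s [p [hs hp Ey]]] := chartP hy; have hB := gen_subring k s.
have [|R [hR _ dR]] := @closed_ctr _ k (gen k s) s hk (@gen_base _ _ _) hB (@gen_mem _ _ _)
  (fun R hR kR lR => gen_min (vr_sub hR) kR lR) y.
 by split=> [|y' hy' y'y]; [exists p|apply: cy => //; apply/(m_cover hM); exists s].
have yl := Y_local hy; have ky := Y_base hy.
move=> x yx; have [c kc hc] := kvr_rat hR (proj1 dR _ yx); exists c => //.
by apply/(dominates_max dR); member.
Qed.

Lemma closed_of_rational y : Y y -> rational k y (maxid y) -> closed_point Y y.
Proof.
move=> hy ry; split=> // y' hy' y'y; have [s [p [hs hp Ey']]] := chartP hy'; have hB := gen_subring k s.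
have By : gen k s `<=` y by move=> x Bx; apply: y'y; rewrite Ey'; member.
have [q hq Ey] := chart_of hs hy By; have [R hR dR] := rational_kvr hk (Y_local hy) (Y_base hy) ry.
have e : y = ctr (gen k s) R by apply: (spec_ctr hB) => //; exists q.
rewrite e; apply: (proj2 (ctr_closed hk (@gen_base _ _ _) hB hR (subset_trans By (proj1 dR)))); first by exists p.
by rewrite -e.
Qed.

Lemma center_closed (R y : set F) : kvr k R -> Y y -> dominates R y -> closed_point Y y.
Proof.
move=> hR hy dy; apply: closed_of_rational => // x yx; have [c kc hc] := kvr_rat hR (proj1 dy _ yx); exists c => //.
by apply/(dominates_max dy) => //; apply: (subring_sub (proj1 (Y_local hy)) yx); exact: Y_base.
Qed.

Lemma notsub_loc (B p q : set F) : subring_set B -> prime_ideal B p -> prime_ideal B q ->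
 ~ localization B p `<=` localization B q -> exists2 x, q x & ~ p x.
Proof.
move=> hB hp hq nE; apply: contrapT => h; apply: nE; apply/loc_mono => // x qx.
by apply: contrapT => px; apply: h; exists x.
Qed.

(** For each E in the chart whose closure misses y there is a function b in the prime of E that does
    not vanish at y. A rational place inside a valuation ring dominating y, chosen finite on the
    inverses of all these b, has the desired centre. *)
Lemma closed_below y (Es : seq (set F)) : Y y -> (forall E, E \in Es -> Y E /\ ~ y `<=` E) ->
 exists z, [/\ closed_point Y z, z `<=` y & forall E, E \in Es -> ~ z `<=` E].
Proof.
move=> hy hE; have [s [p [hs hp Ey]]] := chartP hy; have hB := gen_subring k s.
have By : gen k s `<=` y by rewrite Ey; member.
have [R hR dR] := local_vr (Y_local hy); have yR := proj1 dR.
have [l [ly hl]] : exists l : seq F, l `in` R /\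
  forall E, E \in Es -> gen k s `<=` E -> exists b, [/\ gen k s b, maxid E b, b != 0 & b^-1 \in l].
 elim: Es hE => [|E Es IH] hE; first by exists [::].
 have [l [h1 h2]] := IH (fun E' h => hE E' (@mem_behead _ (E :: Es) E' h)).
 have [hYE nE] := hE E (mem_head _ _).
 have [BE|nBE] := pselect (gen k s `<=` E); last first.
  by exists l; split=> // E' /in_consP[-> /nBE|/h2].
 have [q hq EE] := chart_of hs hYE BE.
 rewrite Ey EE in nE; have [b qb pb] := notsub_loc hB hp hq nE.
 have Bb := prime_sub hq qb; have b0 := notp_neq0 hp pb.
 have Rb : R b^-1 by apply: yR; rewrite Ey; member.
 exists (b^-1 :: l); split=> [x|E']; case/in_consP=> [-> //|].
 - exact: h1.
 - by move=> _; exists b; rewrite mem_head; split=> //; rewrite EE; apply/loc_max_trace.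
 - by move=> /h2 h /h[b' [h3 h4 h5 h6]]; exists b'; split=> //; rewrite inE h6 orbT.
have [R' [hR' R'R mR lR]] : exists R', [/\ kvr k R', R' `<=` R, maxid R `<=` maxid R' & s ++ l `in` R'].
 apply: kplace => // [c kc|x]; first member.
 by case/in_catP=> [xs|/ly //]; apply: yR; apply: By; exact: gen_mem.
have vR' := kvr_vr hR'.
have BR' : gen k s `<=` R'.
 by apply: gen_min => [||x xs]; [member|member|apply: lR; rewrite mem_cat xs].
have [hz dz] := center_Y vR' hs BR'; set z := localization _ _ in hz dz.
have zl := loc_local hB (maxid_prime vR' hB BR').
exists z; split=> [||E EEs zE].
- exact: (center_closed hR').
- rewrite Ey; apply/loc_mono => //; first exact: maxid_prime.
 move=> x px; have Bx := prime_sub hp px; split=> //; apply: mR.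
 by apply/(dominates_max dR (By _ Bx)); rewrite Ey; apply/(loc_max_trace hB hp Bx).
- have [hYE nE] := hE E EEs; have Bz : gen k s `<=` z by apply: loc_base => //; exact: maxid_prime.
 have BE : gen k s `<=` E by move=> x /Bz/zE.
 have [b [Bb mb b0 bl]] := hl E EEs BE; have [q hq EE] := chart_of hs hYE BE.
 have qb : q b by move: mb; rewrite EE => /(loc_max_trace hB hq Bb).
 have Ez : z = localization (gen k s) (maxid R' `&` gen k s) by [].
 move: zE; rewrite EE => /(loc_mono (maxid_prime vR' hB BR') hq hB)/(_ _ qb)[mb' _].
 by apply: (unit_notmax b0 _ mb'); apply: lR; rewrite mem_cat bl orbT.
Qed.

End Model.

Ltac point_local := match goal with
 | hM : model _ _ _, h : _ ?y |- local ?y => first [exact (Y_local hM h) | exact (Y_local hM (proj1 h))]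
 end.
Ltac member_hook ::= first [member_loc | lazymatch goal with
 | |- local _ => point_local
 | |- subring_set _ => apply: proj1; point_local
 | |- ideal _ (maxid _) => apply: local_ideal; point_local
 | |- maxid ?y _ => lazymatch goal with
  | _ : local y |- _ => fail
  | |- _ => have ? : local y by point_local
  end; member
 end].

Section QValFacts.
Variables (F : fieldType) (k : set F) (nu : F -> rat).
Hypotheses (hk : acsub k) (hq : qval k nu).

Lemma qval1 : nu 1 = 0.
Proof. by apply: (qvalk hq); [member|exact: oner_neq0]. Qed.

Lemma qvalV x : x != 0 -> nu x^-1 = - nu x.
Proof. by move=> x0; apply/eqP; rewrite -addr_eq0 -(qvalM hq) ?invr_neq0 // mulVf // qval1. Qed.

Lemma qvalX x n : x != 0 -> nu (x ^+ n) = nu x *+ n.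
Proof. by move=> x0; elim: n => [|n IH]; rewrite ?qval1 // exprS (qvalM hq) ?expf_neq0 // IH mulrS. Qed.

Lemma qvalXz x (i : int) : x != 0 -> nu (x ^ i) = nu x * i%:~R.
Proof.
move=> x0; case: i => n; first by rewrite qvalX // -mulr_natr.
by rewrite qvalV ?expf_neq0 // qvalX // mulrN -mulr_natr.
Qed.

Lemma qvalN x : x != 0 -> nu (- x) = nu x.
Proof.
move=> x0; rewrite -mulN1r (qvalM hq) ?oppr_eq0 ?oner_neq0 // (qvalk hq) ?add0r ?oppr_eq0 ?oner_neq0 //.
member.
Qed.

Lemma qval_vr : valuation_subring (valuation_ring nu).
Proof.
split; last first.
 by move=> x x0; case: (leP 0 (nu x)) => h; [left; right|right; right; rewrite qvalV // oppr_ge0 ltW].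
split; first by right; rewrite qval1.
- have VN y : valuation_ring nu y -> valuation_ring nu (- y).
  case=> [->|h]; first by left; rewrite oppr0.
  by have [->|y0] := eqVneq y 0; [left; rewrite oppr0|right; rewrite qvalN].
 move=> x y hx /VN; move: (- y) => z hz; have [x0|x0] := eqVneq x 0; first by rewrite x0 add0r.
 have [z0|z0] := eqVneq z 0; first by rewrite z0 addr0.
 case: hx hz => [/eqP|hx]; first by rewrite (negbTE x0).
 case=> [/eqP|hz]; first by rewrite (negbTE z0).
 have [xz|xz] := eqVneq (x + z) 0; first by left.
 by right; apply: le_trans (qvalD hq x0 z0 xz); rewrite le_min hx.
- move=> x y hx hy; have [x0|x0] := eqVneq x 0; first by left; rewrite x0 mul0r.
 have [y0|y0] := eqVneq y 0; first by left; rewrite y0 mulr0.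
 case: hx hy => [/eqP|hx]; first by rewrite (negbTE x0).
 case=> [/eqP|hy]; first by rewrite (negbTE y0).
 by right; rewrite (qvalM hq) // addr_ge0.
Qed.

Lemma qval_ringP x : x != 0 -> valuation_ring nu x <-> 0 <= nu x.
Proof. by move=> x0; split=> [[/eqP|//]|]; [rewrite (negbTE x0)|right]. Qed.

Lemma qval_maxid x : x != 0 -> maxid (valuation_ring nu) x <-> 0 < nu x.
Proof.
move=> x0; split=> [[/(qval_ringP x0) h1 h2]|h].
 rewrite lt_neqAle h1 andbT; apply/eqP => e; apply: h2; split=> //; right.
 by rewrite qvalV // -e.
split; first by right; exact: ltW.
by move=> [_] /qval_ringP; rewrite invr_eq0 qvalV // => /(_ x0); rewrite oppr_ge0 leNgt h.
Qed.

Lemma qval_base : k `<=` valuation_ring nu.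
Proof. by move=> c kc; have [->|c0] := eqVneq c 0; [left|right; rewrite (qvalk hq)]. Qed.

End QValFacts.

(** * Polyhedra *)

Lemma between (lo up : seq rat) : (forall x y, x \in lo -> y \in up -> x <= y) ->
 exists t, (forall x, x \in lo -> x <= t) /\ (forall y, y \in up -> t <= y).
Proof.
elim: lo => [|x lo IH] h.
 elim: up {h} => [|y up [t [_ ht]]]; first by exists 0.
 exists (Num.min t y); split=> // z /in_consP[->|/ht h]; first by rewrite ge_min lexx orbT.
 by rewrite ge_min h.
have [|t [h1 h2]] := IH; first by move=> a b ha; apply: h; exact: mem_tail.
exists (Num.max t x); split=> z.
 by case/in_consP=> [->|/h1 hz]; rewrite le_max ?lexx ?orbT // hz.
by move=> zu; rewrite ge_max h2 //= h // mem_head.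
Qed.

Lemma exists_argmax (T : eqType) (f : T -> rat) (P : pred T) (s : seq T) :
 (exists2 x, x \in s & P x) -> exists x, [/\ x \in s, P x & forall y, y \in s -> P y -> f y <= f x].
Proof.
elim: s => [[x]|x s IH hs] => //.
have [[z zs Pz]|ns] := pselect (exists2 y, y \in s & P y); last first.
 have [y] := hs; case/in_consP=> [->|ys Py]; last by case: ns; exists y.
 exists x; rewrite mem_head; split=> // z /in_consP[-> //|zs Pz].
 by case: ns; exists z.
have [|y [ys Py hy]] := IH; first by exists z.
have [/andP[Px fyx]|nPx] := boolP (P x && (f y <= f x)).
 exists x; rewrite mem_head; split=> // t /in_consP[-> //|ts Pt].
 exact: le_trans (hy t ts Pt) fyx.
exists y; rewrite inE ys orbT; split=> // t /in_consP[-> Px|]; last exact: hy.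
by move: nPx; rewrite Px -ltNge => /ltW.
Qed.

(* The multipliers do not depend on the right-hand side b. *)
Theorem fourier_motzkin_nat N : forall (I : finType) (A : I -> nat -> rat),
 exists L : seq {ffun I -> rat}, (forall l, l \in L -> (forall i, 0 <= l i) /\
   forall j, (j < N)%N -> \sum_i l i * A i j = 0) /\
  forall b : I -> rat, (forall l, l \in L -> \sum_i l i * b i <= 0) ->
   exists x : nat -> rat, forall i, b i <= \sum_(j < N) A i j * x j.
Proof.
elim: N => [|N IH] I A.
 exists [seq [ffun j => (j == i)%:R] | i <- enum I]; split.
  by move=> _ /mapP[i _ ->]; split=> // j; rewrite ffunE.
 move=> b hb; exists (fun=> 0) => i; rewrite big_ord0.
 have /hb : [ffun j => (j == i)%:R] \in [seq [ffun j => (j == i)%:R : rat] | i <- enum I].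
  by apply: map_f; rewrite mem_enum.
 by rewrite (bigD1 i) //= ffunE eqxx mul1r big1 ?addr0 // => j /negbTE h; rewrite ffunE h mul0r.
pose a i := A i N.
(* The rows after elimination of variable N: a pair (i, i) keeps a row with coefficient 0, a pair
   (i, j) combines a positive with a negative coefficient; all other pairs give the zero row. *)
pose q (p : I * I) l : rat :=
 if (p.1 == p.2) && (a p.1 == 0) then (l == p.1)%:R
 else if (0 < a p.1) && (a p.2 < 0) then (l == p.1)%:R * - a p.2 + (l == p.2)%:R * a p.1 else 0.
have q_ge0 p l : 0 <= q p l.
 rewrite /q; case: ifP => // _; case: ifP => // /andP[h1 h2].
 by rewrite addr_ge0 // mulr_ge0 // ?oppr_ge0 ltW.
have sum1 i (c : I -> rat) : \sum_l (l == i)%:R * c l = c i.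
 by rewrite (bigD1 i) //= eqxx mul1r big1 ?addr0 // => j /negbTE ->; rewrite mul0r.
have qsum p (c : I -> rat) : \sum_l q p l * c l = if (p.1 == p.2) && (a p.1 == 0) then c p.1
  else if (0 < a p.1) && (a p.2 < 0) then c p.1 * - a p.2 + c p.2 * a p.1 else 0.
 rewrite /q; case: ifP => _ => //.
 case: ifP => _; last by rewrite big1 // => l _; rewrite mul0r.
 under eq_bigr => l _ do rewrite mulrDl mulrAC [X in _ + X]mulrAC.
 by rewrite big_split -!mulr_suml !sum1.
have [L [h1 h2]] := IH _ (fun p j => \sum_l q p l * A l j).
exists (map (fun l' : {ffun I * I -> rat} => [ffun l => \sum_p l' p * q p l]) L); split.
 move=> _ /mapP[l' l'L ->]; have [g1 g2] := h1 _ l'L; split.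
  by move=> i; rewrite ffunE sumr_ge0 // => p _; rewrite mulr_ge0.
 move=> j hj; under eq_bigr => i _ do rewrite ffunE mulr_suml.
 rewrite exchange_big /=; under eq_bigr => p _.
  under eq_bigr => i _ do rewrite -mulrA.
  rewrite -mulr_sumr; over.
 have [jN|jN] := ltnP j N; first exact: g2.
 have -> : j = N by lia.
 apply: big1 => p _; rewrite qsum; case: ifP => [/andP[_ /eqP]|_]; first by rewrite /a => ->; rewrite mulr0.
 by case: ifP => _; rewrite -/(a p.1) -/(a p.2); ring.
move=> b hb; have [|x hx] := h2 (fun p => \sum_l q p l * b l).
 move=> l' l'L; have := hb _ (map_f _ l'L); congr (_ <= _).
 under eq_bigr => i _ do rewrite ffunE mulr_suml.
 rewrite exchange_big /=; apply: eq_bigr => p _; rewrite mulr_sumr.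
 by apply: eq_bigr => i _; rewrite mulrA.
pose c i := b i - \sum_(j < N) A i j * x j.
have hc p : \sum_l q p l * c l <= 0.
 under eq_bigr => l _ do rewrite mulrBr mulr_sumr.
 rewrite sumrB subr_le0 exchange_big /=; apply: le_trans (hx p) _.
 apply: ler_sum => j _; rewrite mulr_suml; apply: ler_sum => l _; by rewrite mulrA.
have [|t [t1 t2]] := @between [seq c i / a i | i <- enum I & 0 < a i] [seq c i / a i | i <- enum I & a i < 0].
 move=> _ _ /mapP[i hi ->] /mapP[j hj ->]; move: hi hj; rewrite !mem_filter => /andP[ai _] /andP[aj _].
 have := hc (i, j); rewrite qsum /= ai aj; case: ifP => [/andP[/eqP e]|_].
  by rewrite e in ai; have := lt_trans ai aj.
 move=> h; rewrite ler_pdivrMr // mulrAC ler_ndivlMr; lra.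
exists (fun j => if j == N then t else x j) => i; rewrite big_ord_recr /= eqxx.
have -> : \sum_(j < N) A i j * (if val j == N then t else x j) = \sum_(j < N) A i j * x j.
 by apply: eq_bigr => j _; rewrite ltn_eqF // ltn_ord.
rewrite -lerBlDl -/(c i) -/(a i); case: (ltgtP (a i) 0) => ai.
- by rewrite mulrC -ler_ndivlMr //; apply: t2; apply/mapP; exists i => //; rewrite mem_filter ai mem_enum.
- by rewrite mulrC -ler_pdivrMr //; apply: t1; apply/mapP; exists i => //; rewrite mem_filter ai mem_enum.
- by have := hc (i, i); rewrite qsum /= ai eqxx mul0r.
Qed.

Theorem fourier_motzkin (I J : finType) (A : I -> J -> rat) :
 exists L : seq {ffun I -> rat}, (forall l, l \in L -> (forall i, 0 <= l i) /\
   forall j, \sum_i l i * A i j = 0) /\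
  forall b : I -> rat, (forall l, l \in L -> \sum_i l i * b i <= 0) ->
   exists x : J -> rat, forall i, b i <= \sum_j A i j * x j.
Proof.
pose A' i k := if insub k is Some k then A i (enum_val (k : 'I_#|J|)) else 0.
have A'E i (k : 'I_#|J|) : A' i k = A i (enum_val k) by rewrite /A' valK.
have [L [h1 h2]] := fourier_motzkin_nat #|J| A'; exists L; split.
 move=> l /h1[g1 g2]; split=> // j; rewrite -[RHS](g2 (enum_rank j) (ltn_ord _)); apply: eq_bigr => i _.
 by rewrite A'E enum_rankK.
move=> b /h2[x hx]; exists (fun j => x (enum_rank j)) => i; apply: le_trans (hx i) _.
rewrite [leRHS](reindex (@enum_val J predT)) /=; last first.
 by exists enum_rank => j _; rewrite ?enum_valK ?enum_rankK.
by apply: ler_sum => k _; rewrite A'E enum_valK.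
Qed.

Section Pairing.
Variable n : nat.
Implicit Types (u v w : 'rV[rat]_n).

Lemma pairingDr u v w : pairing u (v + w) = pairing u v + pairing u w.
Proof. by rewrite -big_split; apply: eq_bigr => j _; rewrite mxE mulrDr. Qed.
Lemma pairingDl u v w : pairing (u + v) w = pairing u w + pairing v w.
Proof. by rewrite -big_split; apply: eq_bigr => j _; rewrite mxE mulrDl. Qed.
Lemma pairingZr u c v : pairing u (c *: v) = c * pairing u v.
Proof. by rewrite mulr_sumr; apply: eq_bigr => j _; rewrite mxE mulrCA. Qed.
Lemma pairingZl u c v : pairing (c *: u) v = c * pairing u v.
Proof. by rewrite mulr_sumr; apply: eq_bigr => j _; rewrite mxE mulrA. Qed.
Lemma pairing0r u : pairing u 0 = 0.
Proof. by rewrite -[0](scale0r (0 : 'rV_n)) pairingZr mul0r. Qed.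
Lemma pairing0l v : pairing 0 v = 0.
Proof. by rewrite -[0](scale0r (0 : 'rV_n)) pairingZl mul0r. Qed.
Lemma pairingNl u v : pairing (- u) v = - pairing u v.
Proof. by rewrite -scaleN1r pairingZl mulN1r. Qed.
Lemma pairingNr u v : pairing u (- v) = - pairing u v.
Proof. by rewrite -scaleN1r pairingZr mulN1r. Qed.
Lemma pairing_sumr (I : Type) (r : seq I) (P : pred I) u (f : I -> 'rV_n) :
 pairing u (\sum_(i <- r | P i) f i) = \sum_(i <- r | P i) pairing u (f i).
Proof. by elim/big_rec2: _ => [|i y1 y2 _ <-]; rewrite ?pairing0r ?pairingDr. Qed.
Lemma pairing_suml (I : Type) (r : seq I) (P : pred I) v (f : I -> 'rV_n) :
 pairing (\sum_(i <- r | P i) f i) v = \sum_(i <- r | P i) pairing (f i) v.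
Proof. by elim/big_rec2: _ => [|i y1 y2 _ <-]; rewrite ?pairing0l ?pairingDl. Qed.

Lemma lattice_multiple u : exists m (w : 'rV[int]_n), (0 < m)%N /\ lattice_vect w = m%:R *: u.
Proof.
pose dd j := absz (denq (u 0 j)); pose m := (\prod_(j < n) dd j)%N.
exists m, (\row_j (numq (u 0 j) * (m %/ dd j)%N%:Z)); split.
 by rewrite prodn_gt0 // => j; rewrite absz_gt0.
apply/rowP => j; rewrite !mxE rmorphM /= -{2}[u 0 j]divq_num_den.
have d0 : (denq (u 0 j))%:~R != 0 :> rat by rewrite intr_eq0.
have dm : (dd j %| m)%N by rewrite /m (bigD1 j) //= dvdn_mulr.
have e1 : (dd j)%:R = (denq (u 0 j))%:~R :> rat by rewrite -[LHS]/((Posz (dd j))%:~R) gez0_abs.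
have -> : m%:R = ((m %/ dd j)%N)%:R * (denq (u 0 j))%:~R :> rat.
 by rewrite -e1 -natrM divnK.
by rewrite -[RHS]mulrA [(denq _)%:~R * _]mulrC mulfVK // [RHS]mulrC.
Qed.

End Pairing.

(** * Linear programming duality and elimination *)

Section Programming.
Variable n : nat.
Local Notation V := 'rV[rat]_n.
Implicit Types (u v w x : V) (cs : seq (V * rat)).

Definition poly cs : set V := [set v | forall c, c \in cs -> c.2 <= pairing c.1 v].

(** Eliminate x from cs together with the condition that u is at most m. Combinations in which u has
    weight 0 hold already, as the polyhedron is nonempty; the others bound m from below by [val l].
    The largest [val l] is the minimum of u, and its multipliers express u. *)
Theorem linear_program cs u : poly cs !=set0 -> (exists d, forall x, poly cs x -> d <= pairing u x) ->
 exists x0 (l : 'I_(size cs) -> rat), [/\ poly cs x0, forall i, 0 <= l i,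
  u = \sum_i l i *: (cs`_i).1 & pairing u x0 = \sum_i l i * (cs`_i).2].
Proof.
move=> [p hp] [d hd]; pose I := option 'I_(size cs).
pose A (i : I) (j : 'I_n) : rat := if i is Some i then (cs`_i).1 0 j else - u 0 j.
have [L [h1 h2]] := fourier_motzkin A.
pose val (l : {ffun I -> rat}) := (\sum_i l (Some i) * (cs`_i).2) / l None.
have sumI (f : I -> rat) : \sum_i f i = f None + \sum_i f (Some i).
 rewrite (bigD1 None) //=; congr (_ + _).
 rewrite (reindex_omap Some id) /=; last by case.
 by apply: eq_bigl => i; rewrite eqxx.
have AE (i : I) x : \sum_j A i j * x 0 j = if i is Some i then pairing (cs`_i).1 x else - pairing u x.
 by case: i => [i|]; [|rewrite -pairingNl; apply: eq_bigr => j _; rewrite mxE].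
have polyP x : poly cs x <-> forall i : 'I_(size cs), (cs`_i).2 <= pairing (cs`_i).1 x.
 split=> [h i|h c /(nthP 0)[i hi <-]]; first by apply: h; exact: mem_nth.
 exact: (h (Ordinal hi)).
have comb l : l \in L -> \sum_i l (Some i) *: (cs`_i).1 = l None *: u.
 move=> lL; apply/rowP => j; have [_ /(_ j)] := h1 _ lL; rewrite sumI /= => /eqP.
 rewrite mulrN addrC subr_eq0 => /eqP E; rewrite !mxE -E summxE; apply: eq_bigr => i _; by rewrite mxE.
have feas m : (forall l, l \in L -> 0 < l None -> val l <= m) -> exists2 x, poly cs x & pairing u x <= m.
 move=> hm; have [|x hx] := h2 (fun i => if i is Some i then (cs`_i).2 else - m).
  move=> l lL; rewrite sumI mulrN addrC subr_le0; have [g1 _] := h1 _ lL.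
  have := g1 None; rewrite le_eqVlt => /orP[/eqP E|l0]; last by rewrite [leRHS]mulrC -ler_pdivrMr // hm.
  rewrite -E mul0r; have e0 := comb _ lL; rewrite -E scale0r in e0.
  have := pairing0l p; rewrite -{1}e0 pairing_suml => e1; rewrite -[leRHS]e1; apply: ler_sum => i _.
  by rewrite pairingZl ler_wpM2l; move/polyP: hp.
 exists (\row_j x j); first by apply/polyP => i; have := hx (Some i); congr (_ <= _); apply: eq_bigr => j _; rewrite mxE.
 have := hx None; rewrite lerNl -sumrN => h; apply: le_trans h; rewrite le_eqVlt; apply/orP; left; apply/eqP.
 by apply: eq_bigr => j _; rewrite mxE mulNr opprK.
have [Lp|] := pselect (exists2 l, l \in L & 0 < l None); last first.
 (* If no combination involved u, even the value d - 1 would be attained, below the bound d. *)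
 move=> nL; have [|x hx] := feas (d - 1); first by move=> l lL l0; case: nL; exists l.
 by have := hd _ hx; lra.
have [l [lL l0 lm]] : exists l, [/\ l \in L, 0 < l None & forall l', l' \in L -> 0 < l' None -> val l' <= val l].
 exact: (@exists_argmax _ val (fun l : {ffun I -> rat} => 0 < l None) L Lp).
have [x0 px0 ux0] := feas _ lm; have l00 : l None != 0 by rewrite gt_eqF.
have uE : u = \sum_i (l (Some i) / l None) *: (cs`_i).1.
 under eq_bigr => i _ do rewrite mulrC -scalerA.
 by rewrite -scaler_sumr comb // scalerA mulVf // scale1r.
exists x0, (fun i => l (Some i) / l None); split=> //.
 by move=> i; rewrite divr_ge0; case: (h1 _ lL).
have vE : val l = \sum_i (l (Some i) / l None) * (cs`_i).2.
 by rewrite /val mulr_suml; apply: eq_bigr => i _; rewrite mulrAC.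
apply/eqP; rewrite eq_le -vE ux0 vE {1}uE pairing_suml; apply: ler_sum => i _.
rewrite pairingZl ler_wpM2l ?divr_ge0; try by case: (h1 _ lL).
by move/polyP: px0.
Qed.

(* Substituting X_e = m_e x_e makes the sum of the m_e P_e a system whose matrix does not depend on m. *)
Theorem cutting r (cs : 'I_r -> seq (V * rat)) (ts : seq V) :
 exists L : seq (V * {ffun 'I_r -> rat}),
  (forall l, l \in L -> (forall x, (forall a, a \in ts -> 0 <= pairing a x) -> 0 <= pairing l.1 x) /\
    forall e x, poly (cs e) x -> l.2 e <= pairing l.1 x) /\
  forall (m : 'I_r -> rat) v, (forall l, l \in L -> \sum_e m e * l.2 e <= pairing l.1 v) ->
   exists X : 'I_r -> V, (forall e c, c \in cs e -> m e * c.2 <= pairing c.1 (X e)) /\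
    forall a, a \in ts -> 0 <= pairing a (v - \sum_e X e).
Proof.
pose M := (\max_e size (cs e))%N.
pose I := ('I_r * 'I_M + 'I_(size ts))%type.
pose A (i : I) (j : 'I_r * 'I_n) : rat :=
 match i with inl p => (p.1 == j.1)%:R * ((cs p.1)`_(p.2)).1 0 j.2 | inr t => - (ts`_t) 0 j.2 end.
have [L [h1 h2]] := fourier_motzkin A.
pose U (l : {ffun I -> rat}) : V := \sum_t l (inr t) *: ts`_t.
pose H (l : {ffun I -> rat}) : {ffun 'I_r -> rat} := [ffun e => \sum_k l (inl (e, k)) * ((cs e)`_k).2].
have sumI (f : I -> rat) : \sum_i f i = \sum_e \sum_k f (inl (e, k)) + \sum_t f (inr t).
 rewrite big_sumType; congr (_ + _); rewrite pair_big; by apply: eq_bigr => -[].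
have sume (e0 : 'I_r) (f : 'I_r -> rat) : \sum_e (e == e0)%:R * f e = f e0.
 by rewrite (bigD1 e0) //= eqxx mul1r big1 ?addr0 // => e /negbTE ->; rewrite mul0r.
have pairE (G : 'I_r * 'I_n -> rat) : \sum_p G p = \sum_i \sum_j G (i, j).
 by rewrite pair_bigA; apply: eq_bigr => -[].
have comb l e : l \in L -> \sum_k l (inl (e, k)) *: ((cs e)`_k).1 = U l.
 move=> lL; apply/rowP => j; have [_ /(_ (e, j))] := h1 _ lL; rewrite sumI /=.
 have -> : \sum_e0 \sum_k l (inl (e0, k)) * ((e0 == e)%:R * ((cs e0)`_k).1 0 j) = \sum_k l (inl (e, k)) * ((cs e)`_k).1 0 j.
  rewrite -[RHS](sume e (fun e0 => \sum_k l (inl (e0, k)) * ((cs e0)`_k).1 0 j)); apply: eq_bigr => e0 _.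
  by rewrite mulr_sumr; apply: eq_bigr => k _; rewrite mulrCA.
 rewrite (eq_bigr (fun t => - (l (inr t) * ts`_t 0 j))); last by move=> t _; rewrite mulrN.
 rewrite sumrN => /eqP; rewrite subr_eq0 => /eqP E; rewrite !summxE.
 by transitivity (\sum_t l (inr t) * ts`_t 0 j); [rewrite -E|]; apply: eq_bigr => k _; rewrite mxE.
exists [seq (U l, H l) | l <- L]; split.
 move=> _ /mapP[l lL ->] /=; have [g1 _] := h1 _ lL; split.
  move=> x hx; rewrite pairing_suml sumr_ge0 // => t _; rewrite pairingZl mulr_ge0 // hx //; exact: mem_nth.
 move=> e x hx; rewrite ffunE -(comb _ e lL) pairing_suml; apply: ler_sum => k _; rewrite pairingZl ler_wpM2l //.
 have [ke|ke] := ltnP k (size (cs e)); first by apply: hx; exact: mem_nth.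
 by rewrite nth_default // pairing0l.
move=> m v hv.
have [|x hx] := h2 (fun i => match i with inl p => m p.1 * ((cs p.1)`_(p.2)).2 | inr t => - pairing ts`_t v end).
 move=> l lL; have := hv _ (map_f _ lL); rewrite sumI /= => h.
 rewrite (eq_bigr (fun t => - (pairing (l (inr t) *: ts`_t) v))); last by move=> t _; rewrite pairingZl mulrN.
 rewrite sumrN subr_le0 -pairing_suml; apply: le_trans h; apply: ler_sum => e _; rewrite ffunE mulr_sumr.
 by apply: ler_sum => k _; rewrite mulrCA.
exists (fun e => \row_j x (e, j)); split=> [e c /(nthP 0)[k ke <-]|a /(nthP 0)[t tl <-]].
 have kM : (k < M)%N by apply: leq_trans ke _; exact: (leq_bigmax (F := fun e => size (cs e))).
 have := hx (inl (e, Ordinal kM)); rewrite /= => h; apply: le_trans h _.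
 rewrite pairE /=.
 rewrite (bigD1 e) //= [X in _ + X]big1 ?addr0; last first.
  by move=> i /negbTE ni; rewrite big1 // => j _; rewrite eq_sym ni !mul0r.
 by apply: ler_sum => j _; rewrite eqxx mul1r mxE.
have := hx (inr (Ordinal tl)); rewrite /= lerNl -sumrN => h; rewrite pairingDr pairingNr subr_ge0; apply: le_trans h.
rewrite pairing_sumr pairE /=.
by apply: ler_sum => e _; apply: ler_sum => j _; rewrite mxE mulNr opprK.
Qed.

End Programming.

Section Sigma.
Variable n : nat.
Local Notation V := 'rV[rat]_n.
Implicit Types (u v w x : V) (sigma Delta P Q : set V) (cs : seq (V * rat)).

Definition recession cs : seq (V * rat) := [seq (c.1, 0) | c <- cs].

Lemma recessionP cs v : poly (recession cs) v <-> forall c, c \in cs -> 0 <= pairing c.1 v.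
Proof.
split=> [h c hc|h _ /mapP[c hc ->]]; last exact: (h c hc).
by apply: (h (c.1, 0)); apply/mapP; exists c.
Qed.

Lemma tail_poly cs : poly cs !=set0 -> tail_cone (poly cs) = poly (recession cs).
Proof.
move=> [p hp]; apply/seteqP; split=> [v hv|v /recessionP hv x t hx t0 c hc]; last first.
 by rewrite pairingDr pairingZr; apply: ler_wpDr; [rewrite mulr_ge0 // hv|exact: hx].
apply/recessionP => c hc; rewrite leNgt; apply/negP => neg.
(* At p + t v the functional c.1 takes the value c.2 - 1, one below its bound. *)
pose t := (pairing c.1 p - c.2 + 1) / - pairing c.1 v.
have t0 : 0 <= t by rewrite divr_ge0; have := hp c hc; lra.
have := hv p t hp t0 c hc; rewrite pairingDr pairingZr /t invrN mulrN mulNr mulfVK; lra.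
Qed.

Lemma sigmaP sigma Delta : sigma_polyhedron sigma Delta ->
 exists cs, [/\ Delta = poly cs, sigma = poly (recession cs) & poly cs !=set0].
Proof. by move=> [[cs E] ne <-]; exists cs; rewrite -/(poly cs) in E; rewrite E in ne *; rewrite tail_poly. Qed.

Lemma sigma_coneP sigma : polyhedral_cone sigma -> sigma_polyhedron sigma sigma.
Proof.
move=> [s ->]; pose cs := [seq (u, 0 : rat) | u <- s].
have E : [set v | forall u, u \in s -> 0 <= pairing u v] = poly cs.
 apply/seteqP; split=> v h; first by move=> _ /mapP[u us ->]; exact: h.
 by move=> u us; apply: (h (u, 0)); apply/mapP; exists u.
have ne : poly cs !=set0 by exists 0 => _ /mapP[u us ->]; rewrite pairing0r.
split; [by exists cs|by rewrite E|rewrite E tail_poly //; congr poly].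
by rewrite /recession -map_comp.
Qed.

Lemma cone0 sigma : polyhedral_cone sigma -> sigma 0.
Proof. by move=> [s ->] u _; rewrite pairing0r. Qed.
Lemma coneD sigma v w : polyhedral_cone sigma -> sigma v -> sigma w -> sigma (v + w).
Proof. by move=> [s ->] hv hw u us; rewrite pairingDr addr_ge0 ?hv ?hw. Qed.
Lemma coneZ sigma c v : polyhedral_cone sigma -> 0 <= c -> sigma v -> sigma (c *: v).
Proof. by move=> [s ->] c0 hv u us; rewrite pairingZr mulr_ge0 ?hv. Qed.

Lemma dualD sigma u v : dual_cone sigma u -> dual_cone sigma v -> dual_cone sigma (u + v).
Proof. by move=> hu hv x hx; rewrite pairingDl addr_ge0 ?hu ?hv. Qed.
Lemma dualZ sigma c u : 0 <= c -> dual_cone sigma u -> dual_cone sigma (c *: u).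
Proof. by move=> c0 hu x hx; rewrite pairingZl mulr_ge0 ?hu. Qed.

(** Duality on the recession cone writes u as a nonnegative combination of the normals, which bounds
    u from below on Delta; duality on Delta then attains the minimum. *)
Lemma face_ex sigma Delta u : sigma_polyhedron sigma Delta -> dual_cone sigma u ->
 exists x, face Delta u x.
Proof.
move=> /sigmaP[cs [-> -> ne]] du.
have [||x0 [l [_ l0 ul _]]] := @linear_program _ (recession cs) u.
- by exists 0; apply/recessionP => c _; rewrite pairing0r.
- by exists 0.
have [|x1 [l1 [px1 l10 u1 e1]]] := @linear_program _ cs u ne.
 exists (\sum_i l i * (cs`_i).2) => x hx; rewrite ul pairing_suml; apply: ler_sum => i _.
 have ics : (i < size cs)%N by apply: leq_trans (ltn_ord i) _; rewrite size_map.
 by rewrite pairingZl ler_wpM2l // (nth_map 0) //=; apply: hx; exact: mem_nth.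
exists x1; split=> // v hv; rewrite e1 u1 pairing_suml; apply: ler_sum => i _.
by rewrite pairingZl ler_wpM2l //; apply: hv; exact: mem_nth.
Qed.

Lemma separating_functional sigma P q : sigma_polyhedron sigma P -> ~ P q ->
 exists u d, [/\ dual_cone sigma u, pairing u q < d & forall p, P p -> d <= pairing u p].
Proof.
move=> /sigmaP[cs [-> -> ne]] nq; apply: contrapT => h; apply: nq => c hc.
rewrite leNgt; apply/negP => neg; apply: h; exists c.1, c.2; split=> //.
 by move=> v /recessionP; apply.
by move=> p; apply.
Qed.

Lemma face_poly Delta cs w x0 : Delta = poly cs -> face Delta w x0 ->
 face Delta w = poly ((- w, - pairing w x0) :: cs).
Proof.
move=> -> [h0 m0]; apply/seteqP; split=> [v [hv mv] c|v hv].
 by case/in_consP=> [->|/hv //]; rewrite pairingNl lerN2 mv.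
have hv' : poly cs v by move=> c /mem_tail/hv.
split=> // v' hv''; apply: le_trans (m0 _ hv'').
by have := hv _ (mem_head _ _); rewrite pairingNl lerN2.
Qed.

Lemma face_sigma sigma Delta w : sigma_polyhedron sigma Delta -> dual_cone sigma w ->
 sigma_polyhedron (face sigma w) (face Delta w).
Proof.
move=> hD dw; have [x0 hx0] := face_ex hD dw; have [cs [ED Es ne]] := sigmaP hD.
have EF := face_poly ED hx0; have ne' : poly ((- w, - pairing w x0) :: cs) !=set0 by exists x0; rewrite -EF.
split; [by exists ((- w, - pairing w x0) :: cs)|by exists x0|].
rewrite EF tail_poly // /=.
have h0 : face sigma w 0 by rewrite Es; split=> [|v hv]; [apply/recessionP => c _; rewrite pairing0r|rewrite pairing0r; apply: dw; rewrite Es].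
by rewrite (face_poly Es h0) pairing0r.
Qed.

(* Affine Farkas: u + k w >= d + k c on Delta once k exceeds the multiplier of w. *)
Lemma eventually_above sigma Delta u w c d : sigma_polyhedron sigma Delta -> face Delta w !=set0 ->
 (forall x, face Delta w x -> pairing w x = c) -> (forall x, face Delta w x -> d <= pairing u x) ->
 exists k0 : nat, forall k x, (k0 <= k)%N -> Delta x -> d + k%:R * c <= pairing u x + k%:R * pairing w x.
Proof.
move=> /sigmaP[cs [ED _ _]] [x0 hx0] hc hd; have EF := face_poly ED hx0.
have [||x1 [l [px1 l0 ul e1]]] := @linear_program _ ((- w, - pairing w x0) :: cs) u.
- by exists x0; rewrite -EF.
- by exists d => x hx; apply: hd; rewrite EF.
pose t := l ord0; exists (Num.bound t) => k x k0k Dx.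
have tk : t <= k%:R.
 apply: le_trans (_ : (Num.bound t)%:R <= _); last by rewrite ler_nat.
 by apply/ltW; have := archi_boundP (l0 ord0).
have dle : d <= \sum_i l i * ((((- w, - pairing w x0) :: cs)`_i).2) by rewrite -e1; apply: hd; rewrite EF.
have cE : c = pairing w x0 by rewrite hc.
have wx : c <= pairing w x by rewrite cE; apply: (proj2 hx0).
have := dle; rewrite big_ord_recl /= => dle'.
have : pairing u x = - t * pairing w x + \sum_(i < size cs) l (lift ord0 i) * pairing (cs`_i).1 x.
 rewrite {1}ul big_ord_recl /= pairingDl pairingZl pairingNl pairing_suml mulrN -mulNr; congr (_ + _).
 by apply: eq_bigr => i _; rewrite pairingZl.
have : \sum_(i < size cs) l (lift ord0 i) * (cs`_i).2 <= \sum_(i < size cs) l (lift ord0 i) * pairing (cs`_i).1 x.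
 by apply: ler_sum => i _; rewrite ler_wpM2l //; move: Dx; rewrite ED; apply; exact: mem_nth.
move: (\sum_(i < size cs) _) dle' => s1; move: (\sum_(i < size cs) _) => s2 a1 a2 a3.
rewrite -/t -cE in a1; have : 0 <= (k%:R - t) * (pairing w x - c) by rewrite mulr_ge0 ?subr_ge0.
lra.
Qed.

(** * Minkowski sums of finite families *)

Section Sums.
Variables (I : choiceType) (Es : seq I).
Hypothesis uEs : uniq Es.

(** The finite form of [minkowski_sum], in which summands equal to sigma may be listed as well, so
    that several families can share one index list. *)
Definition msum sigma (Delta : I -> set V) : set V := [set v | exists w (x : I -> V),
 [/\ sigma w, forall i, i \in Es -> Delta i (x i) & v = w + \sum_(i <- Es) x i]].

Lemma minkowski_sumE sigma (P : set I) (Delta : I -> set V) : polyhedral_cone sigma ->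
 Es `in` P -> (forall i, P i -> Delta i <> sigma -> i \in Es) ->
 minkowski_sum sigma P Delta = msum sigma Delta.
Proof.
move=> hs sP Ps; pose Q := [set i | P i /\ Delta i <> sigma].
have sumQ (x : I -> V) : \sum_(i \in Q) x i = \sum_(i <- Es | `[< Delta i <> sigma >]) x i.
 rewrite -[RHS]big_filter [RHS]fsbig_seq ?filter_uniq //.
 suff -> : Q = [set` [seq i <- Es | `[< Delta i <> sigma >]]] by [].
 apply/seteqP; split=> i /=; rewrite mem_filter; last by move=> /andP[/asboolP ne /sP].
 by move=> [Pi ne]; rewrite (Ps i Pi ne) andbT; apply/asboolP.
apply/seteqP; split=> _ [w [x [hw hx ->]]].
 exists w, (fun i => if `[< Delta i <> sigma >] then x i else 0); split=> //.
  move=> i iEs; case: asboolP => [ne|/contrapT ->]; [exact: hx (sP i iEs) ne|exact: cone0].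
 by rewrite sumQ big_mkcond.
exists (w + \sum_(i <- Es | ~~ `[< Delta i <> sigma >]) x i), x; split=> //.
- apply: coneD => //; rewrite big_seq_cond; apply: (big_ind sigma); [exact: cone0|move=> *; exact: coneD|].
 by move=> i /andP[iEs /asboolPn/contrapT E]; have := hx i iEs; rewrite E.
- by move=> i Pi ne; apply: hx; exact: Ps.
- by rewrite sumQ -addrA; congr (_ + _); rewrite (bigID (fun i => `[< Delta i <> sigma >])) addrC.
Qed.

Lemma msum_face_split sigma (Delta : I -> set V) u w (x : I -> V) : sigma w -> (forall i, i \in Es -> Delta i (x i)) ->
 face (msum sigma Delta) u (w + \sum_(i <- Es) x i) ->
 face sigma u w /\ forall i, i \in Es -> face (Delta i) u (x i).
Proof.
move=> hw hx [_ hm]; split=> [|i iEs].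
 split=> // w' hw'; have := hm (w' + \sum_(i <- Es) x i); rewrite !pairingDr lerD2r; apply.
 by exists w', x.
split; first exact: hx.
move=> y hy; have := hm (w + \sum_(j <- Es) if j == i then y else x j).
rewrite !pairingDr lerD2l !(bigD1_seq i) //= eqxx.
have -> : \sum_(j <- Es | j != i) (if j == i then y else x j) = \sum_(j <- Es | j != i) x j.
 by apply: eq_bigr => j /negbTE ->.
rewrite !pairingDr lerD2r; apply; exists w, (fun j => if j == i then y else x j); split=> //.
 by move=> j jEs; case: eqP => [->|_] //; exact: hx.
by rewrite (bigD1_seq i) //= eqxx; congr (_ + (_ + _)); apply: eq_bigr => j /negbTE ->.
Qed.

Lemma msum_face_join sigma (Delta : I -> set V) u w (x : I -> V) : face sigma u w ->
 (forall i, i \in Es -> face (Delta i) u (x i)) ->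
 face (msum sigma Delta) u (w + \sum_(i <- Es) x i).
Proof.
move=> [hw mw] hx; split; first by exists w, x; split=> // i /hx[].
move=> _ [w' [x' [hw' hx' ->]]]; rewrite !pairingDr !pairing_sumr lerD ?mw //.
by rewrite big_seq [leRHS]big_seq ler_sum // => i iEs; apply: (proj2 (hx i iEs)); exact: hx'.
Qed.

(** A point q of Q i outside P i is separated from P i by some u in the dual of tau. Added to points
    minimizing u on the other P j, it gives a point of the sum at which u is below its minimum on
    the sum of the P j. The same applies to the tail cones. *)
Lemma cancellation tau tau' (P Q : I -> set V) : polyhedral_cone tau -> tau `<=` tau' ->
 (forall i, i \in Es -> sigma_polyhedron tau (P i)) -> (forall i, i \in Es -> P i `<=` Q i) ->
 msum tau' Q `<=` msum tau P -> tau' `<=` tau /\ forall i, i \in Es -> Q i `<=` P i.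
Proof.
move=> ht tt hP PQ h.
have minP u : dual_cone tau u -> exists p : I -> V, forall i, i \in Es -> face (P i) u (p i).
 move=> du; have [p hp] := choice_in 0 (fun i hi => face_ex (hP i hi) du).
 by exists p.
split=> [q hq|i0 i0Es q hq]; apply: contrapT => nq.
 have [u [d [du ud dp]]] := separating_functional (sigma_coneP ht) nq.
 have [p hp] := minP u du.
 have [|w [x [hw hx E]]] := h (q + \sum_(i <- Es) p i).
  by exists q, p; split=> // i iEs; apply: (PQ i iEs); case: (hp i iEs).
 have : pairing u (\sum_(i <- Es) p i) <= pairing u (\sum_(i <- Es) x i).
  rewrite !pairing_sumr big_seq [leRHS]big_seq ler_sum // => i iEs; apply: (proj2 (hp i iEs)); exact: hx.
 have := congr1 (pairing u) E; rewrite !pairingDr => e1.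
 by have := dp _ hw; lra.
have [u [d [du ud dp]]] := separating_functional (hP i0 i0Es) nq.
have [p hp] := minP u du.
have [|w [x [hw hx E]]] := h (0 + \sum_(i <- Es) if i == i0 then q else p i).
 exists 0, (fun i => if i == i0 then q else p i); split=> //; first by apply: tt; exact: cone0.
 by move=> i iEs; case: eqP => [->|_] //; apply: (PQ i iEs); case: (hp i iEs).
have e1 := congr1 (pairing u) E; rewrite !pairingDr pairing0r add0r !(bigD1_seq i0) //= eqxx !pairingDr in e1.
have : \sum_(i <- Es | i != i0) pairing u (if i == i0 then q else p i) <= \sum_(i <- Es | i != i0) pairing u (x i).
 rewrite big_seq_cond [leRHS]big_seq_cond ler_sum // => i /andP[iEs /negbTE ->].
 by apply: (proj2 (hp i iEs)); exact: hx.
rewrite -!pairing_sumr => le1; have := du _ hw; have := dp _ (hx _ i0Es); lra.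
Qed.

(* The functionals that cut out all the sums of multiples of the polyhedra Delta i. *)
Lemma cutting_functionals sigma (Delta : I -> set V) : polyhedral_cone sigma ->
 (forall i, i \in Es -> sigma_polyhedron sigma (Delta i)) ->
 exists us : seq V, us `in` dual_cone sigma /\
  forall (m : I -> rat) v, (forall i, i \in Es -> 0 <= m i) ->
   (forall u (x : I -> V), u \in us -> (forall i, i \in Es -> face (Delta i) u (x i)) ->
     \sum_(i <- Es) m i * pairing u (x i) <= pairing u v) ->
   msum sigma (fun i => poly_scale sigma (m i) (Delta i)) v.
Proof.
move=> hs hD; have [cs hcs] := choice_in [::] (fun i hi => sigmaP (hD i hi)).
have [ts Ets] := hs; pose E (e : 'I_(size Es)) := tnth (in_tuple Es) e.
have EEs e : E e \in Es by exact: mem_tnth.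
have [L [h1 h2]] := cutting (fun e => cs (E e)) ts.
have dL l : l \in L -> dual_cone sigma l.1 by move=> lL x; rewrite Ets => /(proj1 (h1 l lL)).
exists (map fst L); split; first by move=> _ /mapP[l lL ->]; exact: dL.
move=> m v m0 hv; have [|X [X1 X2]] := h2 (fun e => m (E e)) v.
 move=> l lL; have [x hx] := choice_in 0 (fun i hi => face_ex (hD i hi) (dL l lL)).
 apply: le_trans (hv l.1 x (map_f _ lL) hx); rewrite [leRHS]big_tnth; apply: ler_sum => e _.
 rewrite ler_wpM2l ?m0 //; apply: (proj2 (h1 l lL)); have [<- _ _] := hcs _ (EEs e).
 by case: (hx _ (EEs e)).
pose x i := if insub (index i Es) is Some e then X e else 0.
have xE e : x (E e) = X e.
 rewrite /x index_uniq //; by rewrite valK.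
exists (v - \sum_(i <- Es) x i), x; split.
- rewrite Ets => a /X2; congr (_ <= pairing a (_ - _)); rewrite [RHS]big_tnth.
 by apply: eq_bigr => e _.
- move=> i iEs; have /tnthP[e Ei] : i \in in_tuple Es by [].
 have [Di si nei] := hcs i iEs; rewrite /poly_scale; have Xe := X1 e; rewrite -[tnth _ e]/(E e) in Ei.
 rewrite -Ei in Xe; have Xx : X e = x i by rewrite Ei.
 case: eqP => mi; first by rewrite si; apply/recessionP => c /Xe; rewrite mi mul0r Xx.
 exists ((m i)^-1 *: x i); last by rewrite scalerA divff ?scale1r; apply/eqP.
 rewrite Di => c /Xe; rewrite pairingZr -Xx ler_pdivlMl //.
 by rewrite lt_neqAle m0 // andbT eq_sym; apply/eqP.
- by rewrite subrK.
Qed.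

Lemma msum_scale_ge sigma (Delta : I -> set V) (m : I -> rat) u v (x : I -> V) : dual_cone sigma u ->
 (forall i, i \in Es -> 0 <= m i) -> (forall i, i \in Es -> face (Delta i) u (x i)) ->
 msum sigma (fun i => poly_scale sigma (m i) (Delta i)) v ->
 \sum_(i <- Es) m i * pairing u (x i) <= pairing u v.
Proof.
move=> du m0 hx [w [y [hw hy ->]]]; rewrite pairingDr pairing_sumr ler_wpDl ?du //.
rewrite big_seq [leRHS]big_seq ler_sum // => i iEs; have := hy i iEs; rewrite /poly_scale.
case: eqP => [->|_]; first by rewrite mul0r => /du.
by move=> [z Dz <-]; rewrite pairingZr ler_wpM2l ?m0 //; apply: (proj2 (hx i iEs)).
Qed.

End Sums.
End Sigma.

(** * The field F(M) *)

Lemma fracP (R : idomainType) (x : {fraction R}) :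
 exists p q : R, x = FracField.tofrac p / FracField.tofrac q.
Proof.
elim/quotW: x => x; exists (frac x).1, (frac x).2.
have d0 : @FracField.tofrac R (frac x).2 != 0 by rewrite tofrac_eq0 denom_ratioP.
apply: (mulIf d0); rewrite mulfVK //; unlock FracField.tofrac.
rewrite -[LHS]FracField.pi_mul; apply/eqmodP; rewrite /= FracField.equivfE /FracField.mulf.
by rewrite !numden_Ratio ?mulf_neq0 ?oner_neq0 ?denom_ratioP // !mulr1 mulrC.
Qed.

Section Fractions.
Variables (F : fieldType) (B : set F).
Hypothesis hB : subring_set B.

Definition fractions : set F := [set x | exists a b, [/\ B a, B b, b != 0 & x = a / b]].

Lemma fractions_subring : [/\ subring_set fractions, B `<=` fractions & forall x, fractions x -> fractions x^-1].
Proof.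
split; first split.
- by exists 1, 1; rewrite divr1 oner_neq0; split=> //; member.
- move=> _ _ [a [b [Ba Bb b0 ->]]] [c [d [Bc Bd d0 ->]]]; exists (a * d - c * b), (b * d).
 split; [member|member|by rewrite mulf_neq0|].
 by rewrite -mulNr addf_div ?mulNr.
- move=> _ _ [a [b [Ba Bb b0 ->]]] [c [d [Bc Bd d0 ->]]]; exists (a * c), (b * d).
 by split; [member|member|rewrite mulf_neq0|rewrite mulf_div].
- by move=> x Bx; exists x, 1; rewrite divr1 oner_neq0; split=> //; member.
- move=> _ [a [b [Ba Bb b0 ->]]]; have [->|a0] := eqVneq a 0; last by exists b, a; rewrite invf_div.
 by exists 0, 1; rewrite !mul0r invr0 oner_neq0; split=> //; member.
Qed.

End Fractions.

Section Laurent.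
Variables (F : fieldType) (n : nat).
Local Notation L := (laurent_field F n).
Local Notation X := (@character F n).
Local Notation lc := (@laurent_const F n).
Implicit Types (u v : 'rV[int]_n) (f : F) (l : seq (F * 'rV[int]_n)).

Fact lc_zmod : zmod_morphism (lc : F -> L).
Proof. by move=> f g; rewrite /laurent_const mpolyCB tofracB. Qed.
HB.instance Definition _ := GRing.isZmodMorphism.Build F L lc lc_zmod.
Fact lc_monoid : monoid_morphism (lc : F -> L).
Proof. by split=> [|f g]; rewrite /laurent_const // mpolyCM tofracM. Qed.
HB.instance Definition _ := GRing.isMonoidMorphism.Build F L lc lc_monoid.

Lemma lc_neq0 f : f != 0 -> lc f != 0. Proof. by rewrite fmorph_eq0. Qed.

Lemma var_neq0 j : @FracField.tofrac _ ('X_j : {mpoly F[n]}) != 0.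
Proof.
rewrite tofrac_eq0; apply/eqP => /(congr1 (mcoeff U_(j))).
by rewrite mcoeffXU eqxx mcoeff0 => /eqP; rewrite oner_eq0.
Qed.

Lemma char0 : X 0 = 1.
Proof. by apply: big1 => j _; rewrite mxE. Qed.
Lemma charD u v : X (u + v) = X u * X v.
Proof. by rewrite -big_split; apply: eq_bigr => j _; rewrite mxE expfzDr ?var_neq0. Qed.
Lemma char_neq0 u : X u != 0.
Proof. by apply/prodf_neq0 => j _; rewrite expfz_neq0 ?var_neq0. Qed.
Lemma charN u : X (- u) = (X u)^-1.
Proof. by apply: (mulIf (char_neq0 u)); rewrite -charD addNr char0 mulVf ?char_neq0. Qed.
Lemma charMn u m : X (u *+ m) = X u ^+ m.
Proof. by elim: m => [|m IH]; rewrite ?char0 // mulrS charD IH exprS. Qed.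

Definition term (p : F * 'rV[int]_n) : L := lc p.1 * X p.2.
Definition lsum l : L := \sum_(p <- l) term p.

Lemma termM p q : term p * term q = term (p.1 * q.1, p.2 + q.2).
Proof. by rewrite /term rmorphM charD mulrACA. Qed.
Lemma term_neq0 p : p.1 != 0 -> term p != 0.
Proof. by move=> h; rewrite mulf_neq0 ?char_neq0 ?lc_neq0. Qed.
Lemma termV p : p.1 != 0 -> (term p)^-1 = term (p.1^-1, - p.2).
Proof. by move=> h; rewrite /term invfM charN fmorphV. Qed.
Lemma termX p m : term p ^+ m = term (p.1 ^+ m, p.2 *+ m).
Proof. by rewrite /term exprMn charMn rmorphXn. Qed.
Lemma term0 f : term (f, 0) = lc f.
Proof. by rewrite /term char0 mulr1. Qed.

(* Multiplying by a large character reduces to polynomials. *)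
Lemma lsum_eq0 l u : lsum l = 0 -> \sum_(p <- l | p.2 == u) p.1 = 0.
Proof.
have [N hN] : exists N : nat, forall p j, p \in (0, u) :: l -> 0 <= p.2 0 j + N%:Z.
 elim: ((0, u) :: l) => [|p l' [N hN]]; first by exists 0%N.
 exists (N + \sum_j absz (p.2 0%R j))%N => q j; rewrite PoszD => /orP[/eqP ->|/(hN q j) h]; last by lia.
 have : (absz (p.2 0%R j) <= \sum_j absz (p.2 0%R j))%N by rewrite (bigD1 j) //= leq_addr.
 move: (\sum_j _)%N (p.2 0 j) => M x hM; lia.
pose m (w : 'rV[int]_n) : 'X_{1..n} := [multinom absz (w 0%R j + N%:Z)%R | j < n].
pose c : 'rV[int]_n := \row_j N%:Z.
have XE (w : 'rV[int]_n) : (forall j, 0 <= w 0 j + N%:Z) -> X w * X c = @FracField.tofrac _ ('X_[m w] : {mpoly F[n]}).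
 move=> hw; rewrite -charD mpolyXE_id rmorph_prod; apply: eq_bigr => j _.
 by rewrite rmorphXn !mxE mnmE [RHS]exprnP; congr (_ ^ _); rewrite gez0_abs.
have hl p : p \in l -> forall j, 0 <= p.2 0 j + N%:Z by move=> pl j; apply: hN; rewrite inE pl orbT.
move=> /(congr1 (fun x => x * X c)); rewrite mul0r mulr_suml big_seq => E.
have : @FracField.tofrac _ (\sum_(p <- l) p.1%:MP * 'X_[m p.2] : {mpoly F[n]}) = 0.
 rewrite rmorph_sum -[RHS]E [LHS]big_seq; apply: eq_bigr => p pl.
 by rewrite rmorphM /= -(XE _ (hl p pl)) mulrA.
move=> /eqP; rewrite tofrac_eq0 => /eqP/(congr1 (mcoeff (m u))); rewrite mcoeff0 raddf_sum /= => E2; rewrite -[RHS]E2.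
rewrite [LHS]big_mkcond; apply: eq_big_seq => p pl; rewrite mcoeffCM mcoeffX.
have -> : (m p.2 == m u) = (p.2 == u); last by case: ifP; rewrite ?mulr1 ?mulr0.
apply/eqP/eqP => [/mnmP e|-> //]; apply/rowP => j; have := e j; rewrite !mnmE.
have h1 := hl p pl j; have h2 := hN (0, u) j (mem_head _ _); rewrite /= in h2.
by move: (p.2 0 j) (u 0 j) h1 h2 => a b; lia.
Qed.

Section Base.
Variables (K : closedFieldType) (iota : {rmorphism K -> F}).
Local Notation k := (range iota).
Local Notation kL := (range (lc \o iota)).

Lemma acsub_L : acsub kL.
Proof. exact: (@acsub_range K L [the {rmorphism K -> L} of lc \o iota]). Qed.

Lemma kLP c : k c -> kL (lc c).
Proof. by move=> [a _ <-]. Qed.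

Definition lgens s : seq L := map lc s ++ [seq @FracField.tofrac _ ('X_j : {mpoly F[n]}) | j <- enum 'I_n].

Lemma lgens_const s f : gen k s f -> gen kL (lgens s) (lc f).
Proof.
pose C := [set f | gen kL (lgens s) (lc f)]; have hL := gen_subring kL (lgens s).
apply: (@gen_min _ k s C) => [|c kc|x xs].
- split; rewrite /C /=.
 + by rewrite rmorph1; member.
 + by move=> x y; rewrite rmorphB; exact: subring_sub.
 + by move=> x y; rewrite rmorphM; exact: subring_mul.
- by apply: gen_base; exact: kLP.
- by apply: gen_mem; rewrite mem_cat map_f.
Qed.

Lemma lgens_frac s : fraction_field (gen k s) -> fraction_field (gen kL (lgens s)).
Proof.
move=> hF; have hB := gen_subring kL (lgens s); set B := gen kL (lgens s) in hB *.
have [hQ QB QV] := fractions_subring hB; set Q := fractions B in hQ QB QV.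
have Qc f : Q (lc f).
 have [a [b [Ba Bb b0 ->]]] := hF f; exists (lc a), (lc b); rewrite fmorph_div lc_neq0 //.
 by split=> //; exact: lgens_const.
have Qp (p : {mpoly F[n]}) : Q (FracField.tofrac p).
 rewrite [p]mpolyE rmorph_sum; apply: (subring_sum hQ) => m _ _.
 rewrite -mul_mpolyC rmorphM; apply: (subring_mul hQ); first exact: Qc.
 rewrite mpolyXE_id rmorph_prod; apply: QB; apply: (subring_prod hB) => j _ _; rewrite rmorphXn.
 apply: (subringX _ hB); apply: gen_mem; rewrite mem_cat; apply/orP; right.
 by apply/mapP; exists j; rewrite ?mem_enum.
by move=> x; have [p [q ->]] := fracP x; apply: (subring_mul hQ); [|apply: QV; exact: Qp].
Qed.

Lemma restrict_vr (R : set L) : valuation_subring R -> valuation_subring [set f | R (lc f)].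
Proof.
move=> [hR hV]; split; last by move=> f f0; have := hV _ (lc_neq0 f0); rewrite -fmorphV.
split=> [|x y|x y] /=; rewrite ?rmorph1 ?rmorphB ?rmorphM; [member|exact: subring_sub|exact: subring_mul].
Qed.

Lemma restrict_max (R : set L) f : maxid R (lc f) <-> maxid [set f | R (lc f)] f.
Proof. by rewrite /maxid /= -fmorphV fmorph_eq0. Qed.

Lemma restrict_kvr (R : set L) : kvr kL R -> kvr k [set f | R (lc f)].
Proof.
move=> [h1 h2 h3]; split; first exact: restrict_vr.
 by move=> c kc; apply: h2; exact: kLP.
move=> f Rf; have [_ [a _ <-] hc] := h3 _ Rf; exists (iota a) => //.
by apply/restrict_max; rewrite rmorphB.
Qed.

Lemma extend_kvr (R0 : set F) : kvr k R0 -> exists2 R, kvr kL R & [set f | R (lc f)] = R0.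
Proof.
move=> [h1 h2 h3]; pose A := [set lc f | f in R0]; pose J := [set lc f | f in maxid R0].
have hs := vr_sub h1; have hm := maxid_ideal h1.
have hA : subring_set A.
 split; first by exists 1; [member|].
  by move=> _ _ [f hf <-] [g hg <-]; exists (f - g); rewrite ?rmorphB //; member.
 by move=> _ _ [f hf <-] [g hg <-]; exists (f * g); rewrite ?rmorphM //; member.
have [|||||R [hR AR JR]] := exists_kvr (A := A) (J := J) acsub_L.
- by move=> _ [a _ <-]; exists (iota a) => //; apply: h2.
- by [].
- split.
 + by move=> _ [f [hf _] <-]; exists f.
 + by exists 0; [member|].
 + by move=> _ _ [f hf <-] [g hg <-]; exists (f + g); rewrite ?rmorphD //; member.
 + by move=> _ _ [f hf <-] [g hg <-]; exists (f * g); rewrite ?rmorphM //; member.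
- by move=> [f hf] /eqP; rewrite -subr_eq0 -rmorphB fmorph_eq0 subr_eq0 => /eqP f1;
  apply: (maxid_proper hs); rewrite -f1.
- move=> _ [f hf <-]; have [_ [a _ <-] hc] := h3 _ hf; exists (lc (iota a)) => //.
 by exists (f - iota a); rewrite ?rmorphB.
exists R => //; apply/seteqP; split=> f; last by move=> hf; apply: AR; exists f.
move=> Rf; apply: contrapT => nf; have [f0 mf] := vr_out h1 nf.
have m1 : maxid R (lc f^-1) by apply: JR; exists f^-1.
by apply: (@vr_max_out _ R (lc f)) => //; [exact: lc_neq0|rewrite -fmorphV].
Qed.

Variable (nu : L -> rat).
Hypothesis hnu : qval kL nu.

Lemma restrict_qval : qval k (nu \o lc).
Proof.
split=> /=.
- by move=> x y x0 y0; rewrite rmorphM (qvalM hnu) // lc_neq0.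
- by move=> x y x0 y0 xy0; rewrite rmorphD; apply: (qvalD hnu); rewrite -?rmorphD ?lc_neq0.
- by move=> c kc c0; apply: (qvalk hnu); [exact: kLP|exact: lc_neq0].
Qed.

Definition val_vect : 'rV[rat]_n := \row_j nu (@FracField.tofrac _ ('X_j : {mpoly F[n]})).

Lemma qval_char u : nu (X u) = pairing (lattice_vect u) val_vect.
Proof.
rewrite /pairing /character.
suff [] : nu (\prod_(j < n) @FracField.tofrac _ ('X_j : {mpoly F[n]}) ^ (u 0 j)) = \sum_j lattice_vect u 0 j * val_vect 0 j /\
  \prod_(j < n) @FracField.tofrac _ ('X_j : {mpoly F[n]}) ^ (u 0 j) != 0 by [].
elim/big_rec2: _ => [|j y1 y2 _ [IH nz]]; first by rewrite oner_neq0 (qval1 acsub_L hnu).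
have nz' : @FracField.tofrac _ ('X_j : {mpoly F[n]}) ^ u 0 j != 0 by rewrite expfz_neq0 ?var_neq0.
by rewrite (mulf_neq0 nz' nz) (qvalM hnu nz' nz) (qvalXz acsub_L hnu _ (var_neq0 j)) IH !mxE mulrC.
Qed.

Lemma qval_term p : p.1 != 0 -> nu (term p) = nu (lc p.1) + pairing (lattice_vect p.2) val_vect.
Proof. by move=> p0; rewrite (qvalM hnu) ?lc_neq0 ?char_neq0 // qval_char. Qed.

End Base.
End Laurent.

(** * Sections of polyhedral divisors *)

Section GaussValuation.
Variables (F : fieldType) (k : set F) (n : nat) (mu : F -> rat) (v : 'rV[rat]_n).
Hypotheses (hk : acsub k) (hmu : qval k mu).
Local Notation L := (laurent_field F n).

Let wt (p : F * 'rV[int]_n) : rat := mu p.1 + pairing (lattice_vect p.2) v.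
Let span (P : rat -> bool) : set L :=
 [set x | exists2 l, forall p, p \in l -> p.1 = 0 \/ P (wt p) & x = lsum l].

Let latticeD (u w : 'rV[int]_n) : lattice_vect (u + w) = lattice_vect u + lattice_vect w.
Proof. by rewrite /lattice_vect map_mxD. Qed.

Let spanD P x y : span P x -> span P y -> span P (x + y).
Proof.
move=> [l hl ->] [l' hl' ->]; exists (l ++ l'); last by rewrite /lsum big_cat.
by move=> p /in_catP[/hl|/hl'].
Qed.

Let spanM (P Q : rat -> bool) x y : (forall a b, P a -> Q b -> Q (a + b)) -> span P x -> span Q y -> span Q (x * y).
Proof.
move=> PQ [l hl ->] [l' hl' ->].
exists [seq (p.1 * q.1, p.2 + q.2) | p <- l, q <- l'].
 move=> _ /allpairsP[[p q] [/hl hp /hl' hq ->]] /=.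
 have [->|p0] := eqVneq p.1 0; first by left; rewrite mul0r.
 have [->|q0] := eqVneq q.1 0; first by left; rewrite mulr0.
 case: hp hq => [/eqP|hp]; first by rewrite (negbTE p0).
 case=> [/eqP|hq]; first by rewrite (negbTE q0).
 by right; rewrite /wt (qvalM hmu p0 q0) latticeD pairingDl addrACA PQ.
rewrite /lsum big_allpairs_dep mulr_suml; apply: eq_bigr => p _; rewrite mulr_sumr.
by apply: eq_bigr => q _; rewrite termM.
Qed.

(* The centre of the Gauss valuation fX^u |-> mu f + <u, v>. *)
Lemma gauss_valuation : exists2 R : set L, valuation_subring R & forall f u, f != 0 ->
 (0 <= mu f + pairing (lattice_vect u) v -> R (term (f, u))) /\
 (0 < mu f + pairing (lattice_vect u) v -> maxid R (term (f, u))).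
Proof.
pose A := span (fun c => 0 <= c); pose J := span (fun c => 0 < c).
have A1 : A 1.
 exists [:: (1, 0)]; last by rewrite /lsum big_seq1 term0.
 move=> p; rewrite inE => /eqP ->; right; rewrite /wt /= (qval1 hk hmu) add0r.
 by rewrite (_ : lattice_vect 0 = 0) ?pairing0l //; apply/rowP => j; rewrite !mxE.
have AN : A (-1).
 exists [:: (-1, 0)]; last by rewrite /lsum big_seq1 term0 rmorphN.
 move=> p; rewrite inE => /eqP ->; right; rewrite /wt /= (qvalN hk hmu) ?oner_neq0 // (qval1 hk hmu) add0r.
 by rewrite (_ : lattice_vect 0 = 0) ?pairing0l //; apply/rowP => j; rewrite !mxE.
have AM : forall x y, A x -> A y -> A (x * y) by move=> x y; apply: spanM => a b; exact: addr_ge0.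
have hA : subring_set A.
 by split=> // x y Ax Ay; rewrite -[- y]mulN1r; apply: spanD => //; exact: AM.
have hJ : ideal A J.
 split.
 - by move=> _ [l hl ->]; exists l => // p /hl[|/ltW]; [left|right].
 - by exists [::]; rewrite // /lsum big_nil.
 - by move=> x y; exact: spanD.
 - by move=> x y; apply: spanM => a b; exact: ltr_wpDl.
have J1 : ~ J 1.
 (* If 1 were a sum of terms of positive weight, comparing coefficients of the trivial character
    would make 1 a sum of elements of positive value. *)
 move=> [l hl E]; have hV := qval_vr hk hmu.
 have e0 : lsum ((-1, 0) :: l) = 0 by rewrite /lsum big_cons -/(lsum l) -E term0 rmorphN addNr.
 have := lsum_eq0 0 e0; rewrite big_cons eqxx => /eqP; rewrite addrC subr_eq0 => /eqP E1.
 apply: (maxid_proper (vr_sub hV)); rewrite -E1; apply: (ideal_sum (maxid_ideal hV)) => p pl /eqP p2.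
 have [->|p0] := eqVneq p.1 0; first member.
 apply/(qval_maxid hk hmu p0); case: (hl p pl) => [/eqP|]; first by rewrite (negbTE p0).
 by rewrite /wt p2 (_ : lattice_vect 0 = 0) ?pairing0l ?addr0 //; apply/rowP => j; rewrite !mxE.
have [R [hR AR JR]] := exists_vr hA hJ J1.
exists R => // f u f0; split=> h; [apply: AR|apply: JR]; exists [:: (f, u)];
 by [rewrite /lsum big_seq1|move=> p; rewrite inE => /eqP ->; right].
Qed.

End GaussValuation.

Lemma lattice0 n : lattice_vect (0 : 'rV[int]_n) = 0.
Proof. by apply/rowP => j; rewrite !mxE. Qed.
Lemma latticeD n (u w : 'rV[int]_n) : lattice_vect (u + w) = lattice_vect u + lattice_vect w.
Proof. by rewrite /lattice_vect map_mxD. Qed.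
Lemma latticeN n (u : 'rV[int]_n) : lattice_vect (- u) = - lattice_vect u.
Proof. by rewrite /lattice_vect map_mxN. Qed.
Lemma latticeMn n (u : 'rV[int]_n) m : lattice_vect (u *+ m) = m%:R *: lattice_vect u.
Proof. by elim: m => [|m IH]; rewrite ?lattice0 ?scale0r // mulrS latticeD IH -nat1r scalerDl scale1r. Qed.

(** * Prevarieties glued from affine charts *)

Section Values.
Variables (K : closedFieldType) (M : fieldType) (io : {rmorphism K -> M}).
Local Notation k := (range io).
Implicit Types (O R : set M) (f g : M).
Let hk : acsub k := acsub_range io.

Record rational_local O : Prop := RationalLocal {
 rl_local : local O;
 rl_base : k `<=` O;
 rl_rat : rational k O (maxid O) }.

Lemma kvr_rl R : kvr k R -> rational_local R.
Proof. by move=> [h1 h2 h3]; split=> //; exact: vr_local. Qed.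

Section One.
Variable O : set M.
Hypothesis hO : rational_local O.
Local Notation val := (value_at io O).
Let sO : subring_set O := proj1 (rl_local hO).
Let mO : ideal O (maxid O) := local_ideal (rl_local hO).

Lemma valP f : O f -> maxid O (f - io (val f)).
Proof.
by move=> /(rl_rat hO)[_ [c _ <-] hc]; apply: (@xgetPex _ 0 [set c | maxid O (f - io c)]); exists c.
Qed.

Lemma val_uniq f c : maxid O (f - io c) -> val f = c.
Proof.
move=> hc; have hd : maxid O (f - io (val f)) by apply: (@xgetPex _ 0 [set c | maxid O (f - io c)]); exists c.
apply/eqP; rewrite -subr_eq0; apply: contrapT => /negP ne.
have : maxid O (io (val f - c)) by have := idealB sO mO hc hd; congr maxid; ring.
by apply: unit_notmax; [rewrite fmorph_eq0|rewrite -fmorphV; apply: (rl_base hO); exists (val f - c)^-1].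
Qed.

Lemma val_in f : O f -> O (f - io (val f)) /\ O (io (val f)).
Proof. by move=> /valP h; split; [member|apply: (rl_base hO); exists (val f)]. Qed.

Lemma valD f g : O f -> O g -> val (f + g) = val f + val g.
Proof.
move=> hf hg; apply: val_uniq; rewrite rmorphD.
have -> : f + g - (io (val f) + io (val g)) = (f - io (val f)) + (g - io (val g)) by ring.
by apply: (idealD mO); exact: valP.
Qed.

Lemma valM f g : O f -> O g -> val (f * g) = val f * val g.
Proof.
move=> hf hg; apply: val_uniq; rewrite rmorphM.
have -> : f * g - io (val f) * io (val g) = f * (g - io (val g)) + io (val g) * (f - io (val f)) by ring.
by apply: (idealD mO); apply: (idealM mO) => //; [exact: valP|case: (val_in hg)|exact: valP].
Qed.

Lemma val_const c : val (io c) = c.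
Proof. by apply: val_uniq; rewrite subrr; member. Qed.

Lemma val_eq0 f : O f -> val f = 0 <-> maxid O f.
Proof.
move=> hf; split=> [e|h]; first by have := valP hf; rewrite e rmorph0 subr0.
by apply: val_uniq; rewrite rmorph0 subr0.
Qed.

Lemma val_sum (t : seq (M * M)) : (forall q, q \in t -> O q.1 /\ O q.2) ->
 val (\sum_(q <- t) q.1 * q.2) = \sum_(q <- t) val q.1 * val q.2.
Proof.
elim: t => [|q t IH] ht; first by rewrite !big_nil -(rmorph0 io) val_const.
have ht' p : p \in t -> O p.1 /\ O p.2 by move=> /mem_tail/ht.
have [h1 h2] := ht q (mem_head _ _); rewrite !big_cons valD ?valM ?IH //; first member.
by apply: (subring_sum sO) => p /ht'[h3 h4] _; member.
Qed.

End One.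

Lemma val_dominates R O f : rational_local R -> rational_local O -> dominates R O -> O f ->
 value_at io R f = value_at io O f.
Proof.
move=> hR hO [OR mR] hf; apply: (val_uniq hR).
by have := valP hO hf; rewrite mR => -[].
Qed.

End Values.

Section Atlas.
Variables (K : closedFieldType) (M : fieldType) (io : {rmorphism K -> M}).
Local Notation k := (range io).
Let hk : acsub k := acsub_range io.

(** The common form of varieties and of X(S): all chart rings A_i lie in one field M, and [lr x] is
    the local ring at x. Points of different charts may share a local ring without being equal, so
    injectivity is required within a chart only. Finite generation is asked up to integrality, by
    valuation rings. *)
Record atlas (T : space_fun K) (I : Type) (A : I -> set M) (ch : I -> set T) (lr : T -> set M) : Prop := Atlas {
 at_sub : forall i, subring_set (A i);
 at_base : forall i, k `<=` A i;
 at_fin : forall i, exists G : seq M, G `in` A i /\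
  forall R, valuation_subring R -> k `<=` R -> G `in` R -> A i `<=` R;
 at_cover : forall x, exists i, ch i x;
 at_loc : forall i x, ch i x -> exists p, [/\ prime_ideal (A i) p, rational k (A i) p & lr x = localization (A i) p];
 at_center : forall i R, kvr k R -> A i `<=` R -> exists2 x, ch i x & dominates R (lr x);
 at_inj : forall i x x', ch i x -> ch i x' -> lr x = lr x' -> x = x';
 at_open : forall U, is_open U <-> forall i x, ch i x -> U x -> exists s : seq M,
  s `in` lr x /\ forall x', ch i x' -> s `in` lr x' -> U x';
 at_regular : forall U h, regular U h <-> forall i x, ch i x -> U x -> exists (f : M) (s : seq M),
  s `in` lr x /\ forall z, ch i z -> s `in` lr z -> U z ->
   lr z f /\ h z = value_at io (lr z) f;
 at_overlap : forall i j x, ch i x -> ch j x -> exists s : seq M, s `in` lr x /\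
  forall x', ch i x' -> s `in` lr x' -> ch j x';
 at_meet : forall i j, exists x, ch i x /\ ch j x }.

Section One.
Variables (T : space_fun K) (I : Type) (A : I -> set M) (ch : I -> set T) (lr : T -> set M).
Hypothesis hT : atlas A ch lr.

Definition separated_places := forall R x x', kvr k R -> dominates R (lr x) -> dominates R (lr x') -> x = x'.
Definition proper_places := forall R, kvr k R -> exists i, A i `<=` R.

Lemma at_sub_lr i x : ch i x -> A i `<=` lr x.
Proof. move=> /(at_loc hT)[p [hp _ ->]]; exact: (loc_base (at_sub hT i) hp). Qed.

Lemma at_rl x : rational_local io (lr x).
Proof.
have [i hi] := at_cover hT x; have [p [hp rp E]] := at_loc hT hi; have hA := at_sub hT i.
have kA : k `<=` A i by exact: (at_base hT).
by rewrite E; split; [member|member|exact: loc_rational].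
Qed.

Lemma at_kvr x : exists2 R, kvr k R & dominates R (lr x).
Proof. by have [h1 h2 h3] := at_rl x; exact: rational_kvr. Qed.

(* The trace of the maximal ideal determines the local ring, since it is maximal. *)
Lemma at_dominates i x R : ch i x -> kvr k R -> A i `<=` R ->
 (forall a, A i a -> maxid (lr x) a -> maxid R a) -> dominates R (lr x).
Proof.
move=> hi hR AR h; have [p [hp rp E]] := at_loc hT hi; have hA := at_sub hT i.
have hq := maxid_prime (kvr_vr hR) hA AR.
suff -> : lr x = localization (A i) (maxid R `&` A i) by exact: center_dom (kvr_vr hR) hA AR.
have pq : p `<=` maxid R `&` A i.
 move=> a pa; have Aa := prime_sub hp pa; split=> //; apply: h => //; rewrite E; exact/(loc_max_trace hA hp).
rewrite E; congr localization; apply/seteqP; split=> //.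
by apply: (rational_max hk (@at_base _ _ _ _ _ hT i)).
Qed.

(** Finitely many elements of the local ring at x have a common denominator b in A_i; the loci where
    such a 1/b is regular form a basis of the chart. *)
Lemma basic_open i x (s : seq M) : ch i x -> s `in` lr x ->
 exists b, [/\ A i b, b != 0, lr x b^-1 & forall z, ch i z -> lr z b^-1 -> s `in` lr z].
Proof.
move=> hi; have [p [hp rp E]] := at_loc hT hi; have hA := at_sub hT i.
elim: s => [|f s IH] hs.
 by exists 1; rewrite oner_neq0 invr1; split=> //; [member|exact: subring_one (proj1 (rl_local (at_rl x)))].
have [|b [Ab b0 ib hb]] := IH; first by move=> g /mem_tail/hs.
have := hs f (mem_head _ _); rewrite E => -[a [c [Aa Ac nc fE]]]; have c0 := notp_neq0 hp nc.
exists (b * c); split; [member|by rewrite mulf_neq0| |].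
 rewrite -E invfM; apply: (subring_mul (proj1 (rl_local (at_rl x)))) => //; rewrite E; member.
move=> z hz ibc; have sz := proj1 (rl_local (at_rl z)); have Az := at_sub_lr hz.
have iz : lr z b^-1 by rewrite -[b^-1](mulfK c0) mulrC mulrA -invfM [c * b]mulrC; member.
move=> g /in_consP[->|]; last exact: hb.
have -> : f = a * b * (b * c)^-1 by rewrite fE; field; rewrite c0.
member.
Qed.

Lemma chart_open i : is_open (ch i).
Proof. by apply/(at_open hT) => j x hj hi; exact: (at_overlap hT hj hi). Qed.

Lemma value_regular i a : A i a -> regular (ch i) (fun z => value_at io (lr z) a).
Proof. by move=> Aa; apply/(at_regular hT) => j x hj hi; exists a, [::]; split=> // z _ _ zi; split=> //; exact: (at_sub_lr zi Aa). Qed.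

End One.

(* If the maximal ideals of the points x and x' do not generate a proper ideal of the ring A_i A_j,
  then an equation 1 = sum a b separates (x, x') from the linked pairs of points. *)
Lemma linked_closed (T T' : space_fun K) (I I' : Type) (A : I -> set M) (A' : I' -> set M) (ch : I -> set T)
  (ch' : I' -> set T') (lr : T -> set M) (lr' : T' -> set M) : atlas A ch lr -> atlas A' ch' lr' ->
 @prod_open _ T T' (~` [set p | exists2 R, kvr k R & dominates R (lr p.1) /\ dominates R (lr' p.2)]).
Proof.
move=> hT hT' [x x'] /= nl; have [i hi] := at_cover hT x; have [j hj] := at_cover hT' x'.
have [hA hA'] := (at_sub hT i, at_sub hT' j).
have [Ax Ax'] := (at_sub_lr hT hi, at_sub_lr hT' hj); have [rx rx'] := (at_rl hT x, at_rl hT' x').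
have [ix ix'] := (local_ideal (rl_local rx), local_ideal (rl_local rx')).
pose C (P : M * M -> Prop) := [set c | exists2 t : seq (M * M), forall q, q \in t -> [/\ A i q.1, A' j q.2 & P q] & c = \sum_(q <- t) q.1 * q.2].
pose mx (q : M * M) := maxid (lr x) q.1 \/ maxid (lr' x') q.2.
have CD P a b : C P a -> C P b -> C P (a + b).
 move=> [t ht ->] [t' ht' ->]; exists (t ++ t'); last by rewrite big_cat.
 by move=> q /in_catP[/ht|/ht'].
have CM (P Q : M * M -> Prop) a b : (forall q q', A i q.1 -> A' j q.2 -> P q -> Q q' -> Q (q.1 * q'.1, q.2 * q'.2)) ->
  C P a -> C Q b -> C Q (a * b).
 move=> PQ [t ht ->] [t' ht' ->]; exists [seq (q.1 * q'.1, q.2 * q'.2) | q <- t, q' <- t'].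
  move=> _ /allpairsP[[q q'] [/ht[h1 h2 h3] /ht'[h4 h5 h6] ->]] /=.
  by split; [member|member|exact: PQ].
 rewrite big_allpairs_dep mulr_suml; apply: eq_bigr => q _; rewrite mulr_sumr.
 by apply: eq_bigr => q' _; rewrite mulrACA.
have C1 a b (P : M * M -> Prop) : A i a -> A' j b -> P (a, b) -> C P (a * b).
 by move=> ha hb hP; exists [:: (a, b)]; rewrite ?big_seq1 // => q; rewrite inE => /eqP ->.
have [o1 o2] := (subring_one hA, subring_one hA').
have CA a : A i a -> C (fun=> True) a by move=> ha; rewrite -[a]mulr1; exact: C1.
have CA' a : A' j a -> C (fun=> True) a by move=> ha; rewrite -[a]mul1r; exact: C1.
have hC : subring_set (C (fun=> True)).
 split; [member|move=> a b ha hb|by move=> a b; exact: CM].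
 rewrite -mulN1r; apply: CD => //; apply: (CM (fun=> True)) => //; member.
have hJ : ideal (C (fun=> True)) (C mx).
 split.
 - by move=> _ [t ht ->]; exists t => // q /ht[].
 - by exists [::]; rewrite ?big_nil.
 - exact: CD.
 - move=> a b; apply: CM => q q' h1 h2 _ [h|h]; [left|right]; [exact: (idealM ix (Ax _ h1))|exact: (idealM ix' (Ax' _ h2))].
have [t ht E] : C mx 1.
 apply: contrapT => J1; apply: nl.
 have [||R [hR CR JR]] := exists_kvr (J := C mx) hk _ hC hJ J1.
 - by move=> c kc; apply: CA; exact: (at_base hT).
 - move=> _ [t ht ->]; exists (\sum_(q <- t) io (value_at io (lr x) q.1 * value_at io (lr' x') q.2)).
   by apply: (subring_sum (ac_sub hk)) => q _ _.
  rewrite -sumrB big_seq; apply: (big_ind (C mx)) => [|a b|q /ht[h1 h2 _]]; [member|exact: CD|].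
  set c := value_at io (lr x) q.1; set d := value_at io (lr' x') q.2.
  have -> : q.1 * q.2 - io (c * d) = (q.1 - io c) * q.2 + io c * (q.2 - io d) by ring.
  have [kc kd] : A i (io c) /\ A' j (io d) by split; [apply: (at_base hT)|apply: (at_base hT')].
  apply: CD; apply: C1 => //; [member|left; exact: (valP rx (Ax _ h1))|member|].
  by right; exact: (valP rx' (Ax' _ h2)).
 exists R => //; split.
  apply: (at_dominates hT hi hR) => a ha; first member.
  by move=> ma; apply: JR; rewrite -[a]mulr1; apply: C1 => //; left.
 apply: (at_dominates hT' hj hR) => a ha; first member.
 by move=> ma; apply: JR; rewrite -[a]mul1r; apply: C1 => //; right.
(* The additional -1 turns the equation into an expression with value -1 at (x, x') and value 0 at
   all linked pairs. *)
pose t1 := (1, -1) :: t.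
have ht1 q : q \in t1 -> A i q.1 /\ A' j q.2.
 case/in_consP=> [-> /=|/ht[]]; split=> //; member.
have sumE (G : M * M -> K) : \sum_(m < size t1) G (nth 0 t1 m) = \sum_(q <- t1) G q.
 by rewrite [RHS](big_nth 0) big_mkord.
exists (ch i), (ch' j); split=> //; [exact: (chart_open hT)|exact: (chart_open hT')|].
exists (size t1), (fun m z => value_at io (lr z) (nth 0 t1 m).1), (fun m z => value_at io (lr' z) (nth 0 t1 m).2); split.
- by move=> m; apply: (value_regular hT); case: (ht1 _ (mem_nth 0 (ltn_ord m))).
- by move=> m; apply: (value_regular hT'); case: (ht1 _ (mem_nth 0 (ltn_ord m))).
- rewrite (sumE (fun q => value_at io (lr x) q.1 * value_at io (lr' x') q.2)) big_cons big1_seq ?addr0 /=.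
  rewrite -(rmorph1 io) -rmorphN (val_const rx) (val_const rx') mul1r; by rewrite oppr_eq0 oner_neq0.
 move=> q /ht[h1 h2 [h|h]]; first by rewrite (proj2 (val_eq0 rx (Ax _ h1)) h) mul0r.
 by rewrite (proj2 (val_eq0 rx' (Ax' _ h2)) h) mulr0.
- move=> [z z'] /= hz hz'; rewrite (sumE (fun q => value_at io (lr z) q.1 * value_at io (lr' z') q.2)) => nz [R hR [/= dz dz']].
 have rR := kvr_rl hR; move/eqP: nz; apply.
 have [Az Az'] := (at_sub_lr hT hz, at_sub_lr hT' hz').
 transitivity (value_at io R (\sum_(q <- t1) q.1 * q.2)); last first.
  by rewrite big_cons -E mul1r addNr -(rmorph0 io) (val_const rR).
 rewrite (val_sum rR).
  apply: eq_big_seq => q /ht1[h1 h2]; rewrite (val_dominates rR (at_rl hT z) dz (Az _ h1)).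
  by rewrite (val_dominates rR (at_rl hT' z') dz' (Az' _ h2)).
 by move=> q /ht1[/Az h1 /Az' h2]; split; [exact: (proj1 dz)|exact: (proj1 dz')].
Qed.

(** If places have unique centres, the diagonal is the set of linked pairs, closed by
    [linked_closed]. Conversely, if distinct x and x' are linked by R, the expression separating (x,
    x') from the diagonal defines an element th of the field, nonzero because its value at R is. *)
Theorem separatedP (T : space_fun K) (I : Type) (A : I -> set M) (ch : I -> set T) (lr : T -> set M) :
 atlas A ch lr -> separated T <-> separated_places lr.
Proof.
move=> hT; split=> [hsep R x x' hR dx dx'|hs]; last first.
 rewrite /separated; have -> : [set p : T * T | p.1 = p.2] = [set p | exists2 R, kvr k R & dominates R (lr p.1) /\ dominates R (lr p.2)].
  apply/seteqP; split=> [[x x'] /= <-|[x x'] [R hR [h1 h2]]]; last exact: (hs R).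
  by have [R hR dR] := at_kvr hT x; exists R.
 exact: (linked_closed hT hT).
apply: contrapT => ne; have [i hi] := at_cover hT x; have [j hj] := at_cover hT x'.
have [U [V [oU oV Ux Vx' [r [f [g [rf rg n0 hn]]]]]]] := hsep (x, x') ne.
have [sU [sU1 sU2]] := proj1 (at_open hT U) oU i x hi Ux.
have [sV [sV1 sV2]] := proj1 (at_open hT V) oV j x' hj Vx'.
have /choice[fs hfs] : forall m, exists q : M * seq M, q.2 `in` lr x /\
  forall z, ch i z -> q.2 `in` lr z -> U z -> lr z q.1 /\ f m z = value_at io (lr z) q.1.
 by move=> m; have [q [s h]] := proj1 (at_regular hT U (f m)) (rf m) i x hi Ux; exists (q, s).
have /choice[gs hgs] : forall m, exists q : M * seq M, q.2 `in` lr x' /\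
  forall z, ch j z -> q.2 `in` lr z -> V z -> lr z q.1 /\ g m z = value_at io (lr z) q.1.
 by move=> m; have [q [s h]] := proj1 (at_regular hT V (g m)) (rg m) j x' hj Vx'; exists (q, s).
have [w [wi wj]] := at_meet hT i j; have [so [so1 so2]] := at_overlap hT wi wj.
have [b [Ab b0 ib hb]] := basic_open hT wi so1.
have [|b1 [Ab1 b10 ib1 hb1]] := basic_open hT (s := sU ++ flatten [seq (fs m).2 | m <- enum 'I_r]) hi.
 move=> q /in_catP[/sU1 //|/flattenP[_ /mapP[m _ ->]]]; exact: (proj1 (hfs m)).
have [|b2 [Ab2 b20 ib2 hb2]] := basic_open hT (s := sV ++ flatten [seq (gs m).2 | m <- enum 'I_r]) hj.
 move=> q /in_catP[/sV1 //|/flattenP[_ /mapP[m _ ->]]]; exact: (proj1 (hgs m)).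
pose th := \sum_m (fs m).1 * (gs m).1; have rR := kvr_rl hR.
have lx m : lr x (fs m).1 /\ f m x = value_at io (lr x) (fs m).1 by apply: (proj2 (hfs m)) => //; exact: (proj1 (hfs m)).
have lx' m : lr x' (gs m).1 /\ g m x' = value_at io (lr x') (gs m).1 by apply: (proj2 (hgs m)) => //; exact: (proj1 (hgs m)).
have valR R' z z' : kvr k R' -> dominates R' (lr z) -> dominates R' (lr z') ->
  (forall m, lr z (fs m).1 /\ f m z = value_at io (lr z) (fs m).1) ->
  (forall m, lr z' (gs m).1 /\ g m z' = value_at io (lr z') (gs m).1) ->
  R' th /\ value_at io R' th = \sum_m f m z * g m z'.
 move=> hR' dz dz' hz hz'; have rR' := kvr_rl hR'.
 have thE : th = \sum_(q <- [seq ((fs m).1, (gs m).1) | m <- enum 'I_r]) q.1 * q.2 by rewrite big_map enumT.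
 have tR q : q \in [seq ((fs m).1, (gs m).1) | m <- enum 'I_r] -> R' q.1 /\ R' q.2.
  by move=> /mapP[m _ ->]; split; [apply: (proj1 dz); case: (hz m)|apply: (proj1 dz'); case: (hz' m)].
 split.
  rewrite thE; apply: (subring_sum (vr_sub (kvr_vr hR'))) => q /tR[h1 h2] _.
  member.
 rewrite thE (val_sum rR' tR) big_map enumT; apply: eq_bigr => m _ /=.
 have [[h1 ->] [h2 ->]] := (hz m, hz' m).
 by rewrite (val_dominates rR' (at_rl hT z) dz h1) (val_dominates rR' (at_rl hT z') dz' h2).
have [Rth vth] := valR R x x' hR dx dx' lx lx'.
have [G [GA hG]] := at_fin hT i.
have th0 : th != 0 by apply: contraTneq n0 => e; rewrite -vth e -(rmorph0 io) (val_const rR) eqxx.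
(* A place finite on these inverses is centred at a point z of both charts, inside U and V, at which
   th does not vanish; but (z, z) lies on the diagonal. *)
have [R' hR' lR'] := nullstellensatz hk ([:: th^-1; b^-1; b1^-1; b2^-1] ++ G).
have lR c : c \in [:: th^-1; b^-1; b1^-1; b2^-1] -> R' c by move=> h; apply: lR'; rewrite mem_cat h.
have AR : A i `<=` R' by apply: hG; [member|member|move=> a aG; apply: lR'; rewrite mem_cat aG orbT].
have [z zi dz] := at_center hT hR' AR.
have unit_lr j' c : ch j' z -> A j' c -> c != 0 -> R' c^-1 -> lr z c^-1.
 move=> hj' /(at_sub_lr hT hj'); exact: (dominates_inv dz).
have zb := unit_lr _ _ zi Ab b0 (lR b^-1 _); have zj : ch j z by apply: so2 => //; apply: hb => //; apply: zb; rewrite !inE eqxx ?orbT.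
have z1 := hb1 z zi (unit_lr _ _ zi Ab1 b10 (lR b1^-1 ltac:(by rewrite !inE eqxx ?orbT))).
have z2 := hb2 z zj (unit_lr _ _ zj Ab2 b20 (lR b2^-1 ltac:(by rewrite !inE eqxx ?orbT))).
have Uz : U z by apply: sU2 => // q qs; apply: z1; rewrite mem_cat qs.
have Vz : V z by apply: sV2 => // q qs; apply: z2; rewrite mem_cat qs.
have [||R'th vz] := valR R' z z hR' dz dz.
- move=> m; apply: (proj2 (hfs m)) => // q qs; apply: z1; rewrite mem_cat; apply/orP; right.
 by apply/flattenP; exists (fs m).2 => //; apply: map_f; rewrite mem_enum.
- move=> m; apply: (proj2 (hgs m)) => // q qs; apply: z2; rewrite mem_cat; apply/orP; right.
 by apply/flattenP; exists (gs m).2 => //; apply: map_f; rewrite mem_enum.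
apply: (hn (z, z) Uz Vz) => //=; rewrite -vz; apply/eqP => /(val_eq0 (kvr_rl hR') R'th).
by apply: (unit_notmax th0); apply: lR; rewrite !inE eqxx.
Qed.

End Atlas.

(** * Complete prevarieties *)

Section Ultra.
Variables (K : closedFieldType) (J : Type) (G : set_system J).
Hypothesis hG : UltraFilter G.

Let GI (P Q : set J) : G P -> G Q -> G (P `&` Q). Proof. exact: filterI. Qed.
Let GS (P Q : set J) : P `<=` Q -> G P -> G Q. Proof. exact: filterS. Qed.

Let umax : set (J -> K) := [set f | G [set s | f s = 0]].

Lemma ultra_inv (f : J -> K) : [set: J -> K] f -> ~ umax f -> exists2 g, [set: J -> K] g & umax (f * g - 1).
Proof.
move=> _ nf; exists (fun s => (f s)^-1) => //.
have [//|] := in_ultra_setVsetC [set s | f s = 0] hG.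
by apply: GS => s /eqP fs; rewrite /GRing.add /GRing.mul /= divff // subrr.
Qed.

(** The ultrapower of K: functions on J modulo those that vanish on a member of G. *)
Definition ultra : resdata (J -> K).
Proof.
apply: (@ResData _ [set: J -> K] umax) => //; last exact: ultra_inv.
- by apply: filterS (@filterT _ G _).
- by move=> f g hf hg; apply: GS (GI hf hg) => s [/= h1 h2]; rewrite /GRing.add /= /GRing.opp /= h1 h2 subrr.
- by move=> a f _; apply: GS => s /= h; rewrite /GRing.mul /= h mulr0.
- move=> h; have /filter_ex[s /eqP] := h; by rewrite oner_eq0.
Defined.
Local Notation pi := (pi ultra).
Local Notation Ks := (kap ultra).

Lemma ultra_eq (f g : J -> K) : pi f = pi g <-> G [set s | f s = g s].
Proof.
rewrite pi_eqP; split; apply: GS => s /= h; first by apply/eqP; rewrite -subr_eq0; apply/eqP.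
by rewrite /GRing.add /= h subrr.
Qed.

Definition uconst (c : K) : Ks := pi (fun=> c).
Fact uconst_zmod : zmod_morphism uconst.
Proof. by move=> a b; rewrite -piB. Qed.
HB.instance Definition _ := GRing.isZmodMorphism.Build K Ks uconst uconst_zmod.
Fact uconst_monoid : monoid_morphism uconst.
Proof. by split=> [|a b]; [|rewrite -piM]. Qed.
HB.instance Definition _ := GRing.isMonoidMorphism.Build K Ks uconst uconst_monoid.

Section Place.
Variables (M : fieldType) (io : {rmorphism K -> M}) (Rs : J -> set M).
Hypothesis hRs : forall s, kvr (range io) (Rs s).
Local Notation val s := (value_at io (Rs s)).

(* The ultraproduct of the places Rs s, with values in the field Ks. *)
Definition star : set M := [set g | G [set s | Rs s g]].
Definition res (g : M) : Ks := pi (fun s => val s g).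

Let rl s : rational_local io (Rs s) := kvr_rl (hRs s).

Lemma star_sub : subring_set star.
Proof.
split; first by apply: filterS (@filterT _ G _) => s _; exact: subring_one (vr_sub (kvr_vr (hRs s))).
- by move=> x y hx hy; apply: GS (GI hx hy) => s []; exact: subring_sub (vr_sub (kvr_vr (hRs s))) _ _.
- by move=> x y hx hy; apply: GS (GI hx hy) => s []; exact: subring_mul (vr_sub (kvr_vr (hRs s))) _ _.
Qed.

Lemma resD g h : star g -> star h -> res (g + h) = res g + res h.
Proof. by move=> hg hh; rewrite -piD //; apply/ultra_eq; apply: GS (GI hg hh) => s [h1 h2]; exact: (valD (rl s)). Qed.
Lemma resM g h : star g -> star h -> res (g * h) = res g * res h.
Proof. by move=> hg hh; rewrite -piM //; apply/ultra_eq; apply: GS (GI hg hh) => s [h1 h2]; exact: (valM (rl s)). Qed.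
Lemma res_const c : res (io c) = uconst c.
Proof. by apply/ultra_eq; apply: filterS (@filterT _ G _) => s _; exact: val_const (rl s) c. Qed.

Lemma star_const c : star (io c).
Proof. by apply: filterS (@filterT _ G _) => s _; apply: (rl_base (rl s)). Qed.

Lemma res1 : res 1 = 1.
Proof. by have := res_const 1; rewrite rmorph1 => ->. Qed.

Lemma res0 : res 0 = 0.
Proof. by have := res_const 0; rewrite rmorph0 => ->. Qed.

Lemma resB g h : star g -> star h -> res (g - h) = res g - res h.
Proof.
move=> hg hh; apply/eqP; rewrite eq_sym subr_eq -resD ?subrK //; exact: (subring_sub star_sub).
Qed.

Lemma resB_const g c : star g -> res (g - io c) = res g - uconst c.
Proof.
by move=> hg; rewrite (resB hg (star_const c)) res_const.
Qed.

Lemma star_unit g : star g -> res g != 0 -> star g^-1 /\ res g^-1 = (res g)^-1.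
Proof.
move=> hg n0; have hi : G [set s | ~ maxid (Rs s) g].
 have [h|//] := in_ultra_setVsetC [set s | maxid (Rs s) g] hG.
 case/eqP: n0; rewrite -(rmorph0 uconst); apply/ultra_eq; apply: GS (GI hg h) => s [h1 h2].
 exact: (proj2 (val_eq0 (rl s) h1)).
have hs : star g^-1 by apply: GS (GI hg hi) => s [h1 h2]; case: (vr_unit h1 h2).
split=> //; apply: (mulIf n0); rewrite mulVf // -resM // -(rmorph1 uconst).
apply/ultra_eq; apply: GS (GI hg hi) => s [h1 h2]; have [g0 _] := vr_unit h1 h2.
by rewrite /= mulVf // -(rmorph1 io) (val_const (rl s)).
Qed.

Lemma star_vr g : ~ star g -> [/\ g != 0, star g^-1 & res g^-1 = 0].
Proof.
move=> ng; have h : G [set s | maxid (Rs s) g^-1 /\ g != 0].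
 have [//|] := in_ultra_setVsetC [set s | Rs s g] hG.
 by apply: GS => s /(vr_out (kvr_vr (hRs s)))[].
have /filter_ex[s0 [_ g0]] := h; split=> //; first by apply: GS h => s [h1 _]; exact: maxid_sub h1.
apply/ultra_eq; apply: GS h => s [h1 _]; exact: (proj2 (val_eq0 (rl s) (maxid_sub h1))).
Qed.

Variable V : set Ks.
Hypothesis hV : kvr (range uconst) V.
(** The family of places gives values in the ultrapower, and the place V of the ultrapower plays the
    part of the standard part map back to K. *)
Definition composite : set M := [set g | star g /\ V (res g)].

Lemma composite_max g : composite g -> maxid composite g <-> maxid V (res g).
Proof.
move=> [hg vg]; split=> [[_ h]|[_ h]].
 split=> // -[r0 vi]; apply: h; have [hi ri] := star_unit hg r0; split; last by split=> //; rewrite ri.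
 by apply: contraNneq r0 => g0; rewrite g0 -(rmorph0 io) res_const.
split=> // -[g0 [hi vi]]; apply: h; have n0 : res g != 0.
 apply/eqP => e; have := resM hg hi; rewrite divff // e mul0r -(rmorph1 io) res_const rmorph1 => /eqP.
 by rewrite oner_eq0.
by split=> //; have [_ <-] := star_unit hg n0.
Qed.

Lemma composite_kvr : kvr (range io) composite.
Proof.
have sV := vr_sub (kvr_vr hV).
have hc c : composite (io c) by split; [exact: star_const|rewrite res_const; apply: (kvr_k hV); exists c].
have cM g h : composite g -> composite h -> composite (g * h).
 by move=> [h1 h2] [h3 h4]; split; [exact: (subring_mul star_sub)|rewrite resM; member].
have cD g h : composite g -> composite h -> composite (g + h).
 by move=> [h1 h2] [h3 h4]; split; [exact: (subringD star_sub)|rewrite resD; member].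
split; last 1 first.
- move=> g hg; have [h1 h2] := hg; have [_ [c _ <-] hcV] := kvr_rat hV h2; exists (io c) => //.
 have cg : composite (g - io c) by rewrite -rmorphN; apply: cD.
 by apply/(composite_max cg); rewrite resB_const.
- split; first split.
 + by rewrite -(rmorph1 io).
 + by move=> x y hx hy; apply: cD => //; rewrite -mulN1r -(rmorph1 io) -rmorphN; exact: cM.
 + by [].
 move=> g g0; have [hg|/star_vr[_ h1 h2]] := pselect (star g); last first.
  by right; split=> //; rewrite h2; member.
 have [vg|nv] := pselect (V (res g)); first by left.
 have [r0 mi] := vr_out (kvr_vr hV) nv; have [hi ri] := star_unit hg r0.
 by right; split=> //; rewrite ri; exact: maxid_sub.
- by move=> _ [c _ <-].
Qed.

Section Limit.
Variables (T : space_fun K) (I : Type) (A : I -> set M) (ch : I -> set T) (lr : T -> set M).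
Hypothesis hT : atlas io A ch lr.
Variables (ys : J -> T) (y : T) (i : I).
Hypotheses (hys : forall s, dominates (Rs s) (lr (ys s))) (hi : ch i y) (dy : dominates composite (lr y))
 (gch : G [set s | ch i (ys s)]).

Lemma limit_local (l : seq M) : l `in` lr y -> G [set s | ch i (ys s) /\ l `in` lr (ys s)].
Proof.
move=> hl; have [b [Ab b0 ib hb]] := basic_open hT hi hl; have [sib _] := proj1 dy _ ib.
apply: GS (GI gch sib) => s [hc ri]; split=> //; apply: hb => //.
exact: (dominates_inv (hys s) (at_sub_lr hT hc Ab)).
Qed.

Lemma limit_open U : is_open U -> U y -> G [set s | ch i (ys s) /\ U (ys s)].
Proof.
move=> oU Uy; have [l [l1 l2]] := proj1 (at_open hT U) oU i y hi Uy.
by apply: GS (limit_local l1) => s [h1 h2]; split=> //; exact: l2.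
Qed.

Lemma limit_regular U h : is_open U -> regular U h -> U y -> exists phi, [/\ star phi,
 maxid V (res phi - uconst (h y)) & G [set s | h (ys s) = val s phi]].
Proof.
move=> oU rh Uy; have [phi [l [l1 l2]]] := proj1 (at_regular hT U h) rh i y hi Uy.
have [yphi hphi] := l2 y hi l1 Uy; have [sphi vphi] := proj1 dy _ yphi.
exists phi; split=> //.
 have m1 := valP (at_rl hT y) yphi; have [c1 _] := val_in (at_rl hT y) yphi.
 rewrite -resB_const // hphi; apply/composite_max; first exact: (proj1 dy).
 by apply/(dominates_max dy).
apply: GS (GI (limit_open oU Uy) (limit_local l1)) => s [[hc Us] [_ hs]].
have [h1 /= ->] := l2 _ hc hs Us; by rewrite (val_dominates (rl s) (at_rl hT _) (hys s) h1).
Qed.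

End Limit.

Lemma star_list (l : seq M) : l `in` star -> G [set s | l `in` Rs s].
Proof.
elim: l => [|g l IH] h; first by apply: filterS (@filterT _ G _).
have hl : l `in` star by move=> g' /mem_tail/h.
by apply: GS (GI (h g (mem_head _ _)) (IH hl)) => s [h1 h2] g'; case/in_consP=> [->|/h2].
Qed.

(** A_i is generated up to integrality by finitely many elements, so being finite at the limit means
    being finite at almost every Rs s. Uniqueness of centres then puts almost every ys s into the
    chart. *)
Lemma limit_chart (T : space_fun K) (I : Type) (A : I -> set M) (ch : I -> set T) (lr : T -> set M) (ys : J -> T) i :
 atlas io A ch lr -> separated_places io lr -> (forall s, dominates (Rs s) (lr (ys s))) -> A i `<=` star ->
 G [set s | ch i (ys s)].
Proof.
move=> hT hsep hys As; have [l [lA hl]] := at_fin hT i.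
apply: GS (star_list (fun g gl => As g (lA g gl))) => s /(hl _ (kvr_vr (hRs s)) (kvr_k (hRs s))) AR.
have [x hx dx] := at_center hT (hRs s) AR; by rewrite /= (hsep _ _ _ (hRs s) (hys s) dx).
Qed.

End Place.
End Ultra.

(** * The space of closed points of a variety as an atlas *)

Section VarietyAtlas.
Variables (K : closedFieldType) (F : fieldType) (iota : {rmorphism K -> F}) (Y : set (set F)).
Local Notation k := (range iota).
Let hk : acsub k := acsub_range iota.

Lemma alg_genE s : alg_gen iota s = gen k s.
Proof.
apply/seteqP; split=> x h A hA; first by move=> kA; apply: h => // c; apply: kA.
by move=> kA sA; apply: h => // _ [c _ <-].
Qed.

Lemma variety_model : variety iota Y -> exists2 ss, model iota Y ss & ss != [::].
Proof.
move=> [[ss [s0 sF ->]] sep]; exists ss => //; split=> //.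
 by move=> s /sF; rewrite alg_genE.
by move=> y; split=> -[s hs]; exists s => //; [rewrite -alg_genE|rewrite alg_genE].
Qed.

Variable ss : seq (seq F).
Hypothesis hM : model iota Y ss.
Local Notation I := {s | s \in ss}.
Definition vchart (i : I) : set (model_space iota Y) := [set y | gen k (sval i) `<=` sval y].

Lemma variety_center i R : kvr k R -> gen k (sval i) `<=` R ->
 exists2 y : model_space iota Y, vchart i y & dominates R (sval y).
Proof.
move=> hR BR; have [hy dy] := center_Y hM (kvr_vr hR) (svalP i) BR; set y := localization _ _ in hy dy.
have cy : closed_point Y y := center_closed hM hR hy dy.
have hp := maxid_prime (kvr_vr hR) (gen_subring k (sval i)) BR.
by exists (exist _ y cy) => //; exact: (loc_base (gen_subring k (sval i)) hp).
Qed.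

Lemma vchartP (i : I) (y : model_space iota Y) : (forall f, f \in sval i -> sval y f) -> vchart i y.
Proof.
have [hy _] := svalP y; apply: gen_min; [exact: proj1 (Y_local hM hy)|exact: Y_base hM _ hy].
Qed.

Lemma variety_atlas : @atlas K F iota (model_space iota Y) I (fun i => gen k (sval i)) vchart (fun y => sval y).
Proof.
have mem_chart (i : I) (y : model_space iota Y) : vchart i y -> forall f, f \in sval i -> sval y f.
 by move=> h f fs; apply: h; exact: gen_mem.
split.
- by move=> i; member.
- by move=> i; member.
- move=> i; exists (sval i); split=> [a|R hR kR iR]; [exact: gen_mem|by apply: gen_min; member].
- by move=> [y [hy cy]]; have [s hs By] := Y_chart hM hy; exists (exist _ s hs).
- move=> i y hi; have [p hp Ey] := chart_of hM (svalP i) (proj1 (svalP y)) hi; exists p; split=> //.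
 move=> a Ba; have [c kc hc] := rational_of_closed hM (svalP y) (hi _ Ba); exists c => //.
 have Bac : gen k (sval i) (a - c) by member.
 by move: hc; rewrite Ey => /(loc_max_trace (gen_subring _ _) hp Bac).
- exact: variety_center.
- by move=> i [y hy] [z hz] _ _ /= e; subst z; congr exist.
- move=> U; split=> [oU i y _ Uy|h y Uy].
  by have [s [h1 h2]] := oU y Uy; exists s; split=> // z _; exact: h2.
 have [s hs By] := Y_chart hM (proj1 (svalP y)); have [l [h1 h2]] := h (exist _ s hs) y By Uy.
 exists (s ++ l); split=> [f|z hz]; first by case/in_catP=> [fs|/h1 //]; apply: By; exact: gen_mem.
 apply: h2 => [|f fl]; last by apply: hz; rewrite mem_cat fl orbT.
 by apply: vchartP => f fs; apply: hz; rewrite mem_cat fs.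
- move=> U h; split=> [rU i y hi Uy|hU y Uy].
  have [f [W [oW Wy hW]]] := rU y Uy; have [s [h1 h2]] := oW y Wy; exists f, s; split=> // z _ /h2 Wz; exact: hW.
 have [s hs By] := Y_chart hM (proj1 (svalP y)); have [f [l [h1 h2]]] := hU (exist _ s hs) y By Uy.
 exists f, [set z : model_space iota Y | s ++ l `in` sval z]; split.
 + by move=> z Wz; exists (s ++ l).
 + by move=> g /in_catP[gs|/h1 //]; apply: By; exact: gen_mem.
 + move=> z Wz; apply: h2 => [|g gl]; last by apply: Wz; rewrite mem_cat gl orbT.
  by apply: (@vchartP (exist _ s hs)) => g gs; apply: Wz; rewrite mem_cat gs.
- by move=> i j y hi hj; exists (sval j); split=> [|z _]; [exact: mem_chart|exact: vchartP].
- move=> i j; have [R hR lR] := nullstellensatz hk (sval i ++ sval j); have vR := kvr_vr hR.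
 have gR (l : I) : {subset sval l <= sval i ++ sval j} -> gen k (sval l) `<=` R.
  by move=> sub; apply: gen_min => [||f /sub/lR //]; member.
 have [|y hi dy] := variety_center (i := i) hR; first by apply: gR => f fs; rewrite mem_cat fs.
 have [|z hj dz] := variety_center (i := j) hR; first by apply: gR => f fs; rewrite mem_cat fs orbT.
 exists y; split=> //; have e := m_sep hM vR (proj1 (svalP y)) (proj1 (svalP z)) dy dz.
 by rewrite /vchart /= e.
Qed.

Lemma variety_separated_places : @separated_places K F iota (model_space iota Y) (fun y => sval y).
Proof.
move=> R [y hy] [z hz] hR /= dy dz; have e := m_sep hM (kvr_vr hR) (proj1 hy) (proj1 hz) dy dz.
by subst z; congr exist.
Qed.

End VarietyAtlas.

(** * The valuative criterion of completeness *)

Section Complete.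
Variables (K : closedFieldType) (M : fieldType) (io : {rmorphism K -> M}).
Variables (T : space_fun K) (I : Type) (A : I -> set M) (ch : I -> set T) (lr : T -> set M).
Hypothesis hT : atlas io A ch lr.
Local Notation k := (range io).

(* A point z0 in the closure of the projection of C is a limit of points z_s along an ultrafilter;
  properness provides a limit of the x_s with (x_s, z_s) in C. *)
Theorem complete_of_proper : separated_places io lr -> proper_places io A -> complete T.
Proof.
move=> hsep hpr; split; first exact/(separatedP hT).
move=> E j Z vZ C oC; have [zz hZ _] := variety_model vZ.
have aZ := variety_atlas hZ; have sZ := variety_separated_places hZ.
move=> z0 nz0; apply: contrapT => hno.
(* J indexes the basic neighbourhoods of z0; each of them meets the projection of C. The filter F0
   consists of the eventual properties with respect to shrinking neighbourhoods. *)
pose J := {s : seq E | forall f, f \in s -> sval z0 f}.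
have /choice[c hc] : forall s : J, exists q : T * model_space j Z, C q /\ forall f, f \in sval s -> sval q.2 f.
 move=> s; apply: contrapT => h; apply: hno; exists (sval s); split=> [|z hz [q Cq qz]]; first exact: (svalP s).
 by apply: h; exists q; split=> //; rewrite qz.
pose F0 : set_system J := [set P | exists s0 : J, forall s : J, {subset sval s0 <= sval s} -> P s].
have F0P : ProperFilter F0.
 have nilJ : forall f, f \in [::] -> sval z0 f by [].
 split; first by move=> [s0 h]; apply: (h s0).
 split; first by exists (exist _ [::] nilJ).
 - move=> P Q [s1 h1] [s2 h2].
  have catJ : forall f, f \in sval s1 ++ sval s2 -> sval z0 f by move=> f /in_catP[/(svalP s1)|/(svalP s2)].
  by exists (exist _ _ catJ) => s sub; split; [apply: h1|apply: h2] => f fs; apply: sub; rewrite mem_cat fs ?orbT.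
 - by move=> P Q PQ [s0 h]; exists s0 => s /h/PQ.
have [G [hG FG]] := ultraFilterLemma F0P.
have /choice[Rs hRs] : forall s : J, exists R, kvr k R /\ dominates R (lr (c s).1).
 by move=> s; have [R h1 h2] := at_kvr hT (c s).1; exists R.
have /choice[Ss hSs] : forall s : J, exists R, kvr (range j) R /\ dominates R (sval (c s).2).
 by move=> s; have [R h1 h2] := at_kvr aZ (c s).2; exists R.
have kR s := proj1 (hRs s); have kS s := proj1 (hSs s); have dR s := proj2 (hRs s); have dS s := proj2 (hSs s).
have zstar f : sval z0 f -> star G Ss f.
 move=> zf; apply: FG; have sJ : forall g, g \in [:: f] -> sval z0 g by move=> g; rewrite inE => /eqP ->.
 exists (exist _ [:: f] sJ) => s sub; apply: (proj1 (dS s)); apply: (proj2 (hc s)); apply: sub; exact: mem_head.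
have rz := at_rl aZ z0; have sz := proj1 (rl_local rz); have mz := local_ideal (rl_local rz).
pose r := res hG j Ss.
(* V is taken to dominate the image of the local ring at z0 in the ultrapower. The points of Z then
   converge to z0, and the same V is used for the limit in T. *)
have [V [hV zV mV]] : exists V, [/\ kvr (range (uconst hG)) V, forall f, sval z0 f -> V (r f) & forall f, maxid (sval z0) f -> maxid V (r f)].
 have cz c' : sval z0 (j c') by apply: (rl_base rz).
 have hA : subring_set [set r f | f in sval z0].
  split; first by exists 1; [member|exact: (res1 hG kS)].
   move=> _ _ [f hf <-] [g hg <-]; exists (f - g); first member.
   exact: (resB hG kS (zstar _ hf) (zstar _ hg)).
  by move=> _ _ [f hf <-] [g hg <-]; exists (f * g); [member|apply: (resM hG kS); member].
 have hJ : ideal [set r f | f in sval z0] [set r f | f in maxid (sval z0)].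
  split.
  - by move=> _ [f [hf _] <-]; exists f.
  - by exists 0; [member|exact: (res0 hG kS)].
  - move=> _ _ [f hf <-] [g hg <-]; exists (f + g); first member.
   by apply: (resD hG kS); member.
  - move=> _ _ [f hf <-] [g hg <-]; exists (f * g); first member.
   by apply: (resM hG kS); member.
 have [|||V [hV AV JV]] := exists_kvr (acsub_range (uconst hG)) _ hA hJ.
 - by move=> _ [d _ <-]; exists (j d); rewrite // /r res_const.
 - move=> [f mf r1]; have zf := maxid_sub mf; have sf := zstar _ zf.
  have [f1 yi] : f - 1 != 0 /\ sval z0 (f - 1)^-1.
   apply: vr_unit; first member.
   move=> h; apply: (maxid_proper sz); rewrite -[1](subKr f); member.
  have := resM hG kS (zstar _ (subring_sub sz zf (subring_one sz))) (zstar _ yi).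
  have s1 : star G Ss 1 by member.
  rewrite divff // (resB hG kS sf s1) (res1 hG kS) -/(r f) r1 subrr mul0r => /eqP.
  by rewrite oner_eq0.
 - move=> _ [f zf <-]; have [_ [d _ <-] hd] := rl_rat rz zf; exists (uconst hG d) => //.
  by exists (f - j d); rewrite // /r (resB_const hG kS) //; member.
 by exists V; split=> // f hf; [apply: AV; exists f|apply: JV; exists f].
(* Properness provides a chart containing the centre x0 of the limit place. *)
have [i AR] := hpr _ (composite_kvr kR hV).
have [x0 hi dx] := at_center hT (composite_kvr kR hV) AR.
have [i' hi'] := at_cover aZ z0.
have dz : dominates (composite j Ss V) (sval z0).
 apply: dominatesI => [f zf|f mf]; first by split; member.
 by apply/(composite_max kS) ; [split; [|]; member|member].
have g1 := limit_chart hG kR hT hsep dR (fun a Aa => proj1 (AR a Aa)).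
have g2 := limit_chart hG kS aZ sZ dS (fun a Aa => zstar a (hi' a Aa)).
have [Cx|nC] := pselect (C (x0, z0)); first by apply: nz0; exists (x0, z0).
have [U [W [oU oW Ux Wz [m [f [g [rf rg n0 hn]]]]]]] := oC _ nC.
have /choice[p hp] := fun l => limit_regular kR hT dR hi dx g1 oU (rf l) Ux.
have /choice[q hq] := fun l => limit_regular kS aZ dS hi' dz g2 oW (rg l) Wz.
pose va l s := value_at io (Rs s) (p l); pose vb l s := value_at j (Ss s) (q l).
(* The pairs c s lie in C, so the expression separating (x0, z0) from C vanishes at almost all of
   them. Passing to the ultrapower and then to residues of V, it vanishes at (x0, z0), against
   [n0]. *)
have big : G [set s | \sum_l va l s * vb l s = 0].
 have : forall ls : seq 'I_m, G [set s | forall l, l \in ls -> f l (c s).1 = va l s /\ g l (c s).2 = vb l s].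
  elim=> [|l ls IH]; first by apply: filterS (@filterT _ G _).
  have [_ _ h1] := hp l; have [_ _ h2] := hq l.
  by apply: filterS (filterI (filterI h1 h2) IH) => s [[a1 a2] a3] l'; case/in_consP=> [->|/a3].
 move=> /(_ (enum 'I_m)) h1.
 apply: filterS (filterI h1 (filterI (limit_open hT dR hi dx g1 oU Ux) (limit_open aZ dS hi' dz g2 oW Wz))) => s [a1 [[_ a2] [_ a3]]].
 apply/eqP; apply: contrapT => /negP a4; case: (hc s) => Cs _; apply: (hn (c s) a2 a3 _ Cs).
 rewrite (eq_bigr (fun l => va l s * vb l s)) // => l _.
 by have [-> ->] := a1 l (mem_enum _ l).
have sV := vr_sub (kvr_vr hV); have mVi := maxid_ideal (kvr_vr hV).
have e0 : \sum_l res hG io Rs (p l) * res hG j Ss (q l) = 0.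
 have e1 := proj2 (ultra_eq hG (fun s => \sum_l va l s * vb l s) (fun=> 0)) big.
 transitivity (uconst hG (0 : K)) => //.
 rewrite /uconst -e1.
 have -> : (fun s => \sum_l va l s * vb l s) =
   \sum_l va l * vb l.
  by apply/funext => s; rewrite fct_sumE.
 have [|_ ->] := @pi_sum _ (ultra K hG) _ (index_enum 'I_m) (fun l => va l * vb l); first by [].
 by apply: eq_bigr => l _; rewrite piM.
have : maxid V (uconst hG (\sum_l f l x0 * g l z0)).
 rewrite -[uconst hG _]subr0 -e0 rmorph_sum -sumrB; apply: (ideal_sum mVi) => l _ _.
 have [sp vp _] := hp l; have [sq vq _] := hq l; rewrite rmorphM /=.
 set a := uconst hG _ in vp *; set b := uconst hG _ in vq *; set a' := res _ _ _ _ in vp *; set b' := res _ _ _ _ in vq *.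
 have -> : a * b - a' * b' = (- a) * (b' - b) + (- b') * (a' - a) by ring.
 have Va : V a by apply: (kvr_k hV).
 have Vb : V b by apply: (kvr_k hV).
 apply: (idealD mVi); apply: (idealM mVi) => //; apply: (subringN sV) => //.
 by rewrite -[b'](subrK b); apply: (subringD sV) => //; exact: maxid_sub.
apply: unit_notmax; first by rewrite fmorph_eq0.
by rewrite -fmorphV; apply: (kvr_k hV).
Qed.

(* The affine variety Z whose coordinate ring contains the inverses of functions a_m in A_m that
  are not in R; the linked pairs form a closed subset of the product. *)
Theorem proper_of_complete (gs : seq M) (N : nat) (cm : nat -> I) : fraction_field (gen k gs) ->
 (forall x, exists2 m, (m < N)%N & ch (cm m) x) -> complete T -> proper_places io A.
Proof.
move=> hF hcov [_ hc] R hR; apply: contrapT => nR; have vR := kvr_vr hR; have sR := vr_sub vR.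
have hk := acsub_range io.
have /choice[a ha] : forall m, exists a, A (cm m) a /\ ~ R a.
 move=> m; apply: contrapT => h; apply: nR; exists (cm m) => a Aa; apply: contrapT => na; apply: h; by exists a.
pose orient g := if `[< R g >] then g else g^-1.
have oR g : R (orient g).
 by rewrite /orient; case: asboolP => // /(vr_out vR)[_]; exact: maxid_sub.
pose s := map orient gs ++ [seq (a m)^-1 | m <- iota 0 N].
have sRs x : x \in s -> R x.
 case/in_catP=> [/mapP[g _ -> //]|/mapP[m _ ->]].
 by have [_ /(vr_out vR)[_]] := ha m; exact: maxid_sub.
have hB := gen_subring k s; have BR : gen k s `<=` R by apply: gen_min; member.
have fB : fraction_field (gen k s).
 have [hQ QB QV] := fractions_subring hB; have gQ : gen k gs `<=` fractions (gen k s).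
  apply: gen_min => // [c kc|g gg]; first member.
  have : fractions (gen k s) (orient g) by apply: QB; apply: gen_mem; rewrite mem_cat map_f.
  by rewrite /orient; case: asboolP => // _ /QV; rewrite invrK.
 by move=> x; have [u [v [/gQ Qu /gQ Qv _ ->]]] := hF x; apply: (subring_mul hQ); member.
pose Z := spec (gen k s).
have mZ : model io Z [:: s].
 split=> [s'|y|R' y y' _ hy hy' d d'].
 - by rewrite inE => /eqP ->.
 - by split=> [hy|[s']]; [exists s; rewrite ?mem_head|rewrite inE => /eqP ->].
 - by rewrite (spec_ctr hB hy d) (spec_ctr hB hy' d').
have vZ : variety io Z.
 split; last exact: (m_sep mZ).
 exists [:: s]; split=> // [s'|]; first by rewrite inE alg_genE => /eqP ->.
 apply/seteqP; split=> y; first by move=> hy; exists s; rewrite ?mem_head // alg_genE.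
 by move=> [s']; rewrite inE => /eqP ->; rewrite alg_genE.
have aZ := variety_atlas mZ; pose i0 : {s' | s' \in [:: s]} := exist _ s (mem_head _ _).
have [z0 hz0 dz0] := variety_center mZ (i := i0) hR BR.
pose C := [set p : T * model_space io Z | exists2 R, kvr k R & dominates R (lr p.1) /\ dominates R (sval p.2)].
have oC := hc M io Z vZ C (linked_closed hT aZ).
(* A place linking x to z0 is centred in some chart [cm m], where a_m is regular; yet the inverse of
   a_m lies in the maximal ideal at z0. *)
have nz : ~ (snd @` C) z0.
 move=> [[x z] [R' hR' [/= dx dz]] e]; have [m mN hx] := hcov x; subst z0.
 have [Aa nRa] := ha m; have [a0 ma] := vr_out vR nRa.
 have Ba : gen k s (a m)^-1 by apply: gen_mem; rewrite mem_cat; apply/orP; right; apply/mapP; exists m; rewrite ?mem_iota.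
 have zia := hz0 _ Ba; have mz : maxid (sval z) (a m)^-1 by apply/(dominates_max dz0).
 have mR' : maxid R' (a m)^-1 by apply/(dominates_max dz).
 by apply: (vr_max_out a0 mR'); apply: (proj1 dx); exact: (at_sub_lr hT hx).
(* The projection of C is dense: by the Nullstellensatz every neighbourhood of z0 contains the
   centre z of a place that also contains the ring of a chart of T, and this place links z to some
   x. *)
have [l [l1 l2]] := proj1 (at_open aZ _) oC i0 z0 hz0 nz.
have [b [Bb b0 ib hb]] := basic_open aZ hz0 l1.
have [G [GA hG]] := at_fin hT (cm 0%N).
have [R' hR' lR'] := nullstellensatz hk (b^-1 :: s ++ G); have vR' := kvr_vr hR'.
have BR' : gen k s `<=` R'.
 by apply: gen_min => [||x xs]; [member|member|apply: lR'; rewrite inE mem_cat xs orbT].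
have [z hz dz] := variety_center mZ (i := i0) hR' BR'.
have AR' : A (cm 0%N) `<=` R' by apply: hG => //; [member|move=> x xG; apply: lR'; rewrite inE mem_cat xG !orbT].
have [x hx dx] := at_center hT hR' AR'.
apply: (l2 z hz); last by exists (x, z) => //; exists R'.
apply: hb => //; apply: (dominates_inv dz (hz _ Bb) b0); apply: lR'; exact: mem_head.
Qed.

End Complete.

Lemma valuation_overP (K : closedFieldType) (F : fieldType) (iota : {rmorphism K -> F}) mu :
 valuation_over iota mu <-> qval (range iota) mu.
Proof.
split=> [[h1 h2 h3]|[h1 h2 h3]]; split=> //.
 by move=> _ [c _ <-]; rewrite fmorph_eq0; exact: h3.
by move=> c c0; apply: h3; rewrite ?fmorph_eq0.
Qed.

(** A valuation ring containing the base functions b contains all x_j / x_i once x_i has the least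
    value; this is properness over the affine base. That each chart has fraction field F follows
    from [variety]: the trivial valuation ring dominates the generic points of all charts, so they
    coincide. *)
Lemma semiprojective_model (K : closedFieldType) (F : fieldType) (iota : {rmorphism K -> F}) Y :
 variety iota Y -> semiprojective iota Y -> exists (ss : seq (seq F)) (bs : seq F), [/\ model iota Y ss, ss != [::],
  forall x y, x \in bs -> Y y -> y x & forall R, valuation_subring R -> range iota `<=` R ->
   bs `in` R -> exists2 s, s \in ss & gen (range iota) s `<=` R].
Proof.
move=> vY [b [m [x [x0 YE]]]]; have [s0 hM0] := variety_model vY; case: s0 hM0 => // s0 ss0 hM0 _.
set k := range iota; pose chart i := b ++ [seq x j / x i | j <- enum 'I_m.+1].
have YC y : Y y <-> exists i, spec (gen k (chart i)) y.
 by rewrite YE; split=> -[i hi]; exists i; [rewrite -alg_genE|rewrite alg_genE].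
have vT : valuation_subring [set: F] by split=> [|z _]; [|left].
have cT B : subring_set B -> dominates [set: F] (ctr B [set: F]) by move=> hB; exact: center_dom.
have cB B : subring_set B -> spec B (ctr B [set: F]) by move=> hB; exists (maxid [set: F] `&` B) => //; exact: maxid_prime.
have inc B (f : F) : ctr B [set: F] f <-> exists a c, [/\ B a, B c, c != 0 & f = a / c].
 split=> -[a [c [Ba Bc h ->]]]; exists a, c; split=> //; last by move=> [[_ mc] _]; apply: mc.
 by apply/eqP => c0; apply: h; rewrite c0; split; [member|rewrite -c0].
exists [seq chart i | i <- enum 'I_m.+1], b; split.
- split=> [_ /mapP[i _ ->] f|y|R y y'].
 + apply/inc; have hB := gen_subring k (chart i); have hB0 := gen_subring k s0.
  have -> : ctr (gen k (chart i)) [set: F] = ctr (gen k s0) [set: F].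
   apply: (m_sep hM0 vT) (cT _ hB) (cT _ hB0); first by apply/YC; exists i; exact: cB.
   by apply/(m_cover hM0); exists s0; [exact: mem_head|exact: cB].
  by apply/inc; apply: (m_frac hM0); exact: mem_head.
 + rewrite YC; split=> [[i hi]|[_ /mapP[i _ ->] hi]]; last by exists i.
  by exists (chart i) => //; apply: map_f; rewrite mem_enum.
 + exact: (m_sep hM0).
- by rewrite -size_eq0 size_map size_enum_ord.
- move=> f y fb /YC[i [p hp ->]]; apply: (loc_base (gen_subring _ _) hp); apply: gen_mem.
 by rewrite mem_cat fb.
move=> R hR kR bR; have [|c [cs c0 cR]] := @exists_max _ R [seq x j | j <- enum 'I_m.+1] (x ord0) hR _ (x0 ord0).
 by apply: map_f; rewrite mem_enum.
move/mapP: cs => [i _ ce]; rewrite ce in cR; exists (chart i); first by apply: map_f; rewrite mem_enum.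
apply: gen_min => // [|z]; first member.
by case/in_catP=> [/bR //|/mapP[j _ ->]]; apply: cR; apply: map_f; rewrite mem_enum.
Qed.

(** * Divisors on a smooth variety *)

Section Fans.
Variables (K : closedFieldType) (F : fieldType) (iota : {rmorphism K -> F}) (n : nat).
Variables (Y : set (set F)) (ss : seq (seq F)) (bs : seq F).
Local Notation k := (range iota).
Local Notation L := (laurent_field F n).
Local Notation lc := (@laurent_const F n).
Local Notation kL := (range (lc \o iota)).
Local Notation vr := (@valuation_subring F).
Let hk : acsub k := acsub_range iota.
Let hkL : acsub kL := acsub_L n iota.
Hypotheses (hM : model iota Y ss) (smoothY : smooth Y).
Hypotheses (bsY : forall x y, x \in bs -> Y y -> y x)
 (bsR : forall R, valuation_subring R -> k `<=` R -> bs `in` R ->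
   exists2 s, s \in ss & gen k s `<=` R).
Local Notation pd := (prime_divisor Y).
Local Notation lpd D := (prime_divisor (loc Y D)).
Local Notation alg := (pp_algebra Y).
Implicit Types (D : polydiv F n) (E y z : set F) (u : 'rV[int]_n) (w v : 'rV[rat]_n).

Lemma pd_dvr E : pd E -> [/\ local E, noeth E, krull_dim E 1, regular_local E &
 forall x, exists a b, [/\ E a, E b, b != 0 & x = a / b]].
Proof. by move=> [hY hd]; split=> //; [member|exact: Y_noeth hM _ hY|exact: smoothY|exact: Y_frac hM _ hY]. Qed.

Lemma pd_ord_ex E f : pd E -> f != 0 -> ord_spec E f (ord E f).
Proof. by case/pd_dvr=> *; apply: ord_ex. Qed.
Lemma pd_ord_uniq E f (i : int) : pd E -> ord_spec E f i -> ord E f = i.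
Proof. by case/pd_dvr=> *; apply: ord_uniq. Qed.
Lemma pd_ordM E f g : pd E -> f != 0 -> g != 0 -> ord E (f * g) = ord E f + ord E g.
Proof. by case/pd_dvr=> *; apply: ordM. Qed.
Lemma pd_ordV E f : pd E -> f != 0 -> ord E f^-1 = - ord E f.
Proof. by case/pd_dvr=> *; apply: ordV. Qed.
Lemma pd_ord1 E : pd E -> ord E 1 = 0.
Proof. by case/pd_dvr=> *; apply: ord1. Qed.
Lemma pd_ordX E f m : pd E -> f != 0 -> ord E (f ^+ m) = ord E f *+ m.
Proof. by case/pd_dvr=> *; apply: ordX. Qed.
Lemma pd_ordXz E f (i : int) : pd E -> f != 0 -> ord E (f ^ i) = ord E f * i.
Proof. by case/pd_dvr=> *; apply: ordXz. Qed.
Lemma pd_ord_ge0 E f : pd E -> f != 0 -> (0 <= ord E f) <-> E f.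
Proof. by case/pd_dvr=> *; apply: ord_ge0. Qed.
Lemma pd_ord_gt0 E f : pd E -> f != 0 -> (0 < ord E f) <-> maxid E f.
Proof. by case/pd_dvr=> *; apply: ord_gt0. Qed.

Lemma pd_chart s E : s \in ss -> pd E -> gen k s `<=` E -> exists q, [/\ prime_ideal (gen k s) q,
 E = localization (gen k s) q, exists2 x, q x & x != 0 &
 forall p, prime_ideal (gen k s) p -> p `<=` q -> (exists2 x, p x & x != 0) -> q `<=` p].
Proof.
move=> hs [hY hd] BE; have [q hq EE] := chart_of hM hs hY BE; exists q; rewrite EE in hd.
by have [h1 h2] := ht1_of_krull (gen_subring k s) hq hd.
Qed.

Lemma pd_inj E E' : pd E -> pd E' -> E `<=` E' -> E = E'.
Proof.
move=> hE hE' sE; have [s hs BE] := Y_chart hM (proj1 hE); have hB := gen_subring k s.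
have [q [hq Eq _ mq]] := pd_chart hs hE BE.
have [|q' [hq' Eq' nq' _]] := pd_chart hs hE'; first member.
have q'q : q' `<=` q by move: sE; rewrite Eq Eq' => /loc_mono; apply.
by rewrite Eq Eq'; congr localization; apply/seteqP; split=> //; exact: mq.
Qed.

(** On a chart f = a / b, and a divisor along which f has nonzero order contains a b. It therefore
    contains a minimal prime over a b and, being of height one, equals it. *)
Lemma finite_ord f : f != 0 -> exists Es : seq (set F), [/\ uniq Es, Es `in` pd &
 forall E, pd E -> ord E f != 0 -> E \in Es].
Proof.
move=> f0; suff [Es h] : exists Es : seq (set F), forall E, pd E -> ord E f != 0 -> E \in Es.
 exists (undup [seq E <- Es | `[< pd E >]]); split; first exact: undup_uniq.
  by move=> E; rewrite mem_undup mem_filter => /andP[/asboolP].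
 by move=> E hE hf; rewrite mem_undup mem_filter h // andbT; apply/asboolP.
suff [Es h] : exists Es : seq (set F), forall E s, s \in ss -> gen k s `<=` E -> pd E -> ord E f != 0 -> E \in Es.
 by exists Es => E hE; have [s hs BE] := Y_chart hM (proj1 hE); exact: (h E s).
suff: forall ss' : seq (seq F), {subset ss' <= ss} -> exists Es : seq (set F),
  forall E s, s \in ss' -> gen k s `<=` E -> pd E -> ord E f != 0 -> E \in Es by apply.
elim=> [|s ss' IH] hs; first by exists [::].
have [|Es h] := IH; first by move=> s' /mem_tail/hs.
have ss1 : s \in ss by apply: hs; exact: mem_head.
have hB := gen_subring k s; have [a [b [Ba Bb b0 fab]]] := m_frac hM ss1 f.
have a0 : a != 0 by apply: contra_neq f0 => a0; rewrite fab a0 mul0r.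
pose J := [set x | exists2 c, gen k s c & x = a * b * c].
have hJ : ideal (gen k s) J by apply: principal_is_ideal; member.
have [ps [hps mps]] := minimal_primes hB (noeth_gen (s := s) hk) hJ.
exists ([seq localization (gen k s) q | q <- ps] ++ Es) => E s' /in_consP[->|s's'] BE hE oE; last first.
 by rewrite mem_cat (h E s') ?orbT.
have [q [hq Eq _ mq]] := pd_chart ss1 hE BE.
have qab : q (a * b).
 apply: contrapT => nq; move/eqP: oE; apply.
 have [na nb] : ~ q a /\ ~ q b by split=> hh; apply: nq; member.
 apply: pd_ord_uniq => //; have [t [u [mt ht Eu iu [t0 u0 _]]]] := pd_ord_ex hE f0.
 exists t, f; split=> //.
 - by rewrite Eq; exists a, b.
 - by rewrite fab invf_div Eq; exists b, a.
 - by split; rewrite ?mulr1.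
have [|q' q'ps q'q] := mps q hq.
 by move=> _ [c Bc ->]; member.
rewrite mem_cat; apply/orP; left; apply/mapP; exists q' => //; rewrite Eq; congr localization.
have [hq' Jq'] := hps _ q'ps; apply/seteqP; split=> //; apply: mq => //.
exists (a * b); rewrite ?mulf_neq0 //; apply: Jq'; exists 1; rewrite ?mulr1 //; member.
Qed.

(* Translating the generators of the chart to the origin at z. *)
Lemma factorial_at z E : closed_point Y z -> pd E -> z `<=` E ->
 exists g, [/\ z g, g != 0, maxid E g & forall x, z x -> maxid E x -> z (x / g)].
Proof.
move=> hz hE zE; have [s [p [hs hp Ez]]] := chartP hM (proj1 hz); have hB := gen_subring k s.
have Bz : gen k s `<=` z by rewrite Ez; member.
have [|q [hq Eq _ _]] := pd_chart hs hE; first member.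
have rz := rational_of_closed hM hz.
have zl := Y_local hM (proj1 hz).
have rp : rational k (gen k s) p.
 move=> x Bx; have [c kc hc] := rz _ (Bz _ Bx); exists c => //.
 have Bxc : gen k s (x - c) by member.
 by move: hc; rewrite Ez => /(loc_max_trace hB hp Bxc).
have /choice[c hc] : forall x, exists c, gen k s x -> k c /\ p (x - c).
 by move=> x; have [/rp[c kc pc]|nx] := pselect (gen k s x); [exists c|exists 0].
pose s' := [seq x - c x | x <- s].
have s's : gen k s' = gen k s.
 apply/seteqP; split; apply: gen_sub => [x kx|x xs]; try member.
  move: xs => /mapP[y ys ->]; have By : gen k s y by exact: gen_mem.
  by apply: (subring_sub hB) => //; apply: gen_base; case: (hc _ By).
 have Bx : gen k s x by exact: gen_mem.
 rewrite -[x](subrK (c x)); apply: (subringD (gen_subring k s')); last by apply: gen_base; case: (hc _ Bx).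
 by apply: gen_mem; apply/mapP; exists x.
have qp : q `<=` p by move: zE; rewrite Ez Eq => /loc_mono; apply.
have kE := proj2 hE; have rO := smoothY (proj1 hz); have fB := m_frac hM hs.
rewrite Ez in rO; rewrite Eq in kE; rewrite -s's in hp rp hq kE rO fB.
have [|g [qg g0 hg]] := principal_at_regular fB hp rp hq qp kE _ rO.
 move=> _ /mapP[x xs ->]; have Bx : gen k s x by exact: gen_mem.
 by case: (hc _ Bx).
rewrite s's in hp hq hg; exists g; split=> //.
- member.
- by rewrite Eq; apply/(loc_max_trace hB hq); member.
- move=> x; rewrite {1}Ez => -[a [b [Ba Bb nb ->]]] mE.
 have b0 := notp_neq0 hp nb.
 have qa : q a.
  apply/(loc_max_trace hB hq) => //; rewrite -Eq -[a](mulfVK b0) mulrC.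
  member.
 have [c' zc' E1] := hg _ qa; rewrite -Ez in zc'.
 have -> : a / b / g = c' * b^-1 by rewrite E1; field; rewrite b0.
 by apply: (subring_mul (proj1 zl)) => //; rewrite Ez; member.
Qed.

(** The element of [factorial_at] has order 1 along E. Along another E' through z its order is 0,
    for otherwise the prime of E' would contain g and with it the prime of E. *)
Lemma local_equation_closed z E : closed_point Y z -> pd E -> z `<=` E ->
 exists2 g, local_equation Y z E g & z g.
Proof.
move=> hz hE zE; have [g [zg g0 mg hg]] := factorial_at hz hE zE.
have lE := Y_local hM (proj1 hE); have zl := Y_local hM (proj1 hz).
have [s [p [hs hp Ez]]] := chartP hM (proj1 hz); have hB := gen_subring k s.
have Bz : gen k s `<=` z by rewrite Ez; member.
have [|q [hq Eq _ _]] := pd_chart hs hE; first member.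
exists g => //; split=> // E' hE' zE'; case: asboolP => [->|ne].
 rewrite /=; apply: pd_ord_uniq => //; exists g, 1; rewrite invr1.
 split=> //; try exact: subring_one (proj1 lE); last by rewrite oner_neq0 mul1r.
 move=> x; rewrite {1}Eq => /(loc_max hq)[a [b [qa Bb nb ->]]].
 have Ba := prime_sub hq qa.
 have ma : maxid E a by rewrite Eq; apply/loc_max_trace.
 rewrite mulrAC; apply: (subring_mul (proj1 lE)); first by apply: zE; apply: hg; member.
 by rewrite Eq; member.
apply/eqP; rewrite eq_le (proj2 (pd_ord_ge0 hE' g0) (zE' _ zg)) andbT leNgt; apply/negP => /(pd_ord_gt0 hE' g0) mg'.
apply: ne; apply: pd_inj => //; have lE' := Y_local hM (proj1 hE').
have [|q' [hq' Eq' _ _]] := pd_chart hs hE'; first member.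
rewrite Eq Eq'; apply/loc_mono => // x qx; have Bx := prime_sub hq qx.
apply/(loc_max_trace hB hq' Bx); rewrite -Eq' -[x](mulfVK g0); apply: maxidM => //; first member.
by apply: zE'; apply: hg; [member|rewrite Eq; apply/loc_max_trace].
Qed.

(** Take a denominator b of f generating a maximal ideal among all denominators. If b vanished at z,
    a prime divisor through z and b would have an equation g dividing b, and also f b since f has no
    pole there; then b / g would be a better denominator. *)
Lemma hartogs_closed z f : closed_point Y z -> f != 0 ->
 (forall E, pd E -> z `<=` E -> 0 <= ord E f) -> z f.
Proof.
move=> hz f0 hf; have zl := Y_local hM (proj1 hz); have zs := proj1 zl.
have nz := Y_noeth hM (proj1 hz).
pose J b := [set x | exists2 c, z c & x = b * c].
have hJ b : z b -> rideal z (J b) by move/(principal_is_ideal zs)/ideal_rideal.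
have [||_ [b [zb b0 zfb ->]] hm] := noeth_max (C := [set I | exists b, [/\ z b, b != 0, z (f * b) & I = J b]]) nz.
- by move=> _ [b [zb _ _ ->]]; member.
- have [a [b [za zb b0 fab]]] := Y_frac hM (proj1 hz) f; exists (J b), b; split=> //.
 by rewrite fab mulfVK.
have [mb|nmb] := pselect (maxid z b); last first.
 have [_ ib] := vr_unit zb nmb; rewrite -[f](mulfK b0); member.
exfalso; have [s [p [hs hp Ez]]] := chartP hM (proj1 hz); have hB := gen_subring k s.
move: (mb); rewrite Ez => /(loc_max hp)[b1 [b2 [pb1 Bb2 nb2 Eb]]].
have b10 : b1 != 0 by apply: contra_neq b0 => h; rewrite Eb h mul0r.
have [q [t [u [[hq qp qb1 kq] _]]]] := height_one hk (m_frac hM hs) hp pb1 b10.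
set E := localization (gen k s) q in kq.
have hE : pd E by split=> //; apply/(m_cover hM); exists s => //; exists q.
have zE : z `<=` E by rewrite Ez; apply/loc_mono.
have [g [zg g0 mg hg]] := factorial_at hz hE zE.
have lE := Y_local hM (proj1 hE).
have mEb : maxid E b.
 rewrite Eb mulrC; apply: maxidM; first member.
  by apply: loc_inv => //; move/qp.
 by apply/loc_max_trace; member.
have mEfb : maxid E (f * b).
 have ob := proj2 (pd_ord_gt0 hE b0) mEb; apply/(pd_ord_gt0 hE); first by rewrite mulf_neq0.
 by rewrite pd_ordM // ltr_wpDl // hf.
have zbg : z (b / g) by exact: hg.
have [|||c zc E1] := hm (J (b / g)) _ _ (b / g).
- by exists (b / g); split=> //; [rewrite mulf_neq0 ?invr_neq0|rewrite mulrA; exact: hg].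
- by move=> _ [c zc ->]; exists (g * c); [member|field].
- by exists 1; [member|rewrite mulr1].
have h1 : 1 = c * g.
 apply: (mulfI (_ : b / g != 0)); first by rewrite mulf_neq0 ?invr_neq0.
 by rewrite {1}E1; field.
apply: (maxid_proper (proj1 lE)); rewrite h1; member.
Qed.

(* The divisors along which f has a pole avoid some closed point in the closure of y. *)
Theorem hartogs y f : Y y -> f != 0 -> (forall E, pd E -> y `<=` E -> 0 <= ord E f) -> y f.
Proof.
move=> hy f0 hf; have [Es [_ pEs hEs]] := finite_ord f0.
have [|z [hz zy nz]] := closed_below hM (Es := [seq E <- Es | `[< ~ y `<=` E >]]) hy.
 by move=> E; rewrite mem_filter => /andP[/asboolP nE /pEs [hE _]].
apply: zy; apply: hartogs_closed => // E hE zE; have [yE|nyE] := pselect (y `<=` E); first exact: hf.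
have [->|o0] := eqVneq (ord E f) 0 => //.
by case: (nz E) => //; rewrite mem_filter hEs // andbT; apply/asboolP.
Qed.

Lemma unit_of_ord y f : Y y -> f != 0 -> (forall E, pd E -> y `<=` E -> ord E f = 0) -> y f /\ y f^-1.
Proof.
move=> hy f0 hf; split; apply: hartogs; rewrite ?invr_neq0 // => E hE yE.
 by rewrite hf.
by rewrite pd_ordV // hf.
Qed.

Lemma exists_local_equation y E : Y y -> pd E -> exists2 g, local_equation Y y E g & y g.
Proof.
move=> hy hE; have yl := Y_local hM hy; have [yE|nyE] := pselect (y `<=` E); last first.
 exists 1; last member.
 split=> [|E' hE' yE']; first exact: oner_neq0.
 by rewrite pd_ord1 //; case: asboolP => // EE; case: nyE; rewrite -EE.
have [|z [hz zy _]] := closed_below hM (Es := [::]) hy => //.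
have [|g [g0 hg] zg] := local_equation_closed hz hE; first member.
by exists g; [split=> // E' hE' yE'; apply: hg => // x /zy/yE'|member].
Qed.

(** * Weights of prime divisors at the centre of a valuation *)

Section Weights.
Variables (mu : F -> rat) (y : set F).
Hypotheses (hmu : qval k mu) (cy : center Y mu y).
Let hy : Y y := proj1 cy.

Lemma center_ge0 x : y x -> x != 0 -> 0 <= mu x.
Proof. by move=> /(proj1 (proj2 cy)) h x0; apply/(qval_ringP mu x0). Qed.

Lemma center_gt0 x : maxid y x -> x != 0 -> 0 < mu x.
Proof.
move=> mx x0; apply/(qval_maxid hk hmu x0); apply/(dominates_max (proj2 cy)); member.
Qed.

Lemma center_unit x : x != 0 -> (forall E, pd E -> y `<=` E -> ord E x = 0) -> mu x = 0.
Proof.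
move=> x0 hx; have [yx yi] := unit_of_ord hy x0 hx; apply/eqP; rewrite eq_le center_ge0 // andbT.
by rewrite -oppr_ge0 -(qvalV hk hmu) // center_ge0 // invr_neq0.
Qed.

Lemma local_equation_mu E f g : local_equation Y y E f -> local_equation Y y E g -> mu f = mu g.
Proof.
move=> [f0 hf] [g0 hg]; apply/eqP; rewrite -subr_eq0 -(qvalV hk hmu) // -(qvalM hmu) ?invr_neq0 //; apply/eqP.
by apply: center_unit => [|E' hE' yE']; rewrite ?mulf_neq0 ?pd_ordM ?pd_ordV ?invr_neq0 // hf // hg // subrr.
Qed.

Lemma weightE E f : local_equation Y y E f -> weight Y mu y E = mu f.
Proof.
move=> hf; have [g hg ->] : [set c | exists2 f, local_equation Y y E f & c = mu f] (weight Y mu y E).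
 by apply: xgetPex; exists (mu f), f.
exact: (@local_equation_mu E).
Qed.

Lemma weight_ge0 E : pd E -> 0 <= weight Y mu y E.
Proof.
move=> hE; have [g hg yg] := exists_local_equation hy hE; rewrite (weightE hg).
by apply: center_ge0; case: hg.
Qed.

Lemma weight_gt0 E : pd E -> y `<=` E -> 0 < weight Y mu y E.
Proof.
move=> hE yE; have [g hg yg] := exists_local_equation hy hE; rewrite (weightE hg).
have [g0 og] := hg; apply: center_gt0 => //; split=> // -[_ yi].
have := proj2 (pd_ord_ge0 hE (_ : g^-1 != 0)) (yE _ yi); rewrite invr_neq0 // => /(_ isT).
by rewrite pd_ordV // og //; case: asboolP.
Qed.

Lemma weight_eq0 E : pd E -> ~ y `<=` E -> weight Y mu y E = 0.
Proof.
move=> hE nE; rewrite (@weightE E 1) ?(qval1 hk hmu); split=> [|E' hE' yE']; first exact: oner_neq0.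
by rewrite pd_ord1 //; case: asboolP => // EE; case: nE; rewrite -EE.
Qed.

(** At y, f is a unit times a product of powers of local equations, and units at the centre have
    value 0. Divisors of the list that miss y have weight 0. *)
Lemma mu_ord f (Es : seq (set F)) : f != 0 -> uniq Es -> Es `in` pd ->
 (forall E, pd E -> y `<=` E -> ord E f != 0 -> E \in Es) ->
 mu f = \sum_(E <- Es) weight Y mu y E * (ord E f)%:~R.
Proof.
move=> f0 uEs pEs hEs.
have /choice[g hg] : forall E, exists g, pd E -> local_equation Y y E g.
 by move=> E; have [/(exists_local_equation hy)[g hg _]|nE] := pselect (pd E); [exists g|exists 0].
have prodE (l : seq (set F)) : l `in` pd -> uniq l -> [/\ \prod_(E <- l) g E ^ ord E f != 0,
  mu (\prod_(E <- l) g E ^ ord E f) = \sum_(E <- l) weight Y mu y E * (ord E f)%:~R &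
  forall E', pd E' -> y `<=` E' -> ord E' (\prod_(E <- l) g E ^ ord E f) = if E' \in l then ord E' f else 0].
 elim: l => [|E l IH] pl; first by rewrite !big_nil (qval1 hk hmu) oner_neq0; split=> // E' hE' _; exact: pd_ord1.
 rewrite /= => /andP[El ul]; have [|//|h1 h2 h3] := IH; first by move=> E' /mem_tail/pl.
 have pE := pl _ (mem_head _ _); have [g0 og] := hg _ pE; have gz : g E ^ ord E f != 0 by rewrite expfz_neq0.
 rewrite !big_cons; split; first by rewrite mulf_neq0.
  by rewrite (qvalM hmu) // (qvalXz hk hmu) // h2 (weightE (hg _ pE)).
 move=> E' hE' yE'; rewrite pd_ordM // pd_ordXz // og // h3 // inE; case: asboolP => [->|ne].
  by rewrite eqxx (negbTE El) addr0 mul1r.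
 by rewrite mul0r add0r; case: eqP => // /ne.
have [h1 <- h3] := prodE Es pEs uEs.
apply/eqP; rewrite -subr_eq0 -(qvalV hk hmu) // -(qvalM hmu) ?invr_neq0 //; apply/eqP.
apply: center_unit => [|E hE yE]; first by rewrite mulf_neq0 ?invr_neq0.
rewrite pd_ordM ?invr_neq0 // pd_ordV // h3 //; case: ifPn => [_|nE]; first by rewrite subrr.
by rewrite subr0; apply/eqP; apply: contraNT nE; exact: hEs.
Qed.

End Weights.

(** Every [loc Y D] has this form ([loc_avoiding]), and so has Y itself, with the empty list. *)
Definition avoiding (Ls : seq (set F)) : set (set F) := [set y | Y y /\ forall E, E \in Ls -> ~ y `<=` E].

Lemma avoiding_pd Ls E : Ls `in` pd ->
 prime_divisor (avoiding Ls) E <-> pd E /\ E \notin Ls.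
Proof.
move=> hL; split=> [[[hE nE] kE]|[hE nE]].
 by split=> //; apply/negP => /nE; apply.
split; last by case: hE.
split=> [|E' E'L sE]; first by case: hE.
by move: nE; rewrite (pd_inj hE (hL _ E'L) sE) E'L.
Qed.

(* Quasi-compactness, from the ideal generated by the functions whose non-vanishing locus
  avoids the support of some section. *)
Theorem bpf_finite Ls (Es : seq (set F)) (H : set F -> rat) : Ls `in` pd ->
 (forall E, pd E -> H E != 0 -> E \in Es) -> base_point_free (avoiding Ls) H ->
 exists fs : seq F, fs `in` effective_section (avoiding Ls) H /\
  forall y, avoiding Ls y -> exists2 f, f \in fs & ~ supp (avoiding Ls) H f y.
Proof.
move=> hL hEs hbpf; set W := avoiding Ls in hbpf *.
suff aux : forall s, s \in ss -> exists fs : seq F, fs `in` effective_section W H /\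
  forall y, W y -> gen k s `<=` y -> exists2 f, f \in fs & ~ supp W H f y.
 suff aux2 : forall ss' : seq (seq F), {subset ss' <= ss} -> exists fs : seq F,
   fs `in` effective_section W H /\
   forall y s, W y -> s \in ss' -> gen k s `<=` y -> exists2 f, f \in fs & ~ supp W H f y.
  have [fs [h1 h2]] := aux2 ss (fun _ => id); exists fs; split=> // y Wy.
  by have [s hs By] := Y_chart hM (proj1 Wy); exact: (h2 y s).
 elim=> [|s ss' IH] hs; first by exists [::].
 have [|fs [h1 h2]] := IH; first by move=> s' /mem_tail/hs.
 have [fs' [h1' h2']] := aux s (hs s (mem_head _ _)).
 exists (fs' ++ fs); split=> [f|y s' Wy]; first by case/in_catP=> [/h1'|/h1].
 case/in_consP=> [-> By|ss'1 By].
  by have [f ff nf] := h2' y Wy By; exists f; rewrite // mem_cat ff.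
 by have [f ff nf] := h2 y s' Wy ss'1 By; exists f; rewrite // mem_cat ff orbT.
move=> s hs; have hB := gen_subring k s; have rB := subring_rsub hB.
pose P b f := [/\ gen k s b, effective_section W H f &
 forall z, W z -> gen k s `<=` z -> ~ maxid z b -> ~ supp W H f z].
have exP y : W y -> gen k s `<=` y -> exists b f, P b f /\ ~ maxid y b.
 move=> Wy By; have [f hf nf] := hbpf y Wy; have ly := Y_local hM (proj1 Wy).
 have [Fs [_ pF hF]] := finite_ord (proj1 hf).
 (* On the locus where b does not vanish, only divisors through y can contribute to the support of
    div f + H, and those contribute 0 since f does not vanish at y as a section. *)
 have [b [Bb nb hb]] : exists b, [/\ gen k s b, ~ maxid y b &
   forall E, E \in Es ++ Fs -> pd E -> gen k s `<=` E -> ~ y `<=` E -> maxid E b].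
  elim: (Es ++ Fs) => [|E l [b [Bb nb hb]]].
   by exists 1; split; [member|exact: (maxid_proper (proj1 ly))|].
  have [[pE [BE nE]]|no] := pselect (pd E /\ gen k s `<=` E /\ ~ y `<=` E); last first.
   exists b; split=> // E' /in_consP[-> *|]; last exact: hb.
   by case: no.
  have [q [hq Eq _ _]] := pd_chart hs pE BE; have [p hp Ey] := chart_of hM hs (proj1 Wy) By.
  rewrite Ey Eq in nE; have [c qc pc] := notsub_loc hB hp hq nE.
  have Bc := prime_sub hq qc; exists (c * b); split; first member.
   move: nb; rewrite Ey => nb /(loc_max_trace hB hp (subring_mul hB Bc Bb))/(prime_prime hp Bc Bb)[//|pb].
   by apply: nb; apply/(loc_max_trace hB hp).
  move=> E' /in_consP[-> _ _ _|E'l pE' BE' nE'].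
   rewrite mulrC; apply: maxidM; [exact: proj1 (Y_local hM (proj1 pE))|member|].
   by rewrite Eq; apply/(loc_max_trace hB hq).
  by apply: maxidM; [exact: proj1 (Y_local hM (proj1 pE'))|member|exact: hb].
 exists b, f; split=> //; split=> // z Wz Bz nz [_ [E [pE zE oE]]]; apply: nf; split=> //.
 exists E; split=> //; have [pE' nL] := (proj1 (avoiding_pd E hL)) pE.
 apply: contrapT => yE; apply: nz; apply: contrapT => nzb.
 have mE : maxid E b.
  apply: hb => //; last member.
  rewrite mem_cat; have [o0|o0] := eqVneq (ord E f) 0; last by rewrite hF ?orbT.
  by rewrite hEs; move: oE; rewrite o0 add0r.
 have [b0 ib] := vr_unit (Bz _ Bb) nzb; exact: (unit_notmax b0 (zE _ ib)).
pose J := [set x | exists2 t : seq F, (forall b, b \in t -> exists f, P b f) & lin (gen k s) t x].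
have hJ : rideal (gen k s) J.
 split.
 - move=> x [t ht]; apply: lin_min; last by move=> b /ht[f []].
  by split; [|member|move=> a b; exact: (subringD hB)|move=> a b; exact: (subring_mul hB)].
 - by exists [::]; [|exact: lin0].
 - move=> x y [t ht hx] [t' ht' hy]; exists (t ++ t').
   by move=> b /in_catP[/ht|/ht'].
  by apply: linD => //; [exact: lin_catl|exact: lin_catr].
 - by move=> a x Ba [t ht hx]; exists t => //; exact: linM.
have [w wJ Jw] := noeth_gen (s := s) hk hJ.
have [t ht wt] : exists2 t : seq F, (forall b, b \in t -> exists f, P b f) & w `in` lin (gen k s) t.
 elim: w wJ {Jw} => [|x w IH] wJ; first by exists [::].
 have [|t ht wt] := IH; first by move=> x' /mem_tail/wJ.
 have [t' ht' hx] := wJ x (mem_head _ _); exists (t' ++ t).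
  by move=> b /in_catP[/ht'|/ht].
 move=> x' /in_consP[->|/wt h]; [exact: lin_catl|exact: lin_catr].
have [g hg] := choice_in 0 ht.
exists (map g t); split=> [_ /mapP[b bt ->]|y Wy By]; first by case: (hg b bt).
have [b [f [Pbf nb]]] := exP y Wy By; have ly := Y_local hM (proj1 Wy).
have : lin (gen k s) t b.
 apply: (lin_sub rB wt); apply: Jw; exists [:: b]; last by apply: lin_mem; rewrite ?mem_head.
 by move=> b'; rewrite inE => /eqP ->; exists f.
move=> [c hc Eb]; apply: contrapT => hn; apply: nb; rewrite Eb.
apply: (ideal_sum (local_ideal ly)) => i _ _; apply: maxidM; [member|exact: By|].
apply: contrapT => ni; apply: hn; have ti : t`_i \in t by exact: mem_nth.
by exists (g t`_i); [exact: map_f|have [_ _ h] := hg _ ti; exact: h].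
Qed.

(** * Points of the slices *)

Lemma sum_subset (Es Fs : seq (set F)) (g : set F -> rat) : uniq Es -> uniq Fs -> {subset Es <= Fs} ->
 (forall E, E \in Fs -> E \notin Es -> g E = 0) -> \sum_(E <- Fs) g E = \sum_(E <- Es) g E.
Proof.
move=> uE uF sub h; rewrite (bigID (mem Es)) /= [X in _ + X]big1_seq ?addr0; last by move=> E /andP[nE /h]; exact.
rewrite -big_filter; apply: perm_big; apply: uniq_perm => //; first exact: filter_uniq.
by move=> E; rewrite mem_filter; apply/andP/idP => [[]|hE] //; split=> //; exact: sub.
Qed.

Section OnePP.
Variable D : polydiv F n.
Hypothesis hD : pp_divisor iota Y D.
Local Notation sigma := (tail D).
Local Notation pdl := (lpd D).
Local Notation lv p := (lattice_vect p.2).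
Local Notation gsec w := (global_section (loc Y D) (eval D w)).
Let cone_tail : polyhedral_cone sigma := proj1 (pp_tail hD).

Lemma pp_supp : exists Es : seq (set F), [/\ uniq Es, Es `in` pd &
 forall E, coef D E <> sigma -> E \in Es].
Proof.
have [/finite_seqP[s hs] sP] := pp_support hD; exists (undup s); split; first exact: undup_uniq.
 move=> E; rewrite mem_undup => Es; apply: sP; rewrite hs; member.
by move=> E ne; rewrite mem_undup; have : [set E | coef D E <> sigma] E by []; rewrite hs.
Qed.

Lemma loc_pd E : pdl E <-> pd E /\ coef D E !=set0.
Proof.
split=> [[[hE nE] kE]|[hE nE]]; first by split=> //; apply: nE.
split; last by case: hE.
by split=> [|E' hE' sE]; [case: hE|rewrite -(pd_inj hE hE' sE)].
Qed.

Lemma loc_pdE y E : loc Y D y -> pd E -> y `<=` E -> lpd D E.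
Proof. by move=> [_ h] hE yE; apply/loc_pd; split=> //; exact: h. Qed.

Lemma loc_supp : exists Es : seq (set F), [/\ uniq Es, Es `in` pdl &
 forall E, pdl E -> coef D E <> sigma -> E \in Es].
Proof.
have [Es [uEs pEs hEs]] := pp_supp.
exists [seq E <- Es | `[< coef D E !=set0 >]]; split=> [|E|E /loc_pd[_ ne] nt]; first exact: filter_uniq.
 by rewrite mem_filter => /andP[/asboolP ne /pEs pE]; apply/loc_pd.
by rewrite mem_filter hEs // andbT; apply/asboolP.
Qed.

Lemma loc_sigma E : pdl E -> sigma_polyhedron sigma (coef D E).
Proof.
by move=> /loc_pd[hE [x hx]]; case: (pp_coef hD hE) => // e; rewrite e in hx.
Qed.

Lemma evalE w E x : face (coef D E) w x -> eval D w E = pairing w x.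
Proof.
move=> hx; have [z [hz mz] ->] : [set m | exists2 v, face (coef D E) w v & m = pairing w v] (eval D w E).
 by apply: xgetPex; exists (pairing w x), x.
by apply/eqP; rewrite eq_le mz; [case: hx => _; apply|case: hx].
Qed.

Lemma eval_ex w E : pdl E -> dual_cone sigma w ->
 exists2 x, face (coef D E) w x & eval D w E = pairing w x.
Proof. by move=> /loc_sigma hE hw; have [x hx] := face_ex hE hw; exists x => //; exact: evalE. Qed.

Lemma eval_le w E x : pdl E -> dual_cone sigma w -> coef D E x ->
 eval D w E <= pairing w x.
Proof. by move=> hE hw hx; have [z [_ hz] ->] := eval_ex hE hw; member. Qed.

Lemma eval_tail w E : coef D E = sigma -> dual_cone sigma w -> eval D w E = 0.
Proof.
move=> e hw; rewrite (@evalE w E 0) ?pairing0r // e; split; first exact: cone0.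
by move=> x hx; rewrite pairing0r; exact: hw.
Qed.

Lemma eval_scale (m : nat) w E : pdl E -> dual_cone sigma w ->
 eval D (m%:R *: w) E = m%:R * eval D w E.
Proof.
move=> hE hw; have [x hx ->] := eval_ex hE hw; rewrite (@evalE _ E x) ?pairingZl //.
by case: hx => h1 h2; split=> // y hy; rewrite !pairingZl ler_wpM2l ?h2.
Qed.

Lemma eval0 E : pdl E -> eval D 0 E = 0.
Proof.
move=> hE; have d0 : dual_cone sigma 0 by move=> x _; rewrite pairing0l.
by have [x hx ->] := eval_ex hE d0; rewrite pairing0l.
Qed.

Lemma loc_avoiding : exists2 Ls : seq (set F), (Ls `in` pd) & loc Y D = avoiding Ls.
Proof.
have [Es [uEs pEs hEs]] := pp_supp; exists [seq E <- Es | `[< coef D E = set0 >]].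
 by move=> E; rewrite mem_filter => /andP[_ /pEs].
have ne0 : sigma <> set0 by move=> e; have := cone0 cone_tail; rewrite e.
apply/seteqP; split=> y [hy h]; split=> // E.
 by rewrite mem_filter => /andP[/asboolP e /pEs pE] /(h _ pE); rewrite e => -[].
move=> pE yE; apply/set0P/eqP => e; apply: (h E) => //; rewrite mem_filter; apply/andP; split; first exact/asboolP.
by apply: hEs; rewrite e; exact/nesym.
Qed.

Definition sect (p : F * 'rV[int]_n) : Prop := dual_cone sigma (lv p) /\
 effective_section (loc Y D) (eval D (lv p)) p.1.

Lemma sect_algebra p : sect p -> pp_algebra Y D (term p).
Proof.
move=> [h1 h2]; exists [:: p.2], (fun=> p.1); split; last by rewrite big_seq1.
by move=> u; rewrite inE => /eqP ->; split=> //; right.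
Qed.

Lemma sectM p q : sect p -> sect q -> sect (p.1 * q.1, p.2 + q.2).
Proof.
move=> [d1 [p0 h1]] [d2 [q0 h2]]; split; rewrite /= latticeD; first exact: dualD.
split=> [|E hE]; first by rewrite mulf_neq0.
have [pE _] := proj1 (loc_pd E) hE; rewrite (pd_ordM pE p0 q0) rmorphD /=.
have [x [cx _] ->] := eval_ex hE (dualD d1 d2); rewrite pairingDl.
have := h1 E hE; have := h2 E hE; have := eval_le hE d1 cx; have := eval_le hE d2 cx.
move: (eval _ _ _) (eval _ _ _) (pairing _ _) (pairing _ _) (_%:~R) (_%:~R) => a b c d e f; lra.
Qed.

Lemma sect_const f : f != 0 -> (forall E, pdl E -> E f) -> sect (f, 0).
Proof.
move=> f0 hf; split; rewrite /= lattice0; first by move=> x _; rewrite pairing0l.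
split=> // E hE; have [pE _] := proj1 (loc_pd E) hE; rewrite eval0 // addr0 ler0z.
by apply/(pd_ord_ge0 pE f0); exact: hf.
Qed.

Lemma sect_loc H m f : (forall E, pd E -> (H E != 0 <-> coef D E = set0)) ->
 effective_section Y (multiple m H) f -> sect (f, 0).
Proof.
move=> Hne [f0 hf]; apply: sect_const => // E /loc_pd[hE ne]; apply/(pd_ord_ge0 hE f0); have := hf E hE.
have -> : multiple m H E = 0; last by rewrite addr0 ler0z.
apply/eqP; rewrite mulf_eq0; apply/orP; right; apply: contrapT => /negP /(Hne E hE) e.
by move: ne; rewrite e => -[].
Qed.

Lemma sect1 : sect (1, 0).
Proof. by apply: sect_const => [|E [[hE _] _]]; [exact: oner_neq0|exact: subring_one (proj1 (Y_local hM hE))]. Qed.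

Lemma global_sectionB w f g : gsec w f -> gsec w g ->
 gsec w (f - g).
Proof.
have VN h : gsec w h -> gsec w (- h).
 case=> [->|[h0 hh]]; first by left; rewrite oppr0.
 right; split=> [|E hE]; first by rewrite oppr_eq0.
 have [pE _] := proj1 (loc_pd E) hE; have n0 : (-1 : F) != 0 by rewrite oppr_eq0 oner_neq0.
 rewrite -mulN1r (pd_ordM pE n0 h0).
 suff -> : ord E (-1) = 0 by rewrite add0r; member.
 have kE := Y_base hM (proj1 pE); have k1 : k (-1) by exists (-1); rewrite ?rmorphN ?rmorph1.
 apply/eqP; rewrite eq_le (proj2 (pd_ord_ge0 pE n0) (kE _ k1)) andbT -oppr_ge0.
 by rewrite -(pd_ordV pE n0) invrN1; exact: (proj2 (pd_ord_ge0 pE n0) (kE _ k1)).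
move=> hf /VN; move: (- g) => {}g hg; have [f0|f0] := eqVneq f 0; first by rewrite f0 add0r.
have [g0|g0] := eqVneq g 0; first by rewrite g0 addr0.
case: hf => [/eqP|[_ hf]]; first by rewrite (negbTE f0).
case: hg => [/eqP|[_ hg]]; first by rewrite (negbTE g0).
have [fg|fg] := eqVneq (f + g) 0; first by left.
right; split=> // E hE; have [pE _] := proj1 (loc_pd E) hE; have sE := proj1 (Y_local hM (proj1 pE)).
have key a b : a != 0 -> b != 0 -> a + b != 0 -> ord E a <= ord E b -> ord E a <= ord E (a + b).
 move=> a0 b0 ab0 le; rewrite -subr_ge0 -(pd_ordV pE a0) -(pd_ordM pE) ?invr_neq0 //.
 apply/(pd_ord_ge0 pE); first by rewrite mulf_neq0 ?invr_neq0.
 rewrite mulrDl divff //; apply: (subringD sE); first member.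
 apply/(pd_ord_ge0 pE); first by rewrite mulf_neq0 ?invr_neq0.
 by rewrite (pd_ordM pE) ?invr_neq0 // (pd_ordV pE a0) subr_ge0.
have [le|/ltW le] := leP (ord E f) (ord E g).
 by apply: le_trans (hf E hE) _; rewrite lerD2r ler_int key.
by apply: le_trans (hg E hE) _; rewrite lerD2r ler_int addrC key // addrC.
Qed.

Definition gsect (p : F * 'rV[int]_n) : Prop := p.1 = 0 \/ sect p.

(** [pp_algebra] has one coefficient per weight. Terms of equal weight are therefore collected,
    which is possible since sections of a given weight are closed under addition. *)
Lemma pp_algebraP a : pp_algebra Y D a <-> exists2 l, l `in` gsect & a = lsum l.
Proof.
split=> [[s [c [hc ->]]]|[l hl ->]].
 exists [seq (c u, u) | u <- s]; last by rewrite /lsum big_map.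
 by move=> _ /mapP[u /hc[h1 [e|h2]] ->]; [left|right].
pose l' := [seq p <- l | p.1 != 0].
have hl' p : p \in l' -> sect p by rewrite mem_filter => /andP[p0 /hl[/eqP|//]]; rewrite (negbTE p0).
exists (undup (map snd l')), (fun u => \sum_(p <- l' | p.2 == u) p.1); split.
 move=> u; rewrite mem_undup => /mapP[p0 p0l ->]; have [d0 _] := hl' _ p0l; split=> //.
 have gN f g : gsec (lv p0) f -> gsec (lv p0) g -> gsec (lv p0) (f + g).
  move=> hf hg; rewrite -[g]opprK -[- g]sub0r; apply: global_sectionB => //.
  by apply: global_sectionB => //; left.
 rewrite big_seq_cond; apply: big_ind => [|//|p /andP[/hl'[_ h] /eqP e]]; first by left.
 by right; rewrite -e.
have -> : lsum l = lsum l'.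
 rewrite /lsum big_filter [LHS](bigID (fun p => p.1 != 0)) /= [X in _ + X]big1 ?addr0 //.
 by move=> p /negPn/eqP e; rewrite /term e mul0r.
under eq_bigr => u _ do rewrite rmorph_sum mulr_suml.
rewrite (exchange_big_dep xpredT) //=; apply: eq_big_seq => p pl.
rewrite big_mkcond (bigD1_seq p.2) ?undup_uniq ?mem_undup ?map_f //= eqxx.
by rewrite [X in _ + X]big1 ?addr0 // => u /negbTE; rewrite eq_sym => ->.
Qed.

Lemma pp_subring : subring_set (pp_algebra Y D).
Proof.
split.
- have <- : term (1 : F, 0 : 'rV[int]_n) = 1 by rewrite term0.
 by apply: sect_algebra; exact: sect1.
- move=> x y /pp_algebraP[l hl ->] /pp_algebraP[l' hl' ->]; apply/pp_algebraP.
 exists (l ++ [seq (- p.1, p.2) | p <- l']).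
  move=> p /in_catP[/hl //|/mapP[q /hl' hq ->]].
  case: hq => [e|[d h]]; first by left; rewrite e oppr0.
  have : gsec (lv q) (0 - q.1) by apply: global_sectionB; [left|right].
  by rewrite sub0r; case=> [e|h']; [left|right].
 rewrite /lsum big_cat big_map -sumrN; congr (_ + _); apply: eq_bigr => p _.
 by rewrite /term rmorphN mulNr.
- move=> x y /pp_algebraP[l hl ->] /pp_algebraP[l' hl' ->]; apply/pp_algebraP.
 exists [seq (p.1 * q.1, p.2 + q.2) | p <- l, q <- l'].
  move=> _ /allpairsP[[p q] [/hl hp /hl' hq ->]] /=.
  case: hp hq => [e|hp]; first by left; rewrite e mul0r.
  by case=> [e|hq]; [left; rewrite e mulr0|right; exact: sectM].
 rewrite /lsum big_allpairs_dep mulr_suml; apply: eq_bigr => p _; rewrite mulr_sumr.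
 by apply: eq_bigr => q _; rewrite termM.
Qed.

Lemma pp_base : kL `<=` pp_algebra Y D.
Proof.
move=> _ [a _ <-]; have [->|a0] := eqVneq a 0; first by rewrite !rmorph0; exact: subring0 pp_subring.
rewrite /= -term0; apply: sect_algebra; apply: sect_const => [|E [[hE _] _]]; first by rewrite fmorph_eq0.
by apply: (Y_base hM hE).
Qed.

Lemma pp_sub_terms (C : set L) : subring_set C -> (forall p, sect p -> C (term p)) -> pp_algebra Y D `<=` C.
Proof.
move=> hC h a /pp_algebraP[l hl ->]; apply: (subring_sum hC) => p pl _.
by case: (hl p pl) => [e|/h //]; rewrite /term e mul0r; member.
Qed.

Section Slices.
Variables (mu : F -> rat) (y : set F).
Hypotheses (hmu : qval k mu) (cy : center Y mu y).
Local Notation wgt := (weight Y mu y).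
Let hy : Y y := proj1 cy.

Lemma slice_loc v : slice Y mu y D v -> loc Y D y.
Proof.
move=> [w [x [_ hx _]]]; split=> // E hE yE; have w0 := weight_gt0 hmu cy hE yE.
have := hx E hE; rewrite /poly_scale gt_eqF // => h; have [e|ne] := pselect (coef D E = set0); last exact/set0P/eqP.
have [|z cz _] := h; last by exists z.
by rewrite e image_set0 => s0; have := cone0 cone_tail; rewrite -s0.
Qed.

Lemma poly_scale_tail (c : rat) : 0 <= c -> poly_scale sigma c sigma = sigma.
Proof.
rewrite /poly_scale; case: eqP => // /eqP c0 hc; apply/seteqP; split=> [_ [x hx <-]|x hx].
 exact: coneZ.
by exists (c^-1 *: x); [apply: coneZ => //; rewrite invr_ge0|rewrite scalerA divff // scale1r].
Qed.

Lemma sliceE (Es : seq (set F)) : loc Y D y -> uniq Es ->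
 Es `in` pdl ->
 (forall E, pdl E -> coef D E <> sigma -> E \in Es) ->
 slice Y mu y D = msum Es sigma (fun E => poly_scale sigma (wgt E) (coef D E)).
Proof.
move=> [_ ly] uEs pEs hEs; apply: minkowski_sumE => // [E /pEs/loc_pd[]//|E hE ne].
have w0 := weight_ge0 hmu cy hE.
apply: hEs; last by move=> e; apply: ne; rewrite e poly_scale_tail.
apply/loc_pd; split=> //; have [yE|nyE] := pselect (y `<=` E); first exact: ly.
by case: ne; rewrite (weight_eq0 hmu cy hE nyE).
Qed.

Lemma mu_sect f (Es : seq (set F)) : f != 0 -> uniq Es -> Es `in` pd ->
 exists Fs : seq (set F), [/\ uniq Fs, {subset Es <= Fs}, Fs `in` pd &
  mu f = \sum_(E <- Fs) wgt E * (ord E f)%:~R].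
Proof.
move=> f0 uEs pEs; have [Fs [uFs pFs hFs]] := finite_ord f0.
exists (undup (Es ++ Fs)); split; first exact: undup_uniq.
- by move=> E h; rewrite mem_undup mem_cat h.
- by move=> E; rewrite mem_undup mem_cat => /orP[/pEs|/pFs].
apply: (mu_ord hmu cy) => //; first exact: undup_uniq.
 by move=> E; rewrite mem_undup mem_cat => /orP[/pEs|/pFs].
by move=> E hE _ /(hFs E hE) h; rewrite mem_undup mem_cat h orbT.
Qed.

(** As f is a section, its order along E is at least - D(u)(E). Weighted by mu these orders sum to
    mu f, while the weighted sum of the D(u)(E) is the minimum of u on the slice, hence at most the
    value of u at v. *)
Lemma slice_sections v p : slice Y mu y D v -> sect p -> 0 <= mu p.1 + pairing (lv p) v.
Proof.
move=> hv [dp [p0 hp]]; have ly := slice_loc hv; have [Es [uEs pEs hEs]] := loc_supp.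
move: hv; rewrite (sliceE ly uEs pEs hEs) => hv.
have [x hx] := choice_in 0 (fun E hE => face_ex (loc_sigma (pEs E hE)) dp).
have wgt0 E : E \in Es -> 0 <= wgt E by move=> /pEs/loc_pd[hE _]; exact: (weight_ge0 hmu cy).
have := msum_scale_ge dp wgt0 hx hv.
have [|Fs [uFs sFs pFs ->]] := mu_sect p0 uEs; first by move=> E /pEs/loc_pd[].
have pdE E := loc_pdE (E := E) ly.
have -> : \sum_(E <- Es) wgt E * pairing (lv p) (x E) = \sum_(E <- Fs) wgt E * eval D (lv p) E.
 rewrite [RHS](sum_subset uEs uFs sFs); first by apply: eq_big_seq => E /hx/evalE ->.
 move=> E /pFs hE nEs; have [yE|nyE] := pselect (y `<=` E); last by rewrite (weight_eq0 hmu cy hE nyE) mul0r.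
 rewrite eval_tail ?mulr0; apply: contrapT => nt; move/negP: nEs; apply; apply: hEs => //; exact: pdE.
move=> le; apply: le_trans (_ : 0 <= \sum_(E <- Fs) wgt E * ((ord E p.1)%:~R + eval D (lv p) E)) _.
 rewrite big_seq sumr_ge0 // => E /pFs hE; have [yE|nyE] := pselect (y `<=` E).
  by rewrite mulr_ge0 ?(weight_ge0 hmu cy hE) // hp //; exact: pdE.
 by rewrite (weight_eq0 hmu cy hE nyE) mul0r.
under eq_bigr => E _ do rewrite mulrDr.
by rewrite big_split lerD2l.
Qed.

Lemma mu_nonvanishing f (H : set F -> rat) (Es : seq (set F)) : f != 0 -> uniq Es -> Es `in` pd ->
 (forall E, pd E -> y `<=` E -> (ord E f)%:~R = - H E) ->
 (forall E, pd E -> y `<=` E -> H E != 0 -> E \in Es) ->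
 mu f = - \sum_(E <- Es) wgt E * H E.
Proof.
move=> f0 uEs pEs hf hEs; rewrite (mu_ord hmu cy f0 uEs pEs); last first.
 by move=> E hE yE o0; apply: hEs => //; rewrite -oppr_eq0 -hf // intr_eq0.
rewrite -sumrN big_seq [RHS]big_seq; apply: eq_bigr => E /pEs hE; have [yE|nyE] := pselect (y `<=` E).
 by rewrite hf // mulrN.
by rewrite (weight_eq0 hmu cy hE nyE) !mul0r.
Qed.

End Slices.

Lemma nonvanishing_ord (W : set (set F)) H f y : effective_section W H f -> W y -> ~ supp W H f y ->
 forall E, prime_divisor W E -> y `<=` E -> (ord E f)%:~R = - H E.
Proof.
move=> [_ hf] Wy ns E hE yE; apply/eqP; rewrite -addr_eq0; apply: contrapT => /negP o0; apply: ns.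
by split=> //; exists E.
Qed.

Lemma avoiding_nil : avoiding [::] = Y.
Proof. by apply/seteqP; split=> y; [case|]. Qed.

(* Finitely many sections suffice: the functions bs detect the centre, those of a divisor supported
  on the empty coefficients detect the locus, and for each of the finitely many functionals u cutting
  out the slices, sections without common zeros of a multiple of D(u) detect u. *)
Lemma detecting_sections : exists G : seq (F * 'rV[int]_n), G `in` sect /\
 forall mu v, qval k mu -> (forall p, p \in G -> 0 <= mu p.1 + pairing (lv p) v) ->
  exists2 y, center Y mu y & slice Y mu y D v.
Proof.
have [Es0 [uEs0 pEs0 hEs0]] := pp_supp; have [Es [uEs pEs hEs]] := loc_supp.
pose G1 := [seq (b, 0 : 'rV[int]_n) | b <- bs & b != 0].
have G1s p : p \in G1 -> sect p.
 move=> /mapP[b + ->]; rewrite mem_filter => /andP[b0 bb]; apply: sect_const => // E [[hE _] _]; exact: bsY.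
have [H [H0 Hne [m m0 Hbpf]]] := pp_loc hD.
have nes : set0 <> sigma by move=> e; have := cone0 cone_tail; rewrite -e.
have HEs E : pd E -> multiple m H E != 0 -> E \in Es0.
 move=> hE; rewrite mulf_eq0 negb_or => /andP[_ /(Hne E hE) e]; apply: hEs0; rewrite e; member.
have [||fs [fs1 fs2]] := bpf_finite (Ls := [::]) _ HEs; [by []|by rewrite avoiding_nil|].
rewrite avoiding_nil in fs1 fs2; pose G2 := [seq (f, 0 : 'rV[int]_n) | f <- fs].
have G2s p : p \in G2 -> sect p.
 by move=> /mapP[f /fs1 hf ->]; exact: (sect_loc Hne hf).
have [us [us1 us2]] := cutting_functionals uEs cone_tail (fun E hE => loc_sigma (pEs E hE)).
have [Ls Ls1 Ls2] := loc_avoiding.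
have /(choice_in [::])[Gu hGu] : forall u : 'rV[rat]_n, u \in us -> exists Gu : seq (F * 'rV[int]_n), Gu `in` sect /\
  forall mu y v, qval k mu -> center Y mu y -> loc Y D y ->
   (forall p, p \in Gu -> 0 <= mu p.1 + pairing (lv p) v) ->
   forall x, (forall E, E \in Es -> face (coef D E) u (x E)) ->
    \sum_(E <- Es) weight Y mu y E * pairing u (x E) <= pairing u v.
 (* The functional u is rational: m1 u is a lattice vector w, and m2 D(w) is base point free. For a
    section g of weight m2 w that does not vanish at the centre y, mu g is - m1 m2 times the
    weighted sum of the minima of u, so the test of g is exactly the inequality of u. *)
 move=> u uus; have du := us1 u uus; have [m1 [w [m10 wE]]] := lattice_multiple u.
 have dw : dual_cone sigma (lattice_vect w) by rewrite wE; apply: dualZ.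
 have [_ [m2 m20 bpf]] := pp_semiample hD dw; rewrite Ls2 in bpf.
 have [|gs [gs1 gs2]] := bpf_finite (Es := Es0) Ls1 _ bpf.
  move=> E hE; apply: contraNT => nE; rewrite /multiple eval_tail ?mulr0 //.
  by apply: contrapT => /hEs0 h; rewrite h in nE.
 rewrite -Ls2 in gs1 gs2; exists [seq (g, w *+ m2) | g <- gs]; split=> [_ /mapP[g /gs1[g0 hg] ->]|mu y v hmu cy ly hG x hx].
  split; rewrite /= latticeMn; first exact: dualZ.
  by split=> // E hE; rewrite eval_scale; member.
 have [g gg ng] := gs2 y ly; have eg := gs1 g gg.
 have := hG _ (map_f _ gg); rewrite /= latticeMn pairingZl.
 have pdE E := loc_pdE (E := E) ly.
 rewrite (@mu_nonvanishing mu y hmu cy g (multiple m2 (eval D (lattice_vect w))) Es) //; first last.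
 - move=> E hE yE; apply: contraNT => nE; rewrite /multiple eval_tail ?mulr0 //.
  by apply: contrapT => /(hEs E (pdE E hE yE)) h; rewrite h in nE.
 - by move=> E hE yE; apply: (nonvanishing_ord eg ly ng) => //; exact: pdE.
 - by move=> E /pEs/loc_pd[].
 - by case: eg.
 have -> : \sum_(E <- Es) weight Y mu y E * multiple m2 (eval D (lattice_vect w)) E =
   (m2%:R * m1%:R) * \sum_(E <- Es) weight Y mu y E * pairing u (x E).
  rewrite mulr_sumr; apply: eq_big_seq => E hE; rewrite /multiple wE eval_scale ?(evalE (hx E hE)) //; last member.
  by ring.
 by rewrite wE pairingZl mulrA addrC subr_ge0 ler_pM2l // mulr_gt0 ?ltr0n.
exists (G1 ++ G2 ++ flatten (map Gu us)); split.
 move=> p; rewrite !mem_cat => /or3P[/G1s //|/G2s //|/flattenP[_ /mapP[u uus ->]]]; exact: (proj1 (hGu u uus)).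
move=> mu v hmu hG.
have hV := qval_vr hk hmu.
have [s hs sV] : exists2 s, s \in ss & gen k s `<=` valuation_ring mu.
 apply: bsR => //; first exact: (qval_base hmu).
 move=> b bb; have [->|b0] := eqVneq b 0; first member.
 have := hG (b, 0); rewrite !mem_cat map_f /=; last by rewrite mem_filter b0.
 by rewrite lattice0 pairing0l addr0 => /(_ isT); right.
have [hy dy] := center_Y hM hV hs sV; set y := localization _ _ in hy dy.
have cy : center Y mu y by [].
(* A section f of m H that does not vanish at y has a pole along each E through y with empty
   coefficient. This makes mu f negative, although (f, 0) is among the tested sections. *)
have ly : loc Y D y.
 split=> // E hE yE; have [e|ne] := pselect (coef D E = set0); last exact/set0P/eqP.
 have [f ff nf] := fs2 y hy; have ef := fs1 f ff.
 have fG2 : (f, 0 : 'rV[int]_n) \in G2 by exact: map_f.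
 have := hG (f, 0); rewrite !mem_cat fG2 orbT lattice0 pairing0l addr0 => /(_ isT).
 rewrite (@mu_nonvanishing mu y hmu cy f (multiple m H) Es0) //; [|by case: ef|by move=> E' hE' yE'; apply: (nonvanishing_ord ef hy nf)|by move=> E' hE' _; exact: HEs].
 have HE : 0 < H E by rewrite lt_neqAle H0 // andbT eq_sym; apply/(Hne E hE).
 have EEs : E \in Es0 by apply: hEs0; rewrite e.
 rewrite (bigD1_seq E) //= oppr_ge0 leNgt => /negP[]; apply: ltr_wpDr.
  rewrite big_seq_cond sumr_ge0 // => E' /andP[/pEs0 hE' _].
  by rewrite mulr_ge0 ?(weight_ge0 hmu cy hE') // mulr_ge0 // H0.
 by rewrite mulr_gt0 ?(weight_gt0 hmu cy hE yE) // mulr_gt0 // ltr0n.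
exists y => //; rewrite (sliceE hmu cy ly uEs pEs hEs); apply: us2.
 by move=> E /pEs/loc_pd[hE _]; exact: (weight_ge0 hmu cy hE).
move=> u x uus hx; apply: (proj2 (hGu u uus)) => // p pG; apply: hG.
rewrite !mem_cat; apply/or3P; apply: Or33; apply/flattenP; exists (Gu u) => //; exact: map_f.
Qed.

End OnePP.

(** * Faces *)

Lemma center_uniq mu y z : qval k mu -> center Y mu y -> center Y mu z -> y = z.
Proof. by move=> hmu [hy dy] [hz dz]; exact: (m_sep hM (qval_vr hk hmu)). Qed.

Lemma approximation (R : set L) (l : seq L) : valuation_subring R -> kL `<=` R -> exists2 nu, qval kL nu &
 forall x, x \in l -> x != 0 -> (R x -> 0 <= nu x) /\ (maxid R x -> 0 < nu x).
Proof.
move=> hR kR; have vT : valuation_subring [set: F] by split=> [|x _]; [|left].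
(* The trivial valuation ring supplies a chart of Y; its generators and the variables generate the
   field F(M). *)
have [s hs _] := bsR vT (fun _ _ => Logic.I) (fun _ _ => Logic.I).
exact: (q_valuation hkL (lgens_frac (m_frac hM hs)) l hR kR).
Qed.

Section Algebra.
Variable D : polydiv F n.
Hypothesis hD : pp_divisor iota Y D.

Lemma alg_of_slice nu y : qval kL nu -> center Y (nu \o lc) y -> slice Y (nu \o lc) y D (val_vect nu) ->
 alg D `<=` valuation_ring nu.
Proof.
move=> hnu cy hs; have hmu := restrict_qval hnu; apply: (pp_sub_terms (vr_sub (qval_vr hkL hnu))).
move=> p hp; right; have p0 : p.1 != 0 by case: hp => _ [].
by rewrite (qval_term hnu p0); exact: (slice_sections hD hmu cy hs hp).
Qed.

(** Suppose a homogeneous section lies outside R although G lies inside. An approximating nu is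
    nonnegative on G and negative on the section; but its vector then lies in a slice, so nu is
    nonnegative on the whole algebra. The last clause says that the algebra is integral over the
    subalgebra generated by G. *)
Lemma alg_finite : exists G : seq L, G `in` alg D /\
 (forall nu, qval kL nu -> G `in` valuation_ring nu ->
   exists2 y, center Y (nu \o lc) y & slice Y (nu \o lc) y D (val_vect nu)) /\
 forall R, valuation_subring R -> kL `<=` R -> G `in` R -> alg D `<=` R.
Proof.
have [G [Gs hG]] := detecting_sections hD; exists (map (@term F n) G).
have Gn nu : qval kL nu -> (forall a, a \in map (@term F n) G -> valuation_ring nu a) ->
   exists2 y, center Y (nu \o lc) y & slice Y (nu \o lc) y D (val_vect nu).
 move=> hnu hg; apply: hG; first exact: (restrict_qval hnu).
 move=> p pG; have p0 : p.1 != 0 by case: (Gs p pG) => _ [].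
 by rewrite -(qval_term hnu p0); apply/(qval_ringP nu (term_neq0 p0)); apply: hg; exact: map_f.
split; [|split=> //].
 by move=> _ /mapP[p /Gs hp ->]; exact: sect_algebra hp.
move=> R hR kR GR; apply: (pp_sub_terms (vr_sub hR)) => p hp.
have p0 : p.1 != 0 by case: hp => _ [].
apply: contrapT => np; have [t0 mp] := vr_out hR np.
have [nu hnu hl] := approximation ((term p)^-1 :: map (@term F n) G) hR kR.
have it0 : (term p)^-1 != 0 by rewrite invr_eq0.
have := proj2 (hl _ (mem_head _ _) it0) mp; rewrite (qvalV hkL hnu t0) oppr_gt0 ltNge => /negP; apply.
have [|y cy hs] := Gn nu hnu.
 move=> a aG; have [->|a0] := eqVneq a 0; first by left.
 by right; apply: (proj1 (hl a _ a0)); [rewrite inE aG orbT|member].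
by apply/(qval_ringP nu t0); apply: (alg_of_slice hnu cy hs); exact: sect_algebra.
Qed.

End Algebra.

Section Sub.
Variables D' D : polydiv F n.
Hypotheses (hD' : pp_divisor iota Y D') (hD : pp_divisor iota Y D).
Hypotheses (sub_coef : forall E, pd E -> coef D' E `<=` coef D E) (sub_tail : tail D' `<=` tail D).

Lemma sub_dual w : dual_cone (tail D) w -> dual_cone (tail D') w.
Proof. by move=> h x /sub_tail/h. Qed.

Lemma sub_loc : loc Y D' `<=` loc Y D.
Proof. by move=> y [hy h]; split=> // E hE yE; have [x hx] := h E hE yE; exists x; exact: sub_coef. Qed.

Lemma sub_sect p : sect D p -> sect D' p.
Proof.
move=> [d [p0 h]]; split; first exact: sub_dual.
split=> // E hE; have [pE ne] := proj1 (loc_pd D' E) hE.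
have hE' : lpd D E by apply/(loc_pd); split=> //; case: ne => x hx; exists x; exact: sub_coef.
apply: le_trans (h E hE') _; rewrite lerD2l; have [x [hx _] ->] := eval_ex hD' hE (sub_dual d).
by apply: (eval_le hD hE' d); exact: sub_coef.
Qed.

Lemma sub_alg : alg D `<=` alg D'.
Proof.
apply: (pp_sub_terms (pp_subring hD')) => p /sub_sect; exact: sect_algebra.
Qed.

Lemma common_support z : exists Es : seq (set F), [/\ uniq Es, forall E, E \in Es -> pd E /\ z `<=` E,
 forall E, pd E -> z `<=` E -> E \notin Es -> coef D' E = tail D' /\ coef D E = tail D,
 fiber Y D z = msum Es (tail D) (coef D) & fiber Y D' z = msum Es (tail D') (coef D')].
Proof.
have [A [uA pA hA]] := pp_supp hD; have [B [uB pB hB]] := pp_supp hD'.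
exists (undup [seq E <- A ++ B | `[< z `<=` E >]]).
have mE E : E \in undup [seq E <- A ++ B | `[< z `<=` E >]] <-> E \in A ++ B /\ z `<=` E.
 by rewrite mem_undup mem_filter; split=> [/andP[/asboolP]|[h1 h2]] //; apply/andP; split=> //; apply/asboolP.
have pE E : E \in undup [seq E <- A ++ B | `[< z `<=` E >]] -> pd E /\ z `<=` E.
 by move=> /mE[]; case/in_catP=> [/pA|/pB].
split=> //; first exact: undup_uniq.
- move=> E hE zE nE; split; apply: contrapT => ne; move/negP: nE; apply; apply/mE; split=> //; rewrite mem_cat.
  by rewrite (hB E ne) orbT.
 by rewrite (hA E ne).
- apply: minkowski_sumE => [||E /pE[]|E [hE zE] /hA EA]; [exact: undup_uniq|exact: proj1 (pp_tail hD)|by []|].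
 by apply/mE; rewrite mem_cat EA.
- apply: minkowski_sumE => [||E /pE[]|E [hE zE] /hB EB]; [exact: undup_uniq|exact: proj1 (pp_tail hD')|by []|].
 by apply/mE; rewrite mem_cat EB orbT.
Qed.

(** The face condition concerns the Minkowski sum over all divisors through z. Decompositions of
    face points consist of face points ([msum_face_split]), and [cancellation] turns the equality of
    sums into equalities of the summands. *)
Lemma face_fiber z w : loc Y D' z -> dual_cone (tail D) w -> fiber Y D' z = face (fiber Y D z) w ->
 tail D' = face (tail D) w /\ forall E, pd E -> z `<=` E -> coef D' E = face (coef D E) w.
Proof.
move=> lz dw; have [Es [uEs pEs tEs -> ->]] := common_support z => hf.
have c' : polyhedral_cone (tail D') := proj1 (pp_tail hD').
have sD' E : E \in Es -> sigma_polyhedron (tail D') (coef D' E).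
 by move=> /pEs[pE zE]; exact: (loc_sigma hD' (loc_pdE lz pE zE)).
have /(choice_in 0)[p hp] E : E \in Es -> exists x, coef D' E x by case/sD'.
have sp w0 x : tail D' w0 -> (forall E, E \in Es -> coef D' E (x E)) ->
  face (tail D) w w0 /\ forall E, E \in Es -> face (coef D E) w (x E).
 move=> h0 hx; apply: (msum_face_split uEs); first member.
  by move=> E hE; apply: sub_coef; [case: (pEs E hE)|exact: hx].
 by rewrite -hf; exists w0, x.
have t1 : tail D' `<=` face (tail D) w by move=> x hx; case: (sp x p hx hp).
have t2 E : E \in Es -> coef D' E `<=` face (coef D E) w.
 move=> hE x hx; have [|_ /(_ E hE)] := sp 0 (fun E' => if E' == E then x else p E') (cone0 c').
  by move=> E' hE'; case: eqP => [->|_] //; exact: hp.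
 by rewrite eqxx.
have [|t3 t4] := cancellation uEs c' t1 sD' t2.
 by move=> _ [w0 [x [h0 hx ->]]]; rewrite hf; exact: msum_face_join.
have tE : tail D' = face (tail D) w by apply/seteqP.
split=> // E pE zE; have [hE|nE] := boolP (E \in Es).
 by apply/seteqP; split; [exact: t2|exact: t4].
by have [-> ->] := tEs E pE zE nE.
Qed.

Lemma face_cone sigma w : polyhedral_cone sigma -> dual_cone sigma w -> polyhedral_cone (face sigma w).
Proof.
move=> [s ->] dw; exists (- w :: s); apply/seteqP; split=> [x [hx mx] a|x hx].
 case/in_consP=> [->|/hx //]; rewrite pairingNl oppr_ge0 -[leRHS](pairing0r w); apply: mx => c cs.
 by rewrite pairing0r.
have hx' a : a \in s -> 0 <= pairing a x by move=> /mem_tail/hx.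
split=> // y /dw; apply: le_trans.
by have := hx _ (mem_head _ _); rewrite pairingNl oppr_ge0.
Qed.

(** The same cancellation, applied to the w-faces of both families; it turns the third face
    condition at z into a statement about single divisors. *)
Lemma face_fiber_sub z w : loc Y D z -> dual_cone (tail D) w ->
 face (fiber Y D' z) w = face (fiber Y D z) w ->
 forall E, pd E -> z `<=` E -> face (coef D E) w `<=` coef D' E.
Proof.
move=> lz dw; have [Es [uEs pEs tEs -> ->]] := common_support z => hf.
have [c c'] : polyhedral_cone (tail D) /\ polyhedral_cone (tail D') by split; [case: (pp_tail hD)|case: (pp_tail hD')].
have sD E : E \in Es -> sigma_polyhedron (tail D) (coef D E).
 by move=> /pEs[pE zE]; exact: (loc_sigma hD (loc_pdE lz pE zE)).
have [q hq] := choice_in 0 (fun E hE => face_ex (sD E hE) dw).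
have f0 s : dual_cone s w -> polyhedral_cone s -> face s w 0.
 by move=> ds /cone0 s0; split=> // x /ds; rewrite pairing0r.
have [w0 [x [h0 hx Ex]]] : msum Es (tail D') (coef D') (0 + \sum_(E <- Es) q E).
 by have := msum_face_join (f0 _ dw c) hq; rewrite -hf => -[].
have hx' E : E \in Es -> coef D E (x E) by move=> hE; apply: sub_coef; [case: (pEs E hE)|exact: hx].
have [_ fx] : face (tail D) w w0 /\ forall E, E \in Es -> face (coef D E) w (x E).
 by apply: (msum_face_split uEs) => //; [member|rewrite -Ex; exact: msum_face_join (f0 _ dw c) hq].
have sD' E : E \in Es -> sigma_polyhedron (tail D') (coef D' E).
 by move=> hE; have [pE zE] := pEs E hE; case: (pp_coef hD' pE) => // e; have := hx E hE; rewrite e.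
have dw' := sub_dual dw.
have t1 : face (tail D') w `<=` face (tail D) w.
 move=> y [hy my]; split; first member.
 by move=> y' /dw; apply: le_trans; rewrite -(pairing0r w); apply: my; exact: cone0.
have t2 E : E \in Es -> face (coef D' E) w `<=` face (coef D E) w.
 move=> hE y [hy my]; split; first by apply: sub_coef; case: (pEs E hE).
 by move=> y' hy'; apply: le_trans (my _ (hx E hE)) _; apply: (proj2 (fx E hE)).
have [|t3 t4] := cancellation uEs (face_cone c' dw') t1 (fun E hE => face_sigma (sD' E hE) dw') t2.
 move=> _ [w1 [x1 [h1 hx1 ->]]]; have := msum_face_join h1 hx1; rewrite -hf => hm.
 have [w2 [x2 [h2 hx2 E2]]] := proj1 hm; rewrite E2 in hm *.
 by have [g1 g2] := msum_face_split uEs h2 hx2 hm; exists w2, x2.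
move=> E pE zE; have [hE|nE] := boolP (E \in Es); first by move=> y /(t4 E hE)[].
by have [-> ->] := tEs E pE zE nE; move=> y /t3[].
Qed.

End Sub.

(** * Faces give open embeddings *)

Section OpenEmbedding.
Variables D' D : polydiv F n.
Hypotheses (hD' : pp_divisor iota Y D') (hD : pp_divisor iota Y D).
Hypotheses (hface : face_of Y D' D) (sub_tail : tail D' `<=` tail D).
Let sub_coef : forall E, pd E -> coef D' E `<=` coef D E := proj1 hface.

(** The base functions lie in R, which provides the centre y. If y lay on a divisor with empty
    coefficient, a section f of m H without zero at y would have a pole there; its inverse would lie
    in the maximal ideal at y although f, of weight 0, belongs to the algebra of D'. *)
Lemma center_loc (R : set L) : kvr kL R -> alg D' `<=` R ->
 exists y, [/\ closed_point Y y, dominates [set f | R (lc f)] y & loc Y D' y].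
Proof.
move=> hR AR; have h0 := restrict_kvr hR; set R0 := [set f | R (lc f)] in h0 *.
have v0 := kvr_vr h0.
have [||s hs sR] := bsR v0; first member.
 move=> b bb; have [->|b0] := eqVneq b 0; first member.
 rewrite /R0 /= -term0; apply: AR; apply: sect_algebra; apply: (sect_const hD') => // E [[hE _] _].
 exact: bsY.
have [hy dy] := center_Y hM v0 hs sR; set y := localization _ _ in hy dy.
have yl := Y_local hM hy.
exists y; split=> //.
 exact: (center_closed hM h0 hy dy).
split=> // E hE yE; have [e|ne] := pselect (coef D' E = set0); last exact/set0P/eqP.
have [H [H0 Hne [m m0 Hbpf]]] := pp_loc hD'; have [f ef nf] := Hbpf y hy; have f0 := proj1 ef.
have of' := nonvanishing_ord ef hy nf.
have R0f : R0 f.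
 by rewrite /R0 /= -term0; apply: AR; apply: sect_algebra; exact: (sect_loc hD' Hne ef).
have if0 : f^-1 != 0 by rewrite invr_neq0.
have yif : y f^-1.
 apply: (hartogs hy if0) => E' hE' yE'; rewrite (pd_ordV hE' f0) -(ler0z rat) rmorphN /= of' //.
 by rewrite opprK mulr_ge0 ?H0.
have mif : maxid y f^-1.
 split=> // -[_]; rewrite invrK => yf.
 have := proj2 (pd_ord_ge0 hE f0) (yE _ yf); rewrite -(ler0z rat) of' // oppr_ge0 leNgt => /negP; apply.
 by rewrite mulr_gt0 ?ltr0n // lt_neqAle H0 // andbT eq_sym; apply/(Hne E hE).
have : maxid R0 f^-1 by apply/(dominates_max dy).
by move=> /(vr_max_out f0)/(_ R0f).
Qed.

(* Multiplying the section f of D(w) by a section of a multiple of D'(-w) that does not vanish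
  at y gives a unit at y. *)
Theorem open_embedding (R : set L) : kvr kL R -> alg D' `<=` R ->
 exists g, [/\ alg D g, g != 0, R g^-1 & forall a, alg D' a -> exists m, alg D (a * g ^+ m)].
Proof.
move=> hR AR; have [y [cy dy ly]] := center_loc hR AR.
have [u [f [du ef nsf hfib hz]]] := proj2 hface y cy ly; set w := lattice_vect u in du ef nsf hfib hz.
have [tE cE] := face_fiber hD' hD sub_coef sub_tail ly du hfib.
have [f0 hf] := ef; pose g : L := term (f, u).
have g0 : g != 0 by exact: term_neq0.
have ly' := sub_loc sub_coef ly; have hy := proj1 cy.
(* The tail of D' is the face of the tail of D cut out by w. Since w vanishes on it, - w is a weight
   of D' too, and D'(- w) = - D(w) along the divisors through y. *)
have w0 x : tail D' x -> pairing w x = 0.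
 rewrite tE => -[tx mx]; apply/eqP; rewrite eq_le (du _ tx) andbT -(pairing0r w).
 by apply: mx; exact: cone0 (proj1 (pp_tail hD)).
have dNw : dual_cone (tail D') (- w) by move=> x /w0; rewrite pairingNl => ->.
have gR : R g by apply: AR; apply: (sub_alg hD' hD sub_coef sub_tail); exact: sect_algebra.
have igR : R g^-1.
 have [_ [m m0 bpf]] := pp_semiample hD' dNw; have [s es ns] := bpf y ly.
 have [s0 hs] := es.
 have hs' : sect D' (s, - u *+ m).
  split; rewrite /= latticeMn latticeN; first exact: dualZ.
  by split=> // E hE; rewrite (eval_scale hD' _ hE dNw); member.
 have Rs : R (term (s, - u *+ m)) by apply: AR; exact: sect_algebra.
 have sf0 : s * f ^+ m != 0 by rewrite mulf_neq0 ?expf_neq0.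
 have [_ yi] : y (s * f ^+ m) /\ y (s * f ^+ m)^-1.
  apply: (unit_of_ord hy sf0) => E hE yE; have hEl := loc_pdE ly hE yE; have hEl' := loc_pdE ly' hE yE.
  rewrite (pd_ordM hE s0) ?expf_neq0 // (pd_ordX m hE f0).
  apply/eqP; rewrite -(intr_eq0 rat) rmorphD rmorphMn /= (nonvanishing_ord es ly ns hEl yE).
  rewrite (nonvanishing_ord ef ly' nsf hEl' yE) /multiple.
  have [x fx ->] := eval_ex hD' hEl dNw; have fxw : face (coef D E) w x by rewrite -cE; case: fx.
  by rewrite (evalE fxw) pairingNl; apply/eqP; ring.
 have Ri : R (lc (s * f ^+ m)^-1) by exact: (proj1 dy _ yi).
 (* The section s of weight - m u times g^m is s f^m, of weight 0 and a unit at y; division by g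
    leaves m - 1 factors. *)
 have -> : g^-1 = term (s, - u *+ m) * g ^+ m.-1 * lc (s * f ^+ m)^-1.
  apply: (mulIf g0); rewrite (mulVf g0) mulrAC -[_ * g ^+ _ * g]mulrA -exprSr prednK //.
  rewrite termX termM -mulrnDl addNr mul0rn term0 -rmorphM divff //.
 member.
exists g; split=> //; first exact: sect_algebra.
have sD := pp_subring hD; have Dg : alg D g by exact: sect_algebra.
pose C := [set a : L | exists m, alg D (a * g ^+ m)].
suff : alg D' `<=` C by [].
apply: (pp_sub_terms).
 split.
 - by exists 0%N; member.
 - move=> a b [m hm] [m' hm']; exists (m + m')%N; rewrite mulrBl [g ^+ (m + m')]exprD [_ * g ^+ m' in X in _ - X]mulrC !mulrA.
  member.
 - move=> a b [m hm] [m' hm']; exists (m + m')%N; rewrite exprD mulrACA; member.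
move=> [h u'] [du' [h0 hh]]; set w' := lattice_vect u' in du' hh; rewrite /= in h0 du' hh.
suff [m hm] : exists m, sect D (h * f ^+ m, u' + u *+ m).
 by exists m; rewrite termX termM; exact: sect_algebra.
have ct := proj1 (pp_tail hD).
have [|||k0 hk0] := @eventually_above _ _ _ w' w 0 0 (sigma_coneP ct).
- by exists 0; split=> [|x /du]; [exact: cone0|rewrite pairing0r].
- by move=> x; rewrite -tE; exact: w0.
- by move=> x; rewrite -tE; exact: du'.
have dk m : (k0 <= m)%N -> dual_cone (tail D) (w' + m%:R *: w).
 by move=> km x hx; have := hk0 m x km hx; rewrite mulr0 pairingDl pairingZl.
(* It remains to see that h f^m is a section of D(u' + m u) for large m; [bound E] is this claim
   along the single divisor E. *)
pose bound E := exists k1 : nat, forall m, (k1 <= m)%N -> (k0 <= m)%N ->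
 0 <= (ord E (h * f ^+ m))%:~R + eval D (w' + m%:R *: w) E.
have ordE E m : pd E -> (ord E (h * f ^+ m))%:~R = (ord E h)%:~R + m%:R * (ord E f)%:~R :> rat.
 by move=> hE; rewrite (pd_ordM hE h0) ?expf_neq0 // (pd_ordX m hE f0) rmorphD rmorphMn mulr_natl.
have [A [uA pA hA]] := pp_supp hD; have [A' [uA' pA' hA']] := pp_supp hD'.
have [B [uB pB hB]] := finite_ord f0; have [B' [uB' pB' hB']] := finite_ord h0.
have evb E (d c : rat) : lpd D E -> face (coef D E) w !=set0 ->
  (forall x, face (coef D E) w x -> pairing w x = c) -> (forall x, face (coef D E) w x -> d <= pairing w' x) ->
  exists k1 : nat, forall m, (k1 <= m)%N -> (k0 <= m)%N -> d + m%:R * c <= eval D (w' + m%:R *: w) E.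
 move=> hE ne hc hd; have [k1 h1] := eventually_above (loc_sigma hD hE) ne hc hd; exists k1 => m m1 m2.
 by have [x [hx _] ->] := eval_ex hD hE (dk m m2); rewrite pairingDl pairingZl; exact: h1.
have bE E : lpd D E -> bound E.
 move=> hEl; have [hE _] := proj1 (loc_pd D E) hEl.
 have [x0 fx0 ex0] := eval_ex hD hEl du; have fc x : face (coef D E) w x -> pairing w x = eval D w E by move=> /evalE.
 (* Where div f + D(w) is positive along E, a large multiple of it outweighs the fixed contribution
    of h. *)
 have := hf E hEl; rewrite le_eqVlt => /orP[/eqP eq0|gt0]; last first.
  have [x1 [fx1 mx1]] : exists x1, face (face (coef D E) w) w' x1.
   by apply: (face_ex (face_sigma (loc_sigma hD hEl) du)); rewrite -tE.
  have [|||k1 h1] := evb E (pairing w' x1) (eval D w E) hEl; [by exists x0|member|member|].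
  set a := (ord E f)%:~R + _ in gt0; set d := pairing w' x1 in h1.
  pose b : rat := `|(ord E h)%:~R + d| / a.
  exists (maxn k1 (Num.bound b)) => m; rewrite geq_max => /andP[m1 mb] m2; rewrite ordE //.
  have := h1 m m1 m2; have ab : b < m%:R.
   by apply: lt_le_trans (archi_boundP _) _; rewrite ?ler_nat // divr_ge0 // ltW.
  have : `|(ord E h)%:~R + d| <= m%:R * a by rewrite ltW // -ltr_pdivrMr.
  rewrite ler_norml => /andP[h2 _]; rewrite /a in h2; lra.
 (* Where div f + D(w) is zero along E, a closed point z of E away from the other divisors in play
    lies outside the support of the section. The third face condition at z then puts the w-face of
    the coefficient of D at E inside that of D'. *)
 have [|z [cz zE nz]] := closed_below hM (y := E) (Es := [seq E' <- A ++ B | `[< ~ E `<=` E' >]]) (proj1 hE).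
  by move=> E'; rewrite mem_filter mem_cat => /andP[/asboolP nE /orP[/pA[]|/pB[]]].
 have in_eq E' : pd E' -> z `<=` E' -> E' \in A ++ B -> E = E'.
  move=> hE' zE' inE'; apply: (pd_inj hE hE'); apply: contrapT => nE.
  by apply: (nz E') => //; rewrite mem_filter inE' andbT; apply/asboolP.
 have lz : loc Y D z.
  split=> [|E' hE' zE']; first by case: cz.
  have [e|ne] := pselect (coef D E' = set0); last exact/set0P/eqP.
  have EE : E = E'.
   apply: in_eq => //; rewrite mem_cat hA // e => e'.
   by have := cone0 ct; rewrite -e'.
  by rewrite -EE; case: (proj1 (loc_pd D E) hEl).
 have nsz : ~ supp (loc Y D) (eval D w) f z.
  move=> [_ [E' [hE' zE' ne]]]; have [pE' _] := proj1 (loc_pd D E') hE'.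
  have [o0|o0] := eqVneq (ord E' f) 0.
   have EA : E' \in A.
    by apply: hA => e; move: ne; rewrite o0 (eval_tail hD e du).
   by move: ne; rewrite -(in_eq E') -?eq0 // mem_cat EA.
  by move: ne; rewrite -(in_eq E') -?eq0 // mem_cat (hB E' pE' o0) orbT.
 have fsub := face_fiber_sub hD' hD sub_coef sub_tail lz du (hz z cz nsz) hE zE.
 have hEl' : lpd D' E by apply/(loc_pd); split=> //; exists x0; member.
 have [|||k1 h1] := evb E (eval D' w' E) (eval D w E) hEl => //; [by exists x0| |].
  by move=> x /fsub hx; exact: (eval_le hD' hEl' du' hx).
 exists k1 => m m1 m2; rewrite ordE //; have := h1 m m1 m2; have := hh E hEl'; rewrite /= => a1 a2.
 have : m%:R * ((ord E f)%:~R + eval D w E) = 0 by rewrite -eq0 mulr0.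
 by rewrite mulrDr => a3; lra.
(* Outside this finite list the coefficient of D is the tail cone and both f and h have order 0, so
   one m serves for all E. *)
have [k1 hk1] : exists k1 : nat, forall E m, E \in A ++ B ++ B' -> lpd D E -> (k1 <= m)%N -> (k0 <= m)%N ->
  0 <= (ord E (h * f ^+ m))%:~R + eval D (w' + m%:R *: w) E.
 elim: (A ++ B ++ B') => [|E l [k1 IH]]; first by exists 0%N.
 have [hE|nE] := pselect (lpd D E); last first.
  by exists k1 => E' m /in_consP[-> /nE|]; last exact: IH.
 have [k2 h2] := bE E hE; exists (maxn k1 k2) => E' m; rewrite geq_max => /orP[/eqP -> _ /andP[_ m2]|hl hE' /andP[m1 _]].
  exact: h2.
 exact: IH.
exists (maxn k0 k1); set m := maxn k0 k1; have [m0 m1] : (k0 <= m)%N /\ (k1 <= m)%N by rewrite leq_maxl leq_maxr.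
have lE : lattice_vect (u' + u *+ m) = w' + m%:R *: w by rewrite latticeD latticeMn.
split; rewrite /= lE; first member.
split=> [|E hE]; first by rewrite mulf_neq0 ?expf_neq0.
have [inE|nin] := boolP (E \in A ++ B ++ B'); first exact: hk1.
have [pE _] := proj1 (loc_pd D E) hE; move: nin; rewrite !mem_cat !negb_or => /and3P[nA nB nB'].
have ct0 : coef D E = tail D by apply: contrapT => /hA; apply/negP.
rewrite (ordE _ _ pE) (eval_tail hD ct0 (dk m m0)) addr0.
have -> : ord E f = 0 by apply/eqP; apply: contraNT nB; exact: hB.
have -> : ord E h = 0 by apply/eqP; apply: contraNT nB'; exact: hB'.
by rewrite mulr0.
Qed.

End OpenEmbedding.

(** * The prevariety of a divisorial fan *)

Lemma slice_msum D mu y (Es : seq (set F)) : pp_divisor iota Y D -> qval k mu -> center Y mu y -> uniq Es ->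
 (forall E, E \in Es -> pd E /\ y `<=` E) -> (forall E, coef D E <> tail D -> y `<=` E -> E \in Es) ->
 slice Y mu y D = msum Es (tail D) (fun E => poly_scale (tail D) (weight Y mu y E) (coef D E)).
Proof.
move=> hD hmu cy uEs pEs hEs; have ct := proj1 (pp_tail hD).
apply: minkowski_sumE => // [E /pEs[]//|E hE ne].
have [yE|nyE] := pselect (y `<=` E); last by case: ne; rewrite (weight_eq0 hmu cy hE nyE).
by apply: hEs => // e; apply: ne; rewrite e (poly_scale_tail hD) // (weight_ge0 hmu cy hE).
Qed.

Lemma scaleE sigma (c : rat) (Delta : set 'rV[rat]_n) : 0 < c -> poly_scale sigma c Delta = [set x | Delta (c^-1 *: x)].
Proof.
move=> c0; rewrite /poly_scale gt_eqF //; apply/seteqP; split=> [_ [x hx <-]|x hx] /=.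
 by rewrite scalerA mulVf ?gt_eqF // scale1r.
by exists (c^-1 *: x) => //; rewrite scalerA divff ?gt_eqF // scale1r.
Qed.

Lemma face_scale sigma (c : rat) (Delta : set 'rV[rat]_n) w : 0 < c ->
 face (poly_scale sigma c Delta) w = poly_scale sigma c (face Delta w).
Proof.
move=> c0; rewrite !scaleE //; have ci : 0 < c^-1 by rewrite invr_gt0.
apply/seteqP; split=> x [hx mx]; split=> // x' hx'.
 by rewrite pairingZr -ler_pdivlMl ?invrK // -pairingZr; apply: mx; rewrite /= scalerA mulVf ?gt_eqF ?scale1r.
by rewrite -(ler_pM2l ci) -!pairingZr; member.
Qed.

(* The face D' of D2 is cut out near y by a functional w; the two decompositions of v have the
  same minimal value of w. *)
Lemma slice_inter D2 D' D'' mu y v : pp_divisor iota Y D2 -> pp_divisor iota Y D' -> pp_divisor iota Y D'' ->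
 pp_divisor iota Y (inter D' D'') -> face_of Y D' D2 -> tail D' `<=` tail D2 ->
 (forall E, pd E -> coef D'' E `<=` coef D2 E) -> tail D'' `<=` tail D2 -> qval k mu -> center Y mu y ->
 slice Y mu y D' v -> slice Y mu y D'' v -> slice Y mu y (inter D' D'') v.
Proof.
move=> h2 h' h'' hi hf st sc'' st'' hmu cy s' s''; have sc := proj1 hf.
have l' := slice_loc h' hmu cy s'.
have [A2 [uA2 pA2 hA2]] := pp_supp h2; have [A' [uA' pA' hA']] := pp_supp h'; have [A'' [uA'' pA'' hA'']] := pp_supp h''.
pose A := A2 ++ A' ++ A''.
have pA E : E \in A -> pd E by rewrite !mem_cat => /or3P[/pA2|/pA'|/pA''].
(* The face condition is stated at closed points only. The specialization z of y lies on no further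
   divisor with a nontrivial coefficient, so the functional w found at z works at y. *)
have [|z [cz zy nz]] := closed_below hM (y := y) (Es := [seq E <- A | `[< ~ y `<=` E >]]) (proj1 cy).
 by move=> E; rewrite mem_filter => /andP[/asboolP nE /pA[]].
have lz : loc Y D' z.
 split=> [|E hE zE]; first by case: cz.
 have [yE|nyE] := pselect (y `<=` E); first exact: (proj2 l').
 have -> : coef D' E = tail D'; last by exists 0; exact: cone0 (proj1 (pp_tail h')).
 apply: contrapT => /hA' EA; apply: (nz E) => //; rewrite mem_filter !mem_cat EA orbT andbT; exact/asboolP.
have [u [f [du _ _ ff _]]] := proj2 hf z cz lz; set w := lattice_vect u in du ff.
have [tE cE] := face_fiber h' h2 sc st lz du ff.
pose Es := undup [seq E <- A | `[< y `<=` E >]]; have uEs : uniq Es by exact: undup_uniq.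
have pEs E : E \in Es -> pd E /\ y `<=` E by rewrite mem_undup mem_filter => /andP[/asboolP yE /pA].
have EsP D E : (coef D E <> tail D -> E \in A) -> coef D E <> tail D -> y `<=` E -> E \in Es.
 by move=> h /h EA yE; rewrite mem_undup mem_filter EA andbT; apply/asboolP.
have w0 E : E \in Es -> 0 < weight Y mu y E by move=> /pEs[hE yE]; exact: (weight_gt0 hmu cy).
move: s' s''; rewrite (slice_msum h' hmu cy uEs pEs); last first.
 by move=> E; apply: EsP => /hA' EA; rewrite !mem_cat EA orbT.
rewrite (slice_msum h'' hmu cy uEs pEs); last by move=> E; apply: EsP => /hA'' EA; rewrite !mem_cat EA !orbT.
rewrite (slice_msum hi hmu cy uEs pEs); last first.
 move=> E; apply: EsP => ne; apply: contrapT => nA; apply: ne; rewrite /=.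
 have [-> ->] // : coef D' E = tail D' /\ coef D'' E = tail D''.
 by split; [apply: contrapT => /hA' EA|apply: contrapT => /hA'' EA]; apply: nA; rewrite !mem_cat EA !orbT.
move=> [t' [x' [ht' hx' vE']]] [t'' [x'' [ht'' hx'' vE'']]].
pose Delta E := poly_scale (tail D2) (weight Y mu y E) (coef D2 E).
have fv : face (msum Es (tail D2) Delta) w v.
 rewrite vE'; apply: msum_face_join => [|E hE]; first by rewrite -tE.
 have [pE yE] := pEs E hE; have := hx' E hE; rewrite face_scale ?w0 // !scaleE ?w0 // cE //; member.
rewrite vE'' in fv; have [|E hE|ft fx] := msum_face_split uEs _ _ fv.
- member.
- by have := hx'' E hE; rewrite /Delta !scaleE ?w0 //; apply: sc''; case: (pEs E hE).
exists t'', x''; split=> // [|E hE]; first by split=> //; rewrite tE.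
have [pE yE] := pEs E hE; have := hx'' E hE; have := fx E hE; rewrite face_scale ?w0 // !scaleE ?w0 // => h1 h3.
by split=> //; rewrite cE; member.
Qed.

(** R comes from [gauss_valuation]. A detecting section of negative weight at v would have its
    inverse in the maximal ideal of R; hence if the algebra lies in R, all detecting sections pass
    their test and v lies in the slice. *)
Lemma slice_place mu y v : qval k mu -> center Y mu y -> exists R : set L, [/\ valuation_subring R, kL `<=` R &
 forall D, pp_divisor iota Y D -> slice Y mu y D v <-> alg D `<=` R].
Proof.
move=> hmu cy; have [R hR tR] := gauss_valuation v hk hmu; have sR := vr_sub hR.
have kR : kL `<=` R.
 move=> _ [c _ <-]; have [->|c0] := eqVneq c 0; first by rewrite !rmorph0; member.
 rewrite /= -term0; apply: (proj1 (tR _ _ _)); first by rewrite fmorph_eq0.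
 by rewrite lattice0 pairing0l; have [_ _ ->] := hmu; rewrite ?fmorph_eq0.
exists R; split=> // D hD; split=> [hs|AR].
 apply: (pp_sub_terms sR) => -[f u] hp; apply: (proj1 (tR f u _)); first by case: hp => _ [].
 exact: (slice_sections hD hmu cy hs hp).
have [G [Gs hG]] := detecting_sections hD.
have [[f u] pG|z cz] := hG mu v hmu; last by rewrite (center_uniq hmu cz cy).
have hp := Gs _ pG; have p0 : f != 0 by case: hp => _ [].
rewrite /= leNgt; apply/negP => neg.
have : maxid R (term (f^-1, - u)).
 apply: (proj2 (tR _ _ _)); rewrite ?invr_neq0 // (qvalV hk hmu p0) latticeN pairingNl -opprD oppr_gt0.
 by [].
by rewrite -(@termV _ _ (f, u)) // => /(vr_max_out (term_neq0 (p := (f, u)) p0)); apply; apply: AR; exact: sect_algebra hp.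
Qed.

(** An element of the third algebra outside R stays outside the valuation ring of an approximating
    nu that is nonnegative on generators of the first two. The vector of nu lies in both of their
    slices at the same centre, hence in that of D, a contradiction. *)
Lemma alg_of_slices D1 D2 D (R : set L) : pp_divisor iota Y D1 -> pp_divisor iota Y D2 -> pp_divisor iota Y D ->
 (forall mu y v, qval k mu -> center Y mu y -> slice Y mu y D1 v -> slice Y mu y D2 v -> slice Y mu y D v) ->
 valuation_subring R -> kL `<=` R -> alg D1 `<=` R -> alg D2 `<=` R -> alg D `<=` R.
Proof.
move=> h1 h2 h hs hR kR A1 A2 a Aa; apply: contrapT => nRa; have [a0 ma] := vr_out hR nRa.
have [G1 [G1A [G1s _]]] := alg_finite h1; have [G2 [G2A [G2s _]]] := alg_finite h2.
have [nu hnu hl] := approximation (a^-1 :: G1 ++ G2) hR kR.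
have mem x : x \in G1 ++ G2 -> valuation_ring nu x.
 move=> xG; have [->|x0] := eqVneq x 0; first by left.
 right; apply: (proj1 (hl x _ x0)); first by rewrite inE xG orbT.
 by move: xG; case/in_catP=> [/G1A/A1|/G2A/A2].
have [x xG|y1 c1 s1] := G1s nu hnu; first by apply: mem; rewrite mem_cat xG.
have [x xG|y2 c2 s2] := G2s nu hnu; first by apply: mem; rewrite mem_cat xG orbT.
have hmu := restrict_qval hnu; have e := center_uniq hmu c2 c1; subst y2.
have := alg_of_slice h hnu c1 (hs _ _ _ hmu c1 s1 s2) Aa.
have ai0 : a^-1 != 0 by rewrite invr_eq0.
move=> /(qval_ringP nu a0); have := proj2 (hl _ (mem_head _ _) ai0) ma.
by rewrite (qvalV hkL hnu a0) oppr_gt0 ltNge => /negP.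
Qed.

Section Fan.
Variable S : set (polydiv F n).
Hypothesis fanS : divisorial_fan iota Y S.
Let hS D : S D -> pp_divisor iota Y D := proj1 fanS D.
Let io : {rmorphism K -> L} := (lc \o iota).
Local Notation I := {D | S D}.
Local Notation pts := {d : I & X_pp iota Y (sval d)}.
Local Notation pt d x := (existT (fun i : I => X_pp iota Y (sval i)) d x).
Implicit Types (p q r : pts) (d e : I) (R : set L).
Local Notation A := (fun d : I => alg (sval d)).
Local Notation o p := (sval (projT2 p)).
Local Notation rel := (@gluing_rel _ _ iota n Y S).
Local Notation ctrD D := (ctr (pp_algebra Y D)).

Let fan_inter D D' (s : S D) (s' : S D') : S (inter D D') := let: And3 _ _ h := proj2 fanS D D' s s' in h.

Let sA D (s : S D) : subring_set (alg D) := pp_subring (hS s).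

Lemma inter_face D D' : S D -> S D' -> face_of Y (inter D D') D.
Proof. by move=> s s'; have [] := proj2 fanS D D' s s'. Qed.

Lemma interC D D' : inter D D' = inter D' D.
Proof. by congr PolyDiv; apply/funext => E; rewrite setIC. Qed.

Lemma interxx D : inter D D = D.
Proof. by case: D => t c; congr PolyDiv; apply/funext => E; rewrite setIid. Qed.

Lemma alg_inter D D' : S D -> S D' -> alg D `<=` alg (inter D D').
Proof. by move=> s s'; apply: (sub_alg (hS (fan_inter s s')) (hS s)) => [E _|] x []. Qed.

Lemma ctr_dominates D R : S D -> kvr kL R -> alg D `<=` R -> dominates R (ctrD D R).
Proof. by move=> s hR AR; apply: center_dom => //; [member|exact: (sA s)]. Qed.

Lemma sub_ctr D R : S D -> kvr kL R -> alg D `<=` R -> alg D `<=` ctrD D R.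
Proof. by move=> s hR AR; exact: (loc_base (sA s) (maxid_prime (kvr_vr hR) (sA s) AR)). Qed.

(** By [open_embedding] the algebra of the intersection lies in A_D[1/g] with g a unit of R, so both
    algebras have the same localization at the centre of R. *)
Lemma ctr_inter D D' R : S D -> S D' -> kvr kL R -> alg (inter D D') `<=` R -> ctrD D R = ctrD (inter D D') R.
Proof.
move=> s s' hR AR; have si := fan_inter s s'; have iA' := alg_inter s s'; have hA := sA s.
have AR' : alg D `<=` R by move=> x /iA'/AR.
have [d d'] := (ctr_dominates s hR AR', ctr_dominates si hR AR).
have hp := maxid_prime (kvr_vr hR) hA AR'; have ol := loc_local hA hp.
have [|g [Ag g0 ig hg]] := open_embedding (hS si) (hS s) (inter_face s s') _ hR AR; first by move=> x [].
have iA : alg (inter D D') `<=` ctrD D R.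
 move=> a /hg[m Am]; exists (a * g ^+ m), (g ^+ m); split => //; [member| |by rewrite (mulfK (expf_neq0 m g0))].
 move=> [mg _]; apply: (unit_notmax (x := g ^+ m)) mg; first by rewrite expf_neq0.
 by rewrite -exprVn; member.
have si' := sA si.
apply/seteqP; split; last first.
 apply: (loc_min (proj1 ol) iA) => b Ab nb; have [|//] := @vr_unit _ (ctrD D R) b (iA _ Ab).
 by move=> /(dominates_max d (iA _ Ab)) mb; apply: nb.
apply: (loc_min (proj1 (loc_local si' (maxid_prime (kvr_vr hR) si' AR)))) => [x /iA' Ax|b Ab nb].
 exact: (loc_base si' (maxid_prime (kvr_vr hR) si' AR)).
apply: (loc_inv si' (iA' _ Ab)) => -[mb _]; exact: nb.
Qed.

Lemma X_point d R : kvr kL R -> A d `<=` R -> exists x : X_pp iota Y (sval d), sval x = ctrD (sval d) R.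
Proof.
move=> hR AR; have h := hS (svalP d).
have c := ctr_closed hkL (pp_base h) (pp_subring h) hR AR.
by exists (exist _ _ c).
Qed.

Lemma point_kvr p : exists R, [/\ kvr kL R, A (projT1 p) `<=` R & dominates R (o p)].
Proof.
have h := hS (svalP (projT1 p)); have [G [GA [_ hG]]] := alg_finite h.
exact: (closed_ctr hkL (pp_base h) (pp_subring h) GA hG (svalP (projT2 p))).
Qed.

Lemma point_ctr p R : dominates R (o p) -> o p = ctrD (sval (projT1 p)) R.
Proof. exact: (spec_ctr (sA (svalP (projT1 p))) (proj1 (svalP (projT2 p)))). Qed.

Lemma point_sub p : A (projT1 p) `<=` o p.
Proof.
have [q hq ->] := proj1 (svalP (projT2 p)); exact: (loc_base (sA (svalP (projT1 p))) hq).
Qed.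

(** Glued points are centres of a common place of X(D cap D'), and by [ctr_inter] its local ring is
    that of both. The second condition records that the point lies in the overlap of the two
    charts. *)
Lemma relP p q : rel p q <-> o p = o q /\ alg (inter (sval (projT1 p)) (sval (projT1 q))) `<=` o p.
Proof.
have [[s s'] si] := ((svalP (projT1 p), svalP (projT1 q)), fan_inter (svalP (projT1 p)) (svalP (projT1 q))).
split=> [[x [dp dq]]|[e h]].
 have [R [hR AR dR]] := point_kvr (pt (exist _ _ si) x); rewrite /= in AR dR.
 have tr O : dominates (sval x) O -> dominates R O.
  move=> [h1 h2]; apply: dominatesI => [f /h1|f]; first exact: (proj1 dR).
  by rewrite h2 => -[mf _]; apply/(dominates_max dR) => //; exact: maxid_sub mf.
 rewrite (point_ctr (tr _ dp)) (point_ctr (tr _ dq)) (ctr_inter s s' hR AR).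
 rewrite (ctr_inter s' s hR) interC //; split=> // a Aa.
 rewrite interC in AR Aa si *; exact: (sub_ctr si hR AR).
have [R [hR AR dR]] := point_kvr p; have iR : alg (inter (sval (projT1 p)) (sval (projT1 q))) `<=` R by move=> a /h/(proj1 dR).
have [x xE] := X_point (d := exist _ _ si) hR iR; exists x; rewrite xE -e -(ctr_inter s s' hR iR) -(point_ctr dR).
by split; split=> //; apply/seteqP; split=> [f mf|f []//]; split=> //; member.
Qed.

(** D1 cap D2 and D2 cap D3 are both faces of D2. By [slice_inter] a place containing their algebras
    contains that of D1 cap D2 cap D3, and therefore that of D1 cap D3. *)
Lemma rel_trans p q r : rel p q -> rel q r -> rel p r.
Proof.
move=> /relP[e1 h1] /relP[e2 h2]; apply/relP; split; first by rewrite e1.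
have [[s1 s2] s3] := (svalP (projT1 p), svalP (projT1 q), svalP (projT1 r)).
set D1 := sval (projT1 p) in h1 s1 *; set D2 := sval (projT1 q) in h1 h2 s2 *; set D3 := sval (projT1 r) in h2 s3 *.
have [R [hR AR dR]] := point_kvr p; have oR := proj1 dR; have [s12 s23] := (fan_inter s1 s2, fan_inter s2 s3).
have i123 : alg (inter (inter D1 D2) (inter D2 D3)) `<=` R.
 apply: (alg_of_slices (hS s12) (hS s23)) (kvr_vr hR) (kvr_k hR) _ _; first exact: (hS (fan_inter s12 s23)).
 - move=> mu y v hmu cy; apply: (slice_inter (hS s2)) hmu cy; try member.
  + exact: (hS (fan_inter s12 s23)).
  + by rewrite interC; exact: inter_face.
  + by move=> x [].
  + by move=> E _ x [].
  + by move=> x [].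
 - by move=> a /h1/oR.
 - by move=> a /h2; rewrite -e1 => /oR.
have s13 := fan_inter s1 s3.
have i13 : alg (inter D1 D3) `<=` R.
 move=> a ha; apply: i123; apply: (sub_alg (hS (fan_inter s12 s23)) (hS s13)) ha.
  by move=> E _ x [[h _] [_ h']].
 by move=> x [[h _] [_ h']].
rewrite (point_ctr dR) (ctr_inter s1 s3 hR i13); exact: sub_ctr.
Qed.

Lemma clos_rel p q : Relation_Operators.clos_refl_sym_trans _ rel p q <-> rel p q.
Proof.
split=> [|h]; last exact: Relation_Operators.rst_step.
elim=> {p q} [//|p|p q _ /relP[e h]|p q r _ h1 _ h2]; last exact: rel_trans h1 h2.
 by apply/relP; split=> //; rewrite interxx; exact: point_sub.
by apply/relP; split=> //; rewrite interC -e.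
Qed.

Local Notation X := (X_fan iota Y S).
Local Notation gl p := (@glue_in K I (fun d => X_pp iota Y (sval d)) rel (projT1 p) (projT2 p)).

Definition glue_local (C : X) : set L := [set f | exists q : pts, sval C q /\ o q f].

Definition glue_chart d : set X := [set C | exists x : X_pp iota Y (sval d), C = gl (pt d x)].

Lemma glue_eq p q : gl p = gl q <-> rel p q.
Proof.
case: p q => d x [e y]; split=> [E|/clos_rel h].
 have : sval (gl (pt e y)) (pt e y) by exact: Relation_Operators.rst_refl.
 by rewrite -E => /clos_rel.
apply: eq_exist; apply/seteqP; split=> r hr; apply: Relation_Operators.rst_trans hr => //.
exact: Relation_Operators.rst_sym.
Qed.

Lemma glue_localE p : glue_local (gl p) = o p.
Proof.
case: p => d x; apply/seteqP; split=> [f [q [/clos_rel/relP[/= <- _] //]]|f hf].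
by exists (pt d x); split=> //; exact: Relation_Operators.rst_refl.
Qed.

Lemma glue_surj (C : X) : exists p, C = gl p.
Proof. by case: C => C [[d x] h]; exists (pt d x); apply: eq_exist. Qed.

Lemma X_atlas : atlas io A glue_chart glue_local.
Proof.
split.
- by move=> d; exact: (sA (svalP d)).
- by move=> d; exact: (pp_base (hS (svalP d))).
- move=> d; have [G [GA [_ hG]]] := alg_finite (hS (svalP d)); by exists G.
- by move=> C; have [[d x] ->] := glue_surj C; exists d, x.
- move=> d _ [x ->]; rewrite glue_localE /=; have [R [hR AR dR]] := point_kvr (pt d x).
 have h := hS (svalP d); rewrite (point_ctr dR); exists (maxid R `&` A d); split=> //.
  exact: (maxid_prime (kvr_vr hR) (pp_subring h)).
 exact: (ctr_rational (pp_base h) (pp_subring h)).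
- move=> d R hR AR; have [x xE] := X_point hR AR; exists (gl (pt d x)); first by exists x.
 by rewrite glue_localE xE; exact: ctr_dominates (svalP d) hR AR.
- move=> d _ _ [x ->] [x' ->]; rewrite !glue_localE /= => e; suff -> : x = x' by [].
 by case: x x' e => x hx [x' hx'] /= e; subst x'; congr exist.
- move=> U; split=> [oU d _ [x ->] Ux|h d x Ux].
  have [s [s1 s2]] := oU d x Ux; exists s; rewrite glue_localE; split=> // _ [x' ->]; rewrite glue_localE; exact: s2.
 have [|s [s1 s2]] := h d _ _ Ux; first by exists x.
 exists s; split=> [f /s1|z hz]; first by rewrite (glue_localE (pt d x)).
 by apply: s2; [exists z|move=> f /hz; rewrite (glue_localE (pt d z))].
- move=> U h; split=> [rU d _ [x ->] Ux|hU d x Ux].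
  have [f [W [oW Wx hW]]] := rU d x Ux; have [s [s1 s2]] := oW x Wx; exists f, s; rewrite glue_localE.
  by split=> // _ [z ->]; rewrite glue_localE => /s2; exact: hW.
 have [|f [s [s1 s2]]] := hU d _ _ Ux; first by exists x.
 exists f, [set z : X_pp iota Y (sval d) | s `in` sval z]; split.
 + by move=> z Wz; exists s.
 + by move=> g /s1; rewrite (glue_localE (pt d x)).
 + move=> z Wz Uz; have := s2 (gl (pt d z)); rewrite glue_localE; apply=> //; by exists z.
- move=> d e _ [x ->] [x' /glue_eq/relP[/= xE iA]]; rewrite (glue_localE (pt d x)) /=.
 have [s s'] := (svalP d, svalP e); have si := fan_inter s s'.
 have [R [hR AR dR]] := point_kvr (pt d x); have iR : alg (inter (sval d) (sval e)) `<=` R by move=> a /iA/(proj1 dR).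
 have [|g [Ag g0 ig hg]] := open_embedding (hS si) (hS s) (inter_face s s') _ hR iR; first by move=> z [].
 exists [:: g^-1]; split=> [f|_ [z ->]].
  by rewrite inE => /eqP ->; exact: (dominates_inv dR (point_sub (p := pt d x) Ag)).
 rewrite (glue_localE (pt d z)) /= => /(_ _ (mem_head _ _)) iz; have [R' [hR' AR' dR']] := point_kvr (pt d z).
 have sz : subring_set (sval z).
  have [q hq ->] := proj1 (svalP z); have hA := sA s; member.
 have iz' : alg (inter (sval d) (sval e)) `<=` sval z.
  move=> a /hg[m Am]; rewrite -(mulfK (expf_neq0 m g0) a) -exprVn; apply: (subring_mul sz); last member.
  exact: (point_sub (p := pt d z)).
 have iR' : alg (inter (sval d) (sval e)) `<=` R' by move=> a /iz'/(proj1 dR').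
 have eR' : A e `<=` R' by move=> a ha; apply: iR'; rewrite interC; exact: alg_inter ha.
 have [z' zE] := X_point hR' eR'; exists z'; apply/(glue_eq (pt d z) (pt e z'))/relP => /=; split=> //.
 rewrite zE (ctr_inter s' s hR') interC // -(ctr_inter s s' hR' iR'); exact: (point_ctr (p := pt d z) dR').
(* Any two charts meet, in the centre of a place containing the algebra of the intersection. *)
- move=> d e; have si := fan_inter (svalP d) (svalP e); have [G [GA [_ hG]]] := alg_finite (hS si).
 have [R hR GR] := nullstellensatz hkL G; have iR := hG R (kvr_vr hR) (kvr_k hR) GR.
 have dR : A d `<=` R by move=> a ha; apply: iR; exact: (alg_inter (svalP d) (svalP e)) ha.
 have eR : A e `<=` R by move=> a ha; apply: iR; rewrite interC; exact: (alg_inter (svalP e) (svalP d)) ha.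
 have [x xE] := X_point hR dR; have [x' xE'] := X_point hR eR.
 exists (gl (pt d x)); split; first by exists x.
 exists x'; apply/glue_eq/relP => /=; rewrite xE xE' (ctr_inter (svalP d) (svalP e) hR iR).
 rewrite (ctr_inter (svalP e) (svalP d) hR) interC //; split=> //.
 rewrite interC in iR *; exact: (sub_ctr (fan_inter (svalP e) (svalP d)) hR iR).
Qed.

Lemma separated_places_inter : separated_places io glue_local <->
 forall D D' R, S D -> S D' -> kvr kL R -> alg D `<=` R -> alg D' `<=` R -> alg (inter D D') `<=` R.
Proof.
split=> [hs D D' R s s' hR AR AR'|h R C C' hR].
 have [x xE] := X_point (d := exist _ D s) hR AR; have [x' xE'] := X_point (d := exist _ D' s') hR AR'.
 have dx := ctr_dominates s hR AR; have dx' := ctr_dominates s' hR AR'.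
 have : gl (pt (exist _ D s) x) = gl (pt (exist _ D' s') x').
  by apply: (hs R) => //; rewrite glue_localE ?xE ?xE'.
 by move=> /glue_eq/relP[/= _ iA] a /iA; rewrite xE; exact: (proj1 dx).
have [[p ->] [q ->]] := (glue_surj C, glue_surj C'); rewrite !glue_localE => dp dq.
have [s s'] := (svalP (projT1 p), svalP (projT1 q)).
have iR := h _ _ R s s' hR (fun a ha => proj1 dp _ (point_sub ha)) (fun a ha => proj1 dq _ (point_sub ha)).
apply/glue_eq/relP; rewrite (point_ctr dp) (point_ctr dq) (ctr_inter s s' hR iR).
rewrite (ctr_inter s' s hR) interC //; split=> //; rewrite interC in iR *.
exact: (sub_ctr (fan_inter s' s) hR iR).
Qed.

Let hT := X_atlas.

(** One direction is [alg_of_slices]. For the other, the ring that [slice_place] attaches to a point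
    of both slices need not be a rational place; it is first specialized to one that still contains
    both algebras. *)
Lemma fan_separatedP : fan_separated iota Y S <-> forall D D' R, S D -> S D' -> kvr kL R ->
 alg D `<=` R -> alg D' `<=` R -> alg (inter D D') `<=` R.
Proof.
split=> [hs D D' R s s' hR|h D D' mu y s s' /valuation_overP hmu cy].
 apply: (alg_of_slices (hS s) (hS s') (hS (fan_inter s s'))) (kvr_vr hR) (kvr_k hR).
 by move=> mu y v hmu cy h1 h2; rewrite hs //; exact/valuation_overP.
have vrR (R : set L) : valuation_subring R -> kL `<=` R -> alg D `<=` R -> alg D' `<=` R -> alg (inter D D') `<=` R.
 move=> hR kR A1 A2; have [G1 [G1A [_ hG1]]] := alg_finite (hS s).
 have [G2 [G2A [_ hG2]]] := alg_finite (hS s').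
 have [|R' [hR' RR _ GR]] := kplace (l := G1 ++ G2) hkL hR kR.
  by move=> a /in_catP[/G1A/A1|/G2A/A2].
 have [vR' kR'] := (kvr_vr hR', kvr_k hR'); apply: subset_trans RR; apply: (h D D' R') => //.
  by apply: hG1 => // a aG; apply: GR; rewrite mem_cat aG.
 by apply: hG2 => // a aG; apply: GR; rewrite mem_cat aG orbT.
apply/seteqP; split=> v; have [R [hR kR hv]] := slice_place v hmu cy.
 move=> /(hv _ (hS (fan_inter s s'))) AR; split; apply/(hv _ (hS _)) => //.
  exact: subset_trans (alg_inter s s') AR.
 by rewrite interC in AR; exact: subset_trans (alg_inter s' s) AR.
move=> [/(hv _ (hS s)) A1 /(hv _ (hS s')) A2]; apply/(hv _ (hS (fan_inter s s'))); exact: vrR.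
Qed.

Theorem separated_fan : separated (X_fan iota Y S) <-> fan_separated iota Y S.
Proof.
by rewrite (separatedP hT) fan_separatedP; exact: (separated_places_inter).
Qed.

Hypotheses (ss0 : ss != [::]) (S0 : S !=set0) (qc : quasi_compact (X_fan iota Y S)).

Lemma finite_charts : exists N (cm : nat -> {D | S D}), forall x : X_fan iota Y S, exists2 m, (m < N)%N & glue_chart (cm m) x.
Proof.
have [D0 s0] := S0; pose d0 : {D | S D} := exist _ D0 s0.
have [|x|C0 [C0s /finite_seqP[l lE] hC]] := qc (C := range (glue_chart)).
- by move=> _ [d _ <-]; exact: (chart_open hT).
- by have [d hd] := at_cover hT x; exists (glue_chart d).
have /choice[cm hcm] : forall m, exists d, (m < size l)%N -> glue_chart d = nth set0 l m.
 move=> m; have [ml|_] := boolP (m < size l)%N; last by exists d0.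
 by have [|d _ e] := C0s (nth set0 l m); [rewrite lE; exact: mem_nth|exists d].
exists (size l), cm => x; have [U + Ux] := hC x; rewrite lE => Ul.
by exists (index U l); rewrite ?index_mem // hcm ?index_mem // nth_index.
Qed.

Let ss1 : exists s, s \in ss.
Proof. by case: (ss) ss0 => // s l _; exists s; exact: mem_head. Qed.

Lemma variety_proper : complete (model_space iota Y) -> forall R : set F, kvr k R -> exists2 s, s \in ss & gen k s `<=` R.
Proof.
move=> hc R hR; have [s0 s0s] := ss1.
pose cm m : {s | s \in ss} := insubd (exist _ s0 s0s) (nth s0 ss m).
have [|[s hs] BR] := proper_of_complete (variety_atlas hM) (N := size ss) (cm := cm) (m_frac hM s0s) _ hc hR.
 move=> y; have [i hi] := at_cover (variety_atlas hM) y; exists (index (sval i) ss); first by rewrite index_mem (svalP i).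
 suff -> : cm (index (sval i) ss) = i by [].
 by apply: val_inj; rewrite val_insubd nth_index (svalP i).
by exists s.
Qed.

Theorem complete_fan : complete (X_fan iota Y S) <-> fan_complete iota Y S.
Proof.
have [N [cm hcm]] := finite_charts.
split=> [hc|[cY fsep hcov]].
 have [s hs] := ss1.
 have hpr := proper_of_complete hT (lgens_frac (m_frac hM hs)) hcm hc.
 split; last 2 first.
 - by apply/separated_fan; case: hc.
 - move=> mu y /valuation_overP hmu cy v; have [R [hR kR hv]] := slice_place v hmu cy.
  have [//|R' [hR' RR _ _]] := kplace (l := [::]) hkL hR kR; have [[D s'] AR] := hpr _ hR'.
  exists D => //; apply/(hv _ (hS s')); member.
 (* A place of K(Y) extends to one of K(Y)(M), which contains some A_D because X is complete; its
    centre on Y is a centre of the given place. *)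
 apply: (complete_of_proper (variety_atlas hM) (variety_separated_places hM)) => R0 hR0.
 have [R hR e] := extend_kvr n hR0; have [[D s'] AR] := hpr _ hR.
 have [y [[hy _] [yR _] _]] := center_loc (hS s') hR AR.
 have [s1 hs1 By] := Y_chart hM hy; exists (exist _ s1 hs1); rewrite -e; member.
apply: (complete_of_proper hT).
 by apply/(separated_places_inter)/fan_separatedP.
move=> R hR; apply: contrapT => nR; have [vR kR] := (kvr_vr hR, kvr_k hR).
(* Finitely many a_m, one for each chart [cm m], witness that R contains none of their rings; a
   single approximating nu is then positive on all the inverses. *)
have /choice[a ha] : forall m, exists a, A (cm m) a /\ ~ R a.
 by move=> m; apply: contrapT => h; apply: nR; exists (cm m) => a Aa; apply: contrapT => na; apply: h; exists a.
have ia m : (a m)^-1 != 0 /\ maxid R (a m)^-1.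
 by have [_ /(vr_out vR)[a0 ma]] := ha m; rewrite invr_eq0.
have [s hs sR] := variety_proper cY (restrict_kvr hR).
have [nu hnu hl] := approximation ([seq (a m)^-1 | m <- seq.iota 0 N] ++ [seq lc f | f <- s]) vR kR.
have hmu := restrict_qval hnu; have vmu := qval_vr hk hmu.
have cy : center Y (nu \o lc) (ctr (gen k s) (valuation_ring (nu \o lc))).
 apply: (center_Y hM vmu hs); apply: gen_min => [||f fs]; [member|exact: qval_base|].
 have [->|f0] := eqVneq f 0; first member.
 right; apply: (proj1 (hl (lc f) _ _)); rewrite ?lc_neq0 ?mem_cat ?map_f ?orbT //.
 by apply: sR; exact: gen_mem.
have [|D sD hv] := hcov _ _ _ cy (val_vect nu); first exact/valuation_overP.
have AV := alg_of_slice (hS sD) hnu cy hv; have vV := qval_vr hkL hnu.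
have [G [GA [_ hG]]] := alg_finite (hS sD).
have [|R' [hR' _ mR' GR']] := kplace (l := G) hkL vV (qval_base hnu); first by move=> f /GA/AV.
have AR' := hG R' (kvr_vr hR') (kvr_k hR') GR'.
(* The divisor D whose slice contains the vector of nu need not be one of the finitely many chosen.
   But the centre C of R' in its chart also lies in some chart [cm m], where a_m is regular, whereas
   the inverse of a_m lies in the maximal ideal of R'. *)
have [C hC dC] := at_center hT (i := exist _ D sD) hR' AR'.
have [m mN hm] := hcm C; have [Aa _] := ha m; have [a0 ma] := ia m.
have : maxid R' (a m)^-1.
 apply: mR'; apply/(qval_maxid hkL hnu a0); apply: (proj2 (hl _ _ a0)) => //.
 by rewrite mem_cat; apply/orP; left; apply/mapP; exists m; rewrite ?mem_iota.
move=> /vr_max_out; apply; first by rewrite -invr_eq0.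
by apply: (proj1 dC); exact: (at_sub_lr hT hm).
Qed.

End Fan.
End Fans.

Theorem theorem7p5 (K : closedFieldType) (F : fieldType)
    (iota : {rmorphism K -> F}) (n : nat) (Y : set (set F))
    (varY : variety iota Y) (smoothY : smooth Y)
    (semiprojY : semiprojective iota Y)
    (S : set (polydiv F n)) (fanS : divisorial_fan iota Y S) :
  (separated (X_fan iota Y S) <-> fan_separated iota Y S) /\
  (S !=set0 -> quasi_compact (X_fan iota Y S) ->
    (complete (X_fan iota Y S) <-> fan_complete iota Y S)).
Proof.
have [ss [bs [hM ss0 bsY bsR]]] := semiprojective_model varY semiprojY.
split; first exact: (separated_fan hM smoothY bsY bsR fanS).
exact: (complete_fan hM smoothY bsY bsR fanS).
Qed.
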